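(* Let $C>0$, an integer $k\ge 0$ and a dimension $m$ be given. Then there are $R_1,R_2,R_3>0$ and $D>0$ (depending only on $C,k,m$) such that for every Riemannian manifold $(M^m,g)$ with boundary $\partial M$ the following statements (a1), (a2), (b1), (b2) hold; moreover (c) holds. (a1) If $x\in M-\partial M$, $0<r_3\le R_3$ and $\kappa_x:B(0,r_3)\to M-\partial M$ is a Gaussian chart of radius $r_3$, and if $|\nabla^iR|\le C$ for $i=0,\dots,k$ on the image of $\kappa_x$, then in these coordinates $|D^\alpha g_{ij}|\le D$ and $|D^\alpha g^{ij}|\le D$ whenever $|\alpha|\le k$. (a2) If, on the other hand, for such a Gaussian chart $\kappa_x$ (with $0<r_3\le R_3$) one has $|D^\alpha g_{ij}|\le C$ and $|D^\alpha g^{ij}|\le C$ for all $|\alpha|\le k+2$ in these coordinates, then on the image of $\kappa_x$ we have $|\nabla^iR|\le D$ for $i=0,\dots,k$. (b1) If $x'\in\partial M$, $0<r_1\le R_1$, $0<r_2\le R_2$ and $\kappa_{x'}:B(0,r_1)\times[0,r_2)\to M$ is a normal collar chart of width $(r_1,r_2)$, and if $|\nabla^iR|\le C$ on the image of $\kappa_{x'}$ and $|\bar\nabla^il|\le C$ on the intersection of this image with $\partial M$ for $i=0,\dots,k$, then in these coordinates $|D^\alpha g_{ij}|\le D$ and $|D^\alpha g^{ij}|\le D$ whenever $|\alpha|\le k$. (b2) If, on the other hand, for such a normal collar chart $\kappa_{x'}$ (with $0<r_1\le R_1$, $0<r_2\le R_2$) one has $|D^\alpha g_{ij}|\le C$ and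 $|D^\alpha g^{ij}|\le C$ for all $|\alpha|\le k+2$ in these coordinates, then $|\nabla^iR|\le D$ on the image of $\kappa_{x'}$ and $|\bar\nabla^il|\le D$ on the intersection of this image with $\partial M$ for $i=0,\dots,k$. (c) A Riemannian manifold $M$ with boundary has (coordinate-wise defined) bounded geometry if and only if it has (coordinate-free defined) bounded geometry. The bounded geometry constants of the coordinate-wise definition can be chosen to depend only on the quantities $r_i$, $r_C$, $r_{inj}(\partial M)$ and $C_k$ ($k\ge 0$) of the coordinate-free definition (the dimension $m$ being fixed).
   Context: Notation. $(M^m,g)$ is a Riemannian manifold of dimension $m$ with (possibly empty) boundary $\partial M$; $R$ is its curvature tensor, $\nabla$ its Levi-Civita covariant derivative; $\bar\nabla$ is the Levi-Civita covariant derivative of $\partial M$ with the induced metric; $\nu$ is the unit inward normal field along $\partial M$; $l$ is the second fundamental form of $\partial M$ (so $\bar\nabla_XY=\nabla_XY-l(X,Y)\nu$). $|\cdot|$ on tensors is the pointwise norm induced by the metric. In coordinates $x_1,\dots,x_m$: $\partial_i=\partial/\partial x_i$, $g_{ij}=g(\partial_i,\partial_j)$, $(g^{ij})$ is the inverse matrix of $(g_{ij})$, and for a multi-index $\alpha$, $D^\alpha=\partial^{\alpha_1}_{x_1}\cdots\partial^{\alpha_m}_{x_m}$, $|\alpha|=\sum\alpha_i$. Bounds on $D^\alpha g_{ij}$, $D^\alpha g^{ij}$ are for all $i,j$ and at all points of the chart. $B(0,r)$ denotes the open ball of radius $r$ about $0$ in Euclidean space. $N(s)=\{\exp^M_{x'}(t\nu_{x'})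 : x'\in\partial M,\ 0\le t\le s\}$ for $s\ge0$. Charts. For $x\in M-\partial M$ and $r_3>0$ sufficiently small, identify $T_xM$ with $\mathbb{R}^m$ via an orthonormal basis; the map $\kappa_x:B(0,r_3)\to M$, $v\mapsto\exp_x^M(v)$, defined and a diffeomorphism onto its image, is a Gaussian chart of radius $r_3$. For $x'\in\partial M$ identify $T_{x'}\partial M$ with $\mathbb{R}^{m-1}$ via an orthonormal basis; for $r_1,r_2>0$ small enough that the map is injective (a chart), $\kappa_{x'}:B(0,r_1)\times[0,r_2)\to M$, $(v,t)\mapsto\exp^M_{y}(t\nu_{y})$ with $y=\exp^{\partial M}_{x'}(v)$ and $B(0,r_1)\subset\mathbb{R}^{m-1}$, is a normal collar chart (normal boundary chart) of width $(r_1,r_2)$. ''Normal coordinates'' means either kind. Coordinate-free bounded geometry. $M$ has (coordinate-free defined) bounded geometry if: (N) there is $r_C>0$ such that $\partial M\times[0,r_C)\to M$, $(x,t)\mapsto\exp_x(t\nu_x)$, is a diffeomorphism onto its image; (IC) the injectivity radius $r_{inj}(\partial M)$ of $\partial M$ is positive; (I) there is $r_i>0$ such that if $r\le r_i$, then for every $x\in M-N(r)$ the exponential map is a diffeomorphism on $B(0,r)\subset T_xM$ (onto its image); (B) for every integer $k\ge 0$ there is $C_k>0$ with $|\nabla^iR|\le C_k$ and $|\bar\nabla^il|\le C_k$ for $0\le i\le k$. Coordinate-wise bounded geometry. $M$ has (coordinate-wise defined) bounded geometry if (N), (IC), (I) hold and (B1) there exist $0<R_1\le r_{inj}(\partial M)$,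 $0<R_2\le r_C$, $0<R_3\le r_i$ and constants $C_K>0$ (one for each integer $K\ge0$) such that in all normal collar coordinates of width $(r_1,r_2)$ with $r_1\le R_1$, $r_2\le R_2$ and in all Gaussian coordinates of radius $r_3\le R_3$ one has $|D^\alpha g_{ij}|\le C_K$ and $|D^\alpha g^{ij}|\le C_K$ for all $|\alpha|\le K$. The numbers $R_1,R_2,R_3,C_K$ are called the bounded geometry constants of $M$. *)

(* Defs.v *)
From HB Require Import structures.
From mathcomp Require Import all_boot all_order all_algebra.
From mathcomp Require Import all_classical all_reals all_analysis.

Set Implicit Arguments.
Unset Strict Implicit.
Unset Printing Implicit Defensive.

Import Order.TTheory GRing.Theory Num.Theory.
Import numFieldNormedType.Exports.

Local Open Scope classical_set_scope.
Local Open Scope ring_scope.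

(** * Calculus on subsets of R^n

    Derivatives are limits of difference quotients taken inside a set [D].
    They are only used when [D] is an interval or a relatively open subset of
    R^n or of a closed half space; at the boundary of [D] they are one-sided. *)

Section Calculus.
Variable R : realType.

Definition dquot (S : set R) (f : R -> R) (t : R) : set_system R :=
  (fun h => h^-1 * (f (t + h) - f t)) @ within [set h | S (t + h)] (0 : R)^'.

Definition dwithin (S : set R) (f : R -> R) (t : R) : R := lim (dquot S f t).

Definition dable_within (S : set R) (f : R -> R) (t : R) : Prop :=
  cvg (dquot S f t).

Section Partial.
Variable n : nat.
Implicit Types (D : set 'rV[R]_n) (f : 'rV[R]_n -> R) (x : 'rV[R]_n).

Definition on_line (i : 'I_n) x (h : R) : 'rV[R]_n := x + h *: delta_mx 0 i.

Definition pd D (i : 'I_n) f x : R :=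
  dwithin (on_line i x @^-1` D) (f \o on_line i x) 0.

Definition pdable D (i : 'I_n) f x : Prop :=
  dable_within (on_line i x @^-1` D) (f \o on_line i x) 0.

Definition pds D (s : seq 'I_n) f : 'rV[R]_n -> R := foldr (pd D) f s.

(* C^infinity on [D], up to the points of [D] lying on the boundary of the
   half space. *)
Definition smooth_on D f : Prop :=
  forall s : seq 'I_n,
    {within D, continuous (pds D s f)} /\
    forall i x, D x -> pdable D i (pds D s f) x.

Definition multi_index := {ffun 'I_n -> nat}.
Definition mi_size (al : multi_index) : nat := (\sum_i al i)%N.

Definition Dmulti D (al : multi_index) f : 'rV[R]_n -> R :=
  pds D (flatten [seq nseq (al i) i | i <- enum 'I_n]) f.

(* Row [i] is the [i]-th partial derivative of [F]. *)
Definition jac p D (F : 'rV[R]_n -> 'rV[R]_p) x : 'M[R]_(n, p) :=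
  \matrix_(i, j) pd D i (fun y => F y 0 j) x.

Definition enorm x : R := Num.sqrt (\sum_i x 0 i ^+ 2).
Definition eball (r : R) : set 'rV[R]_n := [set x | enorm x < r].

(* [lastc x] is the last coordinate of [x] (and 0 if [n = 0]). *)
Definition lastc x : R := \sum_(i < n | i.+1 == n) x 0 i.
Definition halfspace : set 'rV[R]_n := [set x | 0 <= lastc x].

(* The embedding and projection between R^(n-1) and R^n = R^(n-1) x R. *)
Definition emb (j : 'I_n.-1) : 'I_n := widen_ord (leq_pred n) j.
Definition front x : 'rV[R]_n.-1 := \row_j x 0 (emb j).
Definition snoc (u : 'rV[R]_n.-1) (t : R) : 'rV[R]_n :=
  \row_i (if insub (i : nat) is Some j then u 0 j else t).

End Partial.

Definition collar n (r1 r2 : R) : set 'rV[R]_n :=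
  [set x | enorm (front x) < r1 /\ 0 <= lastc x < r2].

End Calculus.

(** * Tensor calculus of a metric [G] given in coordinates on [D] *)

Section Coordinates.
Variables (R : realType) (n : nat).
Variables (D : set 'rV[R]_n) (G : 'rV[R]_n -> 'M[R]_n).

(* [christoffel x k i j] is Gamma^k_(i j), i.e.
   nabla_(d_i) d_j = \sum_k Gamma^k_(i j) d_k for the Levi-Civita connection. *)
Definition christoffel (x : 'rV[R]_n) (k i j : 'I_n) : R :=
  2^-1 * \sum_l invmx (G x) k l *
    (pd D i (fun y => G y j l) x + pd D j (fun y => G y i l) x
     - pd D l (fun y => G y i j) x).

(* Covariant tensor fields of rank [k], by their components. *)
Definition tensor (k : nat) := 'rV[R]_n -> k.-tuple 'I_n -> R.

(* The derivative index comes first: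
   (nabla T)_(i s) = d_i T_s - \sum_l \sum_p Gamma^p_(i s_l) T_(s[l := p]). *)
Definition covD k (T : tensor k) : tensor k.+1 := fun x s =>
  let i := thead s in
  let s' := [tuple of behead s] in
  pd D i (fun y => T y s') x
  - \sum_(l < k) \sum_(p < n) christoffel x p i (tnth s' l) *
      T x [tuple if q == l then p else tnth s' q | q < k].

Fixpoint covDn k (T : tensor k) (i : nat) : tensor (i + k) :=
  if i is i'.+1 return tensor (i + k) then covD (@covDn k T i') else T.

Definition tnorm k (T : tensor k) (x : 'rV[R]_n) : R :=
  Num.sqrt (\sum_(s : k.-tuple 'I_n) \sum_(t : k.-tuple 'I_n)
    (\prod_(l < k) invmx (G x) (tnth s l) (tnth t l)) * T x s * T x t).

(* R(d_i, d_j) d_k = \sum_p (curv x i j k p) d_p, where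
   R(X, Y) = [nabla_X, nabla_Y] - nabla_[X, Y]. *)
Definition curv (x : 'rV[R]_n) (i j k p : 'I_n) : R :=
  pd D i (fun y => christoffel y p j k) x
  - pd D j (fun y => christoffel y p i k) x
  + \sum_q (christoffel x p i q * christoffel x q j k
            - christoffel x p j q * christoffel x q i k).

(* g(R(d_i, d_j) d_k, d_l) *)
Definition riem : tensor 4 := fun x s =>
  \sum_p curv x (tnth s 0) (tnth s 1) (tnth s 2) p * G x p (tnth s 3).

(* Bounds on the derivatives up to order [k] of g_ij and of g^ij. *)
Definition metric_bounds (k : nat) (C : R) : Prop :=
  forall al : multi_index n, (mi_size al <= k)%N ->
  forall i j x, D x ->
    `|Dmulti D al (fun y => G y i j) x| <= C /\
    `|Dmulti D al (fun y => invmx (G y) i j) x| <= C.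

End Coordinates.

Arguments covDn {R n} D G {k} T i.

(* For a metric matrix [G] at a boundary point of a half space, the unit normal
   pointing into the half space: n^i = g^(i n) / sqrt g^(n n). *)
Definition inward_normal (R : realType) n (G : 'M[R]_n) : 'rV[R]_n :=
  let w := snoc 0 1 *m invmx G in (Num.sqrt (lastc w))^-1 *: w.

(** * Manifolds

    [chart_space] and [metric_chart_space] only carry the data of a manifold
    and of a Riemannian manifold; the axioms are in [riemannian_manifold].
    This allows all notions to be applied also to the boundary. *)

Record chart_space (R : realType) (n : nat) := ChartSpace {
  pts :> topologicalType ;
  chart : Type ;
  chart_dom : chart -> set pts ;
  chart_map : chart -> pts -> 'rV[R]_n }.

(* [met a] is the matrix (g_ij) in the coordinates of the chart [a];
   [chart_at p] is a preferred chart around [p]. A tangent vector at [p] is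
   represented by its components in the chart [chart_at p]. *)
Record metric_chart_space (R : realType) (n : nat) := MetricChartSpace {
  cspace :> chart_space R n ;
  chart_at : cspace -> chart cspace ;
  met : chart cspace -> 'rV[R]_n -> 'M[R]_n }.

Definition euclid (R : realType) n : chart_space R n :=
  @ChartSpace R n 'rV[R]_n unit (fun=> setT) (fun=> id).

Definition cylinder (R : realType) n (X : chart_space R n.-1) :
    chart_space R n :=
  @ChartSpace R n (X * R)%type (chart X) (fun a => [set z | chart_dom a z.1])
    (fun a z => snoc (chart_map a z.1) z.2).

(* [f] restricts to a diffeomorphism of [A] onto an open subset of [Y]. *)
Definition diffeo_on (R : realType) n (X Y : chart_space R n)
    (A : set X) (f : X -> Y) : Prop :=
  [/\ {in A &, injective f},
      {within A, continuous f},
      (forall O : set X, open O -> open (f @` (A `&` O))) &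
      forall (a : chart X) (b : chart Y),
        let W := A `&` chart_dom a `&` f @^-1` chart_dom b in
        exists F F' : 'rV[R]_n -> 'rV[R]_n,
        [/\ forall j, smooth_on (chart_map a @` W) (fun x => F x 0 j),
            forall j, smooth_on (chart_map b @` (f @` W)) (fun y => F' y 0 j) &
            forall p, W p -> F (chart_map a p) = chart_map b (f p) /\
                             F' (chart_map b (f p)) = chart_map a p]].

Section Geometry.
Variables (R : realType) (n : nat) (X : metric_chart_space R n).

Definition chart_image (a : chart X) : set 'rV[R]_n := chart_map a @` chart_dom a.

Definition metric_at (p : X) : 'M[R]_n :=
  met (chart_at p) (chart_map (chart_at p) p).

Definition inner (p : X) (u v : 'rV[R]_n) : R :=
  (u *m metric_at p *m v^T) 0 0.

Definition tball (p : X) (r : R) : set 'rV[R]_n :=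
  [set v | Num.sqrt (inner p v v) < r].

(* The rows of [E] form an orthonormal basis of the tangent space at [p], and
   [v |-> v *m E] is the resulting identification of R^n with it. *)
Definition orthonormal_frame (p : X) (E : 'M[R]_n) : Prop :=
  forall i j, inner p (row i E) (row j E) = (i == j)%:R.

Definition unit_interval : set R := `[0, 1]%classic.

Definition geodesic (c : R -> X) : Prop :=
  {within unit_interval, continuous c} /\
  forall (a : chart X) (t : R), unit_interval t -> chart_dom a (c t) ->
    let I := unit_interval `&` c @^-1` chart_dom a in
    let x j s := chart_map a (c s) 0 j in
    forall k,
      [/\ dable_within I (x k) t, dable_within I (dwithin I (x k)) t &
          dwithin I (dwithin I (x k)) t +
          \sum_i \sum_j
            christoffel (chart_image a) (met a) (chart_map a (c t)) k i j *
            dwithin I (x i) t * dwithin I (x j) t = 0].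

(* exp_p v is defined and equal to [q]. *)
Definition is_exp (p : X) (v : 'rV[R]_n) (q : X) : Prop :=
  exists c : R -> X,
    [/\ geodesic c, c 0 = p, c 1 = q &
        let a := chart_at p in
        forall j, dwithin (unit_interval `&` c @^-1` chart_dom a)
                          (fun s => chart_map a (c s) 0 j) 0 = v 0 j].

Definition exp_diffeo (p : X) (r : R) : Prop :=
  exists e : 'rV[R]_n -> X,
    (forall v, tball p r v -> is_exp p v (e v)) /\
    diffeo_on (X := euclid R n) (tball p r) e.

Definition inj_radius_at (p : X) : \bar R :=
  ereal_sup [set r%:E | r in [set r | 0 < r /\ exp_diffeo p r]].

(* This is +oo if [X] is empty. *)
Definition inj_radius : \bar R := ereal_inf (range inj_radius_at).

(* |nabla^i Riem| at [p] *)
Definition norm_nabla_riem (i : nat) (p : X) : R :=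
  let a := chart_at p in
  tnorm (met a)
    (covDn (chart_image a) (met a) (riem (chart_image a) (met a)) i)
    (chart_map a p).

(* The matrix g(d_i kappa, d_j kappa) of the metric in the coordinates given
   by the map [kappa] on [D]. *)
Definition pullback_metric (D : set 'rV[R]_n) (kappa : 'rV[R]_n -> X)
    (x : 'rV[R]_n) : 'M[R]_n :=
  let J := jac D (chart_map (chart_at (kappa x)) \o kappa) x in
  J *m metric_at (kappa x) *m J^T.

Definition boundary : set X :=
  [set p | (0 < n)%N /\ lastc (chart_map (chart_at p) p) = 0].

(* The boundary with the induced metric, in the charts obtained by dropping
   the last coordinate. *)
Definition bdry : metric_chart_space R n.-1 :=
  @MetricChartSpace R n.-1
    (@ChartSpace R n.-1 (set_type boundary) (chart X)
       (fun a => [set y | chart_dom a (val y)])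
       (fun a y => front (chart_map a (val y))))
    (fun y => chart_at (val y))
    (fun a u => \matrix_(i, j) met a (snoc u 0) (emb i) (emb j)).

Definition bdry_val (y : bdry) : X := set_val y.

(* l(d_i, d_j) = g(nabla_(d_i) d_j, nu) in the boundary chart [a] *)
Definition second_ff (a : chart X) : tensor R n.-1 2 := fun u s =>
  let x := snoc u 0 in
  let G := met a x in
  \sum_k christoffel (chart_image a) (met a) x k
           (emb (tnth s 0)) (emb (tnth s 1)) *
         (G *m (inward_normal G)^T) k 0.

End Geometry.

(* |bar-nabla^i l| at [y] *)
Definition norm_nabla_l (R : realType) n (X : metric_chart_space R n)
    (i : nat) (y : bdry X) : R :=
  let B := bdry X in
  let a : chart B := chart_at y in
  tnorm (met a) (covDn (chart_image a) (met a) (@second_ff R n X a) i)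
    (chart_map a y).

(* Smooth Riemannian manifolds with (possibly empty) boundary. *)
Record riemannian_manifold (R : realType) (n : nat) := RiemannianManifold {
  mspace :> metric_chart_space R n ;
  m_hausdorff : hausdorff_space mspace ;
  m_second_countable : @second_countable mspace ;
  m_dom_open : forall a : chart mspace, open (chart_dom a) ;
  m_chart_at : forall p : mspace, chart_dom (chart_at p) p ;
  (* charts are homeomorphisms onto open subsets of the half space *)
  m_coord_inj : forall a : chart mspace, {in chart_dom a &, injective (chart_map a)} ;
  m_coord_continuous : forall a : chart mspace,
    {within chart_dom a, continuous (chart_map a)} ;
  m_coord_open : forall (a : chart mspace) (V : set mspace),
    open V -> V `<=` chart_dom a ->
    exists2 O : set 'rV[R]_n, open O & chart_map a @` V = @halfspace R n `&` O ;
  m_met_smooth : forall (a : chart mspace) i j,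
    smooth_on (chart_image a) (fun x => met a x i j) ;
  m_met_sym : forall (a : chart mspace) x, chart_image a x ->
    (met a x)^T = met a x ;
  m_met_pos : forall (a : chart mspace) x, chart_image a x ->
    forall v : 'rV[R]_n, v != 0 -> 0 < (v *m met a x *m v^T) 0 0 ;
  (* smooth changes of coordinates, and transformation law of the metric *)
  m_transition : forall a b : chart mspace,
    let W := chart_dom a `&` chart_dom b in
    exists tau : 'rV[R]_n -> 'rV[R]_n,
    [/\ forall j, smooth_on (chart_map a @` W) (fun x => tau x 0 j),
        forall p, W p -> tau (chart_map a p) = chart_map b p &
        forall p, W p ->
          let J := jac (chart_map a @` W) tau (chart_map a p) in
          met a (chart_map a p) = J *m met b (chart_map b p) *m J^T] }.

(** * Normal coordinates and bounded geometry *)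

Section BoundedGeometry.
Variables (R : realType) (m : nat) (M : riemannian_manifold R m).

Definition gaussian_chart (x : M) (r3 : R) (kappa : 'rV[R]_m -> M) : Prop :=
  [/\ ~ boundary x,
      exists2 E, orthonormal_frame x E &
        forall v, eball r3 v -> is_exp x (v *m E) (kappa v) &
      diffeo_on (X := euclid R m) (eball r3) kappa].

(* exp^M_y (t nu_y) is defined and equal to [q]. *)
Definition is_normal_exp (y : bdry M) (t : R) (q : M) : Prop :=
  is_exp (bdry_val y) (t *: inward_normal (metric_at (bdry_val y))) q.

Definition collar_chart (x' : bdry M) (r1 r2 : R) (kappa : 'rV[R]_m -> M) :
    Prop :=
  (exists2 E, orthonormal_frame x' E &
     forall z, collar r1 r2 z -> exists2 y : bdry M,
       is_exp x' (front z *m E) y & is_normal_exp y (lastc z) (kappa z)) /\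
  diffeo_on (X := euclid R m) (collar r1 r2) kappa.

(* N(s) *)
Definition boundary_nbhd (s : R) : set M :=
  [set q | exists (y : bdry M) (t : R), 0 <= t <= s /\ is_normal_exp y t q].

Definition cond_N (rC : R) : Prop :=
  0 < rC /\
  exists f : bdry M * R -> M,
    (forall y t, 0 <= t < rC -> is_normal_exp y t (f (y, t))) /\
    diffeo_on (X := cylinder (n := m) (bdry M)) (Y := M)
      [set z | 0 <= z.2 < rC] f.

Definition r_inj_bdry : \bar R := inj_radius (bdry M).

Definition cond_IC : Prop := (0 < r_inj_bdry)%E.

Definition cond_I (ri : R) : Prop :=
  0 < ri /\
  forall r, 0 < r <= ri -> forall x : M, ~ boundary_nbhd r x -> exp_diffeo x r.

Definition cond_B (C : nat -> R) : Prop :=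
  forall k, 0 < C k /\
  forall i, (i <= k)%N ->
    (forall p : M, norm_nabla_riem i p <= C k) /\
    (forall y : bdry M, norm_nabla_l i y <= C k).

Definition cond_B1 (rC ri R1 R2 R3 : R) (C : nat -> R) : Prop :=
  [/\ 0 < R1 /\ (R1%:E <= r_inj_bdry)%E, 0 < R2 <= rC, 0 < R3 <= ri,
      forall K, 0 < C K &
      (forall x' r1 r2 kappa, 0 < r1 <= R1 -> 0 < r2 <= R2 ->
         collar_chart x' r1 r2 kappa ->
         forall K, metric_bounds (collar r1 r2)
                     (pullback_metric (collar r1 r2) kappa) K (C K)) /\
      (forall x r3 kappa, 0 < r3 <= R3 -> gaussian_chart x r3 kappa ->
         forall K, metric_bounds (eball r3)
                     (pullback_metric (eball r3) kappa) K (C K))].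

Definition bounded_geometry_free : Prop :=
  exists (rC ri : R) (C : nat -> R),
    [/\ cond_N rC, cond_IC, cond_I ri & cond_B C].

Definition bounded_geometry_coord : Prop :=
  exists (rC ri : R),
    [/\ cond_N rC, cond_IC, cond_I ri &
        exists (R1 R2 R3 : R) (C : nat -> R), cond_B1 rC ri R1 R2 R3 C].

End BoundedGeometry.

(* Main.v *)
(* In normal coordinates let xi be the radial field x_i d_i (Gaussian chart) or the normal field d_n
   (collar chart). Up to the identity in the radial case, the covariant derivative of xi is an
   endomorphism B with L_xi g = 2 g B, and B satisfies a Riccati equation along xi whose right hand
   side is the curvature contracted twice with xi. On a domain whose size depends only on a bound for
   the curvature (and for l), a comparison argument bounds g, its inverse and B. Differentiating the two
   equations gives linear equations along the rays for the derivatives of g and B; up to lower order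
   terms and terms absorbed by the same comparison argument, the derivatives of the curvature
   components are controlled by the covariant derivatives of R, so all derivatives are bounded
   inductively. In a collar this is done for the derivatives tangential to the boundary, with initial
   values on the boundary given by its Gaussian chart, whose curvature is bounded through Gauss'
   equation; the remaining derivatives are then read off from the equations. Conversely R, l and their
   covariant derivatives are universal polynomials in the derivatives of g and of its inverse. For (c),
   a point outside N(r) is the centre of a Gaussian chart, and a point of N(r) lies in a collar chart
   around its foot point. *)

From HB Require Import structures.
From mathcomp Require Import all_boot all_order all_algebra.
From mathcomp Require Import all_classical all_reals all_analysis.
From mathcomp Require Import ring lra.
Require Import Defs.
Set Implicit Arguments.
Unset Strict Implicit.
Unset Printing Implicit Defensive.
Import Order.TTheory GRing.Theory Num.Theory.
Import numFieldNormedType.Exports.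
Local Open Scope classical_set_scope.
Local Open Scope ring_scope.

(** * One-sided calculus on subsets of R^n *)

(** Two difficulties shape the estimates. First, a partial derivative of order j of a curvature
    component is not bounded by covariant derivatives of R alone: the correction contains
    Christoffel symbols differentiated j - 1 times, that is, derivatives of order j of the metric,
    which are the unknowns. No derivative may be lost, since the bounds on R and on g have the same
    order k. The unknowns enter linearly, and in the Riccati equation they are multiplied by
    products of components of xi. In a Gaussian chart these products are O(|x|^2), which the
    singular equation t f' = - c f + r along a ray absorbs. The coupling from derivatives of B into
    those of g has no small factor; it becomes small once the derivatives of g are weighted by a
    small constant. Along the normals of a collar the equation is regular and a Gronwall argument
    needs no smallness. Second, (c) asks for radii that serve all orders at once, so the domain may
    depend only on bounds of order zero; one constant is kept for the radii and another for order
    k. *)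

Ltac exch := rewrite exchange_big /=; apply: eq_bigr.

Section OneD.
Variable R : realType.
Implicit Types (S : set R) (f g : R -> R) (t l : R).

(** The derivative as a relation: the rules below carry neither convergence hypotheses nor
    accumulation points. Only the passage to the value [dwithin] needs [accum], which makes the
    punctured filter proper. *)
Definition isd S f t l : Prop := dquot S f t --> l.

Definition accum S t : Prop :=
  forall d, 0 < d -> exists h, [/\ h != 0, `|h| < d & S (t + h)].

(** With the denominator cleared, [h = 0] satisfies the inequality trivially, and the punctured
    filter disappears from later estimates. *)
Lemma isdP S f t l : isd S f t l <->
  forall e : R, 0 < e -> exists2 d : R, 0 < d &
    forall h, `|h| < d -> S (t + h) -> `|f (t + h) - f t - l * h| <= e * `|h|.
Proof.
split.
- move=> /cvgrPdist_le H e e0.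
  have := H e e0; rewrite near_withinE => H1.
  have [d /= d0 Hd] := H1.
  exists d => // h hd Sh.
  have [->|h0] := eqVneq h 0; first by rewrite addr0 subrr mulr0 subrr normr0 mulr0.
  have := Hd h; rewrite /= sub0r normrN => /(_ hd h0 Sh).
  rewrite -(ler_pM2r (_ : 0 < `|h|)) ?normr_gt0 // => Hh.
  apply: le_trans Hh; rewrite -normrM mulrBl mulrAC mulVf // mul1r distrC //.
- move=> H; apply/cvgrPdist_le => e e0.
  have [d d0 Hd] := H e e0.
  rewrite near_withinE.
  exists d => //= h; rewrite /ball_ /= sub0r normrN => hd h0 Sh.
  rewrite -(ler_pM2r (_ : 0 < `|h|)) ?normr_gt0 //.
  apply: le_trans (Hd h hd Sh); rewrite -normrM mulrBl mulrAC mulVf // mul1r distrC //.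
Qed.

Lemma accum_proper S t : accum S t ->
  ProperFilter (within [set h | S (t + h)] (0 : R)^').
Proof.
move=> H; apply: Build_ProperFilter_ex => P.
rewrite /within /= => -[d /= d0 Hd].
have [h [h0 hd Sh]] := H d d0.
by exists h; apply: (Hd h) => //=; rewrite sub0r normrN.
Qed.

Lemma isd_dwithin S f t l : accum S t -> isd S f t l -> dwithin S f t = l.
Proof.
by move=> /accum_proper H; rewrite /isd /dwithin => Hl; apply: cvg_lim.
Qed.

Lemma isd_dable S f t l : isd S f t l -> dable_within S f t.
Proof. by move=> H; apply/cvg_ex; exists l. Qed.

Lemma dable_isd S f t : dable_within S f t -> isd S f t (dwithin S f t).
Proof. by []. Qed.

Lemma isd_unique S f t l l' : accum S t -> isd S f t l -> isd S f t l' -> l = l'.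
Proof. by move=> a /(isd_dwithin a) <- /(isd_dwithin a) <-. Qed.

Lemma isd_ext S f g t l : (forall s, S s -> f s = g s) -> f t = g t ->
  isd S f t l -> isd S g t l.
Proof.
move=> fg fgt /isdP H; apply/isdP => e e0; have [d d0 Hd] := H e e0.
by exists d => // h hd Sh; rewrite -fg // -fgt; exact: Hd.
Qed.

Lemma isd_loc S S' f t l d : 0 < d -> (forall s, `|s - t| < d -> S' s -> S s) ->
  isd S f t l -> isd S' f t l.
Proof.
move=> d0 SS' /isdP H; apply/isdP => e e0; have [d1 d10 Hd] := H e e0.
exists (Num.min d d1); first by rewrite lt_min d0.
move=> h; rewrite lt_min => /andP[hd hd1] Sh; apply: Hd => //.
by apply: SS' => //; rewrite addrC addKr.
Qed.

Lemma isd_sub S S' f t l : S' `<=` S -> isd S f t l -> isd S' f t l.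
Proof. by move=> SS'; apply: (@isd_loc _ _ _ _ _ 1) => // s _; exact: SS'. Qed.

Lemma isd_cts S f t l : isd S f t l -> forall e : R, 0 < e -> exists2 d : R, 0 < d &
   forall h, `|h| < d -> S (t + h) -> `|f (t + h) - f t| < e.
Proof.
move=> /isdP /(_ 1 ltr01) [d d0 Hd] e e0.
have l0 : 0 < `|l| + 2 by rewrite ltr_wpDl.
exists (Num.min d (e / (`|l| + 2))).
  by rewrite lt_min d0 divr_gt0.
move=> h; rewrite lt_min => /andP[hd he] Sh.
have := Hd h hd Sh; rewrite mul1r => H1.
have [->|h0] := eqVneq h 0; first by rewrite addr0 subrr normr0.
have hp : 0 < `|h| by rewrite normr_gt0.
have : `|h| * (`|l| + 2) < e by rewrite -ltr_pdivlMr.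
apply: le_lt_trans.
have -> : f (t + h) - f t = (f (t + h) - f t - l * h) + l * h by ring.
apply: le_trans (ler_normD _ _) _; rewrite normrM; nra.
Qed.

Lemma isd_cts0 S f t l : isd S f t l ->
  (fun h => f (t + h)) @ within [set h | S (t + h)] (0 : R)^' --> f t.
Proof.
move=> H; apply/cvgrPdist_lt => e e0; have [d d0 Hd] := isd_cts H e0.
rewrite near_withinE; exists d => //= h.
by rewrite /ball_ /= sub0r normrN distrC => hd _; exact: Hd.
Qed.

Lemma isd_cst S c t : isd S (fun=> c) t 0.
Proof.
apply/isdP => e e0; exists 1 => // h _ _.
by rewrite subrr mul0r subrr normr0 mulr_ge0 // ltW.
Qed.

Lemma isd_id S t : isd S id t 1.
Proof.
apply/isdP => e e0; exists 1 => // h _ _.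
by rewrite mul1r [t + h]addrC addrK subrr normr0 mulr_ge0 // ltW.
Qed.

Lemma isdD S f g t l l' : isd S f t l -> isd S g t l' ->
  isd S (fun s => f s + g s) t (l + l').
Proof.
rewrite /isd /dquot => Hf Hg.
have -> : (fun h => h^-1 * (f (t + h) + g (t + h) - (f t + g t))) =
  (fun h => h^-1 * (f (t + h) - f t)) + (fun h => h^-1 * (g (t + h) - g t)).
  by apply/funext => h; rewrite fctE; ring.
exact: cvgD Hf Hg.
Qed.

Lemma isdM S f g t l l' : isd S f t l -> isd S g t l' ->
  isd S (fun s => f s * g s) t (l * g t + f t * l').
Proof.
move=> Hf Hg; have Hg0 := isd_cts0 Hg; move: Hf Hg; rewrite /isd /dquot => Hf Hg.
have -> : (fun h => h^-1 * (f (t + h) * g (t + h) - (f t * g t))) =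
  ((fun h => h^-1 * (f (t + h) - f t)) \* (fun h => g (t + h))) +
  ((fun=> f t) \* (fun h => h^-1 * (g (t + h) - g t))).
  by apply/funext => h; rewrite fctE /=; ring.
apply: cvgD; first exact: cvgM Hf Hg0.
by apply: cvgM Hg; exact: cvg_cst.
Qed.

Lemma isdZ S f t l c : isd S f t l -> isd S (fun s => c * f s) t (c * l).
Proof.
by move=> H; have := isdM (isd_cst S c t) H; rewrite mul0r add0r.
Qed.

Lemma isdN S f t l : isd S f t l -> isd S (fun s => - f s) t (- l).
Proof.
move=> H; rewrite -mulN1r; apply: isd_ext (isdZ (c := -1) H) => //= [s _|]; by rewrite mulN1r.
Qed.

Lemma isdB S f g t l l' : isd S f t l -> isd S g t l' ->
  isd S (fun s => f s - g s) t (l - l').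
Proof. by move=> Hf /isdN Hg; apply: isdD. Qed.

Lemma derive_dquot (phi : R -> R) t :
  (fun h => h^-1 *: ((phi \o shift t) (h *: (1 : R)) - phi t)) =
  (fun h => h^-1 * (phi (t + h) - phi t)).
Proof. by apply/funext => h /=; rewrite /GRing.scale /= mulr1 [h + t]addrC. Qed.

Lemma dquotT phi t : dquot setT phi t = (fun h => h^-1 * (phi (t + h) - phi t)) @ (0 : R)^'.
Proof.
rewrite /dquot; have -> // : within [set h : R | setT (t + h)] 0^' = 0^'.
by rewrite eqEsubset; split=> A; rewrite /within /=; apply: filterS => x // /(_ I).
Qed.

(** The outer function is differentiated two-sidedly, the inner one only within [S]; this covers
    reciprocals, square roots and exponentials. *)
Lemma isd_comp1 S f t l (phi : R -> R) l' :
  is_derive (f t) 1 phi l' -> isd S f t l -> isd S (fun s => phi (f s)) t (l' * l).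
Proof.
move=> [Hphi Hl'] Hf.
have /isdP Hphi' : isd setT phi (f t) l'.
  by rewrite /isd dquotT -derive_dquot -Hl'; exact: Hphi.
apply/isdP => e e0.
have l1 : 0 < `|l| + 1 by rewrite ltr_wpDl.
have e1 : 0 < Num.min 1 (e / (`|l| + 1) / 2).
  by rewrite lt_min ltr01 !divr_gt0.
have [d1 d10 H1] := Hphi' _ e1.
have l2 : 0 < `|l'| + 1 by rewrite ltr_wpDl.
(* The entry 1 yields |u| <= (|l| + 1) |h| for the increment [u] of [f]; the other entry keeps the
   remainder of [f], multiplied by l', below e/2 |h|. *)
have e2 : 0 < Num.min 1 (e / (`|l'| + 1) / 2) by rewrite lt_min ltr01 !divr_gt0.
have [d2 d20 H2] := (isdP S f t l).1 Hf _ e2.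
have [d3 d30 H3] := isd_cts Hf d10.
exists (Num.min d2 d3) => [|h]; first by rewrite lt_min d20.
rewrite lt_min => /andP[h2 h3] Sh.
have K2 := H2 h h2 Sh; have K3 := H3 h h3 Sh.
have := H1 _ K3 I; rewrite [f t + (_ - _)]addrC subrK => K1.
set u := f (t + h) - f t in K1 K2 K3 *.
have E : phi (f (t + h)) - phi (f t) - l' * l * h =
  (phi (f (t + h)) - phi (f t) - l' * u) + l' * (u - l * h) by ring.
rewrite E; apply: le_trans (ler_normD _ _) _.
have hu : `|u| <= (`|l| + 1) * `|h|.
  have -> : u = (u - l * h) + l * h by ring.
  apply: le_trans (ler_normD _ _) _; rewrite normrM mulrDl mul1r addrC lerD2l.
  by apply: le_trans K2 _; rewrite ler_piMl // ge_min lexx.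
have a1 : Num.min 1 (e / (`|l| + 1) / 2) * `|u| <= e / 2 * `|h|.
  apply: (@le_trans _ _ (e / (`|l| + 1) / 2 * ((`|l| + 1) * `|h|))).
    by apply: ler_pM => //; [rewrite ltW|rewrite ge_min lexx orbT].
  by rewrite le_eqVlt; apply/orP; left; apply/eqP; field; rewrite gt_eqF.
have a2 : `|l'| * (Num.min 1 (e / (`|l'| + 1) / 2) * `|h|) <= e / 2 * `|h|.
  rewrite mulrA ler_wpM2r //.
  apply: (@le_trans _ _ ((`|l'| + 1) * (e / (`|l'| + 1) / 2))).
    by apply: ler_pM => //; [rewrite ltW|rewrite lerDl|rewrite ge_min lexx orbT].
  by rewrite le_eqVlt; apply/orP; left; apply/eqP; field; rewrite gt_eqF.
rewrite normrM.
have : `|l'| * `|u - l * h| <= `|l'| * (Num.min 1 (e / (`|l'| + 1) / 2) * `|h|).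
  by rewrite ler_wpM2l.
move=> a3; apply: le_trans (lerD (le_trans K1 a1) (le_trans a3 a2)) _.
by rewrite -mulrDl -splitr.
Qed.

Lemma isdV S f t l : f t != 0 -> isd S f t l ->
  isd S (fun s => (f s)^-1) t (- l / (f t) ^+ 2).
Proof.
move=> ft0 Hf; have -> : - l / f t ^+ 2 = (- f t ^- 2 *: 1) * l.
  by rewrite /GRing.scale /= mulr1 mulNr [l / _]mulrC mulNr.
by apply: isd_comp1 Hf; apply: is_deriveV.
Qed.

Lemma isd_derivable S f t l d : 0 < d -> (forall s, `|s - t| < d -> S s) ->
  isd S f t l -> is_derive t 1 f l.
Proof.
move=> d0 HS H.
have {H} : isd setT f t l by apply: (isd_loc d0) H => s sd _; exact: HS.
rewrite /isd dquotT -derive_dquot => H.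
apply: DeriveDef; first by apply/cvg_ex; exists l.
exact: cvg_lim H.
Qed.

Lemma isd_within_cts S f (A : set R) (f' : R -> R) : A `<=` S ->
  (forall t, A t -> isd S f t (f' t)) -> {within A, continuous f}.
Proof.
move=> AS H; apply/subspace_continuousP => t At.
apply/cvgrPdist_lt => e e0; have [d d0 Hd] := isd_cts (H t At) e0.
rewrite near_withinE; exists d => //= s.
rewrite /ball_ /= distrC => sd As; rewrite distrC.
by have := Hd (s - t) sd; rewrite [t + _]addrC subrK; apply; exact: AS.
Qed.

(** Inside the open interval the derivative within [S] is two-sided, so the classical mean value
    theorem applies; at the endpoints only continuity is used. *)
Lemma isd_MVT S f (f' : R -> R) a b : a < b ->
  (forall t, a <= t <= b -> S t) ->
  (forall t, a <= t <= b -> isd S f t (f' t)) ->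
  exists2 c, a < c < b & f b - f a = f' c * (b - a).
Proof.
move=> ab HS H.
have [c cab Hc] : exists2 c : R, c \in `]a, b[ & f b - f a = f' c * (b - a).
  apply: (@MVT R f f' a b ab) => [t|].
    rewrite in_itv /= => /andP[ta tb].
    apply: (@isd_derivable S f t (f' t) (Num.min (t - a) (b - t))).
    + by rewrite lt_min !subr_gt0 ta.
    + move=> s; rewrite lt_min => /andP[s1 s2]; apply: HS.
      by move: s1 s2; rewrite !ltr_norml; lra.
    + by apply: H; rewrite !ltW.
  apply: (@isd_within_cts S f `[a, b]%classic f') => t /=; rewrite in_itv /=; [exact: HS|exact: H].
by exists c => //; move: cab; rewrite in_itv.
Qed.

(** The derivative has to vanish only in the open interval. This matters along rays: the radial
    field vanishes at the centre and gives no information there. *)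
Lemma isd_const S f (f' : R -> R) a b : a <= b ->
  (forall t, a <= t <= b -> S t) ->
  (forall t, a <= t <= b -> isd S f t (f' t)) ->
  (forall t, a < t < b -> f' t = 0) -> f a = f b.
Proof.
rewrite le_eqVlt => /orP[/eqP ->//|ab] HS H H0.
have [c cab E] := isd_MVT ab HS H.
by apply/eqP; rewrite eq_sym -subr_eq0 E H0 ?mul0r.
Qed.

Lemma accum_itv a b t : a < b -> a <= t <= b -> accum [set s | a <= s <= b] t.
Proof.
move=> ab /andP[ta tb] d d0.
have [tb'|bt] := ltP t b.
- exists (Num.min (d / 2) (b - t)).
  have h0 : 0 < Num.min (d / 2) (b - t) by rewrite lt_min divr_gt0 //= subr_gt0.
  have hd : Num.min (d / 2) (b - t) <= d / 2 by rewrite ge_min lexx.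
  have hb : Num.min (d / 2) (b - t) <= b - t by rewrite ge_min lexx orbT.
  move: h0 hd hb; set h := Num.min _ _ => h0 hd hb.
  split; [by rewrite gt_eqF|rewrite gtr0_norm //; lra|rewrite /=; apply/andP; split; lra].
- have tE : t = b by lra.
  exists (- Num.min (d / 2) (b - a)).
  have h0 : 0 < Num.min (d / 2) (b - a) by rewrite lt_min divr_gt0 //= subr_gt0.
  have hd : Num.min (d / 2) (b - a) <= d / 2 by rewrite ge_min lexx.
  have hb : Num.min (d / 2) (b - a) <= b - a by rewrite ge_min lexx orbT.
  move: h0 hd hb; set h := Num.min _ _ => h0 hd hb.
  split; [by rewrite oppr_eq0 gt_eqF|rewrite normrN gtr0_norm //; lra|rewrite /=; apply/andP; split; lra].
Qed.

End OneD.

Section MatNorm.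
Variable R : realType.

Lemma rv_norm_coord n (x : 'rV[R]_n) i : `|x 0 i| <= `|x|.
Proof.
rewrite [`|x|]mx_normrE; exact: (le_bigmax_cond _ (fun k : 'I_1 * 'I_n => `|x k.1 k.2|) (j := (0, i))).
Qed.

Lemma rv_norm_le n (x : 'rV[R]_n) e : 0 <= e -> (forall i, `|x 0 i| <= e) -> `|x| <= e.
Proof.
move=> e0 H; rewrite [`|x|]mx_normrE; apply: bigmax_le => // -[a b] _ /=.
by rewrite ord1.
Qed.

Lemma rv_norm_lt n (x : 'rV[R]_n) e : 0 < e -> (forall i, `|x 0 i| < e) -> `|x| < e.
Proof.
move=> e0 H; rewrite [`|x|]mx_normrE; apply: bigmax_lt => // -[a b] _ /=.
by rewrite ord1.
Qed.

Lemma fin_pos (I : finType) (P : I -> R -> Prop) :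
  (forall i d d', 0 < d' -> d' <= d -> P i d -> P i d') ->
  (forall i, exists2 d, 0 < d & P i d) -> exists2 d, 0 < d & forall i, P i d.
Proof.
move=> mono H.
suff : exists2 d, 0 < d & forall i, i \in enum I -> P i d.
  by move=> [d d0 Hd]; exists d => // i; apply: Hd; rewrite mem_enum.
elim: (enum I) => [|i s [d d0 IH]]; first by exists 1.
have [d' d'0 Hd'] := H i.
exists (Num.min d d') => [|j]; first by rewrite lt_min d0.
rewrite inE => /orP[/eqP ->|js].
  by apply: mono Hd'; rewrite ?lt_min ?d0 // ge_min lexx orbT.
by apply: (mono j d); rewrite ?lt_min ?d0 ?ge_min ?lexx //; exact: IH.
Qed.

End MatNorm.

(** * Partial derivatives on relatively open subsets of orthant-like sets *)

Section ND.
Variables (R : realType) (n : nat).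
Notation V := 'rV[R]_n.
Implicit Types (D H : set V) (f g : V -> R) (x y z : V).

Definition cw D f x : Prop := forall e : R, 0 < e -> exists2 d : R, 0 < d &
  forall y, D y -> `|y - x| < d -> `|f y - f x| < e.

Lemma cwP D f x : cw D f x <-> f @ within D (nbhs x) --> f x.
Proof.
split.
- move=> H; apply/cvgrPdist_lt => e e0; have [d d0 Hd] := H e e0.
  rewrite near_withinE; apply/nbhs_ballP; exists d => //= y.
  rewrite -ball_normE /ball_ /= distrC => yd Dy; rewrite distrC; exact: Hd.
- move=> /cvgrPdist_lt H e e0; have := H e e0; rewrite near_withinE => /nbhs_ballP[d /= d0 Hd].
  exists d => // y Dy yd; rewrite distrC; apply: Hd => //.
  by rewrite -ball_normE /ball_ /= distrC.
Qed.

Lemma within_contP D f : {within D, continuous f} <-> forall x, D x -> cw D f x.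
Proof.
rewrite subspace_continuousP; split=> H x Dx; apply/cwP; exact: H.
Qed.

Definition between (a b c : R) : bool := (a <= c <= b) || (b <= c <= a).

(** What R^n and a half space have in common. The first clause keeps coordinate staircases between
    two points inside the set; the second lets every point be approached from above in each
    coordinate, so that partial derivatives are limits along proper filters even at the boundary. *)
Definition orth H : Prop :=
  (forall x y z, H x -> H y -> (forall i, between (x 0 i) (y 0 i) (z 0 i)) -> H z) /\
  (forall x i h, H x -> 0 <= h -> H (x + h *: delta_mx 0 i)).

Definition dom D : Prop := exists H O, [/\ orth H, open O & D = H `&` O].

Lemma dom_open D : open D -> dom D.
Proof. by move=> oD; exists setT, D; split=> //; rewrite setTI. Qed.

Lemma dom_box D x : dom D -> D x -> exists H e,
  [/\ orth H, 0 < e, H x, D `<=` H & forall y, H y -> `|y - x| < e -> D y].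
Proof.
move=> [H [U [oH oU E]]]; rewrite E => -[Hx Ux].
have /nbhs_ballP[e /= e0 He] : nbhs x U by exact: open_nbhs_nbhs.
exists H, e; split=> [//|//|//|y []//|y Hy ye]; split=> //; apply: He.
by rewrite -ball_normE /ball_ /= distrC.
Qed.

Lemma on_line0 (i : 'I_n) x : on_line i x 0 = x.
Proof. by rewrite /on_line scale0r addr0. Qed.

Lemma on_line_add (i : 'I_n) x s h : on_line i (on_line i x s) h = on_line i x (s + h).
Proof. by rewrite /on_line -addrA -scalerDl. Qed.

Lemma on_lineE (i : 'I_n) x h j : on_line i x h 0 j = x 0 j + h * (j == i)%:R.
Proof. by rewrite !mxE eqxx /=. Qed.

Lemma on_line_dist (i : 'I_n) x h : `|on_line i x h - x| <= `|h|.
Proof.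
apply: rv_norm_le => // j; rewrite mxE on_lineE mxE addrC addKr.
by case: eqP; rewrite ?mulr1 ?mulr0 ?normr0.
Qed.

Lemma dom_up D x i : dom D -> D x -> exists2 e, 0 < e & forall h, 0 <= h < e -> D (on_line i x h).
Proof.
move=> dD Dx; have [H [e [[_ oH] e0 Hx DH He]]] := dom_box dD Dx.
exists e => // h /andP[h0 he]; apply: He; first exact: oH.
by apply: le_lt_trans (on_line_dist i x h) _; rewrite ger0_norm.
Qed.

Lemma accum_line D x i : dom D -> D x -> accum (on_line i x @^-1` D) 0.
Proof.
move=> dD Dx d d0; have [e e0 He] := dom_up i dD Dx.
have m0 : 0 < Num.min d e by rewrite lt_min d0.
have m1 : Num.min d e / 2 < Num.min d e by rewrite ltr_pdivrMr // ltr_pMr // ltr1n.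
exists (Num.min d e / 2); split.
- by rewrite gt_eqF // divr_gt0.
- rewrite gtr0_norm ?divr_gt0 //; apply: lt_le_trans m1 _; by rewrite ge_min lexx.
- rewrite add0r; apply: He; rewrite divr_ge0 ?(ltW m0) //=.
  apply: lt_le_trans m1 _; by rewrite ge_min lexx orbT.
Qed.

Definition ispd D (i : 'I_n) f x l : Prop :=
  isd (on_line i x @^-1` D) (f \o on_line i x) 0 l.

Lemma ispd_pd D i f x l : dom D -> D x -> ispd D i f x l -> pd D i f x = l.
Proof. by move=> dD Dx; apply: isd_dwithin; apply: accum_line. Qed.

Lemma ispd_pdable D i f x l : ispd D i f x l -> pdable D i f x.
Proof. exact: isd_dable. Qed.

Lemma pdable_ispd D i f x : pdable D i f x -> ispd D i f x (pd D i f x).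
Proof. by []. Qed.

Lemma isd_shift (S : set R) (f : R -> R) t l :
  isd [set h | S (t + h)] (fun h => f (t + h)) 0 l -> isd S f t l.
Proof.
move=> /isdP H; apply/isdP => e e0; have [d d0 Hd] := H e e0.
exists d => // h hd Sh; have := Hd h hd; rewrite /= !add0r addr0; exact.
Qed.

Lemma ispd_line D i f x s l : ispd D i f (on_line i x s) l ->
  isd (on_line i x @^-1` D) (f \o on_line i x) s l.
Proof.
rewrite /ispd => H; apply: isd_shift.
have -> : [set h | (on_line i x @^-1` D) (s + h)] = on_line i (on_line i x s) @^-1` D.
  by apply/funext => h; rewrite /preimage /= on_line_add.
have -> // : (fun h => (f \o on_line i x) (s + h)) = f \o on_line i (on_line i x s).
by apply/funext => h /=; rewrite on_line_add.
Qed.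

(** The endpoints come in either order because a staircase may raise or lower a coordinate. *)
Lemma isd_MVTs (S : set R) (f f' : R -> R) a b :
  (forall t, between a b t -> S t) ->
  (forall t, between a b t -> isd S f t (f' t)) ->
  exists2 c, between a b c & f b - f a = f' c * (b - a).
Proof.
move=> HS Hf; have [ab|ba|<-] := ltgtP a b.
- have [||c /andP[c1 c2] E] := isd_MVT ab (f := f) (f' := f') (S := S).
  + by move=> t tab; apply: HS; rewrite /between tab.
  + by move=> t tab; apply: Hf; rewrite /between tab.
  by exists c => //; rewrite /between (ltW c1) (ltW c2).
- have [||c /andP[c1 c2] E] := isd_MVT ba (f := f) (f' := f') (S := S).
  + by move=> t tab; apply: HS; rewrite /between tab orbT.
  + by move=> t tab; apply: Hf; rewrite /between tab orbT.
  exists c; first by rewrite /between (ltW c1) (ltW c2) orbT.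
  by rewrite -opprB E -mulrN opprB.
- by exists a; rewrite ?subrr ?mulr0 // /between lexx.
Qed.

Definition C1 D f : Prop := forall i x, D x -> pdable D i f x /\ cw D (pd D i f) x.

(** Strict differentiability, with both points free near [x]: the increment is telescoped along a
    staircase and each edge is handled by the mean value theorem and the continuity of one partial
    derivative. *)
Lemma C1_strict D f x : dom D -> C1 D f -> D x ->
  forall e, 0 < e -> exists2 d, 0 < d & forall y z, D y -> D z ->
    `|y - x| < d -> `|z - x| < d ->
    `|f y - f z - \sum_i pd D i f x * (y 0 i - z 0 i)| <= e * `|y - z|.
Proof.
move=> dD Cf Dx e e0; have [H [r [[oH1 oH2] r0 Hx DH Hr]]] := dom_box dD Dx.
have e1 : 0 < e / n.+1%:R by rewrite divr_gt0.
have [d d0 Hd] : exists2 d, 0 < d & forall i y, D y -> `|y - x| < d ->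
    `|pd D i f y - pd D i f x| < e / n.+1%:R.
  apply: fin_pos => [i d d' _ dd' Hd y Dy yd|i].
    by apply: Hd => //; apply: lt_le_trans dd'.
  exact: ((Cf i x Dx).2 _ e1).
exists (Num.min r d) => [|y z Dy Dz]; first by rewrite lt_min r0.
rewrite !lt_min => /andP[yr yd] /andP[zr zd].
(* The staircase from z to y: the first k coordinates are already those of y. Its vertices and edges
   lie coordinatewise between y and z, hence in D and close to x. *)
pose w (k : nat) : V := \row_i (if (i < k)%N then y 0 i else z 0 i).
have wn : w n = y by apply/rowP => i; rewrite mxE ltn_ord.
have w0 : w 0%N = z by apply/rowP => i; rewrite mxE ltn0.
have key (u : V) : (forall i, between (y 0 i) (z 0 i) (u 0 i)) -> D u /\ `|u - x| < d.
  move=> Hu; have bd a b c q p : between a b c -> `|a - q| < p -> `|b - q| < p -> `|c - q| < p.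
    by rewrite /between !ltr_norml; lra.
  have co p v : `|v - x| < p -> forall i, `|v 0 i - x 0 i| < p.
    by move=> vp i; apply: le_lt_trans vp; have := rv_norm_coord (v - x) i; rewrite !mxE.
  split.
    apply: Hr; first by apply: (oH1 y z); auto.
    apply: rv_norm_lt => // i; rewrite !mxE; apply: bd (Hu i) _ _; exact: co.
  apply: rv_norm_lt => // i; rewrite !mxE; apply: bd (Hu i) _ _; exact: co.
have step (i : 'I_n) : `|f (w i.+1) - f (w i) - pd D i f x * (y 0 i - z 0 i)|
    <= e / n.+1%:R * `|y - z|.
  have wl s j : on_line i (w i) s 0 j = w i 0 j + s * (j == i)%:R by rewrite on_lineE.
  have bw t : between 0 (y 0 i - z 0 i) t -> D (on_line i (w i) t) /\ `|on_line i (w i) t - x| < d.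
    move=> bt; apply: key => j; rewrite wl mxE.
    have [->|ji] := eqVneq j i; last first.
      by rewrite mulr0 addr0; case: ifP => _; rewrite /between; have := le_total (y 0 j) (z 0 j); lra.
    by rewrite ltnn mulr1; move: bt; rewrite /between; lra.
  have wS : w i.+1 = on_line i (w i) (y 0 i - z 0 i).
    apply/rowP => j; rewrite wl !mxE ltnS leq_eqVlt.
    have [->|ji] := eqVneq j i; first by rewrite eqxx ltnn /=; ring.
    by rewrite (negPf (_ : val j != val i)) // mulr0 addr0.
  have [|t bt|c bc E] := @isd_MVTs (on_line i (w i) @^-1` D) (f \o on_line i (w i))
     (fun s => pd D i f (on_line i (w i) s)) 0 (y 0 i - z 0 i).
  + by move=> t /bw[].
  + by apply: ispd_line; apply: pdable_ispd; apply: (Cf i _ (bw t bt).1).1.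
  move: E; rewrite /= on_line0 -wS subr0 => ->; rewrite -mulrBl normrM.
  apply: ler_pM => //; first by apply: ltW; apply: Hd; case: (bw c bc).
  by have := rv_norm_coord (y - z) i; rewrite !mxE.
have -> : f y - f z = \sum_(i < n) (f (w i.+1) - f (w i)).
  by rewrite -wn -w0 -(telescope_sumr (fun k => f (w k)) (leq0n n)) big_mkord.
rewrite -sumrB; apply: le_trans (ler_norm_sum _ _ _) _.
apply: (@le_trans _ _ (\sum_(i < n) (e / n.+1%:R * `|y - z|))); first exact: ler_sum.
rewrite sumr_const card_ord -[_ *+ n]mulr_natl mulrA ler_wpM2r //.
rewrite mulrCA ler_piMr ?(ltW e0) // ler_pdivrMr // mul1r ler_nat //.
Qed.

Lemma C1_lip D f x : dom D -> C1 D f -> D x -> exists L d, [/\ 0 < d, 0 <= L &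
  forall y z, D y -> D z -> `|y - x| < d -> `|z - x| < d -> `|f y - f z| <= L * `|y - z|].
Proof.
move=> dD Cf Dx; have [d d0 Hd] := C1_strict dD Cf Dx ltr01.
exists (1 + \sum_i `|pd D i f x|), d; split => // [|y z Dy Dz yd zd].
  by rewrite addr_ge0 // sumr_ge0.
have := Hd y z Dy Dz yd zd => K.
have -> : f y - f z = (f y - f z - \sum_i pd D i f x * (y 0 i - z 0 i)) +
  \sum_i pd D i f x * (y 0 i - z 0 i) by ring.
apply: le_trans (ler_normD _ _) _; rewrite mulrDl; apply: lerD => //.
apply: le_trans (ler_norm_sum _ _ _) _; rewrite mulr_suml; apply: ler_sum => i _.
rewrite normrM; apply: ler_wpM2l => //.
by have := rv_norm_coord (y - z) i; rewrite !mxE.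
Qed.

Lemma isd_chain (S : set R) (c : R -> V) t D f (v : 'I_n -> R) : dom D -> C1 D f ->
  (forall s, S s -> D (c s)) -> D (c t) ->
  (forall i, isd S (fun s => c s 0 i) t (v i)) ->
  isd S (fun s => f (c s)) t (\sum_i pd D i f (c t) * v i).
Proof.
move=> dD Cf SD Dc Hv; apply/isdP => e e0.
(* [L] bounds the speed of the curve near t and [P] the gradient of f at c t; each of the two error
   terms is given half of e. *)
pose L := \sum_i (`|v i| + 1) + 1.
have L1 : 0 < L by rewrite /L ltr_wpDl // sumr_ge0.
pose P := 1 + \sum_i `|pd D i f (c t)|.
have P1 : 0 < P by rewrite /P ltr_pwDl // sumr_ge0.
have e1 : 0 < e / 2 / L by rewrite !divr_gt0.
have [d1 d10 H1] := C1_strict dD Cf Dc e1.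
have e2 : 0 < Num.min 1 (e / 2 / P) by rewrite lt_min ltr01 !divr_gt0.
have [d2 d20 H2] : exists2 d, 0 < d & forall i h, `|h| < d -> S (t + h) ->
    `|c (t + h) 0 i - c t 0 i - v i * h| <= Num.min 1 (e / 2 / P) * `|h|.
  apply: fin_pos => [i d d' _ dd' Hd h hd|i]; first by apply: Hd; apply: lt_le_trans dd'.
  exact: ((isdP _ _ _ _).1 (Hv i) _ e2).
exists (Num.min d2 (d1 / L)) => [|h]; first by rewrite lt_min d20 divr_gt0.
rewrite lt_min ltr_pdivlMr // => /andP[hd2 hd1] Sh.
have K2 i := H2 i h hd2 Sh.
have cL : `|c (t + h) - c t| <= L * `|h|.
  apply: rv_norm_le => [|i]; first by rewrite mulr_ge0 // ltW.
  rewrite !mxE.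
  have -> : c (t + h) 0 i - c t 0 i = (c (t + h) 0 i - c t 0 i - v i * h) + v i * h by ring.
  apply: le_trans (ler_normD _ _) _; rewrite normrM.
  apply: (@le_trans _ _ ((`|v i| + 1) * `|h|)).
    rewrite mulrDl mul1r addrC lerD2l; apply: le_trans (K2 i) _.
    by rewrite ler_piMl // ge_min lexx.
  rewrite ler_wpM2r // /L (bigD1 i) //= -addrA lerDl.
  by apply: addr_ge0 => //; apply: sumr_ge0 => j _; exact: addr_ge0.
have := H1 _ _ (SD _ Sh) Dc; rewrite subrr normr0 => /(_ _ d10) K1.
have {}K1 : `|f (c (t + h)) - f (c t) - \sum_i pd D i f (c t) * (c (t + h) 0 i - c t 0 i)|
   <= e / 2 * `|h|.
  apply: le_trans (K1 _) _; first by apply: le_lt_trans cL _; rewrite mulrC.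
  apply: le_trans (ler_wpM2l (ltW e1) cL) _.
  by rewrite mulrA divfK // gt_eqF.
have -> : f (c (t + h)) - f (c t) - (\sum_i pd D i f (c t) * v i) * h =
  (f (c (t + h)) - f (c t) - \sum_i pd D i f (c t) * (c (t + h) 0 i - c t 0 i)) +
  \sum_i pd D i f (c t) * (c (t + h) 0 i - c t 0 i - v i * h).
  under [X in _ = _ + X]eq_bigr do rewrite mulrBr mulrA.
  by rewrite sumrB -mulr_suml; ring.
apply: le_trans (ler_normD _ _) _; rewrite [in leRHS](splitr e) mulrDl; apply: lerD => //.
apply: le_trans (ler_norm_sum _ _ _) _.
apply: (@le_trans _ _ (\sum_i `|pd D i f (c t)| * (e / 2 / P * `|h|))).
  apply: ler_sum => i _; rewrite normrM; apply: ler_wpM2l => //.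
  apply: le_trans (K2 i) _; rewrite ler_wpM2r // ge_min lexx orbT //.
rewrite -mulr_suml mulrA; apply: ler_wpM2r => //.
by rewrite mulrCA ler_piMr ?divr_ge0 ?(ltW e0) // ler_pdivrMr // mul1r /P lerDr.
Qed.

End ND.

(** * Locality of derivatives *)

Section Loc.
Variables (R : realType).

Lemma dquot_sub (S S' : set R) (f g : R -> R) t d : 0 < d ->
  (forall s, `|s - t| < d -> S' s -> S s) ->
  (forall s, `|s - t| < d -> S' s -> f s = g s) -> f t = g t ->
  dquot S f t `<=` dquot S' g t.
Proof.
move=> d0 SS' fg fgt A.
change (within [set h | S (t + h)] 0^' ((fun h => h^-1 * (f (t + h) - f t)) @^-1` A) ->
  within [set h | S' (t + h)] 0^' ((fun h => h^-1 * (g (t + h) - g t)) @^-1` A)).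
rewrite /within /= => -[e /= e0 He].
exists (Num.min d e) => [|h]; first by rewrite /= lt_min d0.
rewrite /ball_ /= sub0r normrN lt_min => /andP[hd he] h0 Sh.
have hE : `|t + h - t| < d by rewrite addrC addKr.
rewrite /preimage /= -fg // -fgt; apply: (He h) => //=; last exact: SS'.
by rewrite sub0r normrN.
Qed.

(** The filters themselves coincide, so the values of [lim] agree even where no derivative exists.
    Hence [pd_ext] and its iterates need no differentiability. *)
Lemma dquot_loc (S S' : set R) (f g : R -> R) t d : 0 < d ->
  (forall s, `|s - t| < d -> (S s <-> S' s)) ->
  (forall s, `|s - t| < d -> S s -> f s = g s) -> f t = g t ->
  dquot S f t = dquot S' g t.
Proof.
move=> d0 SS' fg fgt; rewrite eqEsubset; split; apply: (dquot_sub d0) => // s sd Ss.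
- by apply/SS'.
- by apply: fg => //; apply/SS'.
- by apply/SS'.
- by rewrite fg.
Qed.

Variable n : nat.
Notation V := 'rV[R]_n.
Implicit Types (D : set V) (f g : V -> R) (x y z : V).

(** Equality of germs with an explicit radius. The domain is compared together with the function,
    since [pd] depends on both. *)
Definition agree e x D D' f g := forall y, `|y - x| < e ->
  (D y <-> D' y) /\ (D y -> f y = g y).

Lemma pd_dquot D D' f g x e i : 0 < e -> D x -> agree e x D D' f g ->
  dquot (on_line i x @^-1` D) (f \o on_line i x) 0 =
  dquot (on_line i x @^-1` D') (g \o on_line i x) 0.
Proof.
move=> e0 Dx H.
have K s : `|s - 0| < e -> `|on_line i x s - x| < e.
  by rewrite subr0; apply: le_lt_trans; exact: on_line_dist.
apply: (dquot_loc e0) => [s /K /H[]//|s /K /H[_ +] //|/=].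
by rewrite on_line0; apply: (H x _).2; rewrite ?subrr ?normr0.
Qed.

Lemma pd_loc D D' f g x e i : 0 < e -> D x -> agree e x D D' f g ->
  pd D i f x = pd D' i g x /\ (pdable D i f x <-> pdable D' i g x).
Proof.
by move=> e0 Dx H; rewrite /pd /pdable /dwithin /dable_within (pd_dquot i e0 Dx H).
Qed.

Lemma agree_sub e e' x y D D' f g : agree e x D D' f g -> `|y - x| + e' <= e ->
  agree e' y D D' f g.
Proof.
move=> H ye z zy; apply: H; apply: lt_le_trans ye.
rewrite -(subrK y z) -addrA; apply: le_lt_trans (ler_normD _ _) _.
by rewrite [ltRHS]addrC ltrD2r.
Qed.

Lemma pds_loc D D' f g x e s : agree e x D D' f g -> agree e x D D' (pds D s f) (pds D' s g).
Proof.
move=> H; elim: s => [//|i s IH] y ye; split; first by case: (H y ye).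
move=> Dy /=; have e0 : 0 < e - `|y - x| by rewrite subr_gt0.
have {}IH : agree (e - `|y - x|) y D D' (pds D s f) (pds D' s g).
  by apply: (agree_sub IH); rewrite addrC subrK.
by have [->] := pd_loc i e0 Dy IH.
Qed.

Lemma agree_ext D f g x : (forall y, D y -> f y = g y) -> agree 1 x D D f g.
Proof. by move=> H y _; split=> //; exact: H. Qed.

Lemma pd_ext D f g x i : (forall y, D y -> f y = g y) -> D x -> pd D i f x = pd D i g x.
Proof. by move=> H Dx; have [->] := pd_loc i ltr01 Dx (agree_ext (x := x) H). Qed.

Lemma pdable_ext D f g x i : (forall y, D y -> f y = g y) -> D x ->
  pdable D i f x -> pdable D i g x.
Proof. by move=> H Dx; have [_ E] := pd_loc i ltr01 Dx (agree_ext (x := x) H); move/E. Qed.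

Lemma pds_ext D f g x s : (forall y, D y -> f y = g y) -> D x -> pds D s f x = pds D s g x.
Proof.
move=> H Dx; have := pds_loc s (agree_ext (x := x) H) (y := x).
by rewrite subrr normr0 => /(_ ltr01)[_]; exact.
Qed.

Lemma cw_loc D D' f g x e : 0 < e -> D x -> agree e x D D' f g -> cw D' g x -> cw D f x.
Proof.
move=> e0 Dx H C r r0; have [d d0 Hd] := C r r0.
exists (Num.min e d) => [|y Dy]; first by rewrite lt_min e0.
rewrite lt_min => /andP[ye yd].
have [K1 K2] := H y ye; have [|_ K3] := H x; first by rewrite subrr normr0.
by rewrite K2 // K3 //; apply: Hd => //; apply/K1.
Qed.

Lemma cw_ext D f g x : (forall y, D y -> f y = g y) -> D x -> cw D f x -> cw D g x.
Proof. by move=> H Dx; apply: (cw_loc ltr01 Dx); apply: agree_ext => y Dy; rewrite H. Qed.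

End Loc.

(** * Smooth functions and their closure properties *)

Section Smooth.
Variables (R : realType).

(** [smooth_on] quantifies over words of derivatives. Peeling off the derivative that is taken first
    gives a recursion on the order, by which products, reciprocals and compositions are handled. *)
Fixpoint Cn n (k : nat) (D : set 'rV[R]_n) (f : 'rV[R]_n -> R) : Prop :=
  (forall x, D x -> cw D f x) /\
  (if k is k'.+1 then forall i, (forall x, D x -> pdable D i f x) /\ Cn k' D (pd D i f) else True).

Definition sm n (D : set 'rV[R]_n) f := forall k, Cn k D f.

Lemma Cn_cw n k D (f : 'rV[R]_n -> R) x : Cn k D f -> D x -> cw D f x.
Proof. by case: k => [|k] [H _]; exact: H. Qed.

Lemma pds_rcons n D (f : 'rV[R]_n -> R) s i : pds D (rcons s i) f = pds D s (pd D i f).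
Proof. by rewrite /pds -cats1 foldr_cat. Qed.

Lemma smP n D (f : 'rV[R]_n -> R) : smooth_on D f <-> sm D f.
Proof.
split.
- move=> + k; elim: k f => [|k IH] f H; split=> //.
  + by have [/within_contP] := H [::].
  + by have [/within_contP] := H [::].
  + move=> i; split=> [x Dx|]; first by have [_] := H [::]; exact.
    by apply: IH => s; rewrite -pds_rcons; exact: H.
- move=> H s; elim/last_ind: s f H => [|s i IH] f H.
  + split; first by apply/within_contP; exact: (H 0%N).1.
    by move=> i x Dx; exact: (((H 1%N).2 i).1 x Dx).
  + by rewrite pds_rcons; apply: IH => k; exact: (((H k.+1).2 i).2).
Qed.

Section Fix.
Variables (n : nat).
Notation V := 'rV[R]_n.
Implicit Types (D : set V) (f g : V -> R) (x y z : V).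

Lemma CnW k D f : Cn k.+1 D f -> Cn k D f.
Proof.
elim: k f => [|k IH] f [H1 H2]; split=> // i; split; first exact: (H2 i).1.
by apply: IH; exact: (H2 i).2.
Qed.

Lemma sm_pd D f i : sm D f -> sm D (pd D i f).
Proof. by move=> H k; exact: (((H k.+1).2 i).2). Qed.

Lemma sm_pds D f s : sm D f -> sm D (pds D s f).
Proof. by move=> H; elim: s => [//|i s IH]; exact: sm_pd. Qed.

Lemma sm_pdable D f i x : sm D f -> D x -> pdable D i f x.
Proof. by move=> H; exact: (((H 1%N).2 i).1 x). Qed.

Lemma sm_cw D f x : sm D f -> D x -> cw D f x.
Proof. by move=> H; exact: (H 0%N).1. Qed.

Lemma sm_C1 D f : sm D f -> C1 D f.
Proof. by move=> H i x Dx; split; [exact: sm_pdable|apply: sm_cw => //; exact: sm_pd]. Qed.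

Lemma Cn_C1 k D f : Cn k.+1 D f -> C1 D f.
Proof. by move=> [_ H] i x Dx; split; [exact: (H i).1|exact: Cn_cw (H i).2 _]. Qed.

Lemma Cn_ext k D f g : (forall x, D x -> f x = g x) -> Cn k D f -> Cn k D g.
Proof.
elim: k f g => [|k IH] f g E [H1 H2]; split=> //; try by move=> x Dx; apply: (cw_ext E).
by move=> x Dx; apply: (cw_ext E) => //; exact: H1.
by move=> x Dx; apply: (cw_ext E) => //; exact: H1.
move=> i; split; first by move=> x Dx; apply: (pdable_ext E) => //; exact: (H2 i).1.
by apply: IH (H2 i).2 => x Dx; exact: pd_ext.
Qed.

Lemma sm_ext D f g : (forall x, D x -> f x = g x) -> sm D f -> sm D g.
Proof. by move=> E H k; apply: Cn_ext E _. Qed.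

(** The radius, the comparison domain and the comparison function may change from point to point;
    smoothness on a set covered by several charts is obtained this way. *)
Lemma sm_loc D f : (forall x, D x -> exists e D' g, [/\ 0 < e, agree e x D D' f g & sm D' g]) ->
  sm D f.
Proof.
move=> H; apply/smP => s; split.
- apply/within_contP => x Dx; have [e [D' [g [e0 ag sg]]]] := H x Dx.
  apply: (cw_loc e0 Dx (pds_loc s ag)); apply: sm_cw; first exact: sm_pds.
  by apply: (ag x _).1.1; rewrite ?subrr ?normr0.
- move=> i x Dx; have [e [D' [g [e0 ag sg]]]] := H x Dx.
  apply: (pd_loc i e0 Dx (pds_loc s ag)).2.2; apply: sm_pdable; first exact: sm_pds.
  by apply: (ag x _).1.1; rewrite ?subrr ?normr0.
Qed.

Lemma sm_sub D D' f : sm D f -> D' `<=` D ->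
  (forall x, D' x -> exists2 e, 0 < e & forall y, D y -> `|y - x| < e -> D' y) -> sm D' f.
Proof.
move=> H DD op; apply: sm_loc => x D'x; have [e e0 He] := op x D'x.
exists e, D, f; split=> // y ye; split=> //; split; [exact: DD|move=> Dy; exact: He].
Qed.

Lemma cw_cst D c x : cw D (fun=> c) x.
Proof. by move=> e e0; exists 1 => // y _ _; rewrite subrr normr0. Qed.

Lemma cw_coord D i x : cw D (fun y => y 0 i) x.
Proof.
move=> e e0; exists e => // y _; apply: le_lt_trans.
by have := rv_norm_coord (y - x) i; rewrite !mxE.
Qed.

Lemma cw_add D f g x : cw D f x -> cw D g x -> cw D (fun y => f y + g y) x.
Proof. by move=> /cwP Hf /cwP Hg; apply/cwP; exact: cvgD Hf Hg. Qed.

Lemma cw_mul D f g x : cw D f x -> cw D g x -> cw D (fun y => f y * g y) x.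
Proof. by move=> /cwP Hf /cwP Hg; apply/cwP; exact: cvgM Hf Hg. Qed.

Lemma cw_inv D f x : f x != 0 -> cw D f x -> cw D (fun y => (f y)^-1) x.
Proof. by move=> f0 /cwP Hf; apply/cwP; exact: cvgV f0 Hf. Qed.

Lemma cw_sqrt D f x : cw D f x -> cw D (fun y => Num.sqrt (f y)) x.
Proof.
move=> /cwP Hf; apply/cwP.
exact: (cvg_comp _ _ Hf (@sqrt_continuous R (f x))).
Qed.

Lemma ispd_cst D i c x : ispd D i (fun=> c) x 0.
Proof. exact: isd_cst. Qed.

Lemma ispd_coord D i j x : ispd D i (fun y => y 0 j) x (i == j)%:R.
Proof.
apply/isdP => e e0; exists 1 => // h _ _.
by rewrite /= !on_lineE eq_sym; case: eqP => _; rewrite ?mulr1 ?mul1r ?mul0r ?mulr0 ?addr0 ?add0r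
  ?[_ + h]addrC ?addrK ?subrr normr0 mulr_ge0 // ltW.
Qed.

Lemma ispd_add D i f g x l l' : ispd D i f x l -> ispd D i g x l' ->
  ispd D i (fun y => f y + g y) x (l + l').
Proof. exact: isdD. Qed.

Lemma ispd_mul D i f g x l l' : ispd D i f x l -> ispd D i g x l' ->
  ispd D i (fun y => f y * g y) x (l * g x + f x * l').
Proof. by move=> H1 H2; have := isdM H1 H2; rewrite /= on_line0. Qed.

Lemma ispd_inv D i f x l : f x != 0 -> ispd D i f x l ->
  ispd D i (fun y => (f y)^-1) x (- l * ((f x)^-1 * (f x)^-1)).
Proof.
move=> f0 H; rewrite /ispd.
have := @isdV R (on_line i x @^-1` D) (f \o on_line i x) 0 l; rewrite /= on_line0 => /(_ f0 H).
by rewrite expr2 invfM.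
Qed.

Lemma ispd_sqrt D i f x l : 0 < f x -> ispd D i f x l ->
  ispd D i (fun y => Num.sqrt (f y)) x ((2 * Num.sqrt (f x))^-1 * l).
Proof.
move=> f0 H; rewrite /ispd.
apply: (@isd_comp1 R _ (f \o on_line i x) 0 l Num.sqrt _ _ H).
by rewrite /= on_line0; exact: is_derive1_sqrt.
Qed.

Lemma ispd_chain p (F : V -> 'rV[R]_p) D (D' : set 'rV[R]_p) i (f : 'rV[R]_p -> R) x :
  dom D' -> C1 D' f -> D x -> (forall y, D y -> D' (F y)) ->
  (forall j, pdable D i (fun y => F y 0 j) x) ->
  ispd D i (fun y => f (F y)) x (\sum_j pd D' j f (F x) * pd D i (fun y => F y 0 j) x).
Proof.
move=> dD' Cf Dx DD' H.
have := @isd_chain R p (on_line i x @^-1` D) (fun h => F (on_line i x h)) 0 D' f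
  (fun j => pd D i (fun y => F y 0 j) x) dD' Cf.
rewrite on_line0; apply=> // [h|]; exact: DD'.
Qed.

Lemma Cn_cst k D c : dom D -> Cn k D (fun=> c).
Proof.
move=> dD; elim: k c => [|k IH] c; first by split=> // x _; exact: cw_cst.
split=> [x _|i]; first exact: cw_cst.
split; first by move=> x Dx; exact: ispd_pdable (@ispd_cst _ _ _ _).
by apply: Cn_ext (IH 0) => x Dx; rewrite (ispd_pd dD Dx (@ispd_cst _ _ _ _)).
Qed.

Lemma Cn_coord k D j : dom D -> Cn k D (fun y => y 0 j).
Proof.
move=> dD; case: k => [|k]; first by split=> // x _; exact: cw_coord.
split=> [x _|i]; first exact: cw_coord.
split; first by move=> x Dx; exact: ispd_pdable (@ispd_coord _ _ _ _).
by apply: Cn_ext (Cn_cst k _ dD) => x Dx; rewrite (ispd_pd dD Dx (@ispd_coord _ _ _ _)).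
Qed.

Lemma Cn_add k D f g : dom D -> Cn k D f -> Cn k D g -> Cn k D (fun y => f y + g y).
Proof.
move=> dD; elim: k f g => [|k IH] f g [Hf Hf'] [Hg Hg']; split=> //.
- by move=> x Dx; apply: cw_add; [exact: Hf|exact: Hg].
- by move=> x Dx; apply: cw_add; [exact: Hf|exact: Hg].
move=> i; have K x : D x -> ispd D i (fun y => f y + g y) x (pd D i f x + pd D i g x).
  by move=> Dx; apply: ispd_add; [exact: (Hf' i).1|exact: (Hg' i).1].
split; first by move=> x /K; exact: ispd_pdable.
apply: Cn_ext (IH _ _ (Hf' i).2 (Hg' i).2) => x Dx.
by rewrite (ispd_pd dD Dx (K x Dx)).
Qed.

Lemma Cn_mul k D f g : dom D -> Cn k D f -> Cn k D g -> Cn k D (fun y => f y * g y).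
Proof.
move=> dD; elim: k f g => [|k IH] f g Cf Cg; move: (Cf) (Cg) => [Hf Hf'] [Hg Hg']; split=> //.
- by move=> x Dx; apply: cw_mul; [exact: Hf|exact: Hg].
- by move=> x Dx; apply: cw_mul; [exact: Hf|exact: Hg].
move=> i; have K x : D x -> ispd D i (fun y => f y * g y) x (pd D i f x * g x + f x * pd D i g x).
  by move=> Dx; apply: ispd_mul; [exact: (Hf' i).1|exact: (Hg' i).1].
split; first by move=> x /K; exact: ispd_pdable.
apply: Cn_ext (Cn_add dD (IH _ _ (Hf' i).2 (CnW Cg)) (IH _ _ (CnW Cf) (Hg' i).2)) => x Dx.
by rewrite (ispd_pd dD Dx (K x Dx)).
Qed.

Lemma Cn_inv k D f : dom D -> (forall x, D x -> f x != 0) -> Cn k D f ->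
  Cn k D (fun y => (f y)^-1).
Proof.
move=> dD f0; elim: k => [|k IH] Cf; move: (Cf) => [Hf Hf']; split=> //.
- by move=> x Dx; apply: cw_inv; [exact: f0|exact: Hf].
- by move=> x Dx; apply: cw_inv; [exact: f0|exact: Hf].
move=> i; have K x : D x -> ispd D i (fun y => (f y)^-1) x (- pd D i f x * ((f x)^-1 * (f x)^-1)).
  by move=> Dx; apply: ispd_inv; [exact: f0|exact: (Hf' i).1].
split; first by move=> x /K; exact: ispd_pdable.
have If := IH (CnW Cf).
apply: Cn_ext (Cn_mul dD (Cn_mul dD (Cn_cst k (-1) dD) (Hf' i).2) (Cn_mul dD If If)) => x Dx.
by rewrite (ispd_pd dD Dx (K x Dx)) mulN1r.
Qed.

Lemma Cn_sqrt k D f : dom D -> (forall x, D x -> 0 < f x) -> Cn k D f ->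
  Cn k D (fun y => Num.sqrt (f y)).
Proof.
move=> dD f0; elim: k => [|k IH] Cf; move: (Cf) => [Hf Hf']; split=> //.
- by move=> x Dx; apply: cw_sqrt; exact: Hf.
- by move=> x Dx; apply: cw_sqrt; exact: Hf.
move=> i; have K x : D x ->
    ispd D i (fun y => Num.sqrt (f y)) x ((2 * Num.sqrt (f x))^-1 * pd D i f x).
  by move=> Dx; apply: ispd_sqrt; [exact: f0|exact: (Hf' i).1].
split; first by move=> x /K; exact: ispd_pdable.
have If := IH (CnW Cf).
have Jf : Cn k D (fun y => (2 * Num.sqrt (f y))^-1).
  apply: Cn_inv => // [x Dx|]; last by apply: Cn_mul => //; exact: Cn_cst.
  by rewrite mulf_neq0 ?pnatr_eq0 // gt_eqF // sqrtr_gt0 f0.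
apply: Cn_ext (Cn_mul dD Jf (Hf' i).2) => x Dx.
by rewrite (ispd_pd dD Dx (K x Dx)).
Qed.

Lemma Cn_sum k D (I : Type) (r : seq I) (P : pred I) (f : I -> V -> R) : dom D ->
  (forall i, P i -> Cn k D (f i)) -> Cn k D (fun y => \sum_(i <- r | P i) f i y).
Proof.
move=> dD H; elim: r => [|i r IH].
  by apply: Cn_ext (Cn_cst k 0 dD) => x _; rewrite big_nil.
case Pi : (P i); last by apply: Cn_ext IH => x _; rewrite big_cons Pi.
by apply: Cn_ext (Cn_add dD (H i Pi) IH) => x _; rewrite big_cons Pi.
Qed.

Lemma Cn_prod k D (I : Type) (r : seq I) (P : pred I) (f : I -> V -> R) : dom D ->
  (forall i, P i -> Cn k D (f i)) -> Cn k D (fun y => \prod_(i <- r | P i) f i y).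
Proof.
move=> dD H; elim: r => [|i r IH].
  by apply: Cn_ext (Cn_cst k 1 dD) => x _; rewrite big_nil.
case Pi : (P i); last by apply: Cn_ext IH => x _; rewrite big_cons Pi.
by apply: Cn_ext (Cn_mul dD (H i Pi) IH) => x _; rewrite big_cons Pi.
Qed.

End Fix.

Lemma cw_comp n p D (D' : set 'rV[R]_p) (F : 'rV[R]_n -> 'rV[R]_p) f x : (forall y, D y -> D' (F y)) ->
  (forall j, cw D (fun y => F y 0 j) x) -> cw D' f (F x) -> cw D (fun y => f (F y)) x.
Proof.
move=> DD HF Hf e e0; have [d d0 Hd] := Hf e e0.
have [r r0 Hr] : exists2 r, 0 < r & forall j y, D y -> `|y - x| < r -> `|F y 0 j - F x 0 j| < d.
  apply: fin_pos => [j r r' _ rr H y Dy yr|j]; last exact: HF.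
  by apply: H => //; apply: lt_le_trans rr.
exists r => // y Dy yr; apply: Hd; first exact: DD.
by apply: rv_norm_lt => // j; rewrite !mxE; exact: Hr.
Qed.

Lemma Cn_comp n p k D (D' : set 'rV[R]_p) (F : 'rV[R]_n -> 'rV[R]_p) f : dom D -> dom D' ->
  (forall y, D y -> D' (F y)) -> (forall j, Cn k D (fun y => F y 0 j)) -> Cn k D' f ->
  Cn k D (fun y => f (F y)).
Proof.
move=> dD dD' DD; elim: k f => [|k IH] f HF Hf.
  split=> // x Dx; apply: (cw_comp (D' := D')) => //; last by apply: Hf.1; exact: DD.
  by move=> j; exact: (HF j).1.
split=> [x Dx|i].
  apply: (cw_comp (D' := D')) => //; last by apply: Hf.1; exact: DD.
  by move=> j; exact: (HF j).1.
have K x : D x -> ispd D i (fun y => f (F y)) x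
    (\sum_j pd D' j f (F x) * pd D i (fun y => F y 0 j) x).
  move=> Dx; apply: ispd_chain => //; first exact: Cn_C1 Hf.
  by move=> j; exact: (((HF j).2 i).1).
split; first by move=> x /K; exact: ispd_pdable.
have S : Cn k D (fun x => \sum_j pd D' j f (F x) * pd D i (fun y => F y 0 j) x).
  apply: Cn_sum => // j _; apply: Cn_mul => //; last exact: ((HF j).2 i).2.
  by apply: (IH (pd D' j f)) => [l|]; [exact: CnW|exact: ((Hf.2 j).2)].
by apply: Cn_ext S => x Dx; rewrite (ispd_pd dD Dx (K x Dx)).
Qed.

End Smooth.

(** * The last coordinate and restriction to the boundary hyperplane *)

Section Restriction.
Variables (R : realType) (n : nat).

Lemma emb_neq_last (j : 'I_n.-1) : (emb j).+1 != n.
Proof. by rewrite /emb /=; case: n j => [[]//|p [j jp]] /=; rewrite eqSS ltn_eqF. Qed.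

Lemma snoc_emb (u : 'rV[R]_n.-1) t j : snoc u t 0 (emb j) = u 0 j.
Proof.
rewrite mxE; case: insubP => [k _ /= kj|]; last by rewrite /emb /= ltn_ord.
by congr (u 0 _); apply: val_inj.
Qed.

Lemma snoc_last (u : 'rV[R]_n.-1) t (i : 'I_n) : i.+1 = n -> snoc u t 0 i = t.
Proof.
move=> iE; rewrite mxE; case: insubP => [k /= kn _|//].
by move: kn; rewrite -[X in (_ < X.-1)%N]iE /= ltnn.
Qed.

(** Informative, so that matrices can be defined by distinguishing the last index from the others,
    as in [frame_ext]. *)
Lemma embP (i : 'I_n) : (i.+1 = n) + {j | i = emb j}.
Proof.
case: (ltnP i n.-1) => [ij|ni]; first by right; exists (Ordinal ij); apply: val_inj.
left; apply/eqP; rewrite eqn_leq ltn_ord /=.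
by case: n i ni => [[]//|p i] /=.
Qed.

Lemma emb_lastP (N : 'I_n) : N.+1 = n -> forall i, i = N \/ exists j, i = emb j.
Proof.
move=> HN i; case: (embP i) => [iN|[j ->]]; last by right; exists j.
by left; apply: val_inj; apply: succn_inj; rewrite iN HN.
Qed.

Lemma snoc_line (u : 'rV[R]_n.-1) t j h : on_line (emb j) (snoc u t) h = snoc (on_line j u h) t.
Proof.
apply/rowP => i; rewrite on_lineE; case: (embP i) => [il|[k ->]].
  rewrite !snoc_last // (_ : i == emb j = false) ?mulr0 ?addr0 //.
  by apply/eqP => ie; have := emb_neq_last j; rewrite -ie il eqxx.
rewrite !snoc_emb on_lineE; congr (_ + _ * _%:R).
Qed.

Definition slice (D : set 'rV[R]_n) : set 'rV[R]_n.-1 := [set u | D (snoc u 0)].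

(** Both sides are limits of the same quotients, so no regularity is assumed. *)
Lemma pd_slice D j f u : pd (slice D) j (fun u => f (snoc u 0)) u = pd D (emb j) f (snoc u 0).
Proof.
rewrite /pd; congr dwithin.
  by apply/funext => h; rewrite /slice /preimage /= snoc_line.
by apply/funext => h /=; rewrite snoc_line.
Qed.

Lemma pds_slice D s f u :
  pds (slice D) s (fun u => f (snoc u 0)) u = pds D (map (@emb n) s) f (snoc u 0).
Proof.
elim: s u => [//|j s IH] u /=; rewrite -pd_slice; congr pd.
by apply/funext => v; exact: IH.
Qed.

Lemma lastc_snoc (u : 'rV[R]_n.-1) t : (0 < n)%N -> lastc (snoc u t) = t.
Proof.
move=> n0; have ln : (n.-1 < n)%N by rewrite prednK.
rewrite /lastc (bigD1 (Ordinal ln)) /=; last by rewrite prednK.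
rewrite snoc_last /= ?prednK // big1 ?addr0 // => i /andP[/eqP il].
by move/negP => []; apply/eqP/val_inj; rewrite /= -[X in _ = X.-1]il.
Qed.

Lemma lastcE (x : 'rV[R]_n) (i : 'I_n) : i.+1 = n -> lastc x = x 0 i.
Proof.
move=> il; rewrite /lastc (bigD1 i) /=; last by rewrite il.
rewrite big1 ?addr0 // => j /andP[/eqP jl].
by move/negP => []; apply/eqP/val_inj; apply: succn_inj; rewrite il.
Qed.

Lemma front_snoc (u : 'rV[R]_n.-1) t : front (snoc u t) = u.
Proof. by apply/rowP => j; rewrite mxE snoc_emb. Qed.

Lemma snoc_front (x : 'rV[R]_n) : snoc (front x) (lastc x) = x.
Proof.
apply/rowP => i; case: (embP i) => [il|[j ->]]; last by rewrite snoc_emb mxE.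
by rewrite snoc_last // (lastcE x il).
Qed.

Lemma orth_half : orth (@halfspace R n).
Proof.
case: (posnP n) => [n0|n0].
  have H x : @halfspace R n x.
    by rewrite /halfspace /= /lastc big1 // => i; have := ltn_ord i; rewrite [X in (_ < X)%N]n0.
  by split=> *; exact: H.
have ln : (n.-1 < n)%N by rewrite prednK.
have il : (Ordinal ln).+1 = n by rewrite /= prednK.
split=> [x y z|x i h]; rewrite /halfspace /= !(lastcE _ il).
  by move=> hx hy /(_ (Ordinal ln)); rewrite /between; lra.
move=> hx h0; rewrite !mxE addr_ge0 // mulr_ge0 // ler0n //.
Qed.

End Restriction.

Opaque pd.

(** * Rules of differentiation and symmetry of iterated derivatives *)

Section SmoothOps.
Variables (R : realType) (n : nat) (D : set 'rV[R]_n).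
Hypothesis dD : dom D.
Notation V := 'rV[R]_n.
Implicit Types (f g : V -> R) (x y z : V).

Lemma sm_cst c : sm D (fun=> c).
Proof. by move=> k; exact: Cn_cst. Qed.

Lemma sm_coord j : sm D (fun y => y 0 j).
Proof. by move=> k; exact: Cn_coord. Qed.

Lemma sm_add f g : sm D f -> sm D g -> sm D (fun y => f y + g y).
Proof. by move=> Hf Hg k; exact: Cn_add. Qed.

Lemma sm_mul f g : sm D f -> sm D g -> sm D (fun y => f y * g y).
Proof. by move=> Hf Hg k; exact: Cn_mul. Qed.

Lemma sm_opp f : sm D f -> sm D (fun y => - f y).
Proof.
move=> Hf; apply: sm_ext (sm_mul (sm_cst (-1)) Hf) => x _; by rewrite mulN1r.
Qed.

Lemma sm_minus f g : sm D f -> sm D g -> sm D (fun y => f y - g y).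
Proof. by move=> Hf Hg; apply: sm_add => //; exact: sm_opp. Qed.

Lemma sm_sum (I : Type) (r : seq I) (P : pred I) (f : I -> V -> R) :
  (forall i, P i -> sm D (f i)) -> sm D (fun y => \sum_(i <- r | P i) f i y).
Proof. by move=> H k; apply: Cn_sum => // i /H. Qed.

Lemma sm_prod (I : Type) (r : seq I) (P : pred I) (f : I -> V -> R) :
  (forall i, P i -> sm D (f i)) -> sm D (fun y => \prod_(i <- r | P i) f i y).
Proof. by move=> H k; apply: Cn_prod => // i /H. Qed.

Lemma sm_inv f : (forall x, D x -> f x != 0) -> sm D f -> sm D (fun y => (f y)^-1).
Proof. by move=> f0 Hf k; exact: Cn_inv. Qed.

Lemma sm_sqrt f : (forall x, D x -> 0 < f x) -> sm D f -> sm D (fun y => Num.sqrt (f y)).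
Proof. by move=> f0 Hf k; exact: Cn_sqrt. Qed.

Lemma sm_comp p (D' : set 'rV[R]_p) (F : V -> 'rV[R]_p) (f : 'rV[R]_p -> R) : dom D' ->
  (forall y, D y -> D' (F y)) -> (forall j, sm D (fun y => F y 0 j)) -> sm D' f ->
  sm D (fun y => f (F y)).
Proof. by move=> dD' DD HF Hf k; apply: (Cn_comp (D' := D')) => // j; exact: HF. Qed.

Lemma sm_det p (M : V -> 'M[R]_p) : (forall i j, sm D (fun y => M y i j)) ->
  sm D (fun y => \det (M y)).
Proof.
move=> H; rewrite /determinant; apply: sm_sum => s _; apply: sm_mul; first exact: sm_cst.
by apply: sm_prod => i _.
Qed.

(** Cramer's rule: cofactors and determinants are polynomials in the entries. *)
Lemma sm_invmx p (M : V -> 'M[R]_p) : (forall i j, sm D (fun y => M y i j)) ->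
  (forall y, D y -> M y \in unitmx) -> forall i j, sm D (fun y => invmx (M y) i j).
Proof.
move=> H U i j.
apply: (@sm_ext _ _ _ (fun y => (\det (M y))^-1 * ((-1) ^+ (j + i) * \det (row' j (col' i (M y)))))).
  by move=> y Dy; rewrite /invmx U // !mxE.
apply: sm_mul.
  apply: sm_inv; last exact: sm_det.
  by move=> x Dx; have := U x Dx; rewrite unitmxE unitfE.
apply: sm_mul; first exact: sm_cst.
apply: sm_det => a b; apply: sm_ext (H (lift j a) (lift i b)) => y _; by rewrite !mxE.
Qed.

Lemma pd_cst i c x : D x -> pd D i (fun=> c) x = 0.
Proof. by move=> Dx; rewrite (ispd_pd dD Dx (@ispd_cst _ _ _ _ _ _)). Qed.

Lemma pd_coord i j x : D x -> pd D i (fun y => y 0 j) x = (i == j)%:R.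
Proof. by move=> Dx; rewrite (ispd_pd dD Dx (@ispd_coord _ _ _ _ _ _)). Qed.

Lemma pd_add i f g x : sm D f -> sm D g -> D x ->
  pd D i (fun y => f y + g y) x = pd D i f x + pd D i g x.
Proof.
move=> Hf Hg Dx; apply: (ispd_pd dD Dx); apply: ispd_add; exact: sm_pdable.
Qed.

Lemma pd_mul i f g x : sm D f -> sm D g -> D x ->
  pd D i (fun y => f y * g y) x = pd D i f x * g x + f x * pd D i g x.
Proof.
move=> Hf Hg Dx; apply: (ispd_pd dD Dx); apply: ispd_mul; exact: sm_pdable.
Qed.

Lemma pd_scale i c f x : sm D f -> D x ->
  pd D i (fun y => c * f y) x = c * pd D i f x.
Proof.
by move=> Hf Dx; rewrite pd_mul ?pd_cst ?mul0r ?add0r //; exact: sm_cst.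
Qed.

Lemma pd_opp i f x : sm D f -> D x -> pd D i (fun y => - f y) x = - pd D i f x.
Proof.
move=> Hf Dx; rewrite -mulN1r -pd_scale //; apply: pd_ext => // y _; by rewrite mulN1r.
Qed.

Lemma pd_minus i f g x : sm D f -> sm D g -> D x ->
  pd D i (fun y => f y - g y) x = pd D i f x - pd D i g x.
Proof. by move=> Hf Hg Dx; rewrite pd_add ?pd_opp //; exact: sm_opp. Qed.

Lemma pd_sum (I : Type) (r : seq I) (P : pred I) (f : I -> V -> R) i x :
  (forall a, P a -> sm D (f a)) -> D x ->
  pd D i (fun y => \sum_(a <- r | P a) f a y) x = \sum_(a <- r | P a) pd D i (f a) x.
Proof.
move=> H Dx; elim: r => [|a r IH].
  by rewrite big_nil -[RHS](pd_cst i 0 Dx); apply: pd_ext => // y _; rewrite big_nil.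
rewrite big_cons; case Pa : (P a); last first.
  by rewrite -IH; apply: pd_ext => // y _; rewrite big_cons Pa.
rewrite -IH -pd_add //; first last.
- exact: sm_sum.
- exact: H.
by apply: pd_ext => // y _; rewrite big_cons Pa.
Qed.

Lemma pd_prod (I : eqType) (r : seq I) (f : I -> V -> R) i x : uniq r ->
  (forall a, sm D (f a)) -> D x ->
  pd D i (fun y => \prod_(a <- r) f a y) x =
  \sum_(a <- r) pd D i (f a) x * \prod_(b <- r | b != a) f b x.
Proof.
move=> + H Dx; elim: r => [_|a r IH /= /andP[ar ur]].
  by rewrite big_nil -[RHS](pd_cst i 1 Dx); apply: pd_ext => // y _; rewrite big_nil.
rewrite (@pd_ext _ _ _ _ (fun y => f a y * \prod_(b <- r) f b y)) //; last first.
  by move=> y _; rewrite big_cons.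
rewrite pd_mul //; last by apply: sm_prod.
rewrite !big_cons eqxx /= IH // mulr_sumr; congr (_ + _).
  congr (_ * _); rewrite [RHS]big_seq_cond [LHS]big_seq; apply: eq_bigl => b.
  by case br : (b \in r) => //=; apply/esym; apply: contraNneq ar => <-.
rewrite [LHS]big_seq [RHS]big_seq; apply: eq_bigr => b br.
have ab : a != b by apply: contraNneq ar => ->.
by rewrite big_cons ab mulrCA.
Qed.

Lemma pd_comp p (D' : set 'rV[R]_p) (F : V -> 'rV[R]_p) (f : 'rV[R]_p -> R) i x : dom D' ->
  (forall y, D y -> D' (F y)) -> (forall j, sm D (fun y => F y 0 j)) -> sm D' f -> D x ->
  pd D i (fun y => f (F y)) x = \sum_j pd D' j f (F x) * pd D i (fun y => F y 0 j) x.
Proof.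
move=> dD' DD HF Hf Dx; apply: (ispd_pd dD Dx); apply: ispd_chain => //; first exact: sm_C1.
by move=> j; exact: sm_pdable.
Qed.

Lemma isd_curve (S : set R) (c : R -> V) t f (v : 'I_n -> R) : sm D f ->
  (forall s, S s -> D (c s)) -> D (c t) ->
  (forall i, isd S (fun s => c s 0 i) t (v i)) ->
  isd S (fun s => f (c s)) t (\sum_i pd D i f (c t) * v i).
Proof. by move=> Hf; apply: isd_chain => //; exact: sm_C1. Qed.

(** Two applications of the mean value theorem, first in direction i and then in direction j. Only
    steps [h > 0] occur, which an orthant-like domain permits at each of its points. *)
Lemma second_diff i j f x : sm D f -> D x -> forall e, 0 < e -> exists2 d, 0 < d &
  forall h, 0 < h < d ->
  `|f (on_line j (on_line i x h) h) - f (on_line i x h) - f (on_line j x h) + f x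
    - h ^+ 2 * pd D j (pd D i f) x| <= e * h ^+ 2.
Proof.
move=> Hf Dx e e0.
have Hif : sm D (pd D i f) by exact: sm_pd.
have [H [r [[_ oH] r0 Hx DH Hr]]] := dom_box dD Dx.
have [d d0 Hd] := sm_cw (sm_pd j Hif) Dx e0.
exists (Num.min r d / 2) => [|h /andP[h0]]; first by rewrite divr_gt0 // lt_min r0.
rewrite ltr_pdivlMr // lt_min => /andP[hr hd].
pose p a b := on_line j (on_line i x a) b.
have pC a b : p a b = on_line i (on_line j x b) a by rewrite /p /on_line addrAC.
have Hp a b : 0 <= a <= h -> 0 <= b <= h -> D (p a b) /\ `|p a b - x| < d.
  move=> /andP[a0 ah] /andP[b0 bh].
  have le2 : `|p a b - x| <= h * 2.
    have -> : p a b - x = (p a b - on_line i x a) + (on_line i x a - x) by rewrite addrA subrK.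
    apply: le_trans (ler_normD _ _) _; rewrite mulr_natr mulr2n; apply: lerD.
      by apply: le_trans (on_line_dist j _ b) _; rewrite ger0_norm.
    by apply: le_trans (on_line_dist i _ a) _; rewrite ger0_norm.
  split; last exact: le_lt_trans hd.
  apply: Hr; last exact: le_lt_trans hr.
  exact: (oH _ _ _ (oH _ _ _ Hx _) _).
have h0' := ltW h0.
have l0 : 0 <= (0 : R) <= h by rewrite lexx h0'.
have lh : 0 <= h <= h by rewrite lexx h0'.
have lineI g b a : sm D g -> 0 <= a <= h -> 0 <= b <= h ->
    isd [set s | 0 <= s <= h] (fun s => g (p s b)) a (pd D i g (p a b)).
  move=> Hg ah bh; rewrite pC.
  have -> : (fun s => g (p s b)) = g \o on_line i (on_line j x b).
    by apply/funext => s /=; rewrite pC.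
  apply: isd_sub (@ispd_line _ _ D i g (on_line j x b) a _ _); last first.
    by rewrite -pC; apply: sm_pdable => //; exact: (Hp a b ah bh).1.
  by move=> s /= sh; rewrite -pC; exact: (Hp s b sh bh).1.
have lineJ g a b : sm D g -> 0 <= a <= h -> 0 <= b <= h ->
    isd [set s | 0 <= s <= h] (fun s => g (p a s)) b (pd D j g (p a b)).
  move=> Hg ah bh; rewrite /p.
  apply: isd_sub (@ispd_line _ _ D j g (on_line i x a) b _ _); last first.
    by apply: sm_pdable => //; exact: (Hp a b ah bh).1.
  by move=> s /= sh; exact: (Hp a s ah sh).1.
have [||c /andP[c0 ch] E1] := @isd_MVT R [set s | 0 <= s <= h] (fun a => f (p a h) - f (p a 0))
    (fun a => pd D i f (p a h) - pd D i f (p a 0)) 0 h h0.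
- by [].
- by move=> t th; apply: isdB; exact: lineI.
have cH : 0 <= c <= h by rewrite !ltW.
have [||c' /andP[c'0 c'h] E2] := @isd_MVT R [set s | 0 <= s <= h] (fun b => pd D i f (p c b))
    (fun b => pd D j (pd D i f) (p c b)) 0 h h0.
- by [].
- by move=> t th; exact: lineJ.
have c'H : 0 <= c' <= h by rewrite !ltW.
have p0 a : p a 0 = on_line i x a by rewrite /p on_line0.
have p1 b : p 0 b = on_line j x b by rewrite pC on_line0.
have -> : f (on_line j (on_line i x h) h) - f (on_line i x h) - f (on_line j x h) + f x =
   h ^+ 2 * pd D j (pd D i f) (p c c').
  move: E1; rewrite E2 !subr0 p0 p1 p0 on_line0 => E1.
  transitivity (f (p h h) - f (on_line i x h) - (f (on_line j x h) - f x)); first by rewrite /p; ring.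
  by rewrite E1; ring.
rewrite -mulrBr normrM ger0_norm ?exprn_ge0 // mulrC ler_wpM2r ?exprn_ge0 // ltW //.
by apply: Hd; case: (Hp c c' cH c'H).
Qed.

(** The second difference is symmetric in i and j, and [second_diff] compares it with either mixed
    derivative. *)
Lemma schwarz i j f x : sm D f -> D x -> pd D i (pd D j f) x = pd D j (pd D i f) x.
Proof.
move=> Hf Dx; apply/eqP; rewrite -subr_eq0 -normr_le0; apply/ler_addgt0Pl => e e0.
rewrite addr0.
have e2 : 0 < e / 2 by rewrite divr_gt0.
have [d d0 H1] := second_diff i j Hf Dx e2.
have [d' d'0 H2] := second_diff j i Hf Dx e2.
pose h := Num.min d d' / 2.
have m0 : 0 < Num.min d d' by rewrite lt_min d0.
have h0 : 0 < h by rewrite divr_gt0.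
have hm : h < Num.min d d' by rewrite ltr_pdivrMr // ltr_pMr // ltr1n.
have hd : 0 < h < d by rewrite h0; apply: lt_le_trans hm _; rewrite ge_min lexx.
have hd' : 0 < h < d' by rewrite h0; apply: lt_le_trans hm _; rewrite ge_min lexx orbT.
have := H1 h hd; have := H2 h hd'.
have -> : on_line i (on_line j x h) h = on_line j (on_line i x h) h by rewrite /on_line addrAC.
set a := f _; set b := f _; set c := f _ => K2 K1.
have hh : 0 < h ^+ 2 by rewrite exprn_gt0.
rewrite -(ler_pM2l hh) -[h ^+ 2 in leLHS]gtr0_norm // -normrM.
move: (pd D i (pd D j f) x) (pd D j (pd D i f) x) (f x) a b c K1 K2 => p q r a b c K1 K2.
have -> : h ^+ 2 * (p - q) = (a - c - b + r - h ^+ 2 * q) - (a - b - c + r - h ^+ 2 * p) by ring.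
apply: le_trans (ler_normB _ _) _; apply: le_trans (lerD K1 K2) _.
by rewrite -mulrDl -splitr mulrC.
Qed.

Lemma pds_mid f i s1 s2 x : sm D f -> D x ->
  pds D (s1 ++ i :: s2) f x = pds D (i :: s1 ++ s2) f x.
Proof.
move=> Hf; elim: s1 x => [//|a s1 IH] x Dx /=.
rewrite (pd_ext a (g := pds D (i :: s1 ++ s2) f)); [|exact: IH|exact: Dx].
by rewrite /= schwarz //; exact: sm_pds.
Qed.

Lemma pds_perm f s s' x : sm D f -> perm_eq s s' -> D x -> pds D s f x = pds D s' f x.
Proof.
move=> Hf; elim: s s' x => [|i s IH] s' x.
  by rewrite perm_sym => /perm_nilP ->.
move=> ps; have : i \in s' by rewrite -(perm_mem ps) inE eqxx.
move=> is'; move: ps; have [s1 [s2 ->]] : exists s1 s2, s' = s1 ++ i :: s2.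
  by case/splitPr: is' => s1 s2; exists s1, s2.
rewrite perm_sym -[i :: s2]cat1s perm_catCA /= perm_cons perm_sym => ps Dx.
by rewrite pds_mid //=; apply: pd_ext => // y Dy; exact: IH.
Qed.

End SmoothOps.

(** * Frames and norms of tensors *)

Section Frames.
Variable R : realType.

Definition posdef n (G : 'M[R]_n) := forall v : 'rV[R]_n, v != 0 -> 0 < (v *m G *m v^T) 0 0.

Lemma posdef_unit n (G : 'M[R]_n) : posdef G -> G \in unitmx.
Proof.
move=> pG; rewrite -row_free_unit -kermx_eq0; apply/eqP/row_matrixP => i; rewrite row0.
apply/eqP; apply: contraT => v0; have := pG _ v0.
have /sub_kermxP -> : (row i (kermx G) <= kermx G)%MS by exact: row_sub.
by rewrite mul0mx mxE ltxx.
Qed.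

Lemma posdef_congr n (G P : 'M[R]_n) : P \in unitmx -> posdef G -> posdef (P *m G *m P^T).
Proof.
move=> uP pG v v0; rewrite !mulmxA -mulmxA -trmx_mul; apply: pG.
by apply: contraNneq v0 => /(congr1 (mulmx^~ (invmx P))); rewrite mulmxK // mul0mx => ->.
Qed.

Lemma invmx_sym n (G : 'M[R]_n) : G^T = G -> (invmx G)^T = invmx G.
Proof. by move=> sG; rewrite trmx_inv sG. Qed.

(** Induction on the dimension by eliminating the first coordinate; the Schur complement of a
    positive definite matrix is positive definite. *)
Lemma frame_exists n (G : 'M[R]_n) : G^T = G -> posdef G ->
  exists E : 'M[R]_n, E *m G *m E^T = 1%:M.
Proof.
elim: n G => [|n IH] G sG pG; first by exists 1%:M; rewrite thinmx0 [RHS]thinmx0.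
pose G1 : 'M[R]_(1 + n) := G; rewrite -/G1 in sG pG *.
have [a [b [C GE]]] : exists a : R, exists b : 'rV[R]_n, exists C : 'M[R]_n,
    G1 = block_mx a%:M b b^T C.
  exists (ulsubmx G1 0 0), (ursubmx G1), (drsubmx G1).
  by rewrite -mx11_scalar trmx_ursub sG submxK.
have CT : C^T = C.
  have sG1 : G1^T = G1 := sG.
  by move: sG1; rewrite GE tr_block_mx => /eq_block_mx[_ _ _].
have a0 : 0 < a.
  have pG1 : @posdef (1 + n) G1 := pG.
  have := pG1 (row_mx 1%:M 0); rewrite GE mul_row_block mul1mx mul0mx addr0 mul1mx mul0mx addr0.
  rewrite tr_row_mx mul_row_col trmx0 mulmx0 addr0 trmx1 mulmx1 mxE eqxx mulr1n; apply.
  apply/eqP => /(congr1 lsubmx); rewrite row_mxKl => /matrixP/(_ 0 0).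
  by rewrite !mxE eqxx => /eqP; rewrite oner_eq0.
(* Congruence by [M] clears the off-diagonal blocks and leaves the pivot a and the Schur complement
   [S]. *)
pose M : 'M[R]_(1 + n) := block_mx 1%:M 0 (- a^-1 *: b^T) 1%:M.
pose S := C - a^-1 *: (b^T *m b).
have MG : M *m G1 *m M^T = block_mx a%:M 0 0 S.
  rewrite GE /M tr_block_mx !mulmx_block !mul1mx !mul0mx !addr0 !trmx1 trmx0 linearZ /= trmxK.
  rewrite !mulmx1 !mulmx0 !addr0.
  have e1 : - a^-1 *: b^T *m a%:M + b^T = 0.
    by rewrite mul_mx_scalar scalerA mulrN mulfV ?gt_eqF // scaleN1r addNr.
  rewrite e1 mul0mx add0r.
  have e2 : a%:M *m (- a^-1 *: b) + b = 0.
    by rewrite mul_scalar_mx scalerA mulrN mulfV ?gt_eqF // scaleN1r addNr.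
  by rewrite e2 -scalemxAl scaleNr addrC.
have uM : M \in unitmx by rewrite unitmxE det_lblock !det1 mulr1 unitr1.
have sS : S^T = S by rewrite /S linearB /= linearZ /= trmx_mul trmxK CT.
have pS : posdef S.
  move=> v v0; have := @posdef_congr (1 + n) G1 M uM pG (row_mx 0 v).
  rewrite MG mul_row_block !mul0mx !mulmx0 addr0 add0r tr_row_mx mul_row_col mul0mx add0r; apply.
  apply: contraNneq v0 => /(congr1 rsubmx); rewrite row_mxKr => ->.
  by apply/eqP/matrixP => i j; rewrite !mxE.
have [E' HE'] := IH S sS pS.
pose F : 'M[R]_(1 + n) := block_mx (Num.sqrt a)^-1%:M 0 0 E'.
suff HF : (F *m M) *m G1 *m (F *m M)^T = 1%:M :> 'M[R]_(1 + n) by exists (F *m M).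
rewrite trmx_mul !mulmxA -[_ *m G1]mulmxA -[_ *m M^T]mulmxA MG.
rewrite /F tr_block_mx !trmx0 tr_scalar_mx !mulmx_block !mul0mx !mulmx0 !addr0 !add0r.
rewrite HE' -!scalar_mxM !mul0mx [RHS]scalar_mx_block; congr block_mx; congr scalar_mx.
have s0 : Num.sqrt a != 0 by rewrite gt_eqF // sqrtr_gt0.
by rewrite -{2}(sqr_sqrtr (ltW a0)); field.
Qed.

Lemma frame_unit n (G E : 'M[R]_n) : E *m G *m E^T = 1%:M ->
  [/\ E \in unitmx, invmx G = E^T *m E & G = invmx E *m (invmx E)^T].
Proof.
move=> HE.
have uE : E \in unitmx by move: HE; rewrite -mulmxA => /mulmx1_unit[].
have GE : G = invmx E *m (invmx E)^T.
  rewrite -[G](mulKmx uE) trmx_inv; congr (_ *m _).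
  by rewrite -[E *m G](@mulmxK _ _ _ E^T) ?unitmx_tr // HE mul1mx.
have H : E^T *m E *m G = 1%:M.
  by rewrite GE mulmxA mulmxK // -trmx_mul mulVmx // trmx1.
have [_ uG] := mulmx1_unit H.
by split=> //; rewrite -[LHS]mul1mx -H mulmxK.
Qed.

End Frames.

(** * Tensor powers of matrices and comparison of norms with components *)

Section TensorPower.
Variables (R : realType) (n : nat).

Lemma sum_tuple_prod k (F : 'I_k -> 'I_n -> R) :
  \sum_(t : k.-tuple 'I_n) \prod_(l < k) F l (tnth t l) = \prod_(l < k) \sum_j F l j.
Proof.
rewrite bigA_distr_bigA /=.
rewrite (reindex (fun t : k.-tuple 'I_n => [ffun i => tnth t i])) /=.
  by apply: eq_bigr => t _; apply: eq_bigr => l _; rewrite ffunE.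
exists (fun f : {ffun 'I_k -> 'I_n} => [tuple f i | i < k]) => [t _|f _].
  by apply: eq_from_tnth => i; rewrite tnth_mktuple ffunE.
by apply/ffunP => i; rewrite ffunE tnth_mktuple.
Qed.

Lemma sum_tuple_cons k (F : k.+1.-tuple 'I_n -> R) :
  \sum_t F t = \sum_a \sum_(t : k.-tuple 'I_n) F [tuple of a :: t].
Proof.
rewrite pair_bigA /= (reindex (fun p : 'I_n * k.-tuple 'I_n => [tuple of p.1 :: p.2])) //=.
exists (fun t => (thead t, [tuple of behead t])) => [[a t] _|t _] /=.
  by congr (_, _); apply: val_inj.
by rewrite -tuple_eta.
Qed.

Lemma sum_tuple0 (F : 0.-tuple 'I_n -> R) : \sum_t F t = F [tuple].
Proof. have E (t : 0.-tuple 'I_n) : t = [tuple] by exact: tuple0.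
by rewrite (big_pred1 [tuple]) // => t; apply/esym/eqP. Qed.

Lemma sum_tuple_const k (c : R) : \sum_(t : k.-tuple 'I_n) c = (n ^ k)%:R * c.
Proof. by rewrite sumr_const card_tuple card_ord [RHS]mulr_natl. Qed.

(** The tensor power of [P] acting on all indices. For a Jacobian it is the pull-back of covariant
    tensors; for a frame [E] it gives the components in that frame. *)
Definition tr k (P : 'M[R]_n) (T : k.-tuple 'I_n -> R) (s : k.-tuple 'I_n) : R :=
  \sum_t (\prod_(l < k) P (tnth s l) (tnth t l)) * T t.

Lemma tr0 P (T : 0.-tuple 'I_n -> R) s : tr P T s = T [tuple].
Proof. by rewrite /tr sum_tuple0 big_ord0 mul1r. Qed.

Lemma tr_cons k P (T : k.+1.-tuple 'I_n -> R) s :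
  tr P T s = \sum_a P (thead s) a * tr P (fun t => T [tuple of a :: t]) [tuple of behead s].
Proof.
rewrite /tr sum_tuple_cons; apply: eq_bigr => a _; rewrite mulr_sumr; apply: eq_bigr => t _.
rewrite mulrA; congr (_ * _); rewrite big_ord_recl; congr (_ * _).
by apply: eq_bigr => l _; rewrite !(tnth_nth (thead s)) /= nth_behead.
Qed.

Lemma eq_tr k P (T T' : k.-tuple 'I_n -> R) : T =1 T' -> tr P T =1 tr P T'.
Proof. by move=> E s; apply: eq_bigr => t _; rewrite E. Qed.

Lemma tr_comp k P Q (T : k.-tuple 'I_n -> R) s : tr P (tr Q T) s = tr (P *m Q) T s.
Proof.
rewrite /tr; under eq_bigr do rewrite mulr_sumr.
exch => u _.
under eq_bigr do rewrite mulrA -big_split /=.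
rewrite -mulr_suml (sum_tuple_prod (fun l j => P (tnth s l) j * Q j (tnth u l))); congr (_ * _); apply: eq_bigr => l _.
by rewrite mxE.
Qed.

Lemma tr1 k (T : k.-tuple 'I_n -> R) s : tr 1%:M T s = T s.
Proof.
rewrite /tr (bigD1 s) //= big1 ?mul1r => [|l _]; last by rewrite mxE eqxx.
rewrite big1 ?addr0 // => t ts.
have [l tl] : exists l, tnth s l != tnth t l.
  apply/existsP; apply: contraT; rewrite negb_exists => /forallP H.
  by case/eqP: ts; apply: eq_from_tnth => l; have := H l; rewrite negbK => /eqP.
by rewrite (bigD1 l) //= mxE (negPf tl) !mul0r.
Qed.

Lemma tr_adj k P (A B : k.-tuple 'I_n -> R) :
  \sum_s A s * tr P B s = \sum_s tr P^T A s * B s.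
Proof.
rewrite /tr; under eq_bigr do rewrite mulr_sumr.
exch => t _; rewrite mulr_suml; apply: eq_bigr => s _.
rewrite mulrA [A s * _]mulrC; congr (_ * _ * _); by apply: eq_bigr => l _; rewrite mxE.
Qed.

Definition tsq k (A : 'M[R]_n) (T : k.-tuple 'I_n -> R) : R :=
  \sum_s \sum_t (\prod_(l < k) A (tnth s l) (tnth t l)) * T s * T t.

Lemma tsqE k A (T : k.-tuple 'I_n -> R) : tsq A T = \sum_s T s * tr A T s.
Proof.
apply: eq_bigr => s _; rewrite /tr mulr_sumr; apply: eq_bigr => t _.
by rewrite mulrA [T s * _]mulrC.
Qed.

Lemma tsq_tr k A J (T : k.-tuple 'I_n -> R) : tsq A (tr J T) = tsq (J^T *m A *m J) T.
Proof.
rewrite !tsqE.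
have E s : tr A (tr J T) s = tr (A *m J) T s by exact: tr_comp.
under eq_bigr do rewrite E mulrC.
rewrite -[RHS](eq_bigr _ (fun s _ => mulrC _ _)).
have -> : \sum_s tr (A *m J) T s * tr J T s = \sum_s tr J^T (tr (A *m J) T) s * T s.
  by rewrite tr_adj.
by apply: eq_bigr => s _; rewrite tr_comp mulmxA.
Qed.

Lemma tsq_frame k E (T : k.-tuple 'I_n -> R) : tsq (E^T *m E) T = \sum_s (tr E T s) ^+ 2.
Proof.
rewrite -[E^T]mulmx1 -tsq_tr tsqE; apply: eq_bigr => s _; by rewrite tr1.
Qed.

Lemma tr_bound k (P : 'M[R]_n) (T : k.-tuple 'I_n -> R) B C : 0 <= B ->
  (forall i j, `|P i j| <= B) -> (forall t, `|T t| <= C) ->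
  forall s, `|tr P T s| <= (n ^ k)%:R * (B ^+ k * C).
Proof.
move=> B0 HP HT s; apply: le_trans (ler_norm_sum _ _ _) _.
apply: (@le_trans _ _ (\sum_(t : k.-tuple 'I_n) B ^+ k * C)); last first.
  by rewrite sum_tuple_const.
apply: ler_sum => t _; rewrite normrM; apply: ler_pM => //.
rewrite normr_prod -[k in B ^+ k]card_ord -prodr_const; apply: ler_prod => l _.
by rewrite normr_ge0 HP.
Qed.

(** From G = E^-1 E^-T, the squared length of the i-th row of E^-1 is G_ii. *)
Lemma frame_inv_bound (G E : 'M[R]_n) b : E *m G *m E^T = 1%:M -> 0 <= b ->
  (forall i, G i i <= b ^+ 2) -> forall i j, `|invmx E i j| <= b.
Proof.
move=> HE b0 Gb i j; have [uE _ GE] := frame_unit HE.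
rewrite -(ler_pXn2r (ltn0Sn 1)) ?nnegrE // real_normK ?num_real //.
apply: le_trans (Gb i); rewrite GE mxE (bigD1 j) //= !mxE -expr2 lerDl.
by apply: sumr_ge0 => l _; rewrite !mxE -expr2 sqr_ge0.
Qed.

(** In an orthonormal frame every component is at most the norm; the change back to coordinates is
    by E^-1, whose entries [frame_inv_bound] controls. Only an upper bound on the diagonal of the
    metric is used. *)
Lemma comp_bound k (G : 'M[R]_n) (T : k.-tuple 'I_n -> R) b C : G^T = G -> posdef G ->
  0 <= b -> (forall i, G i i <= b ^+ 2) -> Num.sqrt (tsq (invmx G) T) <= C ->
  forall s, `|T s| <= (n ^ k)%:R * (b ^+ k * C).
Proof.
move=> sG pG b0 Gb TC s; have [E HE] := frame_exists sG pG.
have [uE iG GE] := frame_unit HE.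
rewrite -[T s]tr1 -(mulVmx uE) -tr_comp; apply: tr_bound => //; first exact: frame_inv_bound HE _ _.
move=> t; apply: le_trans TC; rewrite iG tsq_frame -sqrtr_sqr ler_sqrt; last first.
  by apply: sumr_ge0 => ? _; exact: sqr_ge0.
by rewrite (bigD1 t) //= lerDl; apply: sumr_ge0 => ? _; exact: sqr_ge0.
Qed.

Lemma tsq_bound k (A : 'M[R]_n) (T : k.-tuple 'I_n -> R) b C : 0 <= b ->
  (forall i j, `|A i j| <= b) -> (forall t, `|T t| <= C) ->
  Num.sqrt (tsq A T) <= (n ^ k)%:R * (1 + b ^+ k) * C.
Proof.
move=> b0 Ab TC.
(* If there is no index tuple, [C] could be negative; then n ^ k = 0 and both sides vanish. *)
have [s0|nos] := pickP (fun _ : k.-tuple 'I_n => true); last first.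
  rewrite /tsq big1 ?sqrtr0; last by move=> s; have := nos s.
  have := card_tuple k 'I_n; rewrite card_ord eq_card0 // => <-.
  by rewrite !mul0r.
have C0 : 0 <= C := le_trans (normr_ge0 _) (TC s0).
have K0 : 0 <= (n ^ k)%:R * (1 + b ^+ k) * C.
  by rewrite !mulr_ge0 // addr_ge0 // exprn_ge0.
rewrite -[leRHS]ger0_norm // -sqrtr_sqr ler_wsqrtr //.
apply: (@le_trans _ _ (\sum_(s : k.-tuple 'I_n) \sum_(t : k.-tuple 'I_n) (b ^+ k * C * C))).
  apply: ler_sum => s _; apply: ler_sum => t _; apply: le_trans (ler_norm _) _.
  rewrite !normrM; apply: ler_pM => //; apply: ler_pM => //.
  rewrite normr_prod -[k in b ^+ k]card_ord -prodr_const; apply: ler_prod => l _.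
  by rewrite normr_ge0 Ab.
rewrite !sum_tuple_const.
set N := (n ^ k)%:R; set B := b ^+ k.
have N0 : 0 <= N by rewrite ler0n.
have B0 : 0 <= B by rewrite exprn_ge0.
have -> : (N * (1 + B) * C) ^+ 2 = N * (N * ((1 + B) ^+ 2 * C * C)) by ring.
apply: ler_wpM2l => //; apply: ler_wpM2l => //.
by apply: ler_wpM2r => //; apply: ler_wpM2r => //; nra.
Qed.

End TensorPower.

(** * Levi-Civita connection and its naturality *)

Definition Rsum (R : realType) (n : nat) (F : 'I_n -> R) : R := \sum_(i < n) F i.

(* [ring] compares atoms up to conversion, which would unfold derivatives; sums and derivatives are
   therefore generalized syntactically beforehand. *)
Ltac gen_sums := repeat (match goal with |- context [@bigop.body ?R0 ?I0 ?x ?r ?F] =>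
    match F with (fun i => @BigBody _ _ i _ true (@?f i)) =>
      change (@bigop.body R0 I0 x r F) with (@Rsum _ _ f) end end);
  repeat (match goal with |- context [@Rsum ?R0 ?n0 ?F] =>
    generalize (@Rsum R0 n0 F); let u := fresh "u" in intro u end).
Ltac gen_pds := repeat (match goal with |- context [@pd ?R0 ?n0 ?D0 ?i0 ?F ?x] =>
  generalize (@pd R0 n0 D0 i0 F x); let u := fresh "u" in intro u end).
Ltac gring := rewrite /=; gen_sums; gen_pds; ring.

Section Metric.
Variables (R : realType) (n : nat) (D : set 'rV[R]_n) (G : 'rV[R]_n -> 'M[R]_n).

Definition is_metric : Prop :=
  [/\ forall i j, sm D (fun y => G y i j),
      forall x, D x -> (G x)^T = G x &
      forall x, D x -> posdef (G x)].

Hypothesis dD : dom D.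
Hypothesis mG : is_metric.

Lemma met_unit x : D x -> G x \in unitmx.
Proof. by case: mG => _ _ pG Dx; apply: posdef_unit; exact: pG. Qed.

Lemma met_symE x i j : D x -> G x i j = G x j i.
Proof. by case: mG => _ sG _ /sG {1}<-; rewrite mxE. Qed.

Lemma sm_met i j : sm D (fun y => G y i j).
Proof. by case: mG. Qed.

Lemma sm_imet i j : sm D (fun y => invmx (G y) i j).
Proof. by case: mG => s _ _; apply: sm_invmx => // y; exact: met_unit. Qed.

Lemma imet_symE x i j : D x -> invmx (G x) i j = invmx (G x) j i.
Proof. by case: mG => _ sG _ /sG /invmx_sym {1}<-; rewrite mxE. Qed.

(** The Christoffel symbol of the first kind, with the lowered index last. *)
Definition chr1 (x : 'rV[R]_n) (i j l : 'I_n) : R :=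
  2^-1 * (pd D i (fun y => G y j l) x + pd D j (fun y => G y i l) x
     - pd D l (fun y => G y i j) x).

Lemma chrE x k i j : christoffel D G x k i j = \sum_l invmx (G x) k l * chr1 x i j l.
Proof.
rewrite /christoffel mulr_sumr; apply: eq_bigr => l _; by rewrite /chr1 mulrCA.
Qed.

Lemma imet_mul x k l : D x -> \sum_j invmx (G x) k j * G x j l = (k == l)%:R.
Proof.
by move=> Dx; have /matrixP/(_ k l) := mulVmx (met_unit Dx); rewrite !mxE.
Qed.

Lemma met_imul x k l : D x -> \sum_j G x k j * invmx (G x) j l = (k == l)%:R.
Proof.
by move=> Dx; have /matrixP/(_ k l) := mulmxV (met_unit Dx); rewrite !mxE.
Qed.

Lemma sum_delta (F : 'I_n -> R) k : \sum_j (k == j)%:R * F j = F k.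
Proof.
rewrite (bigD1 k) //= eqxx mul1r big1 ?addr0 // => j jk.
by rewrite eq_sym (negPf jk) mul0r.
Qed.

Lemma sum_delta_r (F : 'I_n -> R) k : \sum_j F j * (j == k)%:R = F k.
Proof. by rewrite -[RHS]sum_delta; apply: eq_bigr => j _; rewrite mulrC eq_sym. Qed.

Lemma chr_low x i j l : D x -> \sum_k christoffel D G x k i j * G x k l = chr1 x i j l.
Proof.
move=> Dx; under eq_bigr do rewrite chrE mulr_suml.
rewrite exchange_big /= -[RHS](sum_delta_r (chr1 x i j)); apply: eq_bigr => a _.
rewrite -(imet_mul a l Dx) mulr_sumr; apply: eq_bigr => k _.
by rewrite (imet_symE k a Dx); ring.
Qed.

Lemma chr_sym x k i j : D x -> christoffel D G x k i j = christoffel D G x k j i.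
Proof.
move=> Dx; rewrite !chrE; apply: eq_bigr => l _; congr (_ * _); rewrite /chr1.
rewrite (pd_ext l (f := fun y => G y i j) (g := fun y => G y j i)) //.
  by congr (_ * _); rewrite [X in X - _]addrC.
by move=> y Dy; rewrite met_symE.
Qed.

Lemma sm_chr1 i j l : sm D (fun y => chr1 y i j l).
Proof.
apply: (sm_mul dD); first exact: sm_cst.
by apply: (sm_minus dD); [apply: (sm_add dD)|]; apply: sm_pd; exact: sm_met.
Qed.

Lemma sm_chr k i j : sm D (fun y => christoffel D G y k i j).
Proof.
apply: (sm_ext (f := fun y => \sum_l invmx (G y) k l * chr1 y i j l)).
  by move=> y _; rewrite chrE.
by apply: (sm_sum dD) => l _; apply: (sm_mul dD); [exact: sm_imet|exact: sm_chr1].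
Qed.

Lemma sm_covD k (T : tensor R n k) : (forall s, sm D (fun y => T y s)) ->
  forall s, sm D (fun y => covD D G T y s).
Proof.
move=> sT s; apply: (sm_minus dD); first exact: sm_pd.
apply: (sm_sum dD) => l _; apply: (sm_sum dD) => p _.
by apply: (sm_mul dD) => //; exact: sm_chr.
Qed.

Lemma sm_covDn k (T : tensor R n k) i : (forall s, sm D (fun y => T y s)) ->
  forall s, sm D (fun y => covDn D G T i y s).
Proof. by move=> sT; elim: i => [//|i IH]; exact: sm_covD. Qed.

Lemma sm_curv i j k p : sm D (fun y => curv D G y i j k p).
Proof.
apply: (sm_add dD).
  by apply: (sm_minus dD); apply: sm_pd; exact: sm_chr.
apply: (sm_sum dD) => q _; apply: (sm_minus dD); apply: (sm_mul dD); exact: sm_chr.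
Qed.

Lemma sm_riem s : sm D (fun y => riem D G y s).
Proof.
apply: (sm_sum dD) => p _; apply: (sm_mul dD); [exact: sm_curv|exact: sm_met].
Qed.

Opaque christoffel.

(* This reduces the naturality of the curvature to that of [covD]. *)
Lemma ricci (T : tensor R n 1) x i j k : (forall s, sm D (fun y => T y s)) -> D x ->
  covD D G (covD D G T) x [tuple i; j; k] - covD D G (covD D G T) x [tuple j; i; k] =
  - \sum_p curv D G x i j k p * T x [tuple p].
Proof.
move=> sT Dx.
have [t tE] : exists t : 'I_n -> 'rV[R]_n -> R, forall p y, T y [tuple p] = t p y.
  by exists (fun p y => T y [tuple p]).
have {}sT' p : sm D (t p) by apply: sm_ext (sT [tuple p]) => y _; rewrite tE.
pose A a b (y : 'rV[R]_n) := pd D a (t b) y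
  - \sum_p christoffel D G y p a b * t p y.
have c1 a b y : covD D G T y [tuple a; b] = A a b y.
  rewrite /covD /A /= ; congr (pd D _ _ _ - _).
    by apply/funext => z; rewrite -tE; congr (T z _); apply: val_inj.
  rewrite big_ord1; apply: eq_bigr => p _; rewrite -tE; congr (christoffel _ _ _ _ _ _ * T _ _).
  by apply: val_inj; rewrite /= enum_ordSl /= enum_ord0.
have smA a b : sm D (A a b).
  apply: (sm_minus dD); first exact: sm_pd.
  by apply: (sm_sum dD) => p _; apply: (sm_mul dD) => //; exact: sm_chr.
have c2 a b c : covD D G (covD D G T) x [tuple a; b; c] = pd D a (A b c) x
   - (\sum_p christoffel D G x p a b * A p c x + \sum_p christoffel D G x p a c * A b p x).
  rewrite [LHS]/covD /=; congr (pd D _ _ _ - _).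
    by apply/funext => z; rewrite -c1; congr (covD D G T z _); apply: val_inj.
  rewrite big_ord_recl big_ord1; congr (_ + _); apply: eq_bigr => p _;
    rewrite -c1; congr (christoffel _ _ _ _ _ _ * covD D G T _ _);
    by apply: val_inj; rewrite /= !enum_ordSl /= enum_ord0.
have pdA a b c : pd D a (A b c) x = pd D a (pd D b (t c)) x
   - \sum_p (pd D a (fun y => christoffel D G y p b c) x * t p x +
             christoffel D G x p b c * pd D a (t p) x).
  rewrite (pd_minus dD) //; first last.
  - by apply: (sm_sum dD) => p _; apply: (sm_mul dD) => //; exact: sm_chr.
  - exact: sm_pd.
  congr (_ - _); rewrite (pd_sum dD) // => [|p _]; last by apply: (sm_mul dD) => //; exact: sm_chr.
  by apply: eq_bigr => p _; rewrite (pd_mul dD) //; exact: sm_chr.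
(* Second derivatives of T cancel by [schwarz], and the terms with the symbol in the two derivative
   indices by [chr_sym]; what remains regroups into the curvature. *)
rewrite !c2 !pdA (schwarz dD i j (sT' _) Dx).
under [X in _ - _ - (_ - _ - (X + _))]eq_bigr do rewrite chr_sym //.
rewrite /A.
have quad a b : \sum_p christoffel D G x p a k * \sum_q christoffel D G x q b p * t q x =
   \sum_p (\sum_q christoffel D G x p b q * christoffel D G x q a k) * t p x.
  under eq_bigr do rewrite mulr_sumr.
  exch => q _; rewrite mulr_suml; apply: eq_bigr => p _; ring.
have lin a b : \sum_p christoffel D G x p a k * (pd D b (t p) x -
    \sum_q christoffel D G x q b p * t q x) =
   \sum_p christoffel D G x p a k * pd D b (t p) x -
   \sum_p (\sum_q christoffel D G x p b q * christoffel D G x q a k) * t p x.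
  by rewrite -quad -sumrB; apply: eq_bigr => p _; rewrite mulrBr.
rewrite (lin i j) (lin j i) !big_split /=.
under [in RHS]eq_bigr do rewrite tE.
have -> : \sum_p curv D G x i j k p * t p x =
    \sum_p pd D i (fun y => christoffel D G y p j k) x * t p x
  - \sum_p pd D j (fun y => christoffel D G y p i k) x * t p x
  + (\sum_p (\sum_q christoffel D G x p i q * christoffel D G x q j k) * t p x
  - \sum_p (\sum_q christoffel D G x p j q * christoffel D G x q i k) * t p x).
  rewrite -!sumrB -big_split /=; apply: eq_bigr => p _; rewrite /curv sumrB.
  by rewrite -!mulrBl -mulrDl.
gring.
Qed.

End Metric.

(** * Connection, covariant derivatives and curvature under a change of coordinates *)

Section Naturality.
Variables (R : realType) (n : nat) (D D' : set 'rV[R]_n) (G G' : 'rV[R]_n -> 'M[R]_n).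
Variable Phi : 'rV[R]_n -> 'rV[R]_n.
Hypotheses (dD : dom D) (dD' : dom D') (mG : is_metric D G) (mG' : is_metric D' G').
Hypothesis DD' : forall x, D x -> D' (Phi x).
Hypothesis sPhi : forall j, sm D (fun y => Phi y 0 j).
Hypothesis HG : forall x, D x -> G x = jac D Phi x *m G' (Phi x) *m (jac D Phi x)^T.

Let J (i j : 'I_n) (x : 'rV[R]_n) : R := pd D i (fun y => Phi y 0 j) x.

Let JE x i j : jac D Phi x i j = J i j x. Proof. by rewrite mxE. Qed.

Let sJ i j : sm D (J i j). Proof. exact: sm_pd. Qed.

Lemma jac_unit x : D x -> jac D Phi x \in unitmx.
Proof.
move=> Dx; have := met_unit mG Dx; rewrite HG // unitmxE !det_mulmx det_tr unitrM => /andP[].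
by rewrite unitrM unitmxE => /andP[].
Qed.

Lemma metE x i j : D x -> G x i j = \sum_a \sum_b J i a x * G' (Phi x) a b * J j b x.
Proof.
move=> Dx; rewrite HG // mxE exchange_big /=; apply: eq_bigr => b _.
rewrite mxE mulr_suml; apply: eq_bigr => a _; by rewrite [_^T _ _]mxE !JE.
Qed.

Lemma sm_compPhi f : sm D' f -> sm D (fun y => f (Phi y)).
Proof. by move=> sf; apply: (sm_comp dD dD'). Qed.

Lemma pd_compPhi f i x : sm D' f -> D x ->
  pd D i (fun y => f (Phi y)) x = \sum_c J i c x * pd D' c f (Phi x).
Proof.
by move=> sf Dx; rewrite (pd_comp dD i dD') //; apply: eq_bigr => c _; rewrite mulrC.
Qed.

(** Differentiating J_j G' J_l in direction i: in [Sf] the first Jacobian is differentiated, in [Tf]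
    the metric. By symmetry of G' the derivative of the second Jacobian is [Sf] with j and l
    exchanged. *)
Let Sf x i j l := \sum_a \sum_b pd D i (J j a) x * G' (Phi x) a b * J l b x.
Let Tf x i j l := \sum_a \sum_b \sum_c
  J i a x * J j b x * J l c x * pd D' a (fun y => G' y b c) (Phi x).

Lemma pd_met x i j l : D x -> pd D i (fun y => G y j l) x = Sf x i j l + Tf x i j l + Sf x i l j.
Proof.
move=> Dx.
have sG' a b : sm D' (fun y => G' y a b) by exact: sm_met.
have sGP a b : sm D (fun y => G' (Phi y) a b) by exact: (@sm_compPhi (fun y => G' y a b)).
rewrite (pd_ext (g := fun y => \sum_a \sum_b J j a y * G' (Phi y) a b * J l b y)) //; last first.
  by move=> y Dy; exact: metE.
have sab a b : sm D (fun y => J j a y * G' (Phi y) a b * J l b y).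
  by do 2?apply: (sm_mul dD).
rewrite (pd_sum dD) // => [|a _]; last by apply: (sm_sum dD).
have -> : Tf x i j l = \sum_a \sum_b \sum_c J j a x * (J i c x * pd D' c (fun y => G' y a b) (Phi x)) * J l b x.
  rewrite /Tf exchange_big /=; apply: eq_bigr => b _; exch => c _.
  by apply: eq_bigr => a _; gring.
have -> : Sf x i l j = \sum_a \sum_b J j a x * G' (Phi x) a b * pd D i (J l b) x.
  rewrite /Sf exchange_big /=; apply: eq_bigr => b _; apply: eq_bigr => a _.
  by rewrite (met_symE mG' a b (DD' Dx)); gring.
rewrite -!big_split /=; apply: eq_bigr => a _; rewrite (pd_sum dD) // -!big_split /=.
apply: eq_bigr => b _.
rewrite (pd_mul dD) //; last by apply: (sm_mul dD).
rewrite (pd_mul dD) // (pd_compPhi _ (sG' a b)) //.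
have -> : \sum_(i0 < n) J j a x * (J i i0 x * pd D' i0 (fun y => G' y a b) (Phi x)) * J l b x
  = J j a x * (\sum_c J i c x * pd D' c (fun y => G' y a b) (Phi x)) * J l b x.
  by rewrite mulr_sumr mulr_suml.
gring.
Qed.

Lemma S_sym x i j l : D x -> Sf x i j l = Sf x j i l.
Proof.
move=> Dx; apply: eq_bigr => a _; apply: eq_bigr => b _.
by rewrite /J (schwarz dD i j) //; exact: sPhi.
Qed.

(** The transformation law of the connection. Both sides, as row vectors in c, are multiplied by the
    invertible matrix G' J^T: the left one becomes a symbol of the first kind, computed from three
    instances of [pd_met], in which all second derivatives of Phi but one cancel. *)
Lemma chr_nat x i j c : D x ->
  \sum_k christoffel D G x k i j * J k c x = pd D i (J j c) x +
   \sum_a \sum_b J i a x * J j b x * christoffel D' G' (Phi x) c a b.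
Proof.
move=> Dx; have D'x := DD' Dx.
pose M := G' (Phi x) *m (jac D Phi x)^T.
have uM : M \in unitmx by rewrite unitmx_mul unitmx_tr jac_unit // (met_unit mG' D'x).
pose v : 'rV[R]_n := \row_c \sum_k christoffel D G x k i j * J k c x.
pose w : 'rV[R]_n := \row_c (pd D i (J j c) x +
   \sum_a \sum_b J i a x * J j b x * christoffel D' G' (Phi x) c a b).
suff /(congr1 (mulmx^~ (invmx M))) : v *m M = w *m M.
  by rewrite !mulmxK // => /matrixP/(_ 0 c); rewrite !mxE.
apply/rowP => l; rewrite mxE [RHS]mxE.
transitivity (chr1 D G x i j l).
  rewrite -(chr_low mG i j l Dx) .
  have -> : \sum_k christoffel D G x k i j * G x k l =
     \sum_k \sum_c christoffel D G x k i j * J k c x * M c l.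
    apply: eq_bigr => k _; rewrite HG // -mulmxA mxE mulr_sumr; apply: eq_bigr => d _.
    by rewrite JE mulrA.
  by exch => d _; rewrite mxE mulr_suml.
have -> : chr1 D G x i j l = Sf x i j l + 2^-1 * (Tf x i j l + Tf x j i l - Tf x l i j).
  rewrite /chr1 !pd_met // (S_sym j i) // (S_sym l i) // (S_sym l j) //.
  move: (Sf x i j l) (Sf x i l j) (Sf x j l i) (Tf x i j l) (Tf x j i l) (Tf x l i j) => p q r s t u.
  by field.
have ME d : M d l = \sum_b G' (Phi x) d b * J l b x.
  by rewrite mxE; apply: eq_bigr => b _; rewrite [_^T _ _]mxE JE.
under [in RHS]eq_bigr do rewrite mxE mulrDl.
rewrite big_split /=; congr (_ + _).
  apply: eq_bigr => a _; rewrite ME mulr_sumr; apply: eq_bigr => b _; by rewrite mulrA.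
have -> : \sum_(d < n) (\sum_a \sum_b J i a x * J j b x * christoffel D' G' (Phi x) d a b) * M d l
  = \sum_a \sum_b \sum_d J i a x * J j b x * J l d x * chr1 D' G' (Phi x) a b d.
  under eq_bigr do rewrite mulr_suml.
  exch => a _.
  under eq_bigr do rewrite mulr_suml.
  exch => b _.
  under eq_bigr do rewrite ME mulr_sumr.
  exch => d _; rewrite -(chr_low mG' a b d D'x) mulr_sumr.
  by apply: eq_bigr => e _; ring.
have T2 : Tf x j i l = \sum_a \sum_b \sum_d J i a x * J j b x * J l d x * pd D' b (fun y => G' y a d) (Phi x).
  rewrite /Tf exchange_big /=; apply: eq_bigr => a _; apply: eq_bigr => b _; apply: eq_bigr => d _; gring.
have T3 : Tf x l i j = \sum_a \sum_b \sum_d J i a x * J j b x * J l d x * pd D' d (fun y => G' y a b) (Phi x).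
  rewrite /Tf exchange_big /=; apply: eq_bigr => a _; exch => b _.
  by apply: eq_bigr => d _; gring.
rewrite T2 T3 /Tf -big_split /= -sumrB mulr_sumr; apply: eq_bigr => a _.
rewrite -big_split /= -sumrB mulr_sumr; apply: eq_bigr => b _.
rewrite -big_split /= -sumrB mulr_sumr; apply: eq_bigr => d _.
rewrite /chr1; gring.
Qed.

Lemma prod_upd k (s t : k.-tuple 'I_n) (F : 'I_n -> 'I_n -> R) (l : 'I_k) p :
  \prod_(q < k) F (tnth [tuple if q == l then p else tnth s q | q < k] q) (tnth t q) =
  F p (tnth t l) * \prod_(q < k | q != l) F (tnth s q) (tnth t q).
Proof.
rewrite (bigD1 l) //= tnth_mktuple eqxx; congr (_ * _).
by apply: eq_bigr => q ql; rewrite tnth_mktuple (negPf ql).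
Qed.

Lemma pd_tr k (T' : tensor R n k) (s : k.-tuple 'I_n) i x : (forall t, sm D' (fun y => T' y t)) -> D x ->
  pd D i (fun y => tr (jac D Phi y) (T' (Phi y)) s) x =
  \sum_l \sum_t pd D i (J (tnth s l) (tnth t l)) x *
     (\prod_(q < k | q != l) J (tnth s q) (tnth t q) x) * T' (Phi x) t +
  \sum_a J i a x * tr (jac D Phi x) (fun t => pd D' a (fun y => T' y t) (Phi x)) s.
Proof.
move=> sT Dx.
have sTP t : sm D (fun y => T' (Phi y) t) by exact: (@sm_compPhi (fun y => T' y t)).
have sP (t : k.-tuple 'I_n) : sm D (fun y => \prod_(l < k) J (tnth s l) (tnth t l) y) by apply: (sm_prod dD).
rewrite (pd_ext (g := fun y => \sum_t (\prod_(l < k) J (tnth s l) (tnth t l) y) * T' (Phi y) t)) //; last first.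
  by move=> y Dy; apply: eq_bigr => t _; congr (_ * _); apply: eq_bigr => l _; rewrite JE.
rewrite (pd_sum dD) // => [|t _]; last by apply: (sm_mul dD).
rewrite exchange_big /=.
have -> : \sum_a J i a x * tr (jac D Phi x) (fun t => pd D' a (fun y => T' y t) (Phi x)) s =
  \sum_t (\prod_(l < k) J (tnth s l) (tnth t l) x) * \sum_a J i a x * pd D' a (fun y => T' y t) (Phi x).
  under eq_bigr do rewrite mulr_sumr.
  exch => t _; rewrite mulr_sumr; apply: eq_bigr => a _.
  rewrite mulrCA; congr (_ * _); apply: eq_bigr => l _; by rewrite JE.
rewrite -big_split /=; apply: eq_bigr => t _.
rewrite (pd_mul dD) // (pd_compPhi _ (sT t)) //; congr (_ + _).
rewrite (pd_prod dD) ?index_enum_uniq // mulr_suml; apply: eq_bigr => l _; by [].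
Qed.

Lemma upd_upd k (t : k.-tuple 'I_n) (l : 'I_k) p :
  [tuple if q == l then tnth t l else
     tnth [tuple if q' == l then p else tnth t q' | q' < k] q | q < k] = t.
Proof.
apply: eq_from_tnth => q; rewrite !tnth_mktuple; by case: eqP => [->//|].
Qed.

(** The inhomogeneous term of [chr_nat] compensates the derivatives of the Jacobian factors in
    [pd_tr]. *)
Lemma covD_nat k (T : tensor R n k) (T' : tensor R n k) :
  (forall t, sm D' (fun y => T' y t)) ->
  (forall x s, D x -> T x s = tr (jac D Phi x) (T' (Phi x)) s) ->
  forall x s, D x -> covD D G T x s = tr (jac D Phi x) (covD D' G' T' (Phi x)) s.
Proof.
move=> sT' TT' x s Dx; rewrite tr_cons.
set i := thead s; set s' := [tuple of behead s]; rewrite /covD -/i -/s'.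
rewrite (pd_ext (g := fun y => tr (jac D Phi y) (T' (Phi y)) s')) //; last first.
  by move=> y Dy; exact: TT'.
rewrite (pd_tr s' i sT' Dx).
have E1 : \sum_(l < k) \sum_(p < n) christoffel D G x p i (tnth s' l) *
      T x [tuple if q == l then p else tnth s' q | q < k] =
   \sum_l \sum_t pd D i (J (tnth s' l) (tnth t l)) x *
     (\prod_(q < k | q != l) J (tnth s' q) (tnth t q) x) * T' (Phi x) t +
   \sum_l \sum_(t : k.-tuple 'I_n) (\sum_a \sum_b J i a x * J (tnth s' l) b x * christoffel D' G' (Phi x) (tnth t l) a b) *
     (\prod_(q < k | q != l) J (tnth s' q) (tnth t q) x) * T' (Phi x) t.
  rewrite -big_split /=; apply: eq_bigr => l _.
  have -> : \sum_(p < n) christoffel D G x p i (tnth s' l) *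
      T x [tuple if q == l then p else tnth s' q | q < k] =
    \sum_(t : k.-tuple 'I_n) (\sum_p christoffel D G x p i (tnth s' l) * J p (tnth t l) x) *
      (\prod_(q < k | q != l) J (tnth s' q) (tnth t q) x) * T' (Phi x) t.
    under eq_bigr do rewrite TT' // mulr_sumr.
    exch => t _; rewrite !mulr_suml; apply: eq_bigr => p _.
    have -> : \prod_(q < k) jac D Phi x (tnth [tuple if q == l then p else tnth s' q | q < k] q) (tnth t q)
       = J p (tnth t l) x * \prod_(q < k | q != l) J (tnth s' q) (tnth t q) x.
      by rewrite -(prod_upd s' t (fun a b => J a b x)); apply: eq_bigr => q _; rewrite JE.
    by rewrite !mulrA.
  rewrite -big_split /=; apply: eq_bigr => t _.
  by rewrite chr_nat // !mulrDl.
(* Here the second derivatives of Phi cancel. *)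
rewrite E1 opprD addrACA subrr add0r.
have trB (A B : k.-tuple 'I_n -> R) P u : tr P (fun t => A t - B t) u = tr P A u - tr P B u.
  by rewrite /tr -sumrB; apply: eq_bigr => t _; rewrite mulrBr.
have hB a (t : k.-tuple 'I_n) : (covD D' G' T' (Phi x)) [tuple of a :: t] =
  pd D' a (fun y => T' y t) (Phi x) - \sum_(l < k) \sum_(p < n) christoffel D' G' (Phi x) p a (tnth t l) *
      T' (Phi x) [tuple if q == l then p else tnth t q | q < k].
  rewrite /covD /=; have -> : [tuple of behead [tuple of a :: t]] = t by apply: val_inj.
  by [].
under [in RHS]eq_bigr => a _ do rewrite (eq_tr _ (hB a)) trB mulrBr JE.
rewrite sumrB; congr (_ - _).
transitivity (\sum_(l < k) \sum_a \sum_(t : k.-tuple 'I_n) \sum_b J i a x * J (tnth s' l) b x *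
     christoffel D' G' (Phi x) (tnth t l) a b *
     (\prod_(q < k | q != l) J (tnth s' q) (tnth t q) x) * T' (Phi x) t).
  apply: eq_bigr => l _; exch => t _.
  rewrite !mulr_suml; apply: eq_bigr => a _; by rewrite !mulr_suml.
transitivity (\sum_(l < k) \sum_a \sum_(t : k.-tuple 'I_n) \sum_p J i a x *
     ((\prod_(q < k) J (tnth s' q) (tnth t q) x) * (christoffel D' G' (Phi x) p a (tnth t l) *
      T' (Phi x) [tuple if q == l then p else tnth t q | q < k]))); last first.
  exch => a _; rewrite exchange_big /= mulr_sumr.
  apply: eq_bigr => t _; rewrite !mulr_sumr; apply: eq_bigr => l _; rewrite !mulr_sumr.
  apply: eq_bigr => p _; do 2 congr (_ * _); apply: eq_bigr => q _; by rewrite JE.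
apply: eq_bigr => l _; apply: eq_bigr => a _; rewrite !pair_bigA /=.
(* The involution exchanges the free index p with the l-th entry of t; it matches the sum over
   entries before substitution with the one after it. *)
pose h (u : k.-tuple 'I_n * 'I_n) :=
  ([tuple if q == l then u.2 else tnth u.1 q | q < k], tnth u.1 l).
have hK : involutive h.
  by move=> [t p]; rewrite /h /= tnth_mktuple eqxx upd_upd.
rewrite (reindex_inj (inv_inj hK)) /=; apply: eq_bigr => -[t p] _ /=.
rewrite tnth_mktuple eqxx [in RHS](bigD1 l) //=.
have -> : \prod_(q < k | q != l) J (tnth s' q) (tnth [tuple if q == l then p else tnth t q | q < k] q) x
   = \prod_(q < k | q != l) J (tnth s' q) (tnth t q) x.
  by apply: eq_bigr => q ql; rewrite tnth_mktuple (negPf ql).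
ring.
Qed.

Lemma covDn_nat k (T T' : tensor R n k) i :
  (forall t, sm D' (fun y => T' y t)) ->
  (forall x s, D x -> T x s = tr (jac D Phi x) (T' (Phi x)) s) ->
  forall x s, D x -> covDn D G T i x s = tr (jac D Phi x) (covDn D' G' T' i (Phi x)) s.
Proof.
move=> sT' TT'; elim: i => [//|i IH] x s Dx.
by apply: covD_nat => // t; exact: sm_covDn.
Qed.

Lemma tr1E (P : 'M[R]_n) (T : 1.-tuple 'I_n -> R) s :
  tr P T s = \sum_a P (tnth s ord0) a * T [tuple a].
Proof.
rewrite tr_cons; apply: eq_bigr => a _; rewrite tr0; congr (_ * T _); exact: val_inj.
Qed.

Lemma tr3E (P : 'M[R]_n) (T : 3.-tuple 'I_n -> R) i j k :
  tr P T [tuple i; j; k] = \sum_a \sum_b \sum_c P i a * P j b * P k c * T [tuple a; b; c].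
Proof.
rewrite tr_cons; apply: eq_bigr => a _; rewrite tr_cons mulr_sumr; apply: eq_bigr => b _.
rewrite tr_cons !mulr_sumr; apply: eq_bigr => c _; rewrite tr0 -!mulrA; do 3 congr (_ * _).
Qed.

(** [ricci] is applied to the coordinate covector d y^p, whose components are constant, and to its
    pull-back. Second covariant derivatives are natural, hence so is their commutator, which is the
    curvature applied to that covector. *)
Lemma curv_nat x i j k p : D x ->
  \sum_q curv D G x i j k q * J q p x =
  \sum_a \sum_b \sum_c J i a x * J j b x * J k c x * curv D' G' (Phi x) a b c p.
Proof.
move=> Dx; pose T' : tensor R n 1 := fun y s => (tnth s ord0 == p)%:R.
pose T : tensor R n 1 := fun y s => tr (jac D Phi y) (T' (Phi y)) s.
have sT' t : sm D' (fun y => T' y t) by exact: sm_cst.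
have TE y q : T y [tuple q] = J q p y.
  rewrite /T tr1E -[RHS](sum_delta_r (J q ^~ y)); apply: eq_bigr => a _.
  by rewrite JE.
have sT t : sm D (fun y => T y t).
  apply: (sm_ext (f := J (tnth t ord0) p)) => // y _; rewrite -TE; congr (T y _).
  by apply: val_inj; case: (tupleP t) => a u /=; rewrite (tuple0 u).
have TT' y s : D y -> T y s = tr (jac D Phi y) (T' (Phi y)) s by [].
have sT1 t : sm D' (fun y => covD D' G' T' y t) by exact: sm_covD.
have c2 y s : D y -> covD D G (covD D G T) y s = tr (jac D Phi y) (covD D' G' (covD D' G' T') (Phi y)) s.
  move=> Dy; apply: covD_nat => // z t Dz; exact: covD_nat.
have := ricci dD mG i j k sT Dx; rewrite !c2 // !tr3E.
under [in RHS]eq_bigr do rewrite TE.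
have -> : \sum_a \sum_b \sum_c jac D Phi x j a * jac D Phi x i b * jac D Phi x k c *
    covD D' G' (covD D' G' T') (Phi x) [tuple a; b; c] =
  \sum_a \sum_b \sum_c jac D Phi x i a * jac D Phi x j b * jac D Phi x k c *
    covD D' G' (covD D' G' T') (Phi x) [tuple b; a; c].
  exch => a _; apply: eq_bigr => b _; apply: eq_bigr => c _.
  by congr (_ * _ * _); rewrite mulrC.
move=> E; apply: oppr_inj; rewrite -E -sumrB -sumrN; apply: eq_bigr => a _.
rewrite -sumrB -sumrN; apply: eq_bigr => b _; rewrite -sumrB -sumrN; apply: eq_bigr => c _.
rewrite -mulrBr (ricci dD' mG' a b c sT' (DD' Dx)) mulrN !JE; congr (- (_ * _)).
rewrite -[RHS](sum_delta_r (curv D' G' (Phi x) a b c)); apply: eq_bigr => q _.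
by rewrite /T' (tnth_nth q).
Qed.

Lemma tr4E (P : 'M[R]_n) (T : 4.-tuple 'I_n -> R) i j k l :
  tr P T [tuple i; j; k; l] =
  \sum_a \sum_b \sum_c \sum_d P i a * P j b * P k c * P l d * T [tuple a; b; c; d].
Proof.
rewrite tr_cons; apply: eq_bigr => a _; rewrite tr_cons mulr_sumr; apply: eq_bigr => b _.
rewrite tr_cons !mulr_sumr; apply: eq_bigr => c _; rewrite tr_cons !mulr_sumr; apply: eq_bigr => d _.
rewrite tr0 -!mulrA; do 4 congr (_ * _).
Qed.

Lemma riemE (E : set 'rV[R]_n) (H : 'rV[R]_n -> 'M[R]_n) x i j k l :
  riem E H x [tuple i; j; k; l] = \sum_p curv E H x i j k p * H x p l.
Proof. by apply: eq_bigr => p _; rewrite !(tnth_nth i). Qed.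

Lemma riem_nat x s : D x -> riem D G x s = tr (jac D Phi x) (riem D' G' (Phi x)) s.
Proof.
move=> Dx.
have -> : s = [tuple tnth s 0; tnth s 1; tnth s 2; tnth s 3].
  by apply: eq_from_tnth => -[[|[|[|[|q]]]] hq] //=; congr (tnth s _); apply: val_inj.
move: (tnth s 0) (tnth s 1) (tnth s 2) (tnth s 3) => i j k l.
rewrite riemE tr4E.
transitivity (\sum_q (\sum_p curv D G x i j k p * J p q x) * \sum_d G' (Phi x) q d * J l d x).
  under [in RHS]eq_bigr do rewrite mulr_suml.
  rewrite [RHS]exchange_big /=; apply: eq_bigr => p _; rewrite metE // mulr_sumr.
  apply: eq_bigr => q _; rewrite !mulr_sumr; apply: eq_bigr => d _; by rewrite !mulrA.
under eq_bigr do rewrite curv_nat // mulr_suml.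
exch => a _.
under eq_bigr do rewrite mulr_suml.
exch => b _.
under eq_bigr do rewrite mulr_suml.
exch => c _.
under eq_bigr do rewrite mulr_sumr.
exch => d _.
rewrite riemE mulr_sumr; apply: eq_bigr => q _; rewrite !JE; gring.
Qed.

Lemma tnorm_tsq k (E : set 'rV[R]_n) (H : 'rV[R]_n -> 'M[R]_n) (T : tensor R n k) x :
  tnorm H T x = Num.sqrt (tsq (invmx (H x)) (T x)).
Proof. by []. Qed.

Lemma eq_tsq k (A : 'M[R]_n) (T T' : k.-tuple 'I_n -> R) : T =1 T' -> tsq A T = tsq A T'.
Proof. by move=> /funext ->. Qed.

(** The inverse metric transforms by J^T G^-1 J = G'^-1, which moves the Jacobian factors of the
    tensor into the metric. *)
Lemma tnorm_nat k (T T' : tensor R n k) x : D x ->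
  (forall s, T x s = tr (jac D Phi x) (T' (Phi x)) s) -> tnorm G T x = tnorm G' T' (Phi x).
Proof.
move=> Dx TT'; rewrite !(tnorm_tsq D) (eq_tsq _ TT') tsq_tr; congr (Num.sqrt (tsq _ _)).
have uJ := jac_unit Dx; have uG := met_unit mG' (DD' Dx).
have uG0 := met_unit mG Dx.
have H : ((jac D Phi x)^T *m invmx (G x) *m jac D Phi x) *m G' (Phi x) = 1%:M.
  have E : invmx (G x) *m (jac D Phi x *m G' (Phi x) *m (jac D Phi x)^T) = 1%:M by rewrite -HG // mulVmx.
  have -> : (jac D Phi x)^T *m invmx (G x) *m jac D Phi x *m G' (Phi x) =
    (jac D Phi x)^T *m (invmx (G x) *m (jac D Phi x *m G' (Phi x) *m (jac D Phi x)^T)) *m invmx (jac D Phi x)^T.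
    by rewrite !mulmxA mulmxK ?unitmx_tr.
  by rewrite E mulmx1 mulmxV // unitmx_tr.
by rewrite -[LHS](mulmxK uG) H mul1mx.
Qed.

Lemma norm_riem_nat i x : D x ->
  tnorm G (covDn D G (riem D G) i) x = tnorm G' (covDn D' G' (riem D' G') i) (Phi x).
Proof.
move=> Dx; apply: tnorm_nat => // s; apply: covDn_nat => // [t|y t Dy]; first exact: sm_riem.
exact: riem_nat.
Qed.

End Naturality.

Lemma sum_emb (R : realType) n (F : 'I_n -> R) (N : 'I_n) : N.+1 = n ->
  \sum_i F i = \sum_(j < n.-1) F (emb j) + F N.
Proof.
case: n F N => [|p] F N HN; first by case: N HN.
rewrite big_ord_recr /=; congr (_ + F _).
  by apply: eq_bigr => j _; congr F; exact: val_inj.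
by apply: val_inj; case: HN.
Qed.

(** * First order conditions at one-sided minima *)

Section Minima.
Variable R : realType.

Lemma isd_min_ge0 (S : set R) (f : R -> R) l e : isd S f 0 l -> 0 < e ->
  (forall h, 0 <= h < e -> S h /\ f 0 <= f h) -> 0 <= l.
Proof.
move=> /isdP Hf e0 Hmin; rewrite leNgt; apply/negP => l0.
have l2 : 0 < - l / 2 by rewrite divr_gt0 // oppr_gt0.
have [d d0 Hd] := Hf _ l2; pose h := Num.min d e / 2.
have m0 : 0 < Num.min d e by rewrite lt_min d0.
have h0 : 0 < h by rewrite divr_gt0.
have hm : h < Num.min d e by rewrite ltr_pdivrMr // ltr_pMr // ltr1n.
have hd : h < d by apply: lt_le_trans hm _; rewrite ge_min lexx.
have he : h < e by apply: lt_le_trans hm _; rewrite ge_min lexx orbT.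
have [|Sh fh] := Hmin h; first by rewrite (ltW h0) he.
have := Hd h; rewrite add0r gtr0_norm // => /(_ hd Sh); rewrite ler_norml => /andP[_].
nra.
Qed.

Lemma isd_min_le0 (S : set R) (f : R -> R) l e : isd S f 0 l -> 0 < e ->
  (forall h, - e < h <= 0 -> S h /\ f 0 <= f h) -> l <= 0.
Proof.
move=> /isdP Hf e0 Hmin; rewrite -oppr_ge0.
apply: (@isd_min_ge0 [set h | S (- h)] (fun h => f (- h)) _ e) => // [|h /andP[h0 he]].
  apply/isdP => r r0; have [d d0 Hd] := Hf r r0; exists d => // h hd /=.
  rewrite add0r => Sh; have := Hd (- h); rewrite normrN add0r oppr0 mulrN mulNr; exact.
by rewrite oppr0; apply: Hmin; rewrite ltrN2 he oppr_le0.
Qed.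

(** A point of an orthant-like domain can always be moved upwards, so this half of the criterion
    also holds on the boundary. *)
Lemma pd_min_ge0 n (D : set 'rV[R]_n) i f x : dom D -> D x -> pdable D i f x ->
  (forall y, D y -> f x <= f y) -> 0 <= pd D i f x.
Proof.
move=> dD Dx Hf Hmin; have [e e0 He] := dom_up i dD Dx.
apply: (@isd_min_ge0 _ _ _ e Hf e0) => h he; split; first exact: He.
by rewrite /= on_line0; apply: Hmin; exact: He.
Qed.

Lemma pd_min_eq0 n (D : set 'rV[R]_n) i f x e : dom D -> D x -> pdable D i f x -> 0 < e ->
  (forall h, `|h| < e -> D (on_line i x h)) ->
  (forall y, D y -> f x <= f y) -> pd D i f x = 0.
Proof.
move=> dD Dx Hf e0 He Hmin; apply/eqP; rewrite eq_le pd_min_ge0 // andbT.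
apply: (@isd_min_le0 _ _ _ e Hf e0) => h /andP[h1 h2].
have hD : D (on_line i x h) by apply: He; rewrite ler0_norm // ltrNl.
by split=> //=; rewrite on_line0; exact: Hmin.
Qed.

End Minima.

(** * Induced metric and second fundamental form on the boundary hyperplane *)

Section Slice.
Variables (R : realType) (n : nat).
Implicit Types (D : set 'rV[R]_n).

Lemma snoc_dist (u v : 'rV[R]_n.-1) (t : R) : `|snoc u t - snoc v t| <= `|u - v|.
Proof.
apply: rv_norm_le => // i; rewrite mxE [X in _ + X]mxE; case: (embP i) => [il|[j ->]].
  by rewrite !snoc_last // subrr normr0.
by rewrite !snoc_emb; have := rv_norm_coord (u - v) j; rewrite !mxE.
Qed.

Lemma dom_slice D : dom D -> dom (slice D).
Proof.
move=> [H [U [[oH1 oH2] oU DE]]]; rewrite DE.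
exists [set u | H (snoc u 0)], [set u | U (snoc u 0)]; split=> //.
- split=> [x y z|x i h] /=.
    move=> Hx Hy Hb; apply: (oH1 _ _ _ Hx Hy) => i; case: (embP i) => [il|[j ->]].
      by rewrite !snoc_last // /between lexx.
    by rewrite !snoc_emb.
  by move=> Hx h0; rewrite -[x + _]/(on_line i x h) -snoc_line; exact: oH2.
- rewrite openE => u /= Uu.
  have /nbhs_ballP[e /= e0 He] : nbhs (snoc u 0) U by exact: open_nbhs_nbhs.
  apply/nbhs_ballP; exists e => //= v; rewrite -ball_normE /ball_ /= => uv; apply: He.
  by rewrite -ball_normE /ball_ /=; apply: le_lt_trans uv; exact: snoc_dist.
Qed.

Lemma sm_slice D f : dom D -> sm D f -> sm (slice D) (fun u => f (snoc u 0)).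
Proof.
move=> dD sf; apply: (sm_comp (dom_slice dD) dD) => // j; case: (embP j) => [jl|[k ->]].
  by apply: (sm_ext (f := fun=> 0)) (sm_cst (dom_slice dD) 0) => u _; rewrite snoc_last.
by apply: (sm_ext (f := fun u => u 0 k)) (sm_coord (dom_slice dD) k) => u _; rewrite snoc_emb.
Qed.

Definition slice_met (G : 'rV[R]_n -> 'M[R]_n) (u : 'rV[R]_n.-1) : 'M[R]_n.-1 :=
  \matrix_(i, j) G (snoc u 0) (emb i) (emb j).

Lemma posdef_inv p (G : 'M[R]_p) : G^T = G -> posdef G -> posdef (invmx G).
Proof.
move=> sG pG v v0; have uG := posdef_unit pG.
have := pG (v *m invmx G); rewrite trmx_mul (invmx_sym sG) !mulmxA mulmxKV //; apply.
by apply: contraNneq v0 => /(congr1 (mulmx^~ G)); rewrite mulmxKV // mul0mx => ->.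
Qed.

Lemma posdef_diag p (G : 'M[R]_p) i : posdef G -> 0 < G i i.
Proof.
move=> pG; have := pG (delta_mx 0 i); rewrite -rowE trmx_delta -colE !mxE; apply.
by apply/eqP => /matrixP/(_ 0 i); rewrite !mxE !eqxx => /eqP; rewrite oner_eq0.
Qed.

Variables (N : 'I_n) (HN : N.+1 = n).

Lemma slice_metric D G : dom D -> is_metric D G -> is_metric (slice D) (slice_met G).
Proof.
move=> dD [sG tG pG]; split=> [i j|u Du|u Du].
- apply: (sm_ext (f := fun u => G (snoc u 0) (emb i) (emb j))).
    by move=> u _; rewrite mxE.
  exact: (@sm_slice D (fun x => G x (emb i) (emb j))).
- apply/matrixP => i j; rewrite !mxE -[in LHS](tG _ Du) [LHS]mxE //.
- move=> v v0; have := pG _ Du (snoc v 0); set w := snoc v 0.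
  have -> : (w *m G (snoc u 0) *m w^T) 0 0 = (v *m slice_met G u *m v^T) 0 0.
    have wN : w 0 N = 0 by rewrite snoc_last.
    rewrite mxE (sum_emb _ HN) [w^T _ _]mxE wN mulr0 addr0 mxE; apply: eq_bigr => j _.
    rewrite [w^T _ _]mxE snoc_emb [v^T _ _]mxE; congr (_ * _).
    rewrite mxE (sum_emb _ HN) wN mul0r addr0 mxE; apply: eq_bigr => i _.
    by rewrite snoc_emb mxE.
  apply.
  by apply: contraNneq v0 => w0; apply/eqP/rowP => j; rewrite -(snoc_emb v 0) -/w w0 !mxE.
Qed.

(** The formula of [second_ff] for a metric on an arbitrary domain, so that it also applies in
    normal coordinates, which need not be among the given charts. *)
Definition sff D (G : 'rV[R]_n -> 'M[R]_n) : tensor R n.-1 2 := fun u s =>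
  \sum_k christoffel D G (snoc u 0) k (emb (tnth s 0)) (emb (tnth s 1)) *
    (G (snoc u 0) *m (inward_normal (G (snoc u 0)))^T) k 0.

(** The normal is G^-1 e_N normalized; lowering its index gives back a multiple of d x^N. Hence l
    involves only the symbols with upper index N. *)
Lemma lower_normal (G : 'M[R]_n) k : G^T = G -> posdef G ->
  (G *m (inward_normal G)^T) k 0 = (Num.sqrt (invmx G N N))^-1 * (k == N)%:R.
Proof.
move=> sG pG; have uG := posdef_unit pG.
have snocE k' : snoc 0 1 0 k' = (k' == N)%:R :> R.
  case: (emb_lastP HN k') => [->|[j ->]]; first by rewrite snoc_last // eqxx.
  by rewrite snoc_emb mxE; case: eqP => // jN; have := emb_neq_last j; rewrite jN HN eqxx.
rewrite /inward_normal linearZ /= -scalemxAr mxE; congr (_ * _).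
  congr (_^-1); congr (Num.sqrt _); rewrite (lastcE _ HN) mxE -[RHS](sum_delta (invmx G ^~ N)).
  by apply: eq_bigr => j _; rewrite snocE eq_sym.
by rewrite trmx_mul (invmx_sym sG) mulKVmx // mxE snocE.
Qed.

Lemma sffE D G u s : is_metric D G -> slice D u ->
  sff D G u s = christoffel D G (snoc u 0) N (emb (tnth s 0)) (emb (tnth s 1)) *
    (Num.sqrt (invmx (G (snoc u 0)) N N))^-1.
Proof.
move=> [_ tG pG] Du; rewrite /sff.
under eq_bigr do rewrite (lower_normal _ (tG _ Du) (pG _ Du)) mulrA.
by rewrite sum_delta_r.
Qed.

Lemma imet_diag_pos D G x i : is_metric D G -> D x -> 0 < invmx (G x) i i.
Proof.
by move=> [_ tG pG] Dx; apply: posdef_diag; apply: posdef_inv; [exact: tG|exact: pG].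
Qed.

Lemma sm_sff D G s : dom D -> is_metric D G -> sm (slice D) (fun u => sff D G u s).
Proof.
move=> dD mG.
pose f x := christoffel D G x N (emb (tnth s 0)) (emb (tnth s 1)) *
    (Num.sqrt (invmx (G x) N N))^-1.
apply: (sm_ext (f := fun u => f (snoc u 0))).
  by move=> u Du; rewrite (sffE s mG Du).
apply: sm_slice => //; apply: (sm_mul dD); first exact: sm_chr.
apply: (sm_inv dD) => [x Dx|]; first by rewrite gt_eqF // sqrtr_gt0 (imet_diag_pos N mG Dx).
by apply: (sm_sqrt dD) => [x Dx|]; [exact: (imet_diag_pos N mG Dx)|exact: sm_imet].
Qed.

End Slice.

(** * Naturality of the second fundamental form *)

Section SffNaturality.
Variables (R : realType) (n : nat) (D D' : set 'rV[R]_n) (G G' : 'rV[R]_n -> 'M[R]_n).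
Variables (N : 'I_n) (HN : N.+1 = n).
Variable Phi : 'rV[R]_n -> 'rV[R]_n.
Hypotheses (dD : dom D) (dD' : dom D') (mG : is_metric D G) (mG' : is_metric D' G').
Hypothesis DD' : forall x, D x -> D' (Phi x).
Hypothesis sPhi : forall j, sm D (fun y => Phi y 0 j).
Hypothesis HG : forall x, D x -> G x = jac D Phi x *m G' (Phi x) *m (jac D Phi x)^T.
Hypothesis Hbd : forall x, D x -> lastc x = 0 -> lastc (Phi x) = 0.
Hypothesis Hhalf : forall x, D' x -> 0 <= lastc x.

Let phi (u : 'rV[R]_n.-1) : 'rV[R]_n.-1 := front (Phi (snoc u 0)).

Lemma snoc_phi u : slice D u -> snoc (phi u) 0 = Phi (snoc u 0).
Proof.
move=> Du; rewrite -[RHS]snoc_front /phi; congr snoc; apply/esym/Hbd => //.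
by rewrite (lastcE _ HN) snoc_last.
Qed.

Lemma slice_phi u : slice D u -> slice D' (phi u).
Proof. by move=> Du; rewrite /slice /= snoc_phi //; exact: DD'. Qed.

Lemma sm_phi j : sm (slice D) (fun u => phi u 0 j).
Proof.
apply: (sm_ext (f := fun u => Phi (snoc u 0) 0 (emb j))) => [u _|]; first by rewrite mxE.
exact: (@sm_slice _ _ D (fun y => Phi y 0 (emb j))).
Qed.

Lemma jac_phi u i j : slice D u ->
  jac (slice D) phi u i j = jac D Phi (snoc u 0) (emb i) (emb j).
Proof.
move=> Du; rewrite !mxE -pd_slice; apply: pd_ext => // v _; by rewrite mxE.
Qed.

Lemma jac_last0 u i : slice D u -> jac D Phi (snoc u 0) (emb i) N = 0.
Proof.
move=> Du; rewrite mxE -pd_slice -[RHS](pd_cst (dom_slice dD) i 0 Du); apply: pd_ext => // v Dv.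
by rewrite -(lastcE _ HN) Hbd // (lastcE _ HN) snoc_last.
Qed.

Lemma slice_metE u : slice D u ->
  slice_met G u = jac (slice D) phi u *m slice_met G' (phi u) *m (jac (slice D) phi u)^T.
Proof.
move=> Du; apply/matrixP => i j; rewrite mxE HG // mxE (sum_emb _ HN) [RHS]mxE.
rewrite [_^T N _]mxE jac_last0 // mulr0 addr0; apply: eq_bigr => b _.
congr (_ * _); last by rewrite [LHS]mxE [RHS]mxE jac_phi.
rewrite mxE (sum_emb _ HN) jac_last0 // mul0r addr0 mxE; apply: eq_bigr => a _.
by rewrite jac_phi //; congr (_ * _); rewrite [RHS]mxE snoc_phi.
Qed.

(** The N-th component of Phi is nonnegative on D and zero at boundary points, so its derivative
    there is nonnegative; it is not zero, because the tangential entries of that column vanish and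
    the Jacobian is invertible. This sign keeps the normal pointing inwards. *)
Lemma jac_NN_pos u : slice D u -> 0 < jac D Phi (snoc u 0) N N.
Proof.
move=> Du; rewrite lt_neqAle; apply/andP; split.
- have uJ := jac_unit mG HG Du; apply/eqP => J0; move: uJ.
  rewrite unitmxE unitfE => /eqP; apply.
  rewrite (expand_det_col _ N) big1 // => i _; case: (emb_lastP HN i) => [->|[j ->]].
    by rewrite -J0 mul0r.
  by rewrite jac_last0 // mul0r.
- rewrite mxE; apply: pd_min_ge0 => //; first by apply: sm_pdable.
  move=> y Dy; rewrite -!(lastcE _ HN) Hbd //; first by apply: Hhalf; exact: DD'.
  by rewrite (lastcE _ HN) snoc_last.
Qed.

Lemma imet_NN u : slice D u ->
  invmx (G' (Phi (snoc u 0))) N N =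
  jac D Phi (snoc u 0) N N ^+ 2 * invmx (G (snoc u 0)) N N.
Proof.
move=> Du; set x := snoc u 0; have uJ := jac_unit mG HG Du.
have uG := met_unit mG Du; have uG' := met_unit mG' (DD' Du).
have -> : invmx (G' (Phi x)) = (jac D Phi x)^T *m invmx (G x) *m jac D Phi x.
  have H : (jac D Phi x)^T *m invmx (G x) *m jac D Phi x *m G' (Phi x) = 1%:M.
    have E : invmx (G x) *m (jac D Phi x *m G' (Phi x) *m (jac D Phi x)^T) = 1%:M by rewrite -HG // mulVmx.
    have -> : (jac D Phi x)^T *m invmx (G x) *m jac D Phi x *m G' (Phi x) =
      (jac D Phi x)^T *m (invmx (G x) *m (jac D Phi x *m G' (Phi x) *m (jac D Phi x)^T)) *m invmx (jac D Phi x)^T.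
      by rewrite !mulmxA mulmxK ?unitmx_tr.
    by rewrite E mulmx1 mulmxV // unitmx_tr.
  by rewrite -[RHS](mulmxK uG') H mul1mx.
have JNe j : jac D Phi x (emb j) N = 0 by exact: jac_last0.
rewrite mxE (sum_emb _ HN) big1 ?add0r => [|j _]; last by rewrite JNe mulr0.
rewrite mxE (sum_emb _ HN) big1 ?add0r => [|j _]; last by rewrite [_^T _ _]mxE JNe mul0r.
by rewrite [_^T _ _]mxE expr2; ring.
Qed.

Lemma tr2E p (P : 'M[R]_p) (T : 2.-tuple 'I_p -> R) s :
  tr P T s = \sum_a \sum_b P (tnth s 0) a * P (tnth s 1) b * T [tuple a; b].
Proof.
have -> : s = [tuple tnth s 0; tnth s 1].
  by apply: eq_from_tnth => -[[|[|q]] hq] //=; congr (tnth s _); apply: val_inj.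
rewrite tr_cons; apply: eq_bigr => a _; rewrite tr_cons mulr_sumr; apply: eq_bigr => b _.
by rewrite tr0 mulrA.
Qed.

(** In the component N of [chr_nat] the second derivatives of Phi vanish, as Phi preserves the
    boundary, and only the factor J_NN survives. It cancels against the normalization of the normal
    by [imet_NN] and positivity. *)
Lemma sff_nat u s : slice D u ->
  sff D G u s = tr (jac (slice D) phi u) (sff D' G' (phi u)) s.
Proof.
move=> Du; have D'u := slice_phi Du; have Jp := jac_NN_pos Du.
have gp := imet_diag_pos N mG Du.
rewrite (sffE HN s mG Du) tr2E; set i := tnth s 0; set j := tnth s 1.
have := chr_nat dD dD' mG mG' DD' sPhi HG (emb i) (emb j) N Du; set x := snoc u 0.
have J0 k : pd D (emb k) (fun y => Phi y 0 N) x = 0.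
  by have := jac_last0 k Du; rewrite mxE.
rewrite (sum_emb _ HN) big1 ?add0r => [|k _]; last by rewrite J0 mulr0.
have -> : pd D (emb i) (pd D (emb j) (fun y => Phi y 0 N)) x = 0.
  rewrite -pd_slice -[RHS](pd_cst (dom_slice dD) i 0 Du); apply: pd_ext => // v Dv.
  by have := jac_last0 j Dv; rewrite mxE.
rewrite add0r (sum_emb _ HN) [X in _ + X]big1 ?addr0 => [|b _]; last by rewrite J0 !mul0r.
have JN : jac D Phi x N N = pd D N (fun y => Phi y 0 N) x by rewrite mxE.
rewrite -JN => E.
have E1 : christoffel D G x N (emb i) (emb j) = (jac D Phi x N N)^-1 *
   \sum_(a < n.-1) \sum_(b < n.-1) jac (slice D) phi u i a * jac (slice D) phi u j b *
     christoffel D' G' (Phi x) N (emb a) (emb b).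
  rewrite -[LHS](@mulfK _ (jac D Phi x N N)) ?gt_eqF // mulrC; congr (_ * _).
  rewrite E; apply: eq_bigr => a _; rewrite (sum_emb _ HN) J0 mulr0 mul0r addr0.
  by apply: eq_bigr => b _; rewrite !jac_phi // !mxE.
rewrite E1 mulr_sumr mulr_suml; apply: eq_bigr => a _.
rewrite mulr_sumr mulr_suml; apply: eq_bigr => b _.
rewrite (sffE HN _ mG' D'u) snoc_phi // imet_NN // sqrtrM ?sqr_ge0 // sqrtr_sqr gtr0_norm // invfM.
have -> : tnth [tuple a; b] 0 = a by [].
have -> : tnth [tuple a; b] 1 = b by [].
rewrite -/x; ring.
Qed.

Lemma norm_sff_nat i u : slice D u ->
  tnorm (slice_met G) (covDn (slice D) (slice_met G) (sff D G) i) u =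
  tnorm (slice_met G') (covDn (slice D') (slice_met G') (sff D' G') i) (phi u).
Proof.
move=> Du.
have := @tnorm_nat R n.-1 (slice D) (slice D') (slice_met G) (slice_met G') phi
  (slice_metric HN dD mG) (slice_metric HN dD' mG') slice_phi slice_metE.
apply=> // s.
apply: (covDn_nat (dom_slice dD) (dom_slice dD') (slice_metric HN dD mG) (slice_metric HN dD' mG')
   slice_phi sm_phi slice_metE) => // [t|v t Dv]; first exact: (sm_sff HN _ dD' mG').
exact: sff_nat.
Qed.

End SffNaturality.

(** * Estimates for iterated derivatives *)

Lemma sum_ord_const (R : realType) n (c : R) : \sum_(i < n) c = n%:R * c.
Proof. by rewrite sumr_const card_ord [RHS]mulr_natl. Qed.

Section PdsOps.
Variables (R : realType) (n : nat) (D : set 'rV[R]_n).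
Hypothesis dD : dom D.
Implicit Types (f g : 'rV[R]_n -> R) (s : seq 'I_n).

Lemma pds_add s f g x : sm D f -> sm D g -> D x ->
  pds D s (fun y => f y + g y) x = pds D s f x + pds D s g x.
Proof.
move=> sf sg; elim: s x => [//|i s IH] x Dx /=.
rewrite (pd_ext (g := fun y => pds D s f y + pds D s g y)) //.
by rewrite (pd_add dD) //; exact: sm_pds.
Qed.

Lemma pds_scale s c f x : sm D f -> D x ->
  pds D s (fun y => c * f y) x = c * pds D s f x.
Proof.
move=> sf; elim: s x => [//|i s IH] x Dx /=.
rewrite (pd_ext (g := fun y => c * pds D s f y)) //.
by rewrite (pd_scale dD) //; exact: sm_pds.
Qed.

Lemma pds_opp s f x : sm D f -> D x -> pds D s (fun y => - f y) x = - pds D s f x.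
Proof.
move=> sf Dx; rewrite -mulN1r -pds_scale //; apply: pds_ext => // y _; by rewrite mulN1r.
Qed.

Lemma pds_minus s f g x : sm D f -> sm D g -> D x ->
  pds D s (fun y => f y - g y) x = pds D s f x - pds D s g x.
Proof. by move=> sf sg Dx; rewrite pds_add ?pds_opp //; exact: sm_opp. Qed.

Lemma pds_cst0 s x : D x -> pds D s (fun=> 0) x = 0.
Proof.
elim: s x => [//|i s IH] x Dx /=; rewrite (pd_ext (g := fun=> 0)) //.
by rewrite (pd_cst dD).
Qed.

Lemma pds_cst s c x : D x -> s != [::] -> pds D s (fun=> c) x = 0.
Proof.
case/lastP: s => [//|s i] Dx _; rewrite pds_rcons -[RHS](pds_cst0 s Dx).
by apply: pds_ext => // y Dy; rewrite (pd_cst dD).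
Qed.

Lemma pds_sum (I : Type) (r : seq I) (P : pred I) (F : I -> 'rV[R]_n -> R) s x :
  (forall a, P a -> sm D (F a)) -> D x ->
  pds D s (fun y => \sum_(a <- r | P a) F a y) x = \sum_(a <- r | P a) pds D s (F a) x.
Proof.
move=> sF; elim: s x => [//|i s IH] x Dx /=.
rewrite (pd_ext (g := fun y => \sum_(a <- r | P a) pds D s (F a) y)) //.
by rewrite (pd_sum dD) // => a /sF; exact: sm_pds.
Qed.

Variable T : pred 'I_n.

(** Peeling off the innermost derivative doubles the number of products, each of which is bounded by
    M. *)
Lemma pds_mul_bound s f g x M : sm D f -> sm D g -> D x -> all T s ->
  (forall s1 s2, all T s1 -> all T s2 -> (size s1 + size s2 = size s)%N ->
     `|pds D s1 f x| * `|pds D s2 g x| <= M) ->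
  `|pds D s (fun y => f y * g y) x| <= 2 ^+ size s * M.
Proof.
move=> + + Dx; elim/last_ind: s f g => [|s i IH] f g sf sg.
  by move=> _ /(_ [::] [::] isT isT erefl) /=; rewrite mul1r normrM.
rewrite all_rcons => /andP[Ti Ts] H; rewrite pds_rcons.
rewrite (pds_ext (g := fun y => pd D i f y * g y + f y * pd D i g y)) //; last first.
  by move=> y Dy; rewrite (pd_mul dD).
have sfi := sm_pd i sf; have sgi := sm_pd i sg.
rewrite pds_add //; try exact: sm_mul.
apply: le_trans (ler_normD _ _) _; rewrite size_rcons exprS -mulrA mulr_natl mulr2n.
apply: lerD; apply: IH => // s1 s2 T1 T2 E.
  by rewrite -pds_rcons; apply: H => //; rewrite ?all_rcons ?Ti // !size_rcons -E.
by rewrite -pds_rcons; apply: H => //; rewrite ?all_rcons ?Ti // !size_rcons -E addnS.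
Qed.

(* Only the two extreme terms of the Leibniz formula contain derivatives of the highest order. *)
Lemma pds_mul_top s f g x M : sm D f -> sm D g -> D x -> all T s -> s != [::] -> 0 <= M ->
  (forall s1 s2, all T s1 -> all T s2 -> s1 != [::] -> s2 != [::] ->
     (size s1 + size s2 = size s)%N -> `|pds D s1 f x| * `|pds D s2 g x| <= M) ->
  `|pds D s (fun y => f y * g y) x - (f x * pds D s g x + pds D s f x * g x)| <= 3 ^+ size s * M.
Proof.
move=> + + Dx; elim/last_ind: s f g => [//|s i IH] f g sf sg.
rewrite all_rcons => /andP[Ti Ts] _ M0 H; rewrite !pds_rcons.
rewrite (pds_ext (g := fun y => pd D i f y * g y + f y * pd D i g y)) //; last first.
  by move=> y Dy; rewrite (pd_mul dD).
have sfi := sm_pd i sf; have sgi := sm_pd i sg.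
rewrite pds_add //; try exact: sm_mul.
have [->|s0] := eqVneq s [::].
  rewrite /= [X in X - _]addrC subrr normr0 mulr_ge0 // exprn_ge0 //.
have H1 := IH (pd D i f) g sfi sg Ts s0 M0.
have H2 := IH f (pd D i g) sf sgi Ts s0 M0.
have {}H1 : `|pds D s (fun y => pd D i f y * g y) x - (pd D i f x * pds D s g x + pds D s (pd D i f) x * g x)|
    <= 3 ^+ size s * M.
  apply: H1 => s1 s2 T1 T2 n1 n2 E; rewrite -pds_rcons; apply: H => //.
  - by rewrite all_rcons Ti.
  - by rewrite -size_eq0 size_rcons.
  - by rewrite !size_rcons -E.
have {}H2 : `|pds D s (fun y => f y * pd D i g y) x - (f x * pds D s (pd D i g) x + pds D s f x * pd D i g x)|
    <= 3 ^+ size s * M.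
  apply: H2 => s1 s2 T1 T2 n1 n2 E; rewrite -pds_rcons; apply: H => //.
  - by rewrite all_rcons Ti.
  - by rewrite -size_eq0 size_rcons.
  - by rewrite !size_rcons -E addnS.
have H3 : `|pd D i f x * pds D s g x| <= M.
  rewrite normrM; apply: (H [:: i] s) => //=; [by rewrite Ti|by rewrite size_rcons].
have H4 : `|pds D s f x * pd D i g x| <= M.
  rewrite normrM; apply: (H s [:: i]) => //=; [by rewrite Ti|by rewrite size_rcons addn1].
have p3 : 2 * M <= 3 ^+ size s * M.
  apply: ler_wpM2r => //; apply: (@le_trans _ _ (3 ^+ 1)); first by rewrite expr1 ler_nat.
  by apply: ler_weXn2l; [rewrite ler1n|case: (s) s0].
rewrite size_rcons exprS -mulrA.
move: (pds D s (fun y => pd D i f y * g y) x) (pds D s (fun y => f y * pd D i g y) x)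
  (pds D s (pd D i f) x) (pds D s (pd D i g) x) (pds D s f x) (pds D s g x) (pd D i f x) (pd D i g x)
  (3 ^+ size s * M) H1 H2 H3 H4 p3 => a b c d e h p q K H1 H2 H3 H4 p3.
have -> : a + b - (f x * d + c * g x) = (a - (p * h + c * g x)) + (b - (f x * d + e * q)) + (p * h + e * q)
  by ring.
move: H1 H2 H3 H4; rewrite !ler_norml; lra.
Qed.

Section Adm.
Variable x : 'rV[R]_n.
Hypothesis Dx : D x.

(** [N] stands for the still unknown size of the derivatives of top order j of the metric; lower
    orders are bounded by [K] outright. The definition records that the unknown enters at most
    linearly, and only at top order. *)
Definition adm j (K N : R) f : Prop := forall s, all T s -> (size s <= j)%N ->
  `|pds D s f x| <= K * (1 + (size s == j)%:R * N).

Lemma adm_ext j K N f g : (forall y, D y -> f y = g y) -> adm j K N f -> adm j K N g.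
Proof. by move=> E H s Ts sj; rewrite -(pds_ext s E Dx); exact: H. Qed.

Lemma adm_le j K K' N N' f : 0 <= K -> 0 <= N -> K <= K' -> N <= N' -> adm j K N f -> adm j K' N' f.
Proof.
move=> K0 N0 KK NN H s Ts sj; apply: le_trans (H s Ts sj) _.
apply: ler_pM => //; first by rewrite addr_ge0 // mulr_ge0 // ler0n.
by rewrite lerD2l ler_wpM2l // ler0n.
Qed.

Lemma adm_add j K K' N f g : sm D f -> sm D g -> adm j K N f -> adm j K' N g ->
  adm j (K + K') N (fun y => f y + g y).
Proof.
move=> sf sg Hf Hg s Ts sj; rewrite pds_add // mulrDl.
apply: le_trans (ler_normD _ _) _; apply: lerD; [exact: Hf|exact: Hg].
Qed.

Lemma adm_scale j K N c f : sm D f -> adm j K N f -> adm j (`|c| * K) N (fun y => c * f y).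
Proof.
move=> sf Hf s Ts sj; rewrite pds_scale // normrM -mulrA; apply: ler_wpM2l => //; exact: Hf.
Qed.

Lemma adm_opp j K N f : sm D f -> adm j K N f -> adm j K N (fun y => - f y).
Proof. by move=> sf Hf s Ts sj; rewrite pds_opp // normrN; exact: Hf. Qed.

Lemma adm_cst j K N c : 0 <= N -> `|c| <= K -> adm j K N (fun=> c).
Proof.
move=> N0 cK s Ts sj; have K0 : 0 <= K := le_trans (normr_ge0 _) cK.
have w1 : 1 <= 1 + (size s == j)%:R * N by rewrite lerDl mulr_ge0 // ler0n.
have [->|s0] := eqVneq s [::]; last first.
  by rewrite pds_cst // normr0 mulr_ge0 // (le_trans ler01).
by rewrite /=; apply: le_trans cK _; rewrite ler_peMr // lerDl mulr_ge0 // ler0n.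
Qed.

Lemma adm_sum m j K N (F : 'I_m -> 'rV[R]_n -> R) : (forall a, sm D (F a)) ->
  (forall a, adm j K N (F a)) -> adm j (m%:R * K) N (fun y => \sum_a F a y).
Proof.
move=> sF HF s Ts sj; rewrite pds_sum //; apply: le_trans (ler_norm_sum _ _ _) _.
by rewrite -mulrA -sum_ord_const; apply: ler_sum => a _; exact: HF.
Qed.

Lemma adm_mul0 j K K' N f g : sm D f -> sm D g -> 0 <= K -> 0 <= K' -> 0 <= N ->
  adm j K 0 f -> adm j K' N g -> adm j (2 ^+ j * (K * K')) N (fun y => f y * g y).
Proof.
move=> sf sg K0 K'0 N0 Hf Hg s Ts sj; set w := 1 + (size s == j)%:R * N.
have w0 : 0 <= w by rewrite addr_ge0 // mulr_ge0 // ler0n.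
apply: (@le_trans _ _ (2 ^+ size s * (K * (K' * w)))).
  apply: pds_mul_bound => // s1 s2 T1 T2 E; apply: ler_pM => //.
    have s1j : (size s1 <= j)%N by apply: leq_trans sj; rewrite -E leq_addr.
    by have := Hf s1 T1 s1j; rewrite mulr0 addr0 mulr1.
  have s2s : (size s2 <= size s)%N by rewrite -E leq_addl.
  apply: le_trans (Hg s2 T2 (leq_trans s2s sj)) _; apply: ler_wpM2l => //.
  rewrite lerD2l ler_wpM2r // ler_nat; case: eqP => // e2.
  by move: s2s sj; rewrite e2 => a b; rewrite eqn_leq b a.
rewrite -!mulrA; apply: ler_wpM2r; first by rewrite !mulr_ge0.
by apply: ler_weXn2l; rewrite ?ler1n.
Qed.

Lemma adm_low j K N f : adm j.+1 K N f -> adm j K 0 f.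
Proof.
move=> H s Ts sj; have := H s Ts (leqW sj).
by rewrite eqn_leq [(j.+1 <= _)%N]ltnNge sj andbF mul0r !mulr0.
Qed.

(** In a product of positive order at most one factor carries the top order, so linearity in N
    survives. At order zero both factors would, giving N^2; hence the condition on [j = 0]. *)
Lemma adm_mul j K K' N f g : sm D f -> sm D g -> 0 <= K -> 0 <= K' -> 0 <= N ->
  (j = 0%N -> N = 0) ->
  adm j K N f -> adm j K' N g -> adm j (2 ^+ j * (K * K')) N (fun y => f y * g y).
Proof.
move=> sf sg K0 K'0 N0 jN Hf Hg; case: j => [|j] in jN Hf Hg *.
  by rewrite jN // in Hf Hg *; exact: adm_mul0.
move=> s Ts sj; set w := 1 + (size s == j.+1)%:R * N.
have w0 : 0 <= w by rewrite addr_ge0 // mulr_ge0 // ler0n.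
apply: (@le_trans _ _ (2 ^+ size s * (K * K' * w))).
  apply: pds_mul_bound => // s1 s2 T1 T2 E.
  have s1s : (size s1 <= size s)%N by rewrite -E leq_addr.
  have s2s : (size s2 <= size s)%N by rewrite -E leq_addl.
  have h1 := Hf s1 T1 (leq_trans s1s sj); have h2 := Hg s2 T2 (leq_trans s2s sj).
  apply: le_trans (ler_pM _ _ h1 h2) _ => //.
  rewrite mulrACA; apply: ler_wpM2l; first exact: mulr_ge0.
  rewrite /w; case: eqP => e1; case: eqP => e2.
  - by move: E; rewrite e1 e2 => E; move: sj; rewrite -E addnS ltnNge ltnS leq_addl.
  - rewrite mul0r addr0 mulr1 lerD2l ler_wpM2r // ler_nat.
    by rewrite (_ : size s == j.+1) // eqn_leq sj -e1.
  - rewrite mul0r addr0 mul1r lerD2l ler_wpM2r // ler_nat.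
    by rewrite (_ : size s == j.+1) // eqn_leq sj -e2.
  - by rewrite mul0r addr0 mulr1 lerDl mulr_ge0 // ler0n.
rewrite -!mulrA; apply: ler_wpM2r; first by rewrite !mulr_ge0.
by apply: ler_weXn2l; rewrite ?ler1n.
Qed.

Lemma adm_pd j K N f i : T i -> adm j.+1 K N f -> adm j K N (pd D i f).
Proof.
move=> Ti H s Ts sj; rewrite -pds_rcons; have := H (rcons s i).
by rewrite all_rcons Ti size_rcons eqSS; apply.
Qed.

Lemma adm_rcons j K N f : 0 <= K -> 0 <= N -> `|f x| <= K ->
  (forall i, T i -> adm j K N (pd D i f)) -> adm j.+1 K N f.
Proof.
move=> K0 N0 f0 H s; case/lastP: s => [|s i].
  by rewrite /= mul0r addr0 mulr1.
rewrite all_rcons => /andP[Ti Ts]; rewrite size_rcons ltnS eqSS pds_rcons => sj.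
exact: H.
Qed.

End Adm.
End PdsOps.

(** * Derivatives of the inverse metric and of tensor components *)

Section AdmMetric.
Variables (R : realType) (n : nat).

Lemma pd_imet (D : set 'rV[R]_n) G i a b x : dom D -> is_metric D G -> D x ->
  pd D i (fun y => invmx (G y) a b) x =
  - \sum_p \sum_q invmx (G x) a p * (pd D i (fun y => G y p q) x * invmx (G x) q b).
Proof.
move=> dD mG Dx.
have sI c d : sm D (fun y => invmx (G y) c d) by exact: sm_imet.
have sG c d : sm D (fun y => G y c d) by exact: sm_met.
have key q : \sum_p pd D i (fun y => invmx (G y) a p) x * G x p q =
  - \sum_p invmx (G x) a p * pd D i (fun y => G y p q) x.
  apply/eqP; rewrite -addr_eq0 -big_split /=; apply/eqP.
  rewrite -[RHS](pd_cst dD i (a == q)%:R Dx).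
  rewrite -(pd_ext (f := fun y => \sum_p invmx (G y) a p * G y p q)) //; last first.
    by move=> y Dy; exact: (imet_mul mG).
  rewrite (pd_sum dD) // => [|p _]; last exact: sm_mul.
  by apply: eq_bigr => p _; rewrite (pd_mul dD).
rewrite exchange_big /= -sumrN.
rewrite -[LHS](sum_delta_r (fun p => pd D i (fun y => invmx (G y) a p) x)).
under eq_bigr do rewrite -(met_imul mG _ _ Dx) mulr_sumr.
exch => q _.
under eq_bigr do rewrite mulrA.
rewrite -mulr_suml key mulNr mulr_suml; congr (- _); apply: eq_bigr => p _; by rewrite mulrA.
Qed.

(** By [pd_imet] a derivative of the inverse is a product of the inverse, one order lower, and a
    derivative of the metric. So the inverse itself is only needed pointwise, and the top order
    stays linear. *)
Lemma adm_imet j K : 0 <= K -> exists2 K', 0 <= K' &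
  forall (D : set 'rV[R]_n) G T x N, dom D -> is_metric D G -> D x -> 0 <= N -> (j = 0%N -> N = 0) ->
  (forall a b, adm D T x j K N (fun y => G y a b)) ->
  (forall a b, `|invmx (G x) a b| <= K) ->
  forall a b, adm D T x j K' N (fun y => invmx (G y) a b).
Proof.
move=> K0; elim: j => [|j [K1 K10 IH]].
  exists K => // D G T x N dD mG Dx N0 jN Hg Hi a b s Ts.
  by rewrite leqn0 size_eq0 => /eqP ->; rewrite /= jN // mulr0 addr0 mulr1.
pose K2 := n%:R * (n%:R * (2 ^+ j * (K1 * (2 ^+ j * (K1 * K))))).
exists (K + K2) => [|D G T x N dD mG Dx N0 jN Hg Hi a b].
  by rewrite addr_ge0 // !mulr_ge0 // ?ler0n // ?exprn_ge0.
have sI c d : sm D (fun y => invmx (G y) c d) by exact: sm_imet.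
have sG c d : sm D (fun y => G y c d) by exact: sm_met.
have K20 : 0 <= K2 by rewrite !mulr_ge0 // ?ler0n // ?exprn_ge0.
have I1 c d : adm D T x j K1 0 (fun y => invmx (G y) c d).
  by apply: IH => // e h; apply: adm_low (Hg e h).
apply: adm_rcons => //; first by rewrite addr_ge0.
  by apply: le_trans (Hi a b) _; rewrite lerDl.
move=> i Ti.
apply: (adm_le (K := K2) (N := N)) => //; first by rewrite lerDr.
pose F y := - \sum_p \sum_q invmx (G y) a p * (pd D i (fun y => G y p q) y * invmx (G y) q b).
apply: (adm_ext Dx (f := F)) => [y Dy|]; first by rewrite pd_imet.
have s1 p q : sm D (fun y => pd D i (fun y => G y p q) y * invmx (G y) q b).
  by apply: sm_mul => //; exact: sm_pd.
have s2 p q : sm D (fun y => invmx (G y) a p * (pd D i (fun y => G y p q) y * invmx (G y) q b)).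
  exact: sm_mul.
have s3 p : sm D (fun y => \sum_q invmx (G y) a p * (pd D i (fun y => G y p q) y * invmx (G y) q b)).
  exact: sm_sum.
apply: adm_opp => //; first exact: sm_sum.
rewrite /K2; apply: adm_sum => // p.
apply: adm_sum => // q.
apply: adm_mul0 => //; first by rewrite !mulr_ge0 // exprn_ge0.
apply: (adm_ext Dx (f := fun y => invmx (G y) q b * pd D i (fun y => G y p q) y)).
  by move=> y _; rewrite mulrC.
apply: adm_mul0 => //; first exact: sm_pd.
exact: adm_pd.
Qed.

Lemma adm_tensor k j K : 0 <= K -> exists2 K', 0 <= K' &
  forall (D : set 'rV[R]_n) G (T : pred 'I_n) x N (U : tensor R n k), dom D -> is_metric D G -> D x -> 0 <= N ->
  (j = 0%N -> N = 0) -> (forall t, sm D (fun y => U y t)) ->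
  ((0 < j)%N -> forall p i q, T i -> adm D T x j.-1 K N (fun y => christoffel D G y p i q)) ->
  (forall a t, (a <= j)%N -> `|covDn D G U a x t| <= K) ->
  forall t, adm D T x j K' N (fun y => U y t).
Proof.
move=> K0.
(* Induction on the number r of partial derivatives, for all covariant derivatives of U at once, as
   long as the total order is at most j. *)
suff : forall r, (r <= j)%N -> exists2 K', 0 <= K' &
  forall (D : set 'rV[R]_n) G (T : pred 'I_n) x N (U : tensor R n k), dom D -> is_metric D G -> D x -> 0 <= N ->
  (j = 0%N -> N = 0) -> (forall t, sm D (fun y => U y t)) ->
  ((0 < j)%N -> forall p i q, T i -> adm D T x j.-1 K N (fun y => christoffel D G y p i q)) ->
  (forall a t, (a <= j)%N -> `|covDn D G U a x t| <= K) ->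
  forall a s t, all T s -> (size s <= r)%N -> (a + size s <= j)%N ->
    `|pds D s (fun y => covDn D G U a y t) x| <= K' * (1 + (size s == j)%:R * N).
  move=> /(_ j (leqnn j)) [K' K'0 H]; exists K' => // D G T x N U dD mG Dx N0 jN sU HG HU t s Ts sj.
  exact: (H D G T x N U dD mG Dx N0 jN sU HG HU 0%N).
elim=> [_|r IH rj].
  exists K => // D G T x N U dD mG Dx N0 jN sU HG HU a s t Ts.
  rewrite leqn0 size_eq0 => /eqP -> /=; rewrite addn0 => aj.
  apply: le_trans (HU a t aj) _; rewrite ler_peMr // lerDl mulr_ge0 // ler0n //.
have [K1 K10 {}IH] := IH (ltnW rj).
pose K2 := (j + k)%:R * (n%:R * (2 ^+ j * (K * K1))).
have K20 : 0 <= K2 by rewrite !mulr_ge0 // ?ler0n // ?exprn_ge0.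
exists (K1 + K2) => [|D G T x N U dD mG Dx N0 jN sU HG HU a s t Ts sr aj]; first by rewrite addr_ge0.
have {}IH := IH D G T x N U dD mG Dx N0 jN sU HG HU.
set w := 1 + _; have w1 : 1 <= w by rewrite lerDl mulr_ge0 // ler0n.
have w0 : 0 <= w := le_trans ler01 w1.
have [sr'|rs] := leqP (size s) r.
  by apply: le_trans (IH a s t Ts sr' aj) _; rewrite ler_wpM2r // lerDl.
have {sr rs} sr : size s = r.+1 by apply/eqP; rewrite eqn_leq sr rs.
case/lastP: s => [//|s i] in Ts sr aj w w1 w0 *.
move: Ts sr aj; rewrite all_rcons size_rcons => /andP[Ti Ts] [sr] aj.
have sV u : sm D (fun y => covDn D G U a y u) by exact: sm_covDn.
have sW u : sm D (fun y => covDn D G U a.+1 y u) by exact: sm_covDn.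
pose upd (l : 'I_(a + k)) p := [tuple if q == l then p else tnth t q | q < a + k].
have sC p q : sm D (fun y => christoffel D G y p i q) by exact: sm_chr.
have sCU l p : sm D (fun y => christoffel D G y p i (tnth t l) * covDn D G U a y (upd l p)) by exact: sm_mul.
rewrite pds_rcons (pds_ext (g := fun y => covDn D G U a.+1 y [tuple of i :: t] +
   \sum_(l < a + k) \sum_(p < n) christoffel D G y p i (tnth t l) * covDn D G U a y (upd l p))) //; last first.
  move=> y Dy; rewrite /= /covD /=.
  have -> : [tuple of behead [tuple of i :: t]] = t by apply: val_inj.
  have -> : thead [tuple of i :: t] = i by [].
  by rewrite subrK.
rewrite (pds_add dD) // ?pds_sum //; last by apply: sm_sum => // l _; exact: sm_sum.
apply: le_trans (ler_normD _ _) _; rewrite mulrDl; apply: lerD.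
  have a1 : (a.+1 + size s <= j)%N by rewrite addSn -addnS.
  apply: le_trans (IH a.+1 s [tuple of i :: t] Ts _ a1) _; first by rewrite sr.
  rewrite ler_wpM2l // /w lerD2l.
  have -> : (size s == j) = false.
    by apply/negbTE; rewrite neq_ltn; apply/orP; left; rewrite sr.
  by rewrite mul0r mulr_ge0 // ler0n.
apply: le_trans (ler_norm_sum _ _ _) _.
apply: (@le_trans _ _ (\sum_(l < a + k) (n%:R * (2 ^+ j * (K * K1)) * w))).
  apply: ler_sum => l _; rewrite (pds_sum dD) //.
  apply: le_trans (ler_norm_sum _ _ _) _.
  apply: (@le_trans _ _ (\sum_(p < n) (2 ^+ j * (K * K1) * w))); last first.
    by rewrite sum_ord_const [leLHS]mulrA lexx.
  apply: ler_sum => p _.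
  apply: (@le_trans _ _ (2 ^+ size s * (K * w * K1))); last first.
    rewrite -!mulrA [w * _]mulrC; apply: ler_wpM2r; first by rewrite !mulr_ge0.
    by apply: ler_weXn2l; rewrite ?ler1n // sr ltnW.
  apply: (pds_mul_bound dD (T := T)) => // s1 s2 T1 T2 E.
  have j0 : (0 < j)%N by apply: leq_ltn_trans rj.
  have s1s : (size s1 <= r)%N by rewrite -sr -E leq_addr.
  have s2s : (size s2 <= r)%N by rewrite -sr -E leq_addl.
  apply: ler_pM => //.
    have s1j : (size s1 <= j.-1)%N by apply: leq_trans s1s _; rewrite -ltnS prednK.
    apply: le_trans (HG j0 p i (tnth t l) Ti s1 T1 s1j) _.
    rewrite ler_wpM2l // /w size_rcons lerD2l ler_wpM2r // ler_nat; case: eqP => // e1.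
    have -> : (size s).+1 == j; last by [].
    by rewrite sr eqn_leq rj -(prednK j0) ltnS -e1.
  have := IH a s2 (upd l p) T2 s2s; rewrite (_ : size s2 == j = false).
    rewrite mul0r addr0 mulr1; apply; apply: leq_trans aj; rewrite leq_add2l.
    by rewrite -E addnC -addSn; apply: leq_trans (leq_addl _ _) _; rewrite addSn addnC.
  by apply/negbTE; rewrite neq_ltn; apply/orP; left; apply: leq_ltn_trans rj.
rewrite sum_ord_const /K2 [leLHS]mulrA; apply: ler_wpM2r => //.
apply: ler_wpM2r; first by rewrite !mulr_ge0 // ?ler0n // exprn_ge0.
by rewrite ler_nat leq_add2r; apply: leq_trans aj; rewrite leq_addr.
by move=> l _; exact: sm_sum.
Qed.

End AdmMetric.

(** * Comparison for linear and Riccati equations *)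

Section Ode.
Variable R : realType.

Definition seg (tau : R) : set R := [set s | 0 <= s <= tau].

Lemma seg_cont tau (f f' : R -> R) : (forall t, 0 <= t <= tau -> isd (seg tau) f t (f' t)) ->
  {within `[0, tau]%classic, continuous f}.
Proof.
move=> Hf; apply: (@isd_within_cts _ (seg tau) f _ f') => t /=; rewrite in_itv //=; exact: Hf.
Qed.

(** At a maximum away from 0, the right end included, the derivative from within is nonnegative; the
    alternative [t0 = 0] is where initial values enter. *)
Lemma seg_max tau (f f' : R -> R) : 0 <= tau ->
  (forall t, 0 <= t <= tau -> isd (seg tau) f t (f' t)) ->
  exists2 t0, 0 <= t0 <= tau & (forall t, 0 <= t <= tau -> f t <= f t0) /\ (t0 = 0 \/ 0 <= f' t0).
Proof.
move=> tau0 Hf; have [t0 + Hmax] := EVT_max tau0 (seg_cont Hf).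
rewrite in_itv /= => t0I; exists t0 => //; split.
  by move=> t tI; apply: Hmax; rewrite in_itv.
have [->|t00] := eqVneq t0 0; [by left|right].
move: (t0I) => /andP[p0 p1]; have {t00}p0 : 0 < t0 by rewrite lt_neqAle eq_sym t00.
rewrite -oppr_le0.
apply: (@isd_min_le0 R [set h | seg tau (t0 + h)] (fun h => - f (t0 + h)) _ t0) => //.
  have /isdN := Hf t0 t0I; move=> /isdP H; apply/isdP => e e0; have [d d0 Hd] := H e e0.
  by exists d => // h; rewrite add0r addr0; exact: Hd.
move=> h /andP[h1 h2]; have hI : 0 <= t0 + h <= tau by apply/andP; split; lra.
by split=> //; rewrite addr0 lerN2; apply: Hmax; rewrite in_itv.
Qed.

(** A maximum principle for a finite system: w |f| is maximized over components and times together,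
    so at that time the chosen component dominates all others. The square (w f)^2 avoids
    differentiating an absolute value. *)
Lemma max_weight (A : finType) (a0 : A) (f f' : A -> R -> R) (w w' : R -> R) tau : 0 <= tau ->
  (forall a t, 0 <= t <= tau -> isd (seg tau) (f a) t (f' a t)) ->
  (forall t, 0 <= t <= tau -> isd (seg tau) w t (w' t)) ->
  (forall t, 0 <= t <= tau -> 0 < w t) ->
  exists a t0, [/\ 0 <= t0 <= tau,
    forall b t, 0 <= t <= tau -> w t * `|f b t| <= w t0 * `|f a t0| &
    t0 = 0 \/ 0 <= f a t0 * (w' t0 * f a t0 + w t0 * f' a t0)].
Proof.
move=> tau0 Hf Hw w0.
pose g a t := (w t * f a t) * (w t * f a t).
pose g' a t := (w' t * f a t + w t * f' a t) * (w t * f a t) + (w t * f a t) * (w' t * f a t + w t * f' a t).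
have Hg a t : 0 <= t <= tau -> isd (seg tau) (g a) t (g' a t).
  by move=> tI; apply: isdM; apply: isdM; [exact: Hw|exact: Hf|exact: Hw|exact: Hf].
have /choice[m Hm] : forall a, exists t0, 0 <= t0 <= tau /\
    ((forall t, 0 <= t <= tau -> g a t <= g a t0) /\ (t0 = 0 \/ 0 <= g' a t0)).
  by move=> a; have [t0 H1 H2] := seg_max tau0 (Hg a); exists t0.
pose a := [arg max_(i > a0) g i (m i)]%O.
have Ha b : g b (m b) <= g a (m a).
  by rewrite /a; case: arg_maxP => // i _ /(_ b isT).
have [mI [Hmax Hd]] := Hm a; have wm := w0 _ mI.
exists a, (m a); split=> //.
- move=> b t tI; have wt := w0 t tI.
  have H : g b t <= g a (m a) by apply: le_trans (Ha b); exact: (Hm b).2.1.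
  rewrite -[w t]gtr0_norm // -[X in _ <= X * _]gtr0_norm // -!normrM.
  by rewrite -(ler_pXn2r (ltn0Sn 1)) ?nnegrE // !real_normK ?num_real // !expr2.
- case: Hd => [->|Hd]; [by left|right].
  move: Hd; rewrite /g'; set X := w' _ * _ + _; move=> Hd.
  have : 0 <= 2 * w (m a) * (f a (m a) * X) by move: Hd; rewrite (_ : 2 * _ * _ = X * (w (m a) * f a (m a)) + w (m a) * f a (m a) * X) //; ring.
  by rewrite pmulr_rge0 // mulr_gt0.
Qed.

Lemma isd_exp_lin (S : set R) c t : isd S (fun s => expR (c * s)) t (expR (c * t) * c).
Proof.
by have := isd_comp1 (is_derive_expR (c * t)) (isdZ (c := c) (isd_id S t)); rewrite mulr1.
Qed.

Lemma isd_exp_sq (S : set R) c t : isd S (fun s => expR (c * (s * s))) t (expR (c * (t * t)) * (c * (2 * t))).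
Proof.
have H : isd S (fun s => c * (s * s)) t (c * (1 * t + t * 1)) := isdZ (isdM (isd_id S t) (isd_id S t)).
have := isd_comp1 (f := fun s => c * (s * s)) (is_derive_expR (c * (t * t))) H.
by rewrite /= mul1r mulr1 mulr_natl mulr2n.
Qed.

(** Gronwall's inequality by [max_weight] with weight exp(-(L + 1) t). Away from time 0 the maximum
    satisfies (L + 1) F^2 <= F F' <= |F| (K0 + L |F|), and the extra 1 leaves |F| <= K0. *)
Lemma ode_linear (A : finType) (f f' : A -> R -> R) tau K0 K1 L : 0 <= tau -> 0 <= K0 -> 0 <= K1 -> 0 <= L ->
  (forall a t, 0 <= t <= tau -> isd (seg tau) (f a) t (f' a t)) ->
  (forall a t mu, 0 <= t <= tau -> (forall b, `|f b t| <= mu) -> `|f' a t| <= K0 + L * mu) ->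
  (forall a, `|f a 0| <= K1) ->
  forall a t, 0 <= t <= tau -> `|f a t| <= expR ((L + 1) * tau) * (K0 + K1).
Proof.
move=> tau0 K00 K10 L0 Hf Hr H0 a0 t1 t1I.
have wI t : expR (- (L + 1) * t) > 0 by exact: expR_gt0.
have [||a [t0 [t0I Hmax Hd]]] := @max_weight A a0 f f' (fun t => expR (- (L + 1) * t))
   (fun t => expR (- (L + 1) * t) * - (L + 1)) tau tau0 Hf.
- by move=> t _; exact: isd_exp_lin.
- by [].
have mu b : `|f b t0| <= `|f a t0|.
  by have := Hmax b t0 t0I; rewrite ler_pM2l.
have fa : `|f a t0| <= K0 + K1.
  case: Hd => [->|Hd]; first by apply: le_trans (H0 a) _; rewrite lerDr.
  have := Hr a t0 `|f a t0| t0I mu.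
  move: Hd; rewrite mulrAC -mulrA -mulrDr mulrCA pmulr_rge0 //.
  set F := f a t0; set F' := f' a t0 => H1 H2.
  have : F * F' <= `|F| * (K0 + L * `|F|).
    by apply: le_trans (ler_norm _) _; rewrite normrM; apply: ler_wpM2l.
  have FF : F * F = `|F| * `|F| by rewrite -!expr2 real_normK ?num_real.
  have n0 : 0 <= `|F| by [].
  have {}H1 : 0 <= - (L + 1) * (F * F) + F * F'.
    by rewrite (_ : _ + _ = F * (F * - (L + 1) + F')) //; ring.
  move: H1; rewrite FF; move: `|F| n0 => z z0 H1 H3.
  have : z * z <= z * K0 by nra.
  have [->|z1] := eqVneq z 0; first by rewrite addr_ge0.
  have zp : 0 < z by rewrite lt_neqAle eq_sym z1.
  by rewrite ler_pM2l // => zK; apply: le_trans zK _; rewrite lerDl.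
have := Hmax a0 t1 t1I; rewrite -ler_pdivlMl // -expRN => H; apply: le_trans H _.
rewrite [leLHS]mulrA; apply: ler_pM; rewrite ?mulr_ge0 ?expR_ge0 //.
rewrite -expRD ler_expR; move: t0I t1I => /andP[a1 a2] /andP[b1 b2]; nra.
Qed.

(** The equation is singular at t = 0, and because c >= 1 no initial value is needed. With weight
    exp(-L t^2) the maximum satisfies (c + 2 L t^2) F^2 <= F r, so a perturbation of size (1/2 + L
    t^2) |F| is absorbed and |F| <= 2 K0 remains. *)
Lemma ode_radial (A : finType) (f f' r : A -> R -> R) (c : A -> R) K0 L : 0 <= K0 -> 0 <= L ->
  (forall a, 1 <= c a) ->
  (forall a t, 0 <= t <= 1 -> isd (seg 1) (f a) t (f' a t)) ->
  (forall a t, 0 <= t <= 1 -> t * f' a t = - c a * f a t + r a t) ->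
  (forall a t mu, 0 <= t <= 1 -> (forall b, `|f b t| <= mu) ->
     `|r a t| <= K0 + (2^-1 + L * (t * t)) * mu) ->
  forall a, `|f a 1| <= expR L * (2 * K0).
Proof.
move=> K00 L0 c1 Hf Hode Hr a0.
have wI t : expR (- L * (t * t)) > 0 by exact: expR_gt0.
have [||a [t0 [t0I Hmax Hd]]] := @max_weight A a0 f f' (fun t => expR (- L * (t * t)))
   (fun t => expR (- L * (t * t)) * (- L * (2 * t))) 1 ler01 Hf.
- by move=> t _; exact: isd_exp_sq.
- by [].
have mu b : `|f b t0| <= `|f a t0|.
  by have := Hmax b t0 t0I; rewrite ler_pM2l.
have fa : `|f a t0| <= 2 * K0.
  have Hr0 := Hr a t0 `|f a t0| t0I mu; have E := Hode a t0 t0I.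
  (* After multiplication by t0 the inequality also holds at t0 = 0, where both derivative terms
     vanish. *)
  have H1 : 0 <= f a t0 * (- L * (2 * t0) * t0 * f a t0 + t0 * f' a t0).
    case: Hd => [->|]; first by rewrite !mulr0 !mul0r addr0 mulr0.
    rewrite -mulrA -mulrDr mulrCA pmulr_rge0 // => H.
    have t00 : 0 <= t0 by case/andP: t0I.
    by have := mulr_ge0 t00 H; rewrite mulrCA mulrDr; congr (_ <= _ * (_ + _)); ring.
  move: H1 Hr0 (c1 a); rewrite E; move: (f a t0) (r a t0) (c a) t0I => F r0 c0 t0I H1 Hr0 c10.
  have : F * r0 <= `|F| * (K0 + (2^-1 + L * (t0 * t0)) * `|F|).
    by apply: le_trans (ler_norm _) _; rewrite normrM; apply: ler_wpM2l.
  have FF : F * F = `|F| * `|F| by rewrite -!expr2 real_normK ?num_real.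
  have n0 : 0 <= `|F| by [].
  have -> : F * r0 = F * (- L * (2 * t0) * t0 * F + (- c0 * F + r0)) + (2 * L * (t0 * t0) + c0) * (F * F) by ring.
  rewrite FF; move: H1; set X := F * (_ + _); move: `|F| n0 => z z0 H1 H3.
  have Lt : 0 <= L * (t0 * t0) by rewrite mulr_ge0 // -expr2 sqr_ge0.
  have : z * z <= z * (2 * K0) by nra.
  have [->|z1] := eqVneq z 0; first by rewrite mulr_ge0.
  have zp : 0 < z by rewrite lt_neqAle eq_sym z1.
  by rewrite ler_pM2l.
have := Hmax a0 1; rewrite ler01 lexx => /(_ isT); rewrite -ler_pdivlMl // -expRN => H; apply: le_trans H _.
rewrite [leLHS]mulrA; apply: ler_pM; rewrite ?mulr_ge0 ?expR_ge0 //.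
rewrite -expRD ler_expR; move: t0I => /andP[a1 a2]; nra.
Qed.

(** Meant for f = g(v,v), p = g(Bv,Bv), h = g(v,Bv) and q = g(Bv,Qv) along a ray, with Q the
    curvature term. The damping -2p bounds p by the maximum of f, then f' is bounded, and smallness
    of c closes the circle: the oscillation of f is at most a quarter of its maximum, hence a third
    of f(0). *)
Lemma zero_radial (f f' p p' h q : R -> R) c : 0 <= c -> 8 * c <= 1 ->
  (forall t, 0 <= t <= 1 -> isd (seg 1) f t (f' t)) ->
  (forall t, 0 <= t <= 1 -> isd (seg 1) p t (p' t)) ->
  (forall t, 0 <= t <= 1 -> t * f' t = 2 * h t) ->
  (forall t, 0 <= t <= 1 -> t * p' t = - 2 * p t + 2 * q t) ->
  (forall t, 0 <= t <= 1 -> 0 <= f t) -> (forall t, 0 <= t <= 1 -> 0 <= p t) ->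
  (forall t, 0 <= t <= 1 -> h t ^+ 2 <= f t * p t) ->
  (forall t, 0 <= t <= 1 -> q t ^+ 2 <= (c * t ^+ 2) ^+ 2 * (p t * f t)) ->
  `|f 1 - f 0| <= f 0 / 3 /\ p 1 <= c ^+ 2 * (2 * f 0).
Proof.
move=> c0 c8 Hf Hp Ef Ep f0 p0 Hh Hq.
have [tF tFI [FM _]] := seg_max ler01 Hf; set F := f tF in FM.
have I1 : 0 <= (1 : R) <= 1 by rewrite ler01 lexx.
have I0 : 0 <= (0 : R) <= 1 by rewrite lexx ler01.
have F0 : 0 <= F by exact: f0.
(* At a maximum s of p on [0, t] the singular equation gives p <= q, whence p^2 <= (c s^2)^2 p f;
   division by p gives the bound. *)
have pt t : 0 <= t <= 1 -> p t <= (c * t ^+ 2) ^+ 2 * F.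
  move=> tI; move: (tI) => /andP[t0 t1].
  have sub s : 0 <= s <= t -> 0 <= s <= 1 by move=> /andP[-> /le_trans ->].
  have Hpt s : 0 <= s <= t -> isd (seg t) p s (p' s).
    by move=> sI; apply: isd_sub (Hp s (sub s sI)) => u /=; exact: sub.
  have [s sI [sM sd]] := seg_max t0 Hpt.
  have sI1 := sub s sI; move: (sI1) => /andP[s0 s1].
  have ps : p s <= q s.
    have := Ep s sI1; have : 0 <= s * p' s by case: sd => [->|sd]; rewrite ?mul0r // mulr_ge0.
    lra.
  have ptt : p t <= p s by apply: sM; rewrite t0 lexx.
  apply: le_trans ptt _.
  have [ps0|ps0] := leP (p s) 0.
    by apply: le_trans ps0 _; rewrite mulr_ge0 // sqr_ge0.
  have : p s * p s <= (c * s ^+ 2) ^+ 2 * (p s * f s).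
    apply: le_trans (Hq s sI1); rewrite -expr2 ler_pXn2r // nnegrE ltW //.
    by apply: lt_le_trans ps0 _.
  rewrite mulrCA ler_pM2l // => H; apply: le_trans H _.
  apply: ler_pM => //; [by rewrite sqr_ge0|exact: f0| |exact: FM].
  have cs : 0 <= c * s ^+ 2 by rewrite mulr_ge0 // sqr_ge0.
  have st : c * s ^+ 2 <= c * t ^+ 2.
    by apply: ler_wpM2l => //; rewrite ler_pXn2r ?nnegrE //; case/andP: sI.
  by rewrite ler_pXn2r // nnegrE // (le_trans cs).
have f'b t : 0 < t <= 1 -> `|f' t| <= 2 * c * F.
  move=> /andP[t0 t1]; have tI : 0 <= t <= 1 by rewrite ltW.
  have h2 : `|h t| <= c * t ^+ 2 * F.
    have cF : 0 <= c * t ^+ 2 * F by rewrite !mulr_ge0 // ltW.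
    rewrite -(ler_pXn2r (ltn0Sn 1)) ?nnegrE // real_normK ?num_real //.
    apply: le_trans (Hh t tI) _; apply: le_trans (ler_pM (f0 t tI) (p0 t tI) (FM t tI) (pt t tI)) _.
    by rewrite le_eqVlt; apply/orP; left; apply/eqP; ring.
  have := Ef t tI; rewrite -(ler_pM2l t0) -[t in t * `|_|]gtr0_norm // -normrM => ->.
  rewrite normrM ger0_norm //; apply: le_trans (ler_wpM2l _ h2) _ => //.
  have : 0 <= c * F * t by rewrite !mulr_ge0 // ltW.
  by rewrite expr2; nra.
have fd t : 0 <= t <= 1 -> `|f t - f 0| <= 2 * c * F.
  move=> /andP[t0 t1].
  have cF0 : 0 <= 2 * c * F by rewrite !mulr_ge0.
  have [->|tn] := eqVneq t 0; first by rewrite subrr normr0.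
  have tp : 0 < t by rewrite lt_neqAle eq_sym tn.
  have [||s /andP[s0 st] ->] := isd_MVT tp (S := seg 1) (f := f) (f' := f').
  - by move=> s /andP[s0 st]; rewrite /seg /= s0 (le_trans st).
  - by move=> s /andP[s0 st]; apply: Hf; rewrite s0 (le_trans st).
  rewrite subr0 normrM [`|t|]gtr0_norm //.
  have := f'b s; rewrite s0 (le_trans (ltW st) t1) => /(_ isT) H.
  by apply: le_trans (ler_pM _ _ H t1) _; rewrite ?mulr1 // ltW.
have FF : F <= 4 / 3 * f 0.
  have := fd tF tFI; rewrite ler_norml => /andP[_]; rewrite -/F => H.
  have : 2 * c * F <= F / 4 by nra.
  lra.
have f00 := f0 0 I0.
split.
  apply: le_trans (fd 1 I1) _.
  have : 2 * c * F <= F / 4 by nra.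
  lra.
apply: le_trans (pt 1 I1) _; rewrite expr1n mulr1; apply: ler_wpM2l; first exact: sqr_ge0.
by lra.
Qed.

(** The regular analogue of [zero_radial]: without damping, p needs an initial bound. With Q the
    maximum of f + p both functions move by at most tau (1 + c) Q <= Q/2, so Q <= 2 (1 + C1)
    f(0). *)
Lemma zero_collar (f f' p p' h q : R -> R) tau c C1 : 0 <= c -> 0 <= C1 -> 0 <= tau ->
  2 * tau * (1 + c) <= 1 -> 6 * tau * (1 + C1) <= 1 ->
  (forall t, 0 <= t <= tau -> isd (seg tau) f t (f' t)) ->
  (forall t, 0 <= t <= tau -> isd (seg tau) p t (p' t)) ->
  (forall t, 0 <= t <= tau -> f' t = 2 * h t) ->
  (forall t, 0 <= t <= tau -> p' t = 2 * q t) ->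
  (forall t, 0 <= t <= tau -> 0 <= f t) -> (forall t, 0 <= t <= tau -> 0 <= p t) ->
  (forall t, 0 <= t <= tau -> h t ^+ 2 <= f t * p t) ->
  (forall t, 0 <= t <= tau -> q t ^+ 2 <= c ^+ 2 * (p t * f t)) ->
  p 0 <= C1 * f 0 ->
  forall t, 0 <= t <= tau -> `|f t - f 0| <= f 0 / 3 /\ p t <= 2 * (1 + C1) * f 0.
Proof.
move=> c0 C10 tau0 tc tC Hf Hp Ef Ep f0 p0 Hh Hq Hp0 t tI.
have I0 : 0 <= (0 : R) <= tau by rewrite lexx tau0.
have [tQ tQI [QM _]] := seg_max tau0 (fun t tI => isdD (Hf t tI) (Hp t tI)).
set Q := f tQ + p tQ in QM.
have Q0 : 0 <= Q by rewrite addr_ge0 ?f0 ?p0.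
have amgm (a b u : R) : 0 <= a -> 0 <= b -> u ^+ 2 <= a * b -> 2 * `|u| <= a + b.
  move=> a0 b0 H; have ab : 0 <= a + b by rewrite addr_ge0.
  rewrite -(ler_pXn2r (ltn0Sn 1)) ?nnegrE ?mulr_ge0 // exprMn real_normK ?num_real //.
  have := sqr_ge0 (a - b); rewrite !expr2 in H *; nra.
have h2 s : 0 <= s <= tau -> 2 * `|h s| <= Q.
  move=> sI; apply: le_trans (QM s sI); apply: amgm; [exact: f0|exact: p0|exact: Hh].
have q2 s : 0 <= s <= tau -> 2 * `|q s| <= c * Q.
  move=> sI; apply: (@le_trans _ _ (c * f s + c * p s)).
    apply: amgm; rewrite ?mulr_ge0 ?f0 ?p0 //.
    by apply: le_trans (Hq s sI) _; rewrite expr2 mulrACA [c * p s * _]mulrC.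
  by rewrite -mulrDr; apply: ler_wpM2l => //; exact: QM.
have inS a s : 0 <= a <= tau -> 0 <= s <= a -> 0 <= s <= tau.
  by move=> /andP[_ at_] /andP[-> /le_trans ->].
have fd a : 0 <= a <= tau -> `|f a - f 0| <= tau * Q.
  move=> aI; move: (aI) => /andP[a0 a1].
  have [->|an] := eqVneq a 0; first by rewrite subrr normr0 mulr_ge0.
  have ap : 0 < a by rewrite lt_neqAle eq_sym an.
  have [||s /andP[s0 sa] ->] := isd_MVT ap (S := seg tau) (f := f) (f' := f').
  - by move=> s sI; exact: inS sI.
  - by move=> s sI; apply: Hf; exact: inS sI.
  have sI : 0 <= s <= tau by apply: (inS a) => //; rewrite !ltW.
  rewrite subr0 Ef // !normrM [`|a|]gtr0_norm // [`|2|]gtr0_norm // mulrC.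
  by apply: ler_pM => //; exact: h2.
have pd_ a : 0 <= a <= tau -> `|p a - p 0| <= tau * (c * Q).
  move=> aI; move: (aI) => /andP[a0 a1].
  have [->|an] := eqVneq a 0; first by rewrite subrr normr0 !mulr_ge0.
  have ap : 0 < a by rewrite lt_neqAle eq_sym an.
  have [||s /andP[s0 sa] ->] := isd_MVT ap (S := seg tau) (f := p) (f' := p').
  - by move=> s sI; exact: inS sI.
  - by move=> s sI; apply: Hp; exact: inS sI.
  have sI : 0 <= s <= tau by apply: (inS a) => //; rewrite !ltW.
  rewrite subr0 Ep // !normrM [`|a|]gtr0_norm // [`|2|]gtr0_norm // mulrC.
  by apply: ler_pM => //; exact: q2.
have f00 := f0 0 I0.
have QQ : Q <= 2 * ((1 + C1) * f 0).
  have := fd tQ tQI; have := pd_ tQ tQI; rewrite !ler_norml => /andP[_ h1] /andP[_ h3].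
  have : Q <= f 0 + p 0 + tau * (1 + c) * Q by rewrite /Q in h1 h3 *; lra.
  have : tau * (1 + c) * Q <= 2^-1 * Q by apply: ler_wpM2r => //; lra.
  rewrite mulrDl mul1r; lra.
split.
  apply: le_trans (fd t tI) _; apply: le_trans (ler_wpM2l tau0 QQ) _.
  have : 6 * tau * (1 + C1) * f 0 <= 1 * f 0 by apply: ler_wpM2r.
  lra.
have := QM t tI; have := f0 t tI; rewrite -mulrA; lra.
Qed.

End Ode.

(** * Geodesic normal coordinates *)

Section QuadraticForms.
Variables (R : realType) (n : nat).
Implicit Types (G : 'M[R]_n) (v w : 'rV[R]_n).

Definition qf G v w : R := (v *m G *m w^T) 0 0.
Definition esq v : R := \sum_i v 0 i ^+ 2.

Lemma qfE G v w : qf G v w = \sum_i \sum_j v 0 i * G i j * w 0 j.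
Proof.
rewrite /qf mxE exchange_big /=; apply: eq_bigr => j _; rewrite !mxE mulr_suml.
by apply: eq_bigr => i _.
Qed.

Lemma qf_ge0 G v : posdef G -> 0 <= qf G v v.
Proof.
move=> pG; have [->|v0] := eqVneq v 0; last by apply/ltW/pG.
by rewrite /qf !mul0mx mxE.
Qed.

Lemma qf_symE G v w : G^T = G -> qf G v w = qf G w v.
Proof.
move=> sG; rewrite /qf -[LHS](mxE (trmx_key) (fun i j => (v *m G *m w^T) j i) 0 0) -/(_^T).
by rewrite !trmx_mul trmxK sG mulmxA.
Qed.

Lemma qf_CS G v w : G^T = G -> posdef G -> qf G v w ^+ 2 <= qf G v v * qf G w w.
Proof.
move=> sG pG; have [->|w0] := eqVneq w 0.
  by rewrite /qf trmx0 !mulmx0 mxE expr0n mulr0.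
have W : 0 < qf G w w by exact: pG.
pose l := qf G v w / qf G w w.
have := qf_ge0 (v - l *: w) pG.
have -> : qf G (v - l *: w) (v - l *: w) = qf G v v - 2 * l * qf G v w + l ^+ 2 * qf G w w.
  have -> : qf G (v - l *: w) (v - l *: w) =
     qf G v v - l * qf G v w - l * qf G w v + l ^+ 2 * qf G w w.
    rewrite !qfE !mulr_sumr -!sumrB -big_split; apply: eq_bigr => i _.
    by rewrite !mulr_sumr -!sumrB -big_split; apply: eq_bigr => j _; rewrite !mxE /=; ring.
  rewrite (qf_symE w v sG); ring.
have -> : qf G v v - 2 * l * qf G v w + l ^+ 2 * qf G w w =
   (qf G v v * qf G w w - qf G v w ^+ 2) / qf G w w.
  by rewrite /l; field; rewrite gt_eqF.
by rewrite pmulr_lge0 ?invr_gt0 // subr_ge0.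
Qed.

Lemma esq_ge0 v : 0 <= esq v.
Proof. by apply: sumr_ge0 => i _; exact: sqr_ge0. Qed.

Lemma esq_coord v i : v 0 i ^+ 2 <= esq v.
Proof. by rewrite /esq (bigD1 i) //= lerDl; apply: sumr_ge0 => j _; exact: sqr_ge0. Qed.

Lemma enormE v : enorm v = Num.sqrt (esq v). Proof. by []. Qed.

Lemma esq_delta i : esq (delta_mx 0 i) = 1.
Proof.
rewrite /esq (bigD1 i) //= mxE !eqxx expr1n big1 ?addr0 // => j ji.
by rewrite mxE (negPf ji) andbF expr0n.
Qed.

Lemma qf_delta G i j : qf G (delta_mx 0 i) (delta_mx 0 j) = G i j.
Proof. by rewrite /qf trmx_delta -rowE -colE !mxE. Qed.

Lemma met_entry G i j : G^T = G -> posdef G -> (forall v, qf G v v <= 2 * esq v) -> `|G i j| <= 2.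
Proof.
move=> sG pG H; rewrite -(ler_pXn2r (ltn0Sn 1)) ?nnegrE // real_normK ?num_real //.
rewrite -qf_delta; apply: le_trans (qf_CS _ _ sG pG) _.
have b k : qf G (delta_mx 0 k) (delta_mx 0 k) <= 2 by have := H (delta_mx 0 k); rewrite esq_delta mulr1.
by rewrite expr2; apply: ler_pM => //; exact: qf_ge0.
Qed.

(** The i-th row u of the inverse has g(u,u) = g^ii and i-th coordinate g^ii. Comparing with its
    Euclidean length bounds g^ii first, and then every other entry. *)
Lemma imet_entry G i j : G^T = G -> posdef G -> (forall v, esq v <= 3 * qf G v v) ->
  `|invmx G i j| <= 3.
Proof.
move=> sG pG H; have uG := posdef_unit pG.
pose u := row i (invmx G).
have qu : qf G u u = invmx G i i.
  rewrite /qf /u [row i _]rowE mulmxKV // trmx_mul trmx_delta (invmx_sym sG) mulmxA.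
  by rewrite -rowE -colE !mxE.
have uE k : u 0 k = invmx G i k by rewrite mxE.
have := H u; rewrite qu => Hu.
have h1 := le_trans (esq_coord u i) Hu; have h2 := le_trans (esq_coord u j) Hu.
rewrite !uE in h1 h2.
have i0 : 0 < invmx G i i by apply: posdef_diag; exact: posdef_inv.
have i3 : invmx G i i <= 3 by move: h1; rewrite expr2 ler_pM2r.
rewrite -(ler_pXn2r (ltn0Sn 1)) ?nnegrE // real_normK ?num_real //.
apply: le_trans h2 _; rewrite expr2; apply: ler_wpM2l => //.
Qed.

(** In an orthonormal frame each component of T is at most its norm, and each coordinate of a vector
    at most its length. *)
Lemma contr_bound k G (T : k.-tuple 'I_n -> R) (v : 'I_k -> 'rV[R]_n) : G^T = G -> posdef G ->
  `|\sum_s T s * \prod_(l < k) v l 0 (tnth s l)| <=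
  (n ^ k)%:R * (Num.sqrt (tsq (invmx G) T) * \prod_(l < k) Num.sqrt (qf G (v l) (v l))).
Proof.
move=> sG pG; have [E HE] := frame_exists sG pG.
have [uE iG GE] := frame_unit HE; set P := invmx E in GE.
pose U := tr E T.
have TE s : T s = tr P U s by rewrite /U tr_comp mulVmx // tr1.
under eq_bigr do rewrite TE mulrC.
rewrite tr_adj; apply: le_trans (ler_norm_sum _ _ _) _.
rewrite -sum_tuple_const; apply: ler_sum => s _; rewrite normrM mulrC.
apply: ler_pM => //.
  rewrite iG tsq_frame -sqrtr_sqr ler_sqrt; last by apply: sumr_ge0 => ? _; exact: sqr_ge0.
  by rewrite (bigD1 s) //= lerDl; apply: sumr_ge0 => ? _; exact: sqr_ge0.
have -> : tr P^T (fun s => \prod_(l < k) v l 0 (tnth s l)) s = \prod_(l < k) (v l *m P) 0 (tnth s l).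
  rewrite /tr; under eq_bigr do rewrite -big_split /=.
  rewrite (sum_tuple_prod (fun l j => P^T (tnth s l) j * v l 0 j)).
  by apply: eq_bigr => l _; rewrite mxE; apply: eq_bigr => j _; rewrite mxE mulrC.
rewrite normr_prod; apply: ler_prod => l _; rewrite normr_ge0 /=.
have q0 := qf_ge0 (v l) pG.
rewrite -sqrtr_sqr ler_sqrt // /qf GE !mulmxA -[_ *m P^T *m _]mulmxA -trmx_mul [leRHS]mxE.
rewrite (bigD1 (tnth s l)) //= [_^T _ _]mxE -expr2 lerDl; apply: sumr_ge0 => a _.
by rewrite [_^T _ _]mxE -expr2 sqr_ge0.
Qed.

End QuadraticForms.

(* Common setting of the two kinds of normal coordinates: a vector field [xi] (the radial field
   x_i d_i, or the normal field d_n) whose covariant derivative is, up to the identity in the radial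
   case, the endomorphism [B]; then L_xi g = 2 g B and B solves a Riccati equation. *)
Section Flow.
Variables (R : realType) (n : nat).
Implicit Types (D : set 'rV[R]_n) (G : 'rV[R]_n -> 'M[R]_n)
  (B : 'I_n -> 'I_n -> 'rV[R]_n -> R) (xi : 'I_n -> 'rV[R]_n -> R).

Definition along D xi (f : 'rV[R]_n -> R) x : R := \sum_i xi i x * pd D i f x.

(** The endomorphism v |-> R(xi, v) xi, written with the lowered curvature tensor, whose norm is the
    one that is bounded. *)
Definition Qend D G xi (p j : 'I_n) x : R := \sum_l \sum_i \sum_k
  (xi i x * xi k x) * (invmx (G x) p l * riem D G x [tuple i; j; k; l]).

(** [c0] comes from the commutator [d_i, xi] = c0 d_i and [c1] from the identity in nabla xi; both
    are 1 for the radial field and 0 for the normal field. A direction outside [T] must be one in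
    which the derivative of the metric is given by B ([flow_dir]). *)
Record flow D G B xi (c0 c1 : R) (T : pred 'I_n) : Prop := Flow {
  flow_smB : forall p q, sm D (B p q) ;
  flow_smxi : forall i, sm D (xi i) ;
  flow_met : forall x i j, D x ->
    along D xi (fun y => G y i j) x = 2 * \sum_l G x i l * B l j x ;
  flow_ric : forall x p j, D x ->
    along D xi (B p j) x = - c1 * B p j x - \sum_q B p q x * B q j x + Qend D G xi p j x ;
  flow_comm : forall s f x, all T s -> sm D f -> D x ->
    along D xi (pds D s f) x = pds D s (along D xi f) x - c0 * (size s)%:R * pds D s f x ;
  flow_dir : forall i, T i \/ forall x a b, D x ->
    pd D i (fun y => G y a b) x = 2 * \sum_l G x a l * B l b x }.

Definition app B (v : 'rV[R]_n) x : 'rV[R]_n := \row_p \sum_j B p j x * v 0 j.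

Section Zero.
Variables (D : set 'rV[R]_n) (G : 'rV[R]_n -> 'M[R]_n).
Variables (B : 'I_n -> 'I_n -> 'rV[R]_n -> R) (xi : 'I_n -> 'rV[R]_n -> R) (c0 c1 : R) (T : pred 'I_n).
Hypotheses (dD : dom D) (mG : is_metric D G) (FL : flow D G B xi c0 c1 T).

Lemma along_mul f g x : sm D f -> sm D g -> D x ->
  along D xi (fun y => f y * g y) x = along D xi f x * g x + f x * along D xi g x.
Proof.
move=> sf sg Dx; rewrite /along mulr_suml mulr_sumr -big_split /=; apply: eq_bigr => i _.
by rewrite (pd_mul dD) // mulrDr !mulrA; gring.
Qed.

Lemma along_sum (I : Type) (r : seq I) (P : pred I) (F : I -> 'rV[R]_n -> R) x :
  (forall a, P a -> sm D (F a)) -> D x ->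
  along D xi (fun y => \sum_(a <- r | P a) F a y) x = \sum_(a <- r | P a) along D xi (F a) x.
Proof.
move=> sF Dx; rewrite /along.
under eq_bigr do rewrite (pd_sum dD) // mulr_sumr.
by rewrite exchange_big.
Qed.

Lemma along_scale c f x : sm D f -> D x -> along D xi (fun y => c * f y) x = c * along D xi f x.
Proof.
move=> sf Dx; rewrite /along mulr_sumr; apply: eq_bigr => i _; by rewrite (pd_scale dD) // mulrCA.
Qed.

Variable v : 'rV[R]_n.

Let sB p q : sm D (B p q). Proof. exact: flow_smB FL _ _. Qed.
Let sG p q : sm D (fun y => G y p q). Proof. exact: sm_met. Qed.

Lemma sm_app p : sm D (fun y => app B v y 0 p).
Proof.
apply: (sm_ext (f := fun y => \sum_j B p j y * v 0 j)) => [y _|]; first by rewrite mxE.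
by apply: (sm_sum dD) => j _; apply: (sm_mul dD) => //; exact: sm_cst.
Qed.

Lemma sm_qf (u w : 'rV[R]_n -> 'rV[R]_n) : (forall p, sm D (fun y => u y 0 p)) ->
  (forall p, sm D (fun y => w y 0 p)) -> sm D (fun y => qf (G y) (u y) (w y)).
Proof.
move=> su sw; apply: (sm_ext (f := fun y => \sum_i \sum_j u y 0 i * G y i j * w y 0 j)).
  by move=> y _; rewrite qfE.
by apply: (sm_sum dD) => i _; apply: (sm_sum dD) => j _; do 2?apply: (sm_mul dD).
Qed.

Lemma along_ext f g x : (forall y, D y -> f y = g y) -> D x -> along D xi f x = along D xi g x.
Proof. by move=> E Dx; apply: eq_bigr => i _; rewrite (pd_ext i E). Qed.

Lemma along_met x : D x -> along D xi (fun y => qf (G y) v v) x = 2 * qf (G x) v (app B v x).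
Proof.
move=> Dx; rewrite (along_ext (g := fun y => \sum_i \sum_j v 0 i * v 0 j * G y i j)) //; last first.
  by move=> y _; rewrite qfE; apply: eq_bigr => i _; apply: eq_bigr => j _; rewrite mulrAC.
have sv i j : sm D (fun y => v 0 i * v 0 j * G y i j) by apply: (sm_mul dD) => //; exact: sm_cst.
rewrite along_sum // => [|i _]; last exact: sm_sum.
rewrite qfE mulr_sumr; apply: eq_bigr => i _; rewrite along_sum //.
under eq_bigr do rewrite along_scale // (flow_met FL) //.
transitivity (\sum_j \sum_l 2 * (v 0 i * G x i l * (B l j x * v 0 j))).
  apply: eq_bigr => j _; rewrite mulrCA mulr_sumr mulr_sumr; apply: eq_bigr => l _; ring.
rewrite exchange_big /= mulr_sumr; apply: eq_bigr => l _.
by rewrite mxE !mulr_sumr.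
Qed.

Lemma along_app p x : D x -> along D xi (fun y => app B v y 0 p) x =
  - c1 * app B v x 0 p - app B (app B v x) x 0 p + \sum_j Qend D G xi p j x * v 0 j.
Proof.
move=> Dx; rewrite (along_ext (g := fun y => \sum_j v 0 j * B p j y)) //; last first.
  by move=> y _; rewrite mxE; apply: eq_bigr => j _; rewrite mulrC.
have sv j : sm D (fun y => v 0 j * B p j y) by apply: (sm_mul dD) => //; exact: sm_cst.
rewrite along_sum //.
under eq_bigr do rewrite along_scale // (flow_ric FL) //.
have -> : app B v x 0 p = \sum_j B p j x * v 0 j by rewrite mxE.
have -> : app B (app B v x) x 0 p = \sum_j (\sum_q B p q x * B q j x) * v 0 j.
  rewrite mxE; under [RHS]eq_bigr do rewrite mulr_suml.
  exch => q _; rewrite mxE mulr_sumr.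
  by apply: eq_bigr => j _; rewrite mulrA.
rewrite mulr_sumr -sumrB -big_split /=; apply: eq_bigr => j _.
move: (Qend _ _ _ _ _ _) (\sum_q _) => a b; ring.
Qed.

(* The cubic terms of the Riccati equation cancel. *)
Lemma along_app2 x : D x -> along D xi (fun y => qf (G y) (app B v y) (app B v y)) x =
  - 2 * c1 * qf (G x) (app B v x) (app B v x) +
  2 * qf (G x) (app B v x) (\row_p \sum_j Qend D G xi p j x * v 0 j).
Proof.
move=> Dx; have sw := sm_app.
pose w y := app B v y.
have wE y : app B v y = w y by [].
rewrite (along_ext (g := fun y => \sum_i \sum_j (w y 0 i * G y i j) * w y 0 j)) //; last first.
  by move=> y _; rewrite qfE.
have s1 i j : sm D (fun y => w y 0 i * G y i j) by apply: (sm_mul dD).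
have s2 i j : sm D (fun y => w y 0 i * G y i j * w y 0 j) by apply: (sm_mul dD).
rewrite along_sum // => [|i _]; last exact: sm_sum.
under eq_bigr do rewrite along_sum //.
pose r : 'rV[R]_n := \row_p \sum_j Qend D G xi p j x * v 0 j.
pose bw := app B (w x) x.
have aw p : along D xi (fun y => w y 0 p) x = - c1 * w x 0 p - bw 0 p + r 0 p.
  by rewrite /w along_app // /r [X in _ = _ + X]mxE.
transitivity (\sum_i \sum_j ((- c1 * w x 0 i - bw 0 i + r 0 i) * G x i j * w x 0 j
   + w x 0 i * G x i j * (- c1 * w x 0 j - bw 0 j + r 0 j))
   + \sum_i \sum_j w x 0 i * (2 * \sum_l G x i l * B l j x) * w x 0 j).
  rewrite -big_split /=; apply: eq_bigr => i _; rewrite -big_split /=; apply: eq_bigr => j _.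
  rewrite along_mul // along_mul // !aw (flow_met FL) //.
  move: (\sum_l _) => z; ring.
have -> : \sum_i \sum_j w x 0 i * (2 * \sum_l G x i l * B l j x) * w x 0 j = 2 * qf (G x) (w x) bw.
  rewrite qfE mulr_sumr; apply: eq_bigr => i _.
  transitivity (\sum_j \sum_l 2 * (w x 0 i * G x i l * (B l j x * w x 0 j))).
    by apply: eq_bigr => j _; rewrite !mulr_sumr mulr_suml; apply: eq_bigr => l _; ring.
  by rewrite exchange_big /= mulr_sumr; apply: eq_bigr => l _;
    rewrite (_ : bw 0 l = \sum_j B l j x * w x 0 j) ?[LHS]mxE // !mulr_sumr.
have -> : \sum_i \sum_j ((- c1 * w x 0 i - bw 0 i + r 0 i) * G x i j * w x 0 j
   + w x 0 i * G x i j * (- c1 * w x 0 j - bw 0 j + r 0 j)) =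
   - c1 * qf (G x) (w x) (w x) - qf (G x) bw (w x) + qf (G x) r (w x) +
   (- c1 * qf (G x) (w x) (w x) - qf (G x) (w x) bw + qf (G x) (w x) r).
  rewrite !qfE !mulr_sumr -!sumrB -!big_split /=; apply: eq_bigr => i _.
  rewrite !mulr_sumr -!sumrB -!big_split /=; apply: eq_bigr => j _; ring.
have sGx : (G x)^T = G x by case: mG => _ /(_ x Dx).
rewrite (qf_symE bw (w x) sGx) (qf_symE r (w x) sGx) -/r.
move: (qf (G x) (w x) (w x)) (qf (G x) (w x) bw) (qf (G x) (w x) r) => a b c; ring.
Qed.

Lemma qf_Q x w : D x -> qf (G x) w (\row_p \sum_j Qend D G xi p j x * v 0 j) =
  \sum_(s : 4.-tuple 'I_n) riem D G x s * \prod_(l < 4)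
     (tnth [tuple \row_i xi i x; v; \row_i xi i x; w] l) 0 (tnth s l).
Proof.
move=> Dx.
have -> : \sum_(s : 4.-tuple 'I_n) riem D G x s * \prod_(l < 4)
     (tnth [tuple \row_i xi i x; v; \row_i xi i x; w] l) 0 (tnth s l) =
  \sum_i \sum_j \sum_k \sum_l riem D G x [tuple i; j; k; l] * (xi i x * (v 0 j * (xi k x * w 0 l))).
  rewrite sum_tuple_cons; apply: eq_bigr => i _; rewrite sum_tuple_cons; apply: eq_bigr => j _.
  rewrite sum_tuple_cons; apply: eq_bigr => k _; rewrite sum_tuple_cons; apply: eq_bigr => l _.
  rewrite sum_tuple0 !big_ord_recl big_ord0 mulr1 /=.
  by rewrite [X in X * _ = _](_ : _ = riem D G x [tuple i; j; k; l]) // ?(tnth_nth 0) ?(tnth_nth i) /= !mxE.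
pose Z l := \sum_i \sum_j \sum_k riem D G x [tuple i; j; k; l] * (xi i x * (v 0 j * xi k x)).
have QZ p : \sum_j Qend D G xi p j x * v 0 j = \sum_l invmx (G x) p l * Z l.
  rewrite /Qend /Z; under eq_bigr do rewrite mulr_suml.
  exch => l _; rewrite mulr_sumr.
  under eq_bigr do rewrite mulr_suml.
  exch => i _; rewrite mulr_sumr; apply: eq_bigr => j _.
  rewrite mulr_suml mulr_sumr; apply: eq_bigr => k _; ring.
transitivity (\sum_l w 0 l * Z l).
  rewrite qfE.
  transitivity (\sum_a \sum_l (w 0 a * (a == l)%:R) * Z l).
    apply: eq_bigr => a _.
    transitivity (\sum_p \sum_l w 0 a * G x a p * (invmx (G x) p l * Z l)).
      by apply: eq_bigr => p _; rewrite mxE QZ mulr_sumr.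
    exch => l _; rewrite -(met_imul mG a l Dx) mulr_sumr mulr_suml.
    by apply: eq_bigr => p _; rewrite !mulrA.
  exch => l _; rewrite -mulr_suml; congr (_ * _).
  exact: (sum_delta_r (fun a => w 0 a)).
rewrite /Z; under eq_bigr do rewrite mulr_sumr.
exch => i _.
under eq_bigr do rewrite mulr_sumr.
exch => j _.
under eq_bigr do rewrite mulr_sumr.
exch => k _; apply: eq_bigr => l _; ring.
Qed.

(** xi occurs twice in the contraction, whence the factor g(xi, xi): |x|^2 for the radial field, 1
    for the normal one. *)
Lemma qf_Q_bound x w C : D x -> tnorm G (riem D G) x <= C ->
  qf (G x) w (\row_p \sum_j Qend D G xi p j x * v 0 j) ^+ 2 <=
  ((n ^ 4)%:R * C * qf (G x) (\row_i xi i x) (\row_i xi i x)) ^+ 2 * (qf (G x) w w * qf (G x) v v).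
Proof.
move=> Dx TC; have [_ /(_ x Dx) sGx /(_ x Dx) pG] := mG.
have C0 : 0 <= C := le_trans (sqrtr_ge0 _) TC.
rewrite qf_Q //.
have := contr_bound (riem D G x) (fun l => tnth [tuple \row_i xi i x; v; \row_i xi i x; w] l) sGx pG.
set S := \sum_s _; set X := qf (G x) (\row_i _) _ => H.
have X0 : 0 <= X by exact: qf_ge0.
have w0 : 0 <= qf (G x) w w by exact: qf_ge0.
have v0 : 0 <= qf (G x) v v by exact: qf_ge0.
have {}H : `|S| <= (n ^ 4)%:R * C * X * (Num.sqrt (qf (G x) w w) * Num.sqrt (qf (G x) v v)).
  apply: le_trans H _; rewrite !big_ord_recl big_ord0 /= !(tnth_nth 0) /= -/X mulr1.
  have -> : Num.sqrt X * (Num.sqrt (qf (G x) v v) * (Num.sqrt X * Num.sqrt (qf (G x) w w))) =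
    X * (Num.sqrt (qf (G x) w w) * Num.sqrt (qf (G x) v v)).
    by rewrite -{3}(sqr_sqrtr X0); ring.
  rewrite -!mulrA; apply: ler_wpM2l => //; apply: ler_wpM2r => //.
  by rewrite !mulr_ge0 // sqrtr_ge0.
rewrite -[S ^+ 2]real_normK ?num_real //.
have -> : qf (G x) w w * qf (G x) v v = (Num.sqrt (qf (G x) w w) * Num.sqrt (qf (G x) v v)) ^+ 2.
  by rewrite exprMn !sqr_sqrtr.
rewrite -exprMn ler_pXn2r // nnegrE; apply: le_trans H; exact: normr_ge0.
Qed.

End Zero.
End Flow.

(** * Terms of highest order in the differentiated flow equations *)

Section Control.
Variables (R : realType) (n : nat).
Implicit Types (D : set 'rV[R]_n) (G : 'rV[R]_n -> 'M[R]_n)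
  (B : 'I_n -> 'I_n -> 'rV[R]_n -> R) (xi : 'I_n -> 'rV[R]_n -> R).

Lemma adm_chr j K : 0 <= K -> exists2 K', 0 <= K' &
  forall D G B xi c0 c1 T x N, dom D -> is_metric D G -> flow D G B xi c0 c1 T -> D x -> 0 <= N ->
  (forall a b, adm D T x j.+1 K N (fun y => G y a b)) ->
  (forall a b, adm D T x j K 0 (B a b)) ->
  (forall a b, `|invmx (G x) a b| <= K) ->
  forall p i q, adm D T x j K' N (fun y => christoffel D G y p i q).
Proof.
move=> K0; have [K1 K10 H1] := @adm_imet R n j K K0.
pose K2 := K + `|2| * (n%:R * (2 ^+ j * (K * K))).
have K20 : 0 <= K2 by rewrite addr_ge0 // !mulr_ge0 // ?ler0n ?exprn_ge0.
pose K3 := n%:R * (2 ^+ j * (K1 * (`|2^-1| * (K2 + K2 + K2)))).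
have K220 : 0 <= K2 + K2 + K2 by apply: addr_ge0 => //; exact: addr_ge0.
exists K3 => [|D G B xi c0 c1 T x N dD mG FL Dx N0 HG HB HI p i q].
    by rewrite /K3 !mulr_ge0 ?ler0n ?exprn_ge0.
have sG a b : sm D (fun y => G y a b) by exact: sm_met.
have sB a b : sm D (B a b) by exact: flow_smB FL _ _.
have HG0 a b : adm D T x j K 0 (fun y => G y a b) by exact: adm_low (HG a b).
have HdG a b c : adm D T x j K2 N (pd D a (fun y => G y b c)).
  case: (flow_dir FL a) => [Ta|Ha].
    by apply: (adm_le (K := K) (N := N)) => //; [rewrite lerDl !mulr_ge0 ?ler0n ?exprn_ge0|exact: adm_pd].
  apply: (adm_le (K := `|2| * (n%:R * (2 ^+ j * (K * K)))) (N := 0)) => //.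
  - by rewrite !mulr_ge0 ?ler0n ?exprn_ge0.
  - by rewrite lerDr.
  apply: (adm_ext Dx (f := fun y => 2 * \sum_l G y b l * B l c y)) => [y Dy|]; first by rewrite Ha.
  have sGB l : sm D (fun y => G y b l * B l c y) by apply: sm_mul.
  apply: adm_scale => //; first exact: sm_sum.
  apply: adm_sum => // l; exact: adm_mul0.
have sd a b c : sm D (pd D a (fun y => G y b c)) by exact: sm_pd.
apply: (adm_ext Dx (f := fun y => \sum_l invmx (G y) p l * chr1 D G y i q l)) => [y _|]; first by rewrite chrE.
have sc l : sm D (fun y => chr1 D G y i q l) by exact: sm_chr1.
have sI a b : sm D (fun y => invmx (G y) a b) by exact: sm_imet.
have scI l : sm D (fun y => invmx (G y) p l * chr1 D G y i q l) by apply: sm_mul.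
rewrite /K3; apply: adm_sum => // l; apply: adm_mul0 => //.
- by rewrite mulr_ge0.
- by apply: H1.
rewrite /chr1; apply: adm_scale => //; first by apply: sm_minus => //; exact: sm_add.
apply: adm_add => //; [exact: sm_add|exact: sm_opp|exact: adm_add|exact: adm_opp].
Qed.

Lemma ctl_covD j K : 0 <= K -> exists2 K', 0 <= K' &
  forall D G B xi c0 c1 T x N, dom D -> is_metric D G -> flow D G B xi c0 c1 T -> D x -> 0 <= N ->
  (j = 0%N -> N = 0) ->
  (forall a b, adm D T x j K N (fun y => G y a b)) ->
  ((0 < j)%N -> forall a b, adm D T x j.-1 K 0 (B a b)) ->
  (forall a b, `|invmx (G x) a b| <= K) ->
  (forall a t, (a <= j)%N -> `|covDn D G (riem D G) a x t| <= K) ->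
  forall t, adm D T x j K' N (fun y => riem D G y t).
Proof.
move=> K0; have [K1 K10 H1] := @adm_chr j.-1 K K0.
have KK : 0 <= K + K1 by rewrite addr_ge0.
have [K2 K20 H2] := @adm_tensor R n 4 j (K + K1) KK.
exists K2 => // D G B xi c0 c1 T x N dD mG FL Dx N0 jN HG HB HI HR.
apply: (H2 D G T x N) => //; first exact: sm_riem.
- move=> j0 p i q Ti; apply: (adm_le (K := K1) (N := N)) => //; first by rewrite lerDr.
  by apply: (H1 D G B xi c0 c1) => //; [rewrite prednK|exact: HB].
- by move=> a t aj; apply: le_trans (HR a t aj) _; rewrite lerDl.
Qed.

(** [N] and [M] bound the derivatives of order j + 1 of g and of B. By [pds_mul_top] they occur
    linearly, and all of them except in the term g dB come with a factor rho, since B and the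
    products of components of xi are O(rho). In a Gaussian chart rho = |x|^2; this is what
    [ode_radial] can absorb. *)
Lemma core_top j K : 0 <= K -> exists2 K', 0 <= K' &
  forall D G B xi T x rho N M s, dom D -> is_metric D G -> D x ->
  (forall p q, sm D (B p q)) -> (forall i, sm D (xi i)) ->
  0 <= rho -> rho <= 1 -> 0 <= N -> 0 <= M -> all T s -> size s = j.+1 ->
  (forall a b, adm D T x j.+1 K N (fun y => G y a b)) ->
  (forall a b, adm D T x j K 0 (B a b)) ->
  (forall a b, `|pds D s (B a b) x| <= M) ->
  (forall a b, `|B a b x| <= K * rho) -> (forall a b, `|invmx (G x) a b| <= K) ->
  (forall t, adm D T x j.+1 K N (fun y => riem D G y t)) ->
  (forall i k s', all T s' -> s' != [::] -> `|pds D s' (fun y => xi i y * xi k y) x| <= K) ->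
  (forall i k, `|xi i x * xi k x| <= rho) ->
  forall p q,
  [/\ `|pds D s (fun y => \sum_l G y p l * B l q y) x| <= n%:R * (K * M) + K' + K' * (rho * N),
      `|pds D s (fun y => \sum_l B p l y * B l q y) x| <= K' * (rho * M) + K' &
      `|pds D s (Qend D G xi p q) x| <= K' * (rho * N) + K'].
Proof.
move=> K0; have [K1 K10 H1] := @adm_imet R n j.+1 K K0.
pose e3 : R := 3 ^+ j.+1.
have e30 : 0 <= e3 by rewrite exprn_ge0.
pose Kh := 2 ^+ j.+1 * (K1 * K).
have Kh0 : 0 <= Kh by rewrite !mulr_ge0 // exprn_ge0.
pose n' : R := n%:R; have n'0 : 0 <= n' by rewrite ler0n.
pose Ka := n' * (K * K + e3 * (K * K)).
pose Kb := n' * (2 * K + e3 * (K * K)).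
pose Kc := n' * (n' * (n' * (2 * Kh + K * Kh + e3 * (K * Kh)))).
have Ka0 : 0 <= Ka by rewrite !mulr_ge0 // addr_ge0 // ?mulr_ge0 // mulr_ge0.
have Kb0 : 0 <= Kb by rewrite mulr_ge0 // addr_ge0 // ?mulr_ge0 // mulr_ge0.
have Kc0 : 0 <= Kc.
  by do 3 rewrite mulr_ge0 //; rewrite !addr_ge0 // !mulr_ge0 // mulr_ge0.
exists (Ka + Kb + Kc); first by rewrite !addr_ge0.
move=> D G B xi T x rho N M s dD mG Dx sB sxi r0 r1 N0 M0 Ts ss HG HB HBs HBr HI HR Hx Hxr p q.
have sG a b : sm D (fun y => G y a b) by exact: sm_met.
have sI a b : sm D (fun y => invmx (G y) a b) by exact: sm_imet.
have sR t : sm D (fun y => riem D G y t) by exact: sm_riem.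
have s0 : s != [::] by rewrite -size_eq0 ss.
have low f K' N' s' : 0 <= N' -> adm D T x j.+1 K' N' f -> all T s' -> (size s' <= j)%N -> `|pds D s' f x| <= K'.
  move=> _ Hf Ts' sj; have := adm_low Hf Ts' sj; by rewrite mulr0 addr0 mulr1.
have lowB a b s' : all T s' -> (size s' <= j)%N -> `|pds D s' (B a b) x| <= K.
  by move=> Ts' sj; have := HB a b s' Ts' sj; rewrite mulr0 addr0 mulr1.
have szl (s1 s2 : seq 'I_n) : s1 != [::] -> s2 != [::] -> (size s1 + size s2 = j.+1)%N ->
    (size s1 <= j)%N /\ (size s2 <= j)%N.
  rewrite -!size_eq0 -!lt0n; case: (size s1) => // a; case: (size s2) => // b _ _.
  by rewrite addSn => -[<-]; rewrite addnS !ltnS leq_addr leq_addl.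
have rN : 0 <= rho * N by rewrite mulr_ge0.
have rM : 0 <= rho * M by rewrite mulr_ge0.
have top f K' : adm D T x j.+1 K' N f -> `|pds D s f x| <= K' * (1 + N).
  by move=> Hf; have := Hf s Ts; rewrite ss => /(_ (leqnn _)); rewrite eqxx mul1r.
split.
- have sGB l : sm D (fun y => G y p l * B l q y) by apply: sm_mul.
  rewrite (pds_sum dD) //; apply: le_trans (ler_norm_sum _ _ _) _.
  apply: (@le_trans _ _ (\sum_(l < n) (K * M + (K * K + e3 * (K * K)) * (1 + rho * N)))).
    apply: ler_sum => l _.
    have := pds_mul_top dD (sG p l) (sB l q) Dx Ts s0 (mulr_ge0 K0 K0) (T := T).
    rewrite ss -/e3 => H.
    have {}H : `|pds D s (fun y => G y p l * B l q y) x -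
      (G x p l * pds D s (B l q) x + pds D s (fun y => G y p l) x * B l q x)| <= e3 * (K * K).
      apply: H => s1 s2 T1 T2 n1 n2 /(szl _ _ n1 n2)[z1 z2].
      by apply: ler_pM => //; [exact: low N0 (HG p l) _ _|exact: lowB].
    have g0 : `|G x p l| <= K by exact: (low _ K N [::] N0 (HG p l)).
    have h1 : `|G x p l * pds D s (B l q) x| <= K * M by rewrite normrM; apply: ler_pM.
    have h2 : `|pds D s (fun y => G y p l) x * B l q x| <= K * K * (1 + rho * N).
      rewrite normrM; apply: le_trans (ler_pM _ _ (top _ _ (HG p l)) (HBr l q)) _ => //.
      have : K * K * rho <= K * K * 1 by rewrite ler_wpM2l // mulr_ge0.
      nra.
    have e1 : e3 * (K * K) <= e3 * (K * K) * (1 + rho * N) by rewrite ler_peMr ?mulr_ge0 // lerDl.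
    move: H h1 h2 e1; rewrite mulrDl !ler_norml; move: (pds _ _ _ _) (_ * pds _ _ _ _) (pds _ _ _ _ * _) => a b c; clear; lra.
  rewrite sum_ord_const -/n'.
  have -> : n' * (K * M + (K * K + e3 * (K * K)) * (1 + rho * N)) = n' * (K * M) + Ka * (1 + rho * N).
    by rewrite /Ka; ring.
  have h : Ka <= Ka + Kb + Kc by rewrite -addrA lerDl addr_ge0.
  rewrite mulrDr mulr1; have := ler_wpM2r rN h; move: (Ka + Kb + Kc) h => S; clear; lra.
- have sBB l : sm D (fun y => B p l y * B l q y) by apply: sm_mul.
  rewrite (pds_sum dD) //; apply: le_trans (ler_norm_sum _ _ _) _.
  apply: (@le_trans _ _ (\sum_(l < n) ((2 * K + e3 * (K * K)) * (rho * M) + (2 * K + e3 * (K * K))))).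
    apply: ler_sum => l _.
    have := pds_mul_top dD (sB p l) (sB l q) Dx Ts s0 (mulr_ge0 K0 K0) (T := T).
    rewrite ss -/e3 => H.
    have {}H : `|pds D s (fun y => B p l y * B l q y) x -
      (B p l x * pds D s (B l q) x + pds D s (B p l) x * B l q x)| <= e3 * (K * K).
      apply: H => s1 s2 T1 T2 n1 n2 /(szl _ _ n1 n2)[z1 z2].
      by apply: ler_pM => //; exact: lowB.
    have h1 : `|B p l x * pds D s (B l q) x| <= K * (rho * M).
      by rewrite normrM mulrA; apply: ler_pM.
    have h2 : `|pds D s (B p l) x * B l q x| <= K * (rho * M).
      by rewrite normrM [X in X <= _]mulrC mulrA; apply: ler_pM.
    have e1 : 0 <= e3 * (K * K) * (rho * M) by rewrite !mulr_ge0.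
    move: H h1 h2 e1; rewrite mulrDl !ler_norml; move: (pds _ _ _ _) (_ * pds _ _ _ _) (pds _ _ _ _ * _) => a b c.
    nra.
  rewrite sum_ord_const -/n' mulrDr [X in X + _ <= _]mulrA -/Kb; apply: lerD.
    by apply: ler_wpM2r => //; rewrite [Ka + Kb]addrC -addrA lerDl addr_ge0.
  by rewrite [Ka + Kb]addrC -addrA lerDl addr_ge0.
- pose F i k l (y : 'rV[R]_n) := (xi i y * xi k y) * (invmx (G y) p l * riem D G y [tuple i; q; k; l]).
  have sxx i k : sm D (fun y => xi i y * xi k y) by apply: sm_mul.
  have sIR i k l : sm D (fun y => invmx (G y) p l * riem D G y [tuple i; q; k; l]) by apply: sm_mul.
  have sF i k l : sm D (F i k l) by apply: sm_mul.
  have s1F i l : sm D (fun y => \sum_k F i k l y) by apply: sm_sum.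
  have s2F l : sm D (fun y => \sum_i \sum_k F i k l y) by apply: sm_sum.
  rewrite (pds_ext (g := fun y => \sum_l \sum_i \sum_k F i k l y)) //.
  rewrite (pds_sum dD) //; apply: le_trans (ler_norm_sum _ _ _) _.
  pose C0 := 2 * Kh + K * Kh + e3 * (K * Kh).
  have C00 : 0 <= C0 by rewrite !addr_ge0 // !mulr_ge0 // mulr_ge0.
  apply: (@le_trans _ _ (\sum_(l < n) (n' * (n' * (C0 * (rho * N) + C0))))); last first.
    rewrite sum_ord_const -/n'.
    have -> : n' * (n' * (n' * (C0 * (rho * N) + C0))) = Kc * (rho * N) + Kc by rewrite /Kc /C0; ring.
    by apply: lerD; rewrite ?ler_wpM2r // lerDr addr_ge0.
  apply: ler_sum => l _; rewrite (pds_sum dD) //; apply: le_trans (ler_norm_sum _ _ _) _.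
  rewrite -sum_ord_const; apply: ler_sum => i _; rewrite (pds_sum dD) //.
  apply: le_trans (ler_norm_sum _ _ _) _.
  rewrite -sum_ord_const; apply: ler_sum => k _.
  pose h y := invmx (G y) p l * riem D G y [tuple i; q; k; l].
  have ah : adm D T x j.+1 Kh N h.
    by apply: adm_mul => //; apply: H1.
  have := pds_mul_top dD (sxx i k) (sIR i k l) Dx Ts s0 (mulr_ge0 K0 Kh0) (T := T).
  rewrite ss -/e3 -/h => H.
  have {}H : `|pds D s (F i k l) x -
      (xi i x * xi k x * pds D s h x + pds D s (fun y => xi i y * xi k y) x * h x)| <= e3 * (K * Kh).
    apply: H => s1 s2 T1 T2 n1 n2 /(szl _ _ n1 n2)[z1 z2].
    by apply: ler_pM => //; [exact: Hx|exact: low N0 ah _ _].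
  have h1 : `|xi i x * xi k x * pds D s h x| <= Kh + Kh * (rho * N).
    rewrite normrM; apply: le_trans (ler_pM _ _ (Hxr i k) (top _ _ ah)) _ => //.
    have : Kh * rho <= Kh * 1 by rewrite ler_wpM2l.
    nra.
  have h2 : `|pds D s (fun y => xi i y * xi k y) x * h x| <= K * Kh.
    by rewrite normrM; apply: ler_pM => //; [exact: Hx|exact: (low _ Kh N [::] N0 ah)].
  have e0 : 0 <= Kh * (rho * N) by rewrite mulr_ge0.
  have e1 : 0 <= K * Kh * (rho * N) by rewrite !mulr_ge0.
  have e2 : 0 <= e3 * (K * Kh) * (rho * N) by rewrite !mulr_ge0.
  move: H h1 h2 e1 e2; rewrite /C0 !mulrDl !ler_norml.
  move: (pds _ _ _ _) (_ * pds _ _ _ _) (pds _ _ _ _ * _) => a b c; clear; lra.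
Qed.

Lemma Qend_curv D G xi p j x : is_metric D G -> D x ->
  Qend D G xi p j x = \sum_i \sum_k xi i x * xi k x * curv D G x i j k p.
Proof.
move=> mG Dx; rewrite /Qend exchange_big /=; apply: eq_bigr => i _.
exch => k _.
rewrite -mulr_sumr; congr (_ * _).
under eq_bigr do rewrite riemE mulr_sumr.
rewrite exchange_big /= -[RHS](sum_delta_r (curv D G x i j k)); apply: eq_bigr => q _.
rewrite eq_sym -(imet_mul mG p q Dx) mulr_sumr; apply: eq_bigr => l _.
by rewrite (met_symE mG q l Dx); ring.
Qed.

End Control.

Section Ball.
Variables (R : realType) (n : nat).
Implicit Types (x v : 'rV[R]_n) (r t : R).

Lemma sm_esq (D : set 'rV[R]_n) : dom D -> sm D (@esq R n).
Proof.
move=> dD; apply: (sm_ext (f := fun y => \sum_i y 0 i * y 0 i)) => [y _|].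
  by apply: eq_bigr => i _; rewrite expr2.
by apply: (sm_sum dD) => i _; apply: (sm_mul dD); exact: sm_coord.
Qed.

Lemma eball_open r : open (eball r : set 'rV[R]_n).
Proof.
have dT : dom (setT : set 'rV[R]_n) by apply: dom_open; exact: openT.
rewrite openE => x; rewrite /eball /= => xr.
have [||d d0 Hd] := @cw_sqrt R n setT (@esq R n) x _ (r - enorm x); first exact: (sm_cw (sm_esq dT)).
  by rewrite subr_gt0.
apply/nbhs_ballP; exists d => //= y; rewrite -ball_normE /= distrC => /(Hd y I).
by rewrite ltr_norml -!enormE => /andP[_]; rewrite ltrD2r.
Qed.

Lemma eball_dom r : dom (eball r : set 'rV[R]_n).
Proof. by apply: dom_open; exact: eball_open. Qed.

Lemma esqZ t x : esq (t *: x) = t ^+ 2 * esq x.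
Proof. by rewrite /esq mulr_sumr; apply: eq_bigr => i _; rewrite !mxE exprMn. Qed.

Lemma esq0 : esq (0 : 'rV[R]_n) = 0.
Proof. by rewrite /esq big1 // => i _; rewrite mxE expr0n. Qed.

Lemma enormZ t x : 0 <= t -> enorm (t *: x) = t * enorm x.
Proof. by move=> t0; rewrite !enormE esqZ sqrtrM ?sqr_ge0 // sqrtr_sqr ger0_norm. Qed.

Lemma eball_scale r x t : eball r x -> 0 <= t <= 1 -> eball r (t *: x).
Proof.
rewrite /eball /= => xr /andP[t0 t1]; rewrite enormZ //; apply: le_lt_trans xr.
by rewrite ler_piMl // sqrtr_ge0.
Qed.

Lemma eball_esq r x : 0 < r -> eball r x <-> esq x < r ^+ 2.
Proof.
move=> r0; rewrite /eball /= enormE.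
by rewrite -[in X in X <-> _](ger0_norm (ltW r0)) -sqrtr_sqr ltr_sqrt ?exprn_gt0.
Qed.

Lemma eball0 r : 0 < r -> eball r (0 : 'rV[R]_n).
Proof. by move=> r0; apply/(eball_esq _ r0); rewrite esq0 exprn_gt0. Qed.

End Ball.

(* The geodesic equation for the rays [t |-> t x]. *)
Definition radial_chr (R : realType) n (D : set 'rV[R]_n) (G : 'rV[R]_n -> 'M[R]_n) : Prop :=
  forall x k, D x -> \sum_i \sum_j christoffel D G x k i j * (x 0 i * x 0 j) = 0.

(** * Gauss lemma and Riccati equation of the radial field *)

Section Radial.
Variables (R : realType) (n : nat) (r : R) (G : 'rV[R]_n -> 'M[R]_n).
Notation D := (eball r : set 'rV[R]_n).
Notation xi := (fun (i : 'I_n) (y : 'rV[R]_n) => y 0 i).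
Notation E := (along D xi).
Hypotheses (r0 : 0 < r) (mG : is_metric D G).
Hypothesis G0 : G 0 = 1%:M.
Hypothesis Gxx : radial_chr D G.

Let dD : dom D. Proof. exact: eball_dom. Qed.
Let sG i j : sm D (fun y => G y i j). Proof. exact: sm_met. Qed.
Let sx i : sm D (xi i). Proof. exact: sm_coord. Qed.

Lemma isd_ray f x t : sm D f -> D x -> 0 <= t <= 1 ->
  isd (seg 1) (fun s => f (s *: x)) t (\sum_i pd D i f (t *: x) * x 0 i).
Proof.
move=> sf Dx t01; apply: (isd_curve (c := fun s => s *: x) dD sf) => [s s01||i].
- exact: eball_scale.
- exact: eball_scale.
- apply: (isd_ext (f := fun s => x 0 i * s)) => [s _||]; rewrite ?mxE 1?mulrC //.
  by have := isdZ (c := x 0 i) (isd_id (seg 1) t); rewrite mulr1.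
Qed.

Lemma along_ray f x t : t * (\sum_i pd D i f (t *: x) * x 0 i) = E f (t *: x).
Proof. by rewrite mulr_sumr; apply: eq_bigr => i _; rewrite mxE; ring. Qed.

Lemma ray_const f x : sm D f -> (forall y, D y -> E f y = 0) -> D x -> f x = f 0.
Proof.
move=> sf H Dx; rewrite -[x in LHS]scale1r -(scale0r x); apply/esym.
apply: (isd_const (f := fun s => f (s *: x)) ler01 (S := seg 1)) => [//|t tI|t /andP[t0 t1]].
  exact: isd_ray.
have tI : 0 <= t <= 1 by rewrite !ltW.
have := along_ray f x t; rewrite H; last exact: eball_scale.
by move/eqP; rewrite mulf_eq0 gt_eqF //= => /eqP.
Qed.

Let A l y := \sum_i \sum_j pd D l (fun z => G z i j) y * (y 0 i * y 0 j).
Let P l y := \sum_j G y l j * y 0 j.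

(** The geodesic equation with its index lowered: the first two terms of the symbols give the same
    radial derivative, the third gives [A]. *)
Lemma radial_geo l y : D y -> \sum_j E (fun z => G z j l) y * y 0 j = 2^-1 * A l y.
Proof.
move=> Dy; have : \sum_k (\sum_i \sum_j christoffel D G y k i j * (y 0 i * y 0 j)) * G y k l = 0.
  by rewrite big1 // => k _; rewrite Gxx // mul0r.
have -> : \sum_k (\sum_i \sum_j christoffel D G y k i j * (y 0 i * y 0 j)) * G y k l =
   \sum_i \sum_j chr1 D G y i j l * (y 0 i * y 0 j).
  under eq_bigr do rewrite mulr_suml.
  exch => i _.
  under eq_bigr do rewrite mulr_suml.
  exch => j _.
  by rewrite -(chr_low mG) // mulr_suml; apply: eq_bigr => k _; rewrite mulrAC.
have -> : \sum_i \sum_j chr1 D G y i j l * (y 0 i * y 0 j) =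
  2^-1 * (\sum_j E (fun z => G z j l) y * y 0 j) + 2^-1 * (\sum_j E (fun z => G z j l) y * y 0 j) - 2^-1 * A l y.
  rewrite {2}/along; under [X in _ + _ * X - _]eq_bigr do rewrite mulr_suml.
  rewrite /along; under [X in _ * X + _ - _]eq_bigr do rewrite mulr_suml.
  rewrite [X in _ * X + _ - _]exchange_big /= /A !mulr_sumr -!big_split -!sumrB /=; apply: eq_bigr => i _.
  rewrite !mulr_sumr -!big_split -!sumrB /=; apply: eq_bigr => j _.
  rewrite /chr1; gring.
move: (\sum_j _) => a; lra.
Qed.

(** Contracting [radial_geo] once more with y turns its left side into the sum on the right, which
    therefore equals half of itself. *)
Lemma radial_A y : D y -> \sum_l A l y * y 0 l = 0.
Proof.
move=> Dy; have : \sum_l (\sum_j E (fun z => G z j l) y * y 0 j) * y 0 l = \sum_l A l y * y 0 l.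
  rewrite /along /A.
  transitivity (\sum_l \sum_j \sum_i pd D i (fun z => G z j l) y * (y 0 i * y 0 j * y 0 l)).
    apply: eq_bigr => l _; rewrite mulr_suml; apply: eq_bigr => j _; rewrite !mulr_suml.
    by apply: eq_bigr => i _; gring.
  transitivity (\sum_i \sum_j \sum_l pd D i (fun z => G z j l) y * (y 0 i * y 0 j * y 0 l)).
    rewrite exchange_big /= [RHS]exchange_big /=; apply: eq_bigr => j _.
    by rewrite exchange_big.
  apply: eq_bigr => i _; rewrite mulr_suml; apply: eq_bigr => j _; rewrite mulr_suml.
  by apply: eq_bigr => l _; gring.
under eq_bigr do rewrite radial_geo // -mulrA.
rewrite -mulr_sumr; move: (\sum_l _) => a; lra.
Qed.

Let q y := \sum_i \sum_j G y i j * (y 0 i * y 0 j).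

Let sxx i j : sm D (fun y => y 0 i * y 0 j). Proof. by apply: (sm_mul dD). Qed.
Let sGx i j : sm D (fun y => G y i j * y 0 j). Proof. by apply: (sm_mul dD). Qed.

(** Geodesics have constant speed: by [radial_A] the form G(s x), evaluated on the fixed vector x,
    is constant in s, and it is Euclidean at s = 0. *)
Lemma gauss_esq x : D x -> q x = esq x.
Proof.
move=> Dx; pose F y := \sum_i \sum_j G y i j * (x 0 i * x 0 j).
have sF1 i j : sm D (fun y => G y i j * (x 0 i * x 0 j)) by apply: (sm_mul dD) => //; exact: sm_cst.
have sF2 i : sm D (fun y => \sum_j G y i j * (x 0 i * x 0 j)) by exact: sm_sum.
have sF : sm D F by exact: sm_sum.
have -> : esq x = F (0 *: x).
  rewrite scale0r /F G0 /esq; apply: eq_bigr => i _; rewrite (bigD1 i) //= mxE eqxx mul1r big1 ?addr0 ?expr2 //.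
  by move=> j ji; rewrite mxE eq_sym (negPf ji) mul0r.
have -> : q x = F (1 *: x) by rewrite scale1r.
apply/esym; apply: (isd_const (f := fun s => F (s *: x)) ler01 (S := seg 1)) => [//|t tI|t /andP[t0 t1]].
  exact: isd_ray.
have tI : 0 <= t <= 1 by rewrite !ltW.
have Dt := eball_scale Dx tI.
have := radial_A Dt.
have -> : \sum_l A l (t *: x) * (t *: x) 0 l = t ^+ 3 * (\sum_i pd D i F (t *: x) * x 0 i).
  rewrite mulr_sumr; apply: eq_bigr => l _; rewrite /F (pd_sum dD) // /A !mulr_suml mulr_sumr.
  apply: eq_bigr => i _; rewrite (pd_sum dD) // !mulr_suml mulr_sumr; apply: eq_bigr => j _.
  have -> : (fun y => G y i j * (x 0 i * x 0 j)) = (fun y => (x 0 i * x 0 j) * G y i j).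
    by apply/funext => y; rewrite mulrC.
  by rewrite (pd_scale dD) // !mxE; gring.
by move/eqP; rewrite mulf_eq0 expf_eq0 gt_eqF //= => /eqP.
Qed.

Lemma sm_P l : sm D (P l). Proof. by apply: (sm_sum dD) => j _. Qed.

Lemma pd_gauss l y : D y -> A l y + 2 * P l y = 2 * y 0 l.
Proof.
move=> Dy; have : pd D l q y = pd D l (@esq R n) y by apply: pd_ext => // z; exact: gauss_esq.
have -> : pd D l (@esq R n) y = 2 * y 0 l.
  rewrite (pd_ext l (g := fun z => \sum_i z 0 i * z 0 i)) //.
  rewrite (pd_sum dD) // -[RHS](sum_delta (fun i => 2 * y 0 i) l); apply: eq_bigr => i _.
  by rewrite (pd_mul dD) // (pd_coord dD) //; ring.
have sq1 i j : sm D (fun y => G y i j * (y 0 i * y 0 j)) by apply: (sm_mul dD).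
have sq2 i : sm D (fun y => \sum_j G y i j * (y 0 i * y 0 j)) by exact: sm_sum.
move=> <-; rewrite /q (pd_sum dD) // /A.
have PE : 2 * P l y = \sum_i \sum_j (G y i j * ((l == i)%:R * y 0 j + y 0 i * (l == j)%:R)).
  transitivity (\sum_i \sum_j (l == i)%:R * (G y i j * y 0 j) +
     \sum_i \sum_j G y i j * y 0 i * (j == l)%:R).
    rewrite (_ : \sum_i \sum_j (l == i)%:R * (G y i j * y 0 j) = P l y); last first.
      by under eq_bigr do rewrite -mulr_sumr; rewrite sum_delta.
    rewrite (_ : \sum_i \sum_j G y i j * y 0 i * (j == l)%:R = P l y); last first.
      by under eq_bigr do rewrite sum_delta_r; apply: eq_bigr => i _; rewrite (met_symE mG).
    by rewrite mulr2n mulrDl mul1r.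
  rewrite -big_split /=; apply: eq_bigr => i _; rewrite -big_split /=; apply: eq_bigr => j _.
  by rewrite [l == j]eq_sym; ring.
rewrite PE -big_split /=; apply: eq_bigr => i _; rewrite (pd_sum dD) // -big_split /=.
by apply: eq_bigr => j _; rewrite (pd_mul dD) // (pd_mul dD) // !(pd_coord dD).
Qed.

Lemma along_coord i y : D y -> E (xi i) y = y 0 i.
Proof.
move=> Dy; rewrite /along -[RHS](sum_delta_r (fun k => y 0 k)); apply: eq_bigr => k _.
by rewrite (pd_coord dD).
Qed.

(** By [radial_geo] the radial derivative of P_l is A_l / 2 + P_l, which is y_l by [pd_gauss]. So
    P_l - y_l is constant along rays and vanishes at the centre. *)
Lemma gauss_lemma l y : D y -> P l y = y 0 l.
Proof.
move=> Dy; have sPx k : sm D (fun y => P k y - y 0 k) by apply: (sm_minus dD) => //; exact: sm_P.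
suff: P l y - y 0 l = 0 by move/eqP; rewrite subr_eq0 => /eqP.
rewrite (ray_const (sPx l) _ Dy) => [|z Dz].
  by rewrite /P big1 ?mxE ?subr0 // => j _; rewrite mxE mulr0.
have -> : E (fun y => P l y - y 0 l) z = E (P l) z - E (xi l) z.
  rewrite /along -sumrB; apply: eq_bigr => i _; rewrite (pd_minus dD) ?mulrBr //; exact: sm_P.
rewrite along_coord // (along_sum xi dD) //.
under eq_bigr do rewrite (along_mul xi dD) // along_coord //.
rewrite big_split /= -/(P l z).
rewrite (eq_bigr (fun j => E (fun z => G z j l) z * z 0 j)); last first.
  by move=> j _; congr (_ * _); apply: along_ext => // w Dw; rewrite (met_symE mG).
by rewrite radial_geo //; have := pd_gauss l Dz; move: (A l z) (P l z) => a b; lra.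
Qed.

(** For the radial field, nabla_(d_j) xi = d_j + sum_l (rad_B l j) d_l. *)
Definition rad_B (l j : 'I_n) (y : 'rV[R]_n) : R := \sum_k christoffel D G y l j k * y 0 k.

Lemma sm_rad_B l j : sm D (rad_B l j).
Proof. by apply: (sm_sum dD) => k _; apply: (sm_mul dD) => //; exact: sm_chr. Qed.

(** The differentiated Gauss lemma makes the lowered B symmetric, so the antisymmetric part of the
    first-kind symbol drops out. *)
Lemma rad_met x i j : D x -> E (fun y => G y i j) x = 2 * \sum_l G x i l * rad_B l j x.
Proof.
move=> Dx; have -> : \sum_l G x i l * rad_B l j x = \sum_k chr1 D G x j k i * x 0 k.
  rewrite /rad_B; under eq_bigr do rewrite mulr_sumr.
  exch => k _; rewrite -(chr_low mG) // mulr_suml.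
  by apply: eq_bigr => l _; rewrite (met_symE mG i l) //; ring.
have dP a b : pd D a (P b) x = \sum_k pd D a (fun y => G y k b) x * x 0 k + G x b a.
  rewrite (pd_sum dD) //.
  transitivity (\sum_k (pd D a (fun y => G y k b) x * x 0 k + (a == k)%:R * G x b k)); last first.
    by rewrite big_split /= sum_delta.
  apply: eq_bigr => k _; rewrite (pd_mul dD) // (pd_coord dD) // [_ * (a == k)%:R]mulrC.
  by congr (_ * _ + _); apply: pd_ext => // y Dy; rewrite (met_symE mG).
have dP1 a b : pd D a (P b) x = (a == b)%:R.
  by rewrite (pd_ext a (g := fun y => y 0 b)) ?(pd_coord dD) // => y Dy; rewrite gauss_lemma.
have h1 := dP j i; have h2 := dP i j; rewrite !dP1 [j == i]eq_sym in h1 h2.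
have -> : \sum_k chr1 D G x j k i * x 0 k = 2^-1 * (\sum_k pd D j (fun y => G y k i) x * x 0 k +
   E (fun y => G y i j) x - \sum_k pd D i (fun y => G y k j) x * x 0 k).
  rewrite /along -big_split -sumrB /= mulr_sumr; apply: eq_bigr => k _; rewrite /chr1.
  rewrite (pd_ext k (f := fun y => G y j i) (g := fun y => G y i j)) // => [|y Dy]; last by rewrite (met_symE mG).
  rewrite (pd_ext i (f := fun y => G y j k) (g := fun y => G y k j)) // => [|y Dy]; last by rewrite (met_symE mG).
  gring.
rewrite (met_symE mG j i Dx) in h2.
by move: h1 h2; rewrite /along; gen_sums; lra.
Qed.

Lemma rad_ric x p j : D x ->
  E (rad_B p j) x = - 1 * rad_B p j x - \sum_q rad_B p q x * rad_B q j x + Qend D G xi p j x.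
Proof.
move=> Dx; have sC a b c : sm D (fun y => christoffel D G y a b c) by exact: sm_chr.
have sCx a b c d : sm D (fun y => christoffel D G y a b c * y 0 d) by apply: (sm_mul dD).
have EB : E (rad_B p j) x = \sum_k E (fun y => christoffel D G y p j k) x * x 0 k + rad_B p j x.
  rewrite (along_sum xi dD) // -big_split /=; apply: eq_bigr => k _.
  by rewrite (along_mul xi dD) // along_coord.
(* The geodesic equation of the rays, differentiated in direction j; it removes the derivative of
   the symbols in direction j from the curvature. *)
have Z : \sum_i \sum_k pd D j (fun y => christoffel D G y p i k) x * (x 0 i * x 0 k) + 2 * rad_B p j x = 0.
  have : pd D j (fun y => \sum_i \sum_k christoffel D G y p i k * (y 0 i * y 0 k)) x = 0.
    by rewrite (pd_ext j (g := fun=> 0)) ?(pd_cst dD) // => y Dy; exact: Gxx.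
  have s1 i k : sm D (fun y => christoffel D G y p i k * (y 0 i * y 0 k)) by apply: (sm_mul dD).
  have s2 i : sm D (fun y => \sum_k christoffel D G y p i k * (y 0 i * y 0 k)) by exact: sm_sum.
  rewrite (pd_sum dD) // => H; apply: etrans H.
  have -> : 2 * rad_B p j x = \sum_i \sum_k christoffel D G x p i k * ((j == i)%:R * x 0 k + x 0 i * (j == k)%:R).
    transitivity (\sum_i \sum_k (j == i)%:R * (christoffel D G x p i k * x 0 k) +
       \sum_i \sum_k christoffel D G x p i k * x 0 i * (k == j)%:R).
      rewrite (_ : \sum_i \sum_k (j == i)%:R * (christoffel D G x p i k * x 0 k) = rad_B p j x); last first.
        by under eq_bigr do rewrite -mulr_sumr; rewrite sum_delta.
      rewrite (_ : \sum_i \sum_k christoffel D G x p i k * x 0 i * (k == j)%:R = rad_B p j x); last first.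
        by under eq_bigr do rewrite sum_delta_r; apply: eq_bigr => i _; rewrite (chr_sym mG).
      by rewrite mulr2n mulrDl mul1r.
    rewrite -big_split /=; apply: eq_bigr => i _; rewrite -big_split /=; apply: eq_bigr => k _.
    by rewrite [j == k]eq_sym; ring.
  rewrite -big_split /=; apply: eq_bigr => i _; rewrite (pd_sum dD) // -big_split /=.
  by apply: eq_bigr => k _; rewrite (pd_mul dD) // (pd_mul dD) // !(pd_coord dD).
rewrite (Qend_curv _ _ _ mG) //.
have -> : \sum_i \sum_k x 0 i * x 0 k * curv D G x i j k p =
   \sum_k E (fun y => christoffel D G y p j k) x * x 0 k
   - \sum_i \sum_k pd D j (fun y => christoffel D G y p i k) x * (x 0 i * x 0 k)
   + \sum_i \sum_k x 0 i * x 0 k * \sum_q (christoffel D G x p i q * christoffel D G x q j k)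
   - \sum_i \sum_k x 0 i * x 0 k * \sum_q (christoffel D G x p j q * christoffel D G x q i k).
  rewrite /along; under [X in _ = X - _ + _ - _]eq_bigr do rewrite mulr_suml.
  rewrite [X in _ = X - _ + _ - _]exchange_big /= -sumrB -big_split -sumrB /=; apply: eq_bigr => i _.
  rewrite -sumrB -big_split -sumrB /=; apply: eq_bigr => k _.
  rewrite /curv sumrB; gring.
have -> : \sum_i \sum_k x 0 i * x 0 k * (\sum_q (christoffel D G x p j q * christoffel D G x q i k)) = 0.
  transitivity (\sum_q christoffel D G x p j q * \sum_i \sum_k christoffel D G x q i k * (x 0 i * x 0 k)).
    under [RHS]eq_bigr do rewrite mulr_sumr.
    rewrite [RHS]exchange_big /=; apply: eq_bigr => i _.
    under [RHS]eq_bigr do rewrite mulr_sumr.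
    rewrite [RHS]exchange_big /=; apply: eq_bigr => k _; rewrite mulr_sumr.
    by apply: eq_bigr => q1 _; ring.
  by rewrite big1 // => q1 _; rewrite Gxx // mulr0.
have -> : \sum_i \sum_k x 0 i * x 0 k * (\sum_q (christoffel D G x p i q * christoffel D G x q j k)) =
   \sum_q rad_B p q x * rad_B q j x.
  rewrite /rad_B.
  transitivity (\sum_i \sum_q \sum_k (christoffel D G x p i q * x 0 i) * (christoffel D G x q j k * x 0 k)).
    apply: eq_bigr => i _; under eq_bigr do rewrite mulr_sumr.
    by exch => q1 _; apply: eq_bigr => k _; ring.
  exch => q1 _; rewrite mulr_suml; apply: eq_bigr => i _.
  by rewrite -mulr_sumr (chr_sym mG p q1 i).
rewrite EB; move: Z.
by move: (rad_B p j x) => d; gen_sums; lra.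
Qed.

Lemma pd_along i h x : sm D h -> D x -> pd D i (E h) x = pd D i h x + E (pd D i h) x.
Proof.
move=> sh Dx; have sdh k : sm D (pd D k h) by exact: sm_pd.
have sxd k : sm D (fun y => y 0 k * pd D k h y) by apply: (sm_mul dD).
rewrite (pd_sum dD) // -[X in _ = X + _](sum_delta (fun k => pd D k h x) i) /along -big_split /=.
apply: eq_bigr => k _; rewrite (pd_mul dD i (sx k) (sdh k) Dx).
by rewrite (pd_coord dD i k Dx) (schwarz dD i k sh Dx).
Qed.

(** Since [d_i, E] = d_i for the radial operator E, each letter of [s] contributes one copy of
    [pds D s f]. *)
Lemma rad_comm s f x : sm D f -> D x -> E (pds D s f) x = pds D s (E f) x - 1 * (size s)%:R * pds D s f x.
Proof.
move=> sf; have sE g : sm D g -> sm D (E g).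
  by move=> sg; apply: (sm_sum dD) => k _; apply: (sm_mul dD) => //; exact: sm_pd.
elim: s x => [|i s IH] x Dx /=; first by rewrite mulr0 mul0r subr0.
have sh : sm D (pds D s f) by exact: sm_pds.
have -> : pd D i (pds D s (E f)) x = pd D i (fun y => E (pds D s f) y + (size s)%:R * pds D s f y) x.
  apply: pd_ext => // y Dy; rewrite IH // mul1r; move: (pds _ _ _ _) (pds _ _ _ _) => a b; ring.
rewrite (pd_add dD) ?(pd_scale dD) //; last by apply: (sm_mul dD) => //; exact: sm_cst.
  by rewrite (pd_along i sh Dx) -natr1; gring.
exact: sE.
Qed.

Lemma rad_flow : flow D G rad_B xi 1 1 predT.
Proof.
split; [exact: sm_rad_B|by []|by move=> *; exact: rad_met|exact: rad_ric|by move=> *; exact: rad_comm|by left].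
Qed.
End Radial.

(** * Estimates of order zero in a Gaussian chart *)

Section RadialZero.
Variables (R : realType) (n : nat) (r : R) (G : 'rV[R]_n -> 'M[R]_n).
Notation D := (eball r : set 'rV[R]_n).
Notation xi := (fun (i : 'I_n) (y : 'rV[R]_n) => y 0 i).
Hypotheses (r0 : 0 < r) (mG : is_metric D G).
Hypothesis G0 : G 0 = 1%:M.
Hypothesis Gxx : radial_chr D G.
Variable C : R.
Hypotheses (C0 : 0 <= C) (rC : 8 * ((n ^ 4)%:R * C * r ^+ 2) <= 1).
Hypothesis RC : forall x, D x -> tnorm G (riem D G) x <= C.

Let dD : dom D. Proof. exact: eball_dom. Qed.
Notation B := (rad_B r G).

Lemma qf_xi x : D x -> qf (G x) (\row_i x 0 i) (\row_i x 0 i) = esq x.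
Proof.
move=> Dx; rewrite -(gauss_esq mG G0 Gxx Dx) qfE; apply: eq_bigr => i _; apply: eq_bigr => j _.
by rewrite !mxE; ring.
Qed.

(** [zero_radial] along the segment from 0 to x, for a vector v with constant coordinates. The
    constant c is the curvature bound times |x|^2, and [rC] is the smallness it requires. *)
Lemma radial_qf x v : D x -> `|qf (G x) v v - esq v| <= esq v / 3 /\
  qf (G x) (app B v x) (app B v x) <= ((n ^ 4)%:R * C * esq x) ^+ 2 * (2 * esq v).
Proof.
move=> Dx; set c := (n ^ 4)%:R * C * esq x.
have FL := rad_flow mG G0 Gxx.
have c0 : 0 <= c by rewrite !mulr_ge0 ?ler0n ?esq_ge0.
have c8 : 8 * c <= 1.
  apply: le_trans rC; rewrite ler_wpM2l // /c; apply: ler_wpM2l; first by rewrite mulr_ge0 ?ler0n.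
  by apply: ltW; apply/eball_esq.
have sf : sm D (fun y => qf (G y) v v) by apply: (sm_qf dD mG) => p; exact: sm_cst.
have sw p : sm D (fun y => app B v y 0 p) by exact: (sm_app dD FL).
have sp : sm D (fun y => qf (G y) (app B v y) (app B v y)) by apply: (sm_qf dD mG).
have Dt t : 0 <= t <= 1 -> D (t *: x) by move=> tI; exact: eball_scale.
have pG t : 0 <= t <= 1 -> posdef (G (t *: x)) by move=> /Dt; case: mG => _ _; exact.
have sG t : 0 <= t <= 1 -> (G (t *: x))^T = G (t *: x) by move=> /Dt; case: mG => _ + _; exact.
pose Qv y := \row_p \sum_j Qend D G xi p j y * v 0 j.
have [] := @zero_radial R (fun t => qf (G (t *: x)) v v)
  (fun t => \sum_i pd D i (fun y => qf (G y) v v) (t *: x) * x 0 i)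
  (fun t => qf (G (t *: x)) (app B v (t *: x)) (app B v (t *: x)))
  (fun t => \sum_i pd D i (fun y => qf (G y) (app B v y) (app B v y)) (t *: x) * x 0 i)
  (fun t => qf (G (t *: x)) v (app B v (t *: x)))
  (fun t => qf (G (t *: x)) (app B v (t *: x)) (Qv (t *: x))) c c0 c8.
- by move=> t tI; exact: (isd_ray sf Dx tI).
- by move=> t tI; exact: (isd_ray sp Dx tI).
- by move=> t tI; rewrite (along_ray r); apply: (along_met dD mG FL); exact: Dt.
- move=> t tI; rewrite (along_ray r (fun y => qf (G y) (app B v y) (app B v y)) x t).
  by rewrite (along_app2 dD mG FL v (Dt _ tI)) mulr1.
- by move=> t tI; apply: qf_ge0; exact: pG.
- by move=> t tI; apply: qf_ge0; exact: pG.
- by move=> t tI; apply: qf_CS; [exact: sG|exact: pG].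
- move=> t tI; have := qf_Q_bound xi mG v (app B v (t *: x)) (Dt _ tI) (RC (Dt _ tI)).
  rewrite qf_xi; last exact: Dt.
  by rewrite esqZ /c [_ * (t ^+ 2 * _)]mulrCA [t ^+ 2 * _]mulrC.
rewrite scale1r scale0r G0 => h1 h2.
have E1 : qf 1%:M v v = esq v.
  rewrite qfE /esq; apply: eq_bigr => i _; rewrite (bigD1 i) //= mxE eqxx mulr1 big1 ?addr0 ?expr2 //.
  by move=> j ji; rewrite mxE eq_sym (negPf ji) mulr0 mul0r.
by move: h1 h2; rewrite E1.
Qed.

(** That B is O(|x|^2), and not merely bounded, is needed later: it supplies the factor rho of
    [core_top]. *)
Lemma radial_zero x : D x -> [/\ forall i j, `|G x i j| <= 2, forall i j, `|invmx (G x) i j| <= 3 &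
  forall i j, `|B i j x| <= 2 * (n ^ 4)%:R * C * esq x].
Proof.
move=> Dx; have sGx : (G x)^T = G x by case: mG => _ + _; exact.
have pG : posdef (G x) by case: mG => _ _; exact.
have b v : esq v <= 3 / 2 * qf (G x) v v /\ qf (G x) v v <= 2 * esq v.
  have [+ _] := radial_qf v Dx; have := esq_ge0 v; rewrite ler_norml => e0 /andP[h1 h2]; split; lra.
split=> [i j|i j|i j].
- by apply: met_entry => // v; have [_] := b v.
- apply: imet_entry => // v; have [h _] := b v; have := qf_ge0 v pG; lra.
have [_ h] := radial_qf (delta_mx 0 j) Dx.
have [h1 _] := b (app B (delta_mx 0 j) x).
rewrite esq_delta mulr1 in h; set c := (n ^ 4)%:R * C * esq x in h.
have c0 : 0 <= c by rewrite !mulr_ge0 ?ler0n ?esq_ge0.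
have -> : B i j x = app B (delta_mx 0 j) x 0 i.
  rewrite mxE -[LHS](sum_delta_r (fun k => B i k x)); apply: eq_bigr => k _.
  by rewrite mxE eqxx.
have h2 := esq_coord (app B (delta_mx 0 j) x) i.
rewrite (_ : 2 * (n ^ 4)%:R * C * esq x = 2 * c); last by rewrite /c; ring.
have c2 : 0 <= 2 * c by rewrite mulr_ge0.
rewrite -(ler_pXn2r (ltn0Sn 1)) ?nnegrE // real_normK ?num_real //.
(* The comparison with the Euclidean norm costs 3/2, and 3/2 times 2 c^2 is at most (2 c)^2. *)
apply: le_trans h2 _; apply: le_trans h1 _; rewrite exprMn; have := sqr_ge0 c; nra.
Qed.

End RadialZero.

(** * Higher derivatives in a Gaussian chart *)

Section RadialHigher.
Variables (R : realType) (n : nat).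

(** An abstract form of control of the curvature components by the metric. It is supplied in two
    ways: from covariant derivatives of R in the interior ([ctl_covD]), and through the Gauss
    equation for the boundary metric ([slice_ctl]). *)
Definition curv_ctl (D : set 'rV[R]_n) (G : 'rV[R]_n -> 'M[R]_n)
  (B : 'I_n -> 'I_n -> 'rV[R]_n -> R) (T : pred 'I_n) (x : 'rV[R]_n) k (Kc : nat -> R -> R) : Prop :=
  forall j K N, (j <= k)%N -> 0 <= K -> 0 <= N -> (j = 0%N -> N = 0) ->
  (forall a b, adm D T x j K N (fun y => G y a b)) ->
  ((0 < j)%N -> forall a b, adm D T x j.-1 K 0 (B a b)) ->
  (forall a b, `|invmx (G x) a b| <= K) ->
  forall t, adm D T x j (Kc j K) N (fun y => riem D G y t).

Lemma pds_xixi (D : set 'rV[R]_n) x i k s : dom D -> D x -> esq x <= 1 -> s != [::] ->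
  `|pds D s (fun y => y 0 i * y 0 k) x| <= 2.
Proof.
move=> dD Dx x1.
have x1' j : `|x 0 j| <= 1.
  rewrite -(ler_pXn2r (ltn0Sn 1)) ?nnegrE // expr1n real_normK ?num_real //.
  by apply: le_trans x1; exact: esq_coord.
have sx j : sm D (fun y => y 0 j) by exact: sm_coord.
have d1 j y : D y -> pd D j (fun y => y 0 i * y 0 k) y = (j == i)%:R * y 0 k + y 0 i * (j == k)%:R.
  by move=> Dy; rewrite (pd_mul dD) // !(pd_coord dD).
have sc c : sm D (fun=> c) by exact: sm_cst.
have b1 (b : bool) : `|b%:R : R| <= 1 by case: b; rewrite ?normr1 ?normr0.
case/lastP: s => [//|s j] _; rewrite pds_rcons.
rewrite (pds_ext (g := fun y => (j == i)%:R * y 0 k + y 0 i * (j == k)%:R)) //; last exact: d1.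
case/lastP: s => [|s l] /=.
  apply: le_trans (ler_normD _ _) _; rewrite !normrM.
  have -> : (2 : R) = 1 * 1 + 1 * 1 by ring.
  by apply: lerD; apply: ler_pM.
rewrite pds_rcons (pds_ext (g := fun=> (j == i)%:R * (l == k)%:R + (l == i)%:R * (j == k)%:R)) //; last first.
  move=> y Dy; rewrite (pd_add dD) ?(pd_mul dD) ?(pd_cst dD) ?(pd_coord dD) //; try exact: (sm_mul dD).
  by rewrite mul0r add0r mulr0 addr0.
case: s => [|a s]; last by rewrite (pds_cst dD) ?normr0.
apply: le_trans (ler_normD _ _) _; rewrite !normrM.
have -> : (2 : R) = 1 * 1 + 1 * 1 by ring.
by apply: lerD; apply: ler_pM.
Qed.

Lemma adm_top (D : set 'rV[R]_n) T x j K K' N f : 1 <= K' -> K <= K' -> 0 <= N ->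
  (forall s, all T s -> size s = j.+1 -> `|pds D s f x| <= N) ->
  (forall s, all T s -> (size s <= j)%N -> `|pds D s f x| <= K) -> adm D T x j.+1 K' N f.
Proof.
move=> K1 KK N0 HN HK s Ts; have K0 : 0 <= K' by apply: le_trans K1.
rewrite leq_eqVlt ltnS => /orP[/eqP sj|sj].
  apply: le_trans (HN s Ts sj) _; rewrite sj eqxx mul1r mulrDr mulr1.
  have : 1 * N <= K' * N by apply: ler_wpM2r.
  by rewrite mul1r => h; apply: le_trans h _; rewrite lerDr.
by apply: le_trans (HK s Ts sj) _; rewrite ltn_eqF // mul0r addr0 mulr1.
Qed.

(** Induction on the order. All derivatives of order k + 1 of g and B form one system along the
    rays, to which [ode_radial] applies; the bounds of lower order enter its constants. *)
Lemma radial_higher k C (Kc : nat -> R -> R) : 0 <= C -> (forall j K, 0 <= K -> 0 <= Kc j K) ->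
  exists2 K, 0 <= K & forall r G, 0 < r -> r <= 1 -> is_metric (eball r) G -> G 0 = 1%:M ->
  radial_chr (eball r) G ->
  (forall x, eball r x -> [/\ forall i j, `|G x i j| <= C, forall i j, `|invmx (G x) i j| <= C &
      forall i j, `|rad_B r G i j x| <= C * esq x]) ->
  (forall x, eball r x -> curv_ctl (eball r) G (rad_B r G) predT x k Kc) ->
  forall s x a b, eball r x -> (size s <= k)%N ->
    `|pds (eball r) s (fun y => G y a b) x| <= K /\ `|pds (eball r) s (rad_B r G a b) x| <= K.
Proof.
move=> C0 Kc0; elim: k => [|k [K K0 IH]].
  exists C => // r G r0 r1 mG _ _ HZ _ s x a b Dx.
  rewrite leqn0 size_eq0 => /eqP -> /=; have [h1 _ h2] := HZ x Dx; split=> //.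
  apply: le_trans (h2 a b) _; rewrite ler_piMr //.
  by apply/ltW/(lt_le_trans ((eball_esq x r0).1 Dx)); rewrite expr_le1 // ltW.
pose K1 := K + C + 2.
have K10 : 0 <= K1 by rewrite !addr_ge0.
have K11 : 1 <= K1 by rewrite /K1; lra.
pose K2 := K1 + Kc k.+1 K1.
have K12 : K1 <= K2 by rewrite lerDl Kc0.
have K20 : 0 <= K2 by apply: le_trans K12.
have [K3 K30 H3] := @core_top R n k K2 K20.
(* The derivatives of g are weighted by [e], so that the contribution 2 e n K2 mu of the derivatives
   of B is at most mu / 2, the share [ode_radial] allows. In exchange the derivatives of g are
   bounded only by mu / e, which is harmless in terms with the factor t^2 and explains K3 / e in
   [L]. *)
pose e := (4 * n%:R * K2 + 4)^-1.
have n0 : 0 <= n%:R :> R by rewrite ler0n.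
have den : 0 < 4 * n%:R * K2 + 4 by rewrite ltr_wpDl ?mulr_ge0.
have e0 : 0 < e by rewrite invr_gt0.
have e1 : e <= 1 by rewrite invf_le1 //; have := mulr_ge0 n0 K20; lra.
pose K0' := 2 * K3; pose L := 3 * K3 + K3 / e.
have L0 : 0 <= L by rewrite addr_ge0 ?mulr_ge0 // invr_ge0 ltW.
have K0'0 : 0 <= K0' by rewrite mulr_ge0.
pose K4 := expR L * (2 * K0').
have K40 : 0 <= K4 by rewrite mulr_ge0 ?expR_ge0 // mulr_ge0.
exists (K + K4 / e + K4) => [|r G r0 r1 mG G0 Gxx HZ HC s x a b Dx].
  by rewrite !addr_ge0 // mulr_ge0 // invr_ge0 ltW.
have K4e : 0 <= K4 / e by rewrite mulr_ge0 // invr_ge0 ltW.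
set D := eball r in HC HZ Gxx mG Dx *.
have dD : dom D by exact: eball_dom.
have {}IH s' y p q : D y -> (size s' <= k)%N ->
    `|pds D s' (fun y => G y p q) y| <= K /\ `|pds D s' (rad_B r G p q) y| <= K.
  move=> Dy; apply: (IH r G) => // z Dz j K' N jk; apply: HC => //; exact: leqW.
rewrite leq_eqVlt ltnS => /orP[/eqP ss|ss]; last first.
  have [h1 h2] := IH s x a b Dx ss; split; [apply: le_trans h1 _|apply: le_trans h2 _];
    by rewrite -addrA lerDl addr_ge0.
have FL := rad_flow mG G0 Gxx.
have sG p q : sm D (fun y => G y p q) by exact: sm_met.
have sB p q : sm D (rad_B r G p q) by exact: flow_smB FL _ _.
pose xi (i : 'I_n) (y : 'rV[R]_n) := y 0 i.
have sQ p q : sm D (Qend D G xi p q).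
  apply: (sm_ext (f := fun x => \sum_i \sum_k xi i x * xi k x * curv D G x i q k p)) => [y Dy|].
    by rewrite (Qend_curv xi p q mG Dy).
  by apply: (sm_sum dD) => i _; apply: (sm_sum dD) => l _; do ?[exact: sm_coord|exact: sm_curv|apply: (sm_mul dD)].
pose Aix := (bool * (k.+1).-tuple 'I_n * 'I_n * 'I_n)%type.
pose h (z : Aix) : 'rV[R]_n -> R := let: (b0, t, p, q) := z in
  if b0 then (fun y => e * pds D t (fun y => G y p q) y) else pds D t (rad_B r G p q).
have sh z : sm D (h z).
  case: z => [[[[] t] p] q] /=; last exact: sm_pds.
  by apply: (sm_mul dD); [exact: sm_cst|exact: sm_pds].
have sGB p q : sm D (fun y => \sum_l G y p l * rad_B r G l q y).
  by apply: (sm_sum dD) => l _; apply: (sm_mul dD).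
have sBB p q : sm D (fun y => \sum_l rad_B r G p l y * rad_B r G l q y).
  by apply: (sm_sum dD) => l _; apply: (sm_mul dD).
(* The commutator contributes k + 1, and the linear Riccati term one more for derivatives of B. *)
pose c (z : Aix) : R := k.+1%:R + (~~ z.1.1.1)%:R.
pose rr (z : Aix) (y : 'rV[R]_n) : R := let: (b0, t, p, q) := z in
  if b0 then e * (2 * pds D t (fun y => \sum_l G y p l * rad_B r G l q y) y)
  else - pds D t (fun y => \sum_l rad_B r G p l y * rad_B r G l q y) y + pds D t (Qend D G xi p q) y.
have ode z y : D y -> along D xi (h z) y = - c z * h z y + rr z y.
  case: z => [[[[] t] p] q] Dy /=.
    rewrite (along_scale xi dD) //; last exact: sm_pds.
    rewrite (flow_comm FL) ?all_predT //.
    have -> : pds D t (along D xi (fun y => G y p q)) y = 2 * pds D t (fun y => \sum_l G y p l * rad_B r G l q y) y.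
      by rewrite -(pds_scale dD) //; apply: pds_ext => // w Dw; exact: (flow_met FL).
    rewrite size_tuple /c /= addr0.
    move: (pds _ _ _ _) (pds _ _ _ _) => u v; ring.
  rewrite (flow_comm FL) ?all_predT //.
  have -> : pds D t (along D xi (rad_B r G p q)) y = - pds D t (rad_B r G p q) y
     - pds D t (fun y => \sum_l rad_B r G p l y * rad_B r G l q y) y + pds D t (Qend D G xi p q) y.
    rewrite (pds_ext (g := fun y => - rad_B r G p q y - (\sum_l rad_B r G p l y * rad_B r G l q y)
       + Qend D G xi p q y)) // => [|w Dw]; last by rewrite (flow_ric FL) // mulN1r.
    have s1 : sm D (fun y => - rad_B r G p q y) by exact: sm_opp.
    have s2 : sm D (fun y => - rad_B r G p q y - \sum_l rad_B r G p l y * rad_B r G l q y) by exact: sm_minus.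
    by rewrite (pds_add dD) // (pds_minus dD) // (pds_opp dD).
  rewrite size_tuple /c /=.
  move: (pds _ _ _ _) (pds _ _ _ _) (pds _ _ _ _) => u v w; ring.
have Dt t : 0 <= t <= 1 -> D (t *: x) by move=> tI; exact: eball_scale.
have main z : `|h z x| <= K4.
  rewrite -[x]scale1r.
  apply: (@ode_radial R Aix (fun z t => h z (t *: x)) (fun z t => \sum_i pd D i (h z) (t *: x) * x 0 i)
     (fun z t => rr z (t *: x)) c K0' L) => //.
  - move=> w; rewrite /c -natrD ler1n addSn //.
  - by move=> w t tI; exact: (isd_ray (sh w) Dx tI).
  - by move=> w t tI; rewrite (along_ray r (h w) x t) ode //; exact: Dt.
  move=> w t mu tI Hmu; have Dy := Dt t tI; set y := t *: x in Dy Hmu *.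
  have mu0 : 0 <= mu by apply: le_trans (Hmu w); exact: normr_ge0.
  have x1 : esq x <= 1.
    by apply/ltW/(lt_le_trans ((eball_esq x r0).1 Dx)); rewrite expr_le1 // ltW.
  have rho0 : 0 <= esq y by exact: esq_ge0.
  have rhot : esq y <= t * t by rewrite /y esqZ expr2 ler_piMr // mulr_ge0 //; case/andP: tI.
  have rho1 : esq y <= 1.
    by apply: le_trans rhot _; case/andP: tI => t0 t1; rewrite -[1]mul1r ler_pM.
  have [z1 z2 z3] := HZ y Dy.
  have Ntop t' p q : `|pds D (t' : (k.+1).-tuple 'I_n) (fun y => G y p q) y| <= mu / e.
    have := Hmu (true, t', p, q); rewrite /= normrM gtr0_norm // => H.
    by rewrite ler_pdivlMr // mulrC.
  have Mtop t' p q : `|pds D (t' : (k.+1).-tuple 'I_n) (rad_B r G p q) y| <= mu := Hmu (false, t', p, q).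
  have mue : 0 <= mu / e by rewrite mulr_ge0 // invr_ge0 ltW.
  have K1m : K <= K1 by rewrite /K1 -addrA lerDl addr_ge0.
  have aG K' p q : K1 <= K' -> adm D predT y k.+1 K' (mu / e) (fun y => G y p q).
    move=> KK; have KK' := le_trans K1m KK; apply: (adm_top _ KK') => // [|s' _ s'k|s' _ s'k].
    - exact: le_trans K11 KK.
    - by have := Ntop (tcast s'k (in_tuple s')) p q; rewrite val_tcast.
    - by have [] := IH s' y p q Dy s'k.
  have aB K' p q : K1 <= K' -> adm D predT y k K' 0 (rad_B r G p q).
    move=> KK s' _ s'k; rewrite mulr0 addr0 mulr1.
    have [_ +] := IH s' y p q Dy s'k; move/le_trans; apply; exact: le_trans KK.
  have aI K' p q : K1 <= K' -> `|invmx (G y) p q| <= K'.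
    by move=> KK; apply: le_trans (z2 p q) _; apply: le_trans KK; rewrite /K1 addrAC lerDr addr_ge0.
  have aR t' : adm D predT y k.+1 K2 (mu / e) (fun z => riem D G z t').
    apply: (@adm_le _ _ _ _ _ k.+1 (Kc k.+1 K1) K2 (mu / e) (mu / e)) => //; first exact: Kc0.
      by rewrite /K2 lerDr.
    apply: (HC y Dy k.+1 K1 (mu / e)) => //.
    - by move=> p q; exact: aG.
    - by move=> _ p q; exact: aB.
    - by move=> p q; exact: aI.
  have core (t' : (k.+1).-tuple 'I_n) := H3 D G (rad_B r G) xi predT y (esq y) (mu / e) mu t'
     dD mG Dy sB (fun i => sm_coord dD i) rho0 rho1 mue mu0 (all_predT t') (size_tuple t')
     (fun p q => aG K2 p q K12) (fun p q => aB K2 p q K12) (Mtop t') _ (fun p q => aI K2 p q K12) aR _ _.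
  have {}core (t' : (k.+1).-tuple 'I_n) p q : [/\ `|pds D t' (fun y => \sum_l G y p l * rad_B r G l q y) y| <= n%:R * (K2 * mu) + K3 + K3 * (esq y * (mu / e)),
      `|pds D t' (fun y => \sum_l rad_B r G p l y * rad_B r G l q y) y| <= K3 * (esq y * mu) + K3 &
      `|pds D t' (Qend D G xi p q) y| <= K3 * (esq y * (mu / e)) + K3].
    apply: core => [i j|i j s' _ s'0|i j].
    - apply: le_trans (z3 i j) _; apply: ler_wpM2r => //; apply: le_trans K12.
      by rewrite /K1 addrAC lerDr addr_ge0.
    - by apply: le_trans (pds_xixi i j dD Dy rho1 s'0) _; apply: le_trans K12; rewrite /K1 lerDr addr_ge0.
    - have ec := esq_coord y; rewrite normrM -(ler_pXn2r (ltn0Sn 1)) ?nnegrE ?mulr_ge0 //.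
      by rewrite exprMn !real_normK ?num_real // [leRHS]expr2; apply: ler_pM; rewrite ?sqr_ge0 //; exact: ec.
  have em : e * (mu / e) = mu by rewrite mulrCA divff ?mulr1 // gt_eqF.
  have tm : esq y * (mu / e) <= t * t * (mu / e) by apply: ler_wpM2r.
  have tm' : esq y * mu <= t * t * mu by apply: ler_wpM2r.
  have tt0 : 0 <= t * t * mu by apply: le_trans tm'; rewrite mulr_ge0.
  have Lmu : L * (t * t) * mu = 3 * (K3 * (t * t * mu)) + K3 * (t * t * (mu / e)) by rewrite /L; ring.
  have p1 : 0 <= K3 * (t * t * (mu / e)) by rewrite mulr_ge0 // (le_trans _ tm) // mulr_ge0.
  have p2 : 0 <= K3 * (t * t * mu) by rewrite mulr_ge0.
  have k1 := ler_wpM2l K30 tm; have k2 := ler_wpM2l K30 tm'.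
  rewrite mulrDl Lmu /K0'; case: w => [[[[] t'] p] q] /=; have [c1 c2 c3] := core t' p q.
    rewrite !normrM (gtr0_norm e0) gtr0_norm //.
    have d1 : e * (2 * (n%:R * (K2 * mu))) <= 2^-1 * mu.
      have : e * (4 * n%:R * K2 + 4) = 1 by rewrite mulVf // gt_eqF.
      have := mulr_ge0 (ltW e0) mu0; move: (n%:R) => n' h1 h2.
      have : mu = (e * (4 * n' * K2 + 4)) * mu by rewrite h2 mul1r.
      move=> Emu; have -> : 2^-1 * mu = e * (2 * (n' * (K2 * mu))) + 2 * (e * mu) by rewrite [in LHS]Emu; field.
      by rewrite lerDl mulr_ge0.
    have d2 : e * (esq y * (mu / e)) = esq y * mu by rewrite mulrCA em.
    have d3 := ler_wpM2l (ltW e0) c1.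
    have d4 : e * K3 <= K3 by rewrite ler_piMl.
    have d5 : e * (n%:R * (K2 * mu) + K3 + K3 * (esq y * (mu / e))) =
      e * (n%:R * (K2 * mu)) + e * K3 + K3 * (esq y * mu) by rewrite !mulrDr -d2; ring.
    rewrite d5 in d3; move: d1 d3 d4 k2 p1 p2 K30.
    move: `|_| (e * K3) (K3 * (esq y * mu)) (K3 * (t * t * mu)) (K3 * (t * t * (mu / e))) => a1 a2 a3 a4 a5.
    move: (n%:R * (K2 * mu)) => a6; clear; lra.
  apply: le_trans (ler_normD _ _) _; rewrite normrN.
  move: c2 c3 k1 k2 p1 p2 K30 mu0.
  move: `|_| `|_| (K3 * (esq y * (mu / e))) (K3 * (esq y * mu)) (K3 * (t * t * mu)) (K3 * (t * t * (mu / e))) => a1 a2 a3 a4 a5 a6.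
  clear; lra.
split.
  have := main (true, tcast ss (in_tuple s), a, b); rewrite /= val_tcast /= normrM gtr0_norm // => H.
  have : `|pds D s (fun y => G y a b) x| <= K4 / e by rewrite ler_pdivlMr // mulrC.
  by move/le_trans; apply; rewrite -addrA addrCA lerDl addr_ge0.
have := main (false, tcast ss (in_tuple s), a, b); rewrite /= val_tcast /= => /le_trans; apply.
by rewrite lerDr addr_ge0.
Qed.

End RadialHigher.

Section Components.
Variables (R : realType).

(** [radial_higher] wants the dependence of the curvature bound on order and constant as a function,
    before any metric is given. *)
Lemma choice_bound (P : nat -> R -> R -> Prop) :
  (forall j K, 0 <= K -> exists2 K', 0 <= K' & P j K K') ->
  exists f : nat -> R -> R, forall j K, 0 <= K -> 0 <= f j K /\ P j K (f j K).
Proof.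
move=> H; have /choice[f Hf] (jK : nat * R) : exists K', 0 <= jK.2 -> 0 <= K' /\ P jK.1 jK.2 K'.
  by have [/(H jK.1)[K' h1 h2]|_] := lerP 0 jK.2; [exists K'|exists 0].
by exists (fun j K => f (j, K)) => j K; exact: Hf (j, K).
Qed.

Definition comp_cst (n r k : nat) (C : R) : R := \sum_(i < k.+1) (n ^ (i + r))%:R * (2 ^+ (i + r) * C).

Lemma comp_cst_ge0 n r k C : 0 <= C -> 0 <= comp_cst n r k C.
Proof. by move=> C0; apply: sumr_ge0 => i _; rewrite !mulr_ge0 ?ler0n ?exprn_ge0. Qed.

Lemma comp_cstP n (D : set 'rV[R]_n) G r (T : tensor R n r) k C x : is_metric D G -> D x -> 0 <= C ->
  (forall i, `|G x i i| <= 2) -> (forall i, (i <= k)%N -> tnorm G (covDn D G T i) x <= C) ->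
  forall i t, (i <= k)%N -> `|covDn D G T i x t| <= comp_cst n r k C.
Proof.
move=> [_ sG pG] Dx C0 G2 HT i t ik.
apply: le_trans (@comp_bound R n (i + r) (G x) (covDn D G T i x) 2 C (sG x Dx) (pG x Dx) _ _ (HT i ik) t) _ => //.
  by move=> j; apply: le_trans (ler_norm _) _; apply: le_trans (G2 j) _; rewrite expr2; lra.
rewrite /comp_cst (bigD1 (Ordinal (ik : i < k.+1)%N)) //= lerDl.
by apply: sumr_ge0 => j _; rewrite !mulr_ge0 ?ler0n ?exprn_ge0.
Qed.

Lemma adm_bound n (D : set 'rV[R]_n) T x j K f : (forall s, all T s -> (size s <= j)%N -> `|pds D s f x| <= K) ->
  adm D T x j K 0 f.
Proof. by move=> H s Ts sj; rewrite mulr0 addr0 mulr1; exact: H. Qed.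

Lemma adm_boundP n (D : set 'rV[R]_n) T x j K f : adm D T x j K 0 f -> forall s, all T s -> (size s <= j)%N ->
  `|pds D s f x| <= K.
Proof. by move=> H s Ts sj; have := H s Ts sj; rewrite mulr0 addr0 mulr1. Qed.

Lemma adm_lift n (D : set 'rV[R]_n) (T T' : pred 'I_n) x j j' K N f :
  (forall i, T' i -> T i) -> (j' <= j)%N -> 0 <= K -> 0 <= N ->
  adm D T x j K 0 f -> adm D T' x j' K N f.
Proof.
move=> TT jj K0 N0 H s Ts sj; have := adm_boundP H (s := s) _ (leq_trans sj jj).
move=> h; apply: le_trans (h _) _; last by rewrite ler_peMr // lerDl mulr_ge0.
by apply/allP => i /(allP Ts); exact: TT.
Qed.

End Components.

Section GaussBounds.
Variables (R : realType) (n : nat).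

Lemma small_radius (A r : R) : 0 <= A -> 0 < r -> r <= (1 + A)^-1 -> r <= 1 /\ A * r ^+ 2 <= 1.
Proof.
move=> A0 r0 rA; have r1 : r * (1 + A) <= 1 by rewrite -ler_pdivlMr ?mul1r // ltr_pwDl.
have Ar : 0 <= A * r by rewrite mulr_ge0 // ltW.
have h : r <= 1 by move: r1; rewrite mulrDr; lra.
split=> //; have : A * r * r <= A * r * 1 by rewrite ler_wpM2l.
rewrite expr2 mulrA; move: r1; rewrite mulrDr; lra.
Qed.

(** The radius depends on the bound [C0] for |R| alone and not on [C], which may grow with k;
    otherwise no radius would serve all orders in (c). *)
Lemma gauss_bounds k C : 0 <= C -> exists2 K, 0 <= K & forall C0 r (G : 'rV[R]_n -> 'M[R]_n),
  0 <= C0 -> C0 <= C -> 0 < r -> r <= (1 + 8 * (n ^ 4)%:R * C0)^-1 -> is_metric (eball r) G -> G 0 = 1%:M ->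
  radial_chr (eball r) G ->
  (forall x, eball r x -> tnorm G (riem (eball r) G) x <= C0) ->
  (forall i x, (i <= k)%N -> eball r x -> tnorm G (covDn (eball r) G (riem (eball r) G) i) x <= C) ->
  forall s x a b, eball r x -> (size s <= k)%N ->
    `|pds (eball r) s (fun y => G y a b) x| <= K /\ `|pds (eball r) s (fun y => invmx (G y) a b) x| <= K.
Proof.
move=> C0; pose Cm := comp_cst n 4 k C; have Cm0 : 0 <= Cm by exact: comp_cst_ge0.
have [f Hf] := choice_bound (@ctl_covD R n).
pose Kc j K := f j (K + Cm).
have Kc0 j K : 0 <= K -> 0 <= Kc j K.
  by move=> K0; have [] := Hf j (K + Cm) (addr_ge0 K0 Cm0).
pose Ca := 3 + 2 * (n ^ 4)%:R * C; have Ca0 : 0 <= Ca by rewrite addr_ge0 // !mulr_ge0 ?ler0n.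
have [K K0 HK] := radial_higher n k Ca0 Kc0.
have K30 : 0 <= K + 3 by rewrite addr_ge0.
have [K1 K10 HI] := @adm_imet R n k (K + 3) K30.
exists (K + K1) => [|D0 r G D00 D0C r0 rC mG G0 Gxx RC0 RC s x a b Dx sk]; first exact: addr_ge0.
have dD : dom (eball r : set 'rV[R]_n) by exact: eball_dom.
have [r1 rr] : r <= 1 /\ 8 * (n ^ 4)%:R * D0 * r ^+ 2 <= 1.
  by apply: small_radius => //; rewrite !mulr_ge0 ?ler0n.
have rr' : 8 * ((n ^ 4)%:R * D0 * r ^+ 2) <= 1.
  by rewrite (_ : 8 * _ = 8 * (n ^ 4)%:R * D0 * r ^+ 2) //; ring.
have HZ := radial_zero r0 mG G0 Gxx D00 rr' RC0.
have Ca3 : 3 <= Ca by rewrite lerDl !mulr_ge0 ?ler0n.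
have Ca2 : 2 <= Ca by apply: le_trans Ca3; rewrite ler_nat.
have H := HK r G r0 r1 mG G0 Gxx.
have {}H : forall s x a b, eball r x -> (size s <= k)%N ->
    `|pds (eball r) s (fun y => G y a b) x| <= K /\ `|pds (eball r) s (rad_B r G a b) x| <= K.
  apply: H => [y Dy|y Dy].
    have [h1 h2 h3] := HZ y Dy; split=> [i j|i j|i j].
    - exact: le_trans (h1 i j) Ca2.
    - exact: le_trans (h2 i j) Ca3.
    - apply: le_trans (h3 i j) _; apply: ler_wpM2r; first exact: esq_ge0.
      apply: (@le_trans _ _ (2 * (n ^ 4)%:R * C)); last by rewrite lerDr.
      by rewrite ler_wpM2l // mulr_ge0 ?ler0n.
  move=> j K' N jk K'0 N0 jN aG aB aI t.
  have KC : K' <= K' + Cm by rewrite lerDl.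
  have [_ h] := Hf j (K' + Cm) (addr_ge0 K'0 Cm0).
  apply: (h (eball r) G (rad_B r G) _ 1 1 predT y N dD mG (rad_flow mG G0 Gxx) Dy N0 jN) => /=.
  - by move=> p q; apply: (adm_le (K := K') (N := N)).
  - by move=> j0 p q; apply: (adm_le (K := K') (N := 0)) => //; exact: aB.
  - by move=> p q; apply: le_trans (aI p q) _.
  - move=> i t' ij; have [h1 _ _] := HZ y Dy.
    apply: le_trans (comp_cstP mG Dy C0 (fun l => h1 l l) (k := k) _ _ (leq_trans ij jk)) _.
      by move=> l lk; exact: RC.
    by rewrite lerDr.
have [h1 _] := H s x a b Dx sk.
split; first by apply: le_trans h1 _; rewrite lerDl.
have [z1 z2 _] := HZ x Dx.
have aI := HI (eball r) G predT x 0 dD mG Dx (lexx 0) (fun _ => erefl).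
have {}aI : forall a b, adm (eball r) predT x k K1 0 (fun y => invmx (G y) a b).
  apply: aI => [p q|p q]; last by apply: le_trans (z2 p q) _; rewrite lerDr.
  apply: adm_bound => s' _ s'k; have [h _] := H s' x p q Dx s'k; apply: le_trans h _; by rewrite lerDl.
by apply: le_trans (adm_boundP (aI a b) (all_predT s) sk) _; rewrite lerDr.
Qed.

End GaussBounds.

(** * Metrics of the form d t^2 + h_t: Weingarten map, Riccati and Gauss equations *)

Section NormalFlow.
Variables (R : realType) (n : nat) (D : set 'rV[R]_n) (G : 'rV[R]_n -> 'M[R]_n).
Variables (N : 'I_n) (HN : N.+1 = n).
Hypotheses (dD : dom D) (mG : is_metric D G).
Hypothesis GN : forall x i, D x -> G x i N = (i == N)%:R.

Definition nor_xi (i : 'I_n) (y : 'rV[R]_n) : R := (i == N)%:R.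
(** The covariant derivative of d_N, that is, up to sign, the Weingarten map of the level sets of
    the last coordinate. *)
Definition nor_B (l j : 'I_n) (y : 'rV[R]_n) : R := christoffel D G y l j N.

Let sG i j : sm D (fun y => G y i j). Proof. exact: sm_met. Qed.

Lemma GN' x i : D x -> G x N i = (i == N)%:R.
Proof. by move=> Dx; rewrite (met_symE mG) // GN. Qed.

Lemma pd_GN i j x : D x -> pd D i (fun y => G y j N) x = 0.
Proof. by move=> Dx; rewrite (pd_ext i (g := fun=> (j == N)%:R)) ?(pd_cst dD) // => y Dy; rewrite GN. Qed.

Lemma pd_GN' i j x : D x -> pd D i (fun y => G y N j) x = 0.
Proof. by move=> Dx; rewrite (pd_ext i (g := fun=> (j == N)%:R)) ?(pd_cst dD) // => y Dy; rewrite GN'. Qed.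

Lemma imet_N x i : D x -> invmx (G x) i N = (i == N)%:R.
Proof.
move=> Dx; rewrite -(imet_mul mG i N Dx) -[LHS](sum_delta_r (invmx (G x) i)).
by apply: eq_bigr => j _; rewrite GN.
Qed.

Lemma chr_N_low x i j : D x -> christoffel D G x N i j = chr1 D G x i j N.
Proof.
move=> Dx; rewrite chrE -[RHS](sum_delta_r (chr1 D G x i j)); apply: eq_bigr => l _.
by rewrite (imet_symE mG) // imet_N // mulrC.
Qed.

Lemma chr_N x i j : D x -> christoffel D G x N i j = - (2^-1 * pd D N (fun y => G y i j) x).
Proof. by move=> Dx; rewrite chr_N_low // /chr1 !pd_GN // add0r sub0r mulrN. Qed.

Lemma chr1_N x i j : D x -> chr1 D G x i N j = 2^-1 * pd D N (fun y => G y i j) x.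
Proof. by move=> Dx; rewrite /chr1 pd_GN' // pd_GN // add0r subr0. Qed.

Lemma chr_NN x k : D x -> christoffel D G x k N N = 0.
Proof.
move=> Dx; rewrite chrE big1 // => l _; rewrite /chr1 !pd_GN' //.
by rewrite addr0 subr0 !mulr0.
Qed.

Lemma chr_NN' x j : D x -> christoffel D G x N j N = 0.
Proof. by move=> Dx; rewrite chr_N // pd_GN // mulr0 oppr0. Qed.

Lemma along_nor f x : along D nor_xi f x = pd D N f x.
Proof. by rewrite /along -[RHS](sum_delta_r (fun i => pd D i f x)); apply: eq_bigr => i _; rewrite mulrC. Qed.

Lemma nor_met x i j : D x -> pd D N (fun y => G y i j) x = 2 * \sum_l G x i l * nor_B l j x.
Proof.
move=> Dx; have -> : \sum_l G x i l * nor_B l j x = chr1 D G x j N i.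
  rewrite -(chr_low mG) //; apply: eq_bigr => l _; by rewrite (met_symE mG i l) // mulrC.
rewrite chr1_N // mulrA divff // mul1r.
by apply: pd_ext => // y Dy; rewrite (met_symE mG).
Qed.

Lemma sm_nor_B l j : sm D (nor_B l j). Proof. exact: sm_chr. Qed.

Lemma nor_Qend p j x : D x -> Qend D G nor_xi p j x = curv D G x N j N p.
Proof.
move=> Dx; rewrite (Qend_curv _ _ _ mG) //.
rewrite -[RHS](sum_delta_r (fun i => curv D G x i j N p)); apply: eq_bigr => i _.
rewrite -[RHS](sum_delta_r (fun k => curv D G x i j k p * (i == N)%:R)); apply: eq_bigr => k _.
rewrite /nor_xi; ring.
Qed.

(** The component of R(d_N, d_j) d_N: the symbols with two lower indices N vanish, which leaves the
    normal derivative of B and its square. *)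
Lemma nor_ric x p j : D x -> pd D N (nor_B p j) x = - (\sum_q nor_B p q x * nor_B q j x) + Qend D G nor_xi p j x.
Proof.
move=> Dx; rewrite nor_Qend // /curv.
rewrite (pd_ext j (f := fun y => christoffel D G y p N N) (g := fun=> 0)) ?(pd_cst dD) // => [|y Dy]; last exact: chr_NN.
have -> : \sum_q (christoffel D G x p N q * christoffel D G x q j N - christoffel D G x p j q * christoffel D G x q N N)
   = \sum_q nor_B p q x * nor_B q j x.
  by apply: eq_bigr => q _; rewrite chr_NN // mulr0 subr0 (chr_sym mG p N q).
by rewrite subr0 addrCA addNr addr0.
Qed.

(** Coordinate fields commute, so both constants are 0. The normal direction may be missing from
    [T], because the flow equation itself gives the derivative in that direction. *)
Lemma nor_flow (T : pred 'I_n) : (forall i, T i \/ i = N) -> flow D G nor_B nor_xi 0 0 T.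
Proof.
move=> HT; split.
- exact: sm_nor_B.
- by move=> i; exact: sm_cst.
- by move=> x i j Dx; rewrite along_nor nor_met.
- by move=> x p j Dx; rewrite along_nor nor_ric // oppr0 mul0r add0r.
- move=> s f x _ sf Dx; rewrite along_nor !mul0r subr0.
  rewrite (pds_ext s (g := pd D N f)) // => [|y _]; last exact: along_nor.
  by rewrite -pds_rcons -cats1 (pds_mid dD N s [::] sf Dx) cats0.
- move=> i; case: (HT i) => [|->]; [by left|right] => x a b Dx; exact: nor_met.
Qed.

Notation D0 := (slice D).
Notation H0 := (slice_met G).
Notation pt u := (snoc u 0 : 'rV[R]_n).

Lemma emb_N (j : 'I_n.-1) : (emb j == N) = false.
Proof. by apply/eqP => E; have := emb_neq_last j; rewrite E HN eqxx. Qed.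

Lemma sff_chr u s : D0 u -> sff D G u s = christoffel D G (pt u) N (emb (tnth s 0)) (emb (tnth s 1)).
Proof. by move=> Du; rewrite (sffE HN) // imet_N // eqxx sqrtr1 invr1 mulr1. Qed.

Lemma imet_slice u i j : D0 u -> invmx (H0 u) i j = invmx (G (pt u)) (emb i) (emb j).
Proof.
move=> Du; have mH := slice_metric HN dD mG.
pose A := \matrix_(a, b) invmx (G (pt u)) (emb a) (emb b) : 'M[R]_n.-1.
suff E : A *m H0 u = 1%:M.
  have -> : invmx (H0 u) = A by rewrite -[A]mulmx1 -(mulmxV (met_unit mH Du)) mulmxA E mul1mx.
  by rewrite mxE.
apply/matrixP => a b; rewrite !mxE.
have := imet_mul mG (emb a) (emb b) Du; rewrite (sum_emb _ HN) GN' // emb_N mulr0 addr0.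
have -> : (emb a == emb b) = (a == b) by [].
by move=> <-; apply: eq_bigr => c _; rewrite !mxE.
Qed.

Lemma chr_slice u p i j : D0 u -> christoffel D0 H0 u p i j = christoffel D G (pt u) (emb p) (emb i) (emb j).
Proof.
move=> Du; rewrite !chrE (sum_emb _ HN) imet_N // emb_N mul0r addr0.
apply: eq_bigr => l _; rewrite imet_slice // /chr1; congr (_ * (_ * _)).
have E a b c : pd D0 a (fun y => H0 y b c) u = pd D (emb a) (fun y => G y (emb b) (emb c)) (pt u).
  by rewrite -pd_slice; apply: pd_ext => // y _; rewrite mxE.
by rewrite !E.
Qed.

(** The Gauss equation: splitting the index N off the quadratic part of the curvature leaves
    products of symbols, which are l and, after lowering, minus l. *)
Lemma riem_slice u t : D0 u -> riem D0 H0 u t =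
  riem D G (pt u) [tuple of map (@emb n) t] +
  (sff D G u [tuple tnth t 0; tnth t 3] * sff D G u [tuple tnth t 1; tnth t 2] -
   sff D G u [tuple tnth t 1; tnth t 3] * sff D G u [tuple tnth t 0; tnth t 2]).
Proof.
move=> Du.
have tE (l : 'I_4) : tnth [tuple of map (@emb n) t] l = emb (tnth t l) by rewrite tnth_map.
rewrite /riem !tE; move: (tnth t 0) (tnth t 1) (tnth t 2) (tnth t 3) => a b c d.
rewrite !sff_chr // !(tnth_nth a) /=.
rewrite [X in _ = X + _](sum_emb _ HN) GN' // emb_N mulr0 addr0.
have low e f : \sum_(p < n.-1) christoffel D G (pt u) (emb p) (emb e) N * G (pt u) (emb p) (emb f) =
   - christoffel D G (pt u) N (emb e) (emb f).
  have := chr_low mG (emb e) N (emb f) Du; rewrite (sum_emb _ HN) chr_NN' // mul0r addr0 => ->.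
  by rewrite chr1_N // chr_N // opprK.
have cE p : curv D G (pt u) (emb a) (emb b) (emb c) (emb p) = curv D0 H0 u a b c p +
   (christoffel D G (pt u) (emb p) (emb a) N * christoffel D G (pt u) N (emb b) (emb c)
    - christoffel D G (pt u) (emb p) (emb b) N * christoffel D G (pt u) N (emb a) (emb c)).
  rewrite /curv (sum_emb _ HN) addrA; congr (_ + _ + _).
    congr (_ - _); rewrite -pd_slice; apply: pd_ext => // y Dy; by rewrite chr_slice.
  by apply: eq_bigr => q _; rewrite !chr_slice.
under [in RHS]eq_bigr do rewrite cE mulrDl.
rewrite big_split /= -addrA -[LHS]addr0; congr (_ + _).
  by apply: eq_bigr => p _; rewrite mxE.
have -> : \sum_(i < n.-1) (christoffel D G (pt u) (emb i) (emb a) N * christoffel D G (pt u) N (emb b) (emb c)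
     - christoffel D G (pt u) (emb i) (emb b) N * christoffel D G (pt u) N (emb a) (emb c)) * G (pt u) (emb i) (emb d)
  = - christoffel D G (pt u) N (emb a) (emb d) * christoffel D G (pt u) N (emb b) (emb c)
    + christoffel D G (pt u) N (emb b) (emb d) * christoffel D G (pt u) N (emb a) (emb c).
  rewrite -(low a d) -[christoffel D G _ N (emb b) (emb d)]opprK -(low b d) mulNr !mulr_suml -sumrB.
  apply: eq_bigr => p _; ring.
ring.
Qed.

End NormalFlow.

(** * Normal collar coordinates *)

Section SliceFrames.
Variables (R : realType) (n : nat) (N : 'I_n) (HN : N.+1 = n).

Lemma tr_emb k (E' : 'M[R]_n) (E : 'M[R]_n.-1) (T : k.-tuple 'I_n -> R) (s : k.-tuple 'I_n.-1) :
  (forall i j, E' (emb i) (emb j) = E i j) -> (forall i, E' (emb i) N = 0) ->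
  tr E' T [tuple of map (@emb n) s] = tr E (fun t => T [tuple of map (@emb n) t]) s.
Proof.
move=> HE HE0; elim: k T s => [|k IH] T s; first by rewrite !tr0; congr T; exact: val_inj.
rewrite tr_cons (sum_emb _ HN).
have th : thead [tuple of map (@emb n) s] = emb (thead s) by case/tupleP: s.
have bh : [tuple of behead [tuple of map (@emb n) s]] = [tuple of map (@emb n) [tuple of behead s]].
  by case/tupleP: {th} s => a s'; exact: val_inj.
rewrite th HE0 mul0r addr0 tr_cons; apply: eq_bigr => j _; rewrite HE bh IH; congr (_ * _).
by apply: eq_tr => t; congr T; exact: val_inj.
Qed.

(** Adding d_N completes an orthonormal frame of the boundary to one of the ambient space, so
    tangential frame components of R are bounded by its full norm without any bound on the
    coordinates. *)
Lemma frame_ext (G : 'M[R]_n) (E : 'M[R]_n.-1) : (forall i, G i N = (i == N)%:R) -> (forall i, G N i = (i == N)%:R) ->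
  E *m (\matrix_(i, j) G (emb i) (emb j)) *m E^T = 1%:M ->
  exists E' : 'M[R]_n, [/\ E' *m G *m E'^T = 1%:M, forall i j, E' (emb i) (emb j) = E i j & forall i, E' (emb i) N = 0].
Proof.
move=> GN GN' HE.
have eN (j : 'I_n.-1) : (emb j == N) = false := emb_N HN j.
pose E' : 'M[R]_n := \matrix_(i, j) match embP i, embP j with
  | inl _, inl _ => 1 | inr a, inr b => E (projT1 a) (projT1 b) | _, _ => 0 end.
have embK (j : 'I_n.-1) (p : {i | emb j = emb i}) : projT1 p = j.
  by case: p => i /= /(congr1 val) /= h; apply: val_inj.
have NE (i : 'I_n.-1) : (emb i).+1 <> n by move/eqP; rewrite (negPf (emb_neq_last i)).
have Ne (p : {j | N = emb j}) : False by case: p => j Nj; have := eN j; rewrite -Nj eqxx.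
have E1 i j : E' (emb i) (emb j) = E i j.
  rewrite mxE; case: (embP (emb i)) => [/NE//|a]; case: (embP (emb j)) => [/NE//|b].
  by rewrite !embK.
have E2 i : E' (emb i) N = 0.
  by rewrite mxE; case: (embP (emb i)) => [/NE//|a]; case: (embP N) => [//|b]; case: (Ne b).
have E3 i : E' N (emb i) = 0.
  by rewrite mxE; case: (embP (emb i)) => [/NE//|a]; case: (embP N) => [//|b]; case: (Ne b).
have E4 : E' N N = 1 by rewrite mxE; case: (embP N) => [//|b]; case: (Ne b).
exists E'; split=> //; apply/matrixP => i j; rewrite [LHS]mxE [RHS]mxE (sum_emb _ HN) [E'^T N j]mxE.
have XN k : (E' *m G) k N = E' k N.
  by rewrite mxE -[RHS](sum_delta_r (E' k)); apply: eq_bigr => l _; rewrite GN.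
rewrite XN.
have X0 k (l : 'I_n.-1) : (E' *m G) k (emb l) = \sum_(j0 < n.-1) E' k (emb j0) * G (emb j0) (emb l).
  by rewrite mxE (sum_emb _ HN) GN' eN mulr0 addr0.
case: (emb_lastP HN i) => [->|[a ->]]; case: (emb_lastP HN j) => [->|[b ->]].
- rewrite E4 eqxx mulr1 big1 ?add0r // => l _; by rewrite [E'^T _ _]mxE E3 mulr0.
- rewrite E2 mulr0 addr0 eq_sym eN big1 // => l _; rewrite X0 big1 ?mul0r // => q _.
  by rewrite E3 mul0r.
- rewrite E2 mul0r addr0 eN big1 // => l _; by rewrite [E'^T _ _]mxE E3 mulr0.
- rewrite E2 mul0r addr0; have := congr1 (fun M : 'M[R]_n.-1 => M a b) HE; rewrite !mxE => H.
  have -> : (emb a == emb b) = (a == b) by [].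
  rewrite -H; apply: eq_bigr => l _; rewrite [E'^T _ _]mxE [E^T _ _]mxE E1 X0; congr (_ * _).
  by rewrite mxE; apply: eq_bigr => q _; rewrite E1 mxE.
Qed.

Lemma tr_le k (E : 'M[R]_n) (T : k.-tuple 'I_n -> R) C s : Num.sqrt (tsq (E^T *m E) T) <= C -> `|tr E T s| <= C.
Proof.
rewrite tsq_frame => H; apply: le_trans H; rewrite -sqrtr_sqr ler_sqrt; last by apply: sumr_ge0 => ? _; exact: sqr_ge0.
by rewrite (bigD1 s) //= lerDl; apply: sumr_ge0 => ? _; exact: sqr_ge0.
Qed.

Lemma le_tr k (E : 'M[R]_n) (T : k.-tuple 'I_n -> R) C : 0 <= C -> (forall s, `|tr E T s| <= C) ->
  Num.sqrt (tsq (E^T *m E) T) <= (n ^ k)%:R * C.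
Proof.
move=> C0 H; have nC : 0 <= (n ^ k)%:R * C by rewrite mulr_ge0 ?ler0n.
rewrite tsq_frame -[leRHS]ger0_norm // -sqrtr_sqr ler_sqrt ?sqr_ge0 //.
apply: (@le_trans _ _ ((n ^ k)%:R * C ^+ 2)).
  rewrite -sum_tuple_const; apply: ler_sum => s _.
  by rewrite -[X in X <= _]real_normK ?num_real // ler_pXn2r ?nnegrE.
rewrite exprMn ler_wpM2r ?sqr_ge0 // -natrX ler_nat.
by case: (posnP (n ^ k)) => [->//|p0]; rewrite -mulnn leq_pmulr.
Qed.

End SliceFrames.

Lemma tuple4E (T : eqType) (s : 4.-tuple T) : s = [tuple tnth s 0; tnth s 1; tnth s 2; tnth s 3].
Proof. by case: s => -[|a [|b [|c [|d [|]]]]] // i; apply: val_inj. Qed.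

Section BoundaryCurvature.
Variables (R : realType) (n : nat) (D : set 'rV[R]_n) (G : 'rV[R]_n -> 'M[R]_n).
Variables (N : 'I_n) (HN : N.+1 = n).
Hypotheses (dD : dom D) (mG : is_metric D G).
Hypothesis GN : forall x i, D x -> G x i N = (i == N)%:R.
Notation pt u := (snoc u 0 : 'rV[R]_n).

(** The Gauss equation read in an orthonormal frame: |R| bounds one term and |l|^2 each of the two
    others. No estimate of the metric is used, since this bound comes before all others in a
    collar. *)
Lemma slice_curv_bound u C : 0 <= C -> slice D u -> tnorm G (riem D G) (pt u) <= C ->
  tnorm (slice_met G) (sff D G) u <= C ->
  tnorm (slice_met G) (riem (slice D) (slice_met G)) u <= (n.-1 ^ 4)%:R * (C + 2 * C ^+ 2).
Proof.
move=> C0 Du HR HL; have mH := slice_metric HN dD mG.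
have [_ /(_ u Du) sH /(_ u Du) pH] := mH.
have [E HE] := frame_exists sH pH.
have [E' [HE' EE E0]] := frame_ext HN (fun i => GN i Du) (fun i => GN' mG GN i Du) HE.
have [_ iH _] := frame_unit HE; have [_ iG _] := frame_unit HE'.
have Rt t : `|tr E' (riem D G (pt u)) t| <= C by apply: tr_le; rewrite -iG.
have Lt t : `|tr E (sff D G u) t| <= C by apply: tr_le; rewrite -iH.
rewrite (tnorm_tsq (slice D)) iH; apply: le_tr; first by rewrite addr_ge0 ?mulr_ge0 ?sqr_ge0.
move=> s.
rewrite (eq_tr E (fun t => riem_slice HN dD mG GN t Du)).
rewrite /tr; under eq_bigr do rewrite mulrDr mulrBr.
rewrite big_split sumrB /=.
have -> : \sum_t (\prod_(l < 4) E (tnth s l) (tnth t l)) * riem D G (pt u) [tuple of map (@emb n) t] =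
   tr E' (riem D G (pt u)) [tuple of map (@emb n) s] by rewrite (tr_emb HN _ _ EE E0).
pose i := tnth s 0; pose j := tnth s 1; pose k := tnth s 2; pose l := tnth s 3.
have LL (f : 4.-tuple 'I_n.-1 -> R) : \sum_t (\prod_(l < 4) E (tnth s l) (tnth t l)) * f t =
   \sum_a \sum_b \sum_c \sum_d E i a * E j b * E k c * E l d * f [tuple a; b; c; d].
  by rewrite -[LHS]/(tr E f s) [in LHS](tuple4E s) tr4E.
rewrite !LL {LL}; move: (sff D G u) Lt => L Lt.
have F1 : \sum_a \sum_b \sum_c \sum_d E i a * E j b * E k c * E l d *
    (L [tuple tnth [tuple a; b; c; d] 0; tnth [tuple a; b; c; d] 3] *
     L [tuple tnth [tuple a; b; c; d] 1; tnth [tuple a; b; c; d] 2]) =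
   tr E L [tuple i; l] * tr E L [tuple j; k].
  rewrite !tr2E !(tnth_nth i) /=.
  transitivity (\sum_a \sum_d \sum_b \sum_c (E i a * E l d * L [tuple a; d]) * (E j b * E k c * L [tuple b; c])).
    apply: eq_bigr => a _; rewrite [RHS]exchange_big /=; apply: eq_bigr => b _.
    rewrite [RHS]exchange_big /=; apply: eq_bigr => c _; apply: eq_bigr => d _.
    by rewrite !(tnth_nth a) /=; ring.
  rewrite mulr_suml; apply: eq_bigr => a _; rewrite mulr_suml; apply: eq_bigr => d _.
  by rewrite mulr_sumr; apply: eq_bigr => b _; rewrite [RHS]mulr_sumr.
have F2 : \sum_a \sum_b \sum_c \sum_d E i a * E j b * E k c * E l d *
    (L [tuple tnth [tuple a; b; c; d] 1; tnth [tuple a; b; c; d] 3] *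
     L [tuple tnth [tuple a; b; c; d] 0; tnth [tuple a; b; c; d] 2]) =
   tr E L [tuple j; l] * tr E L [tuple i; k].
  rewrite !tr2E !(tnth_nth i) /=.
  transitivity (\sum_b \sum_d \sum_a \sum_c (E j b * E l d * L [tuple b; d]) * (E i a * E k c * L [tuple a; c])).
    exch => b _; rewrite [RHS]exchange_big /=; apply: eq_bigr => a _.
    rewrite [RHS]exchange_big /=; apply: eq_bigr => c _; apply: eq_bigr => d _.
    by rewrite !(tnth_nth a) /=; ring.
  rewrite mulr_suml; apply: eq_bigr => b _; rewrite mulr_suml; apply: eq_bigr => d _.
  by rewrite mulr_sumr; apply: eq_bigr => a _; rewrite mulr_sumr.
rewrite F1 F2; apply: le_trans (ler_normD _ _) _; apply: lerD; first exact: Rt.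
apply: le_trans (ler_normB _ _) _; rewrite !normrM mulr2n mulrDl mul1r expr2.
by apply: lerD; apply: ler_pM; rewrite ?normr_ge0 //; exact: Lt.
Qed.

End BoundaryCurvature.

Lemma adm_pred (R : realType) n (D : set 'rV[R]_n) T x j K M f : (j = 0%N -> M = 0) -> adm D T x j K M f ->
  adm D T x j.-1 K 0 f.
Proof. by case: j => [|j] jM; [rewrite jM|exact: adm_low]. Qed.

(** * Tangential derivatives of curvature along the boundary *)

Section SliceControl.
Variables (R : realType) (n : nat) (N : 'I_n) (HN : N.+1 = n).
Notation pt u := (snoc u 0 : 'rV[R]_n).

Definition tang (i : 'I_n) : bool := i.+1 != n.

Lemma tang_emb (j : 'I_n.-1) : tang (emb j). Proof. exact: emb_neq_last. Qed.

Lemma tangP i : tang i \/ i = N.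
Proof.
by rewrite /tang; case: (emb_lastP HN i) => [->|[j ->]]; [right|left; exact: emb_neq_last].
Qed.

Lemma tang_map s : all tang s -> exists s', s = map (@emb n) s'.
Proof.
elim: s => [|i s IH] /=; first by exists [::].
case/andP => ti /IH[s' ->]; case: (embP i) => [/eqP ni|[j ->]]; last by exists (j :: s').
by move: ti; rewrite /tang ni.
Qed.

Lemma adm_slice (D : set 'rV[R]_n) u j K M f :
  adm D tang (pt u) j K M f <-> adm (slice D) predT u j K M (fun u => f (pt u)).
Proof.
split=> H s Ts sj.
  rewrite pds_slice; have := H (map (@emb n) s); rewrite size_map; apply=> //.
  by rewrite all_map; apply/allP => i _; exact: tang_emb.
have [s' E] := tang_map Ts; move: sj; rewrite E size_map => sj.
by rewrite -pds_slice; apply: H => //; exact: all_predT.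
Qed.

(** B arises from the symbols with upper index N, which represent l, by raising an index and
    changing the sign. *)
Lemma adm_nor_B j K : 0 <= K -> exists2 K', 0 <= K' &
  forall (D : set 'rV[R]_n) G, dom D -> is_metric D G -> (forall x i, D x -> G x i N = (i == N)%:R) ->
  forall T x, D x ->
  (forall a b, adm D T x j K 0 (fun y => G y a b)) -> (forall a b, `|invmx (G x) a b| <= K) ->
  (forall a b, adm D T x j K 0 (fun y => christoffel D G y N a b)) ->
  forall a b, adm D T x j K' 0 (nor_B D G N a b).
Proof.
move=> K0; have [K1 K10 HI] := @adm_imet R n j K K0.
exists (n%:R * (2 ^+ j * (K1 * K))) => [|D G dD mG GN T x Dx aG bI aC a b].
  by rewrite !mulr_ge0 ?ler0n ?exprn_ge0.
have sC l : sm D (fun y => christoffel D G y N b l) by exact: sm_chr.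
have sI l : sm D (fun y => invmx (G y) a l) by exact: sm_imet.
have sN l : sm D (fun y => - christoffel D G y N b l) by exact: sm_opp.
apply: (adm_ext Dx (f := fun y => \sum_l invmx (G y) a l * - christoffel D G y N b l)) => [y Dy|].
  rewrite /nor_B chrE; apply: eq_bigr => l _; rewrite (chr_N dD mG GN) // (chr1_N dD mG GN) //.
  by rewrite opprK.
apply: adm_sum => // [l|l]; first exact: (sm_mul dD).
apply: adm_mul0 => //; last exact: adm_opp.
by apply: HI => // _; exact: erefl.
Qed.

(** The boundary curvature is controlled through the Gauss equation for components, so its own
    covariant derivatives are never compared with those of R. Tangential partial derivatives of R
    are obtained by [adm_tensor] in the ambient space and those of l by [adm_tensor] on the
    boundary, before they are combined. *)
Lemma slice_ctl j K : 0 <= K -> exists2 K', 0 <= K' &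
  forall (D : set 'rV[R]_n) G, dom D -> is_metric D G -> (forall x i, D x -> G x i N = (i == N)%:R) ->
  forall B xi c0 c1 u M, flow (slice D) (slice_met G) B xi c0 c1 predT -> slice D u -> 0 <= M ->
  (j = 0%N -> M = 0) ->
  (forall a b, adm (slice D) predT u j K M (fun y => slice_met G y a b)) ->
  ((0 < j)%N -> forall a b, adm (slice D) predT u j.-1 K 0 (B a b)) ->
  (forall a b, `|invmx (slice_met G u) a b| <= K) ->
  (forall a t, (a <= j)%N -> `|covDn D G (riem D G) a (pt u) t| <= K) ->
  (forall a t, (a <= j)%N -> `|covDn (slice D) (slice_met G) (sff D G) a u t| <= K) ->
  (forall t, adm (slice D) predT u j K' M (fun y => riem (slice D) (slice_met G) y t)) /\
  (forall t, adm (slice D) predT u j K' M (fun y => sff D G y t)).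
Proof.
move=> K0.
have [K1 K10 H1] := @adm_chr R n.-1 j.-1 K K0.
have KK1 : 0 <= K + K1 by rewrite addr_ge0.
have [K2 K20 H2] := @adm_tensor R n.-1 2 j (K + K1) KK1.
have [K2' K20' H2'] := @adm_tensor R n.-1 2 j.-1 (K + K1) KK1.
pose K3 := K + K1 + K2 + K2' + 1.
have K30 : 0 <= K3 by rewrite !addr_ge0.
have [K3_1 K_3 K13 K23] : [/\ 1 <= K3, K <= K3, K1 <= K3 & K2 <= K3] by rewrite /K3; split; lra.
have [K4 K40 H4] := adm_nor_B j.-1 K30.
have K50 : 0 <= K3 + K4 by rewrite addr_ge0.
have [K5 K50' H5] := @adm_tensor R n 4 j (K3 + K4) K50.
pose K6 := K5 + (2 ^+ j * (K2 * K2) + 2 ^+ j * (K2 * K2)).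
have K60 : 0 <= K6 by rewrite !addr_ge0 // !mulr_ge0 // exprn_ge0.
exists (K6 + K2) => [|D G dD mG GN B xi c0 c1 u M FL Du M0 jM aH aB bI cR cL]; first exact: addr_ge0.
have DP : D (pt u) := Du.
have dD0 := dom_slice dD; have mH := slice_metric HN dD mG.
have sL t : sm (slice D) (fun y => sff D G y t) by exact: (sm_sff HN).
have aC : (0 < j)%N -> forall p i q, adm (slice D) predT u j.-1 K1 M (fun y => christoffel (slice D) (slice_met G) y p i q).
  move=> j0 p i q; apply: (H1 (slice D) (slice_met G) B xi c0 c1) => //; last exact: aB.
  by rewrite prednK.
have aL t : adm (slice D) predT u j K2 M (fun y => sff D G y t).
  apply: (H2 (slice D) (slice_met G)) => // [j0 p i q _|a t' aj].
    by apply: (adm_le (K := K1) (N := M)) => //; [rewrite lerDr|exact: aC].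
  by apply: le_trans (cL a t' aj) _; rewrite lerDl.
have K2K6 : K2 <= K6 + K2 by rewrite lerDr.
split=> t; last by apply: (adm_le (K := K2) (N := M)).
have aCN : (0 < j)%N -> forall a b, adm D tang (pt u) j.-1 K3 0 (fun y => christoffel D G y N a b).
  move=> j0 a b; have [bN|[b' E]] := emb_lastP HN b.
    apply: (adm_ext DP (f := fun=> 0)) => [y Dy|]; first by rewrite bN (chr_NN' dD mG GN).
    by apply: adm_cst => //; rewrite normr0.
  have [aN|[a' E']] := emb_lastP HN a.
    apply: (adm_ext DP (f := fun=> 0)) => [y Dy|]; first by rewrite aN (chr_sym mG) // (chr_NN' dD mG GN).
    by apply: adm_cst => //; rewrite normr0.
  rewrite E E'; apply/adm_slice.
  apply: (adm_le (K := K2) (N := 0)) => //.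
  apply: (adm_ext Du (f := fun y => sff D G y [tuple a'; b'])) => [y Dy|].
    by rewrite (sff_chr HN mG GN) // !(tnth_nth a').
  by apply: (@adm_low _ _ (slice D) predT u j.-1 K2 M); rewrite prednK.
have aG : forall a b, adm D tang (pt u) j.-1 K3 0 (fun y => G y a b).
  move=> a b.
  have [bN|[b' E]] := emb_lastP HN b.
    apply: (adm_ext DP (f := fun=> (a == N)%:R)) => [y Dy|]; first by rewrite bN GN.
    by apply: adm_cst => //; case: (a == N); rewrite ?normr0 ?normr1.
  have [aN|[a' E']] := emb_lastP HN a.
    apply: (adm_ext DP (f := fun=> (b == N)%:R)) => [y Dy|]; first by rewrite aN (GN' mG GN).
    by apply: adm_cst => //; case: (b == N); rewrite ?normr0 ?normr1.
  rewrite E E'; apply/adm_slice.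
  apply: (adm_le (K := K) (N := 0)) => //.
  apply: (adm_ext Du (f := fun y => slice_met G y a' b')) => [y Dy|]; first by rewrite mxE.
  by apply: adm_pred jM (aH a' b').
have bIG a b : `|invmx (G (pt u)) a b| <= K3.
  have [bN|[b' E]] := emb_lastP HN b.
    by rewrite bN (imet_N mG GN) //; case: (a == N); rewrite ?normr0 ?normr1.
  have [aN|[a' E']] := emb_lastP HN a.
    by rewrite aN (imet_symE mG) // (imet_N mG GN) //; case: (b == N); rewrite ?normr0 ?normr1.
  by rewrite E E' -(imet_slice HN dD mG GN) //; exact: le_trans (bI a' b') K_3.
(* For a tangential direction the ambient symbols are of three kinds: the Weingarten map, l, and the
   symbols of the boundary. Only the last kind carries the unknown M. *)
have aR t' : adm D tang (pt u) j K5 M (fun y => riem D G y t').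
  apply: (H5 D G tang (pt u) M) => // [t''|j0 p i q ti|a t'' aj].
  - exact: sm_riem.
  - have [qN|[q' E]] := emb_lastP HN q.
      apply: (adm_le (K := K4) (N := 0)) => //; first by rewrite lerDr.
      by rewrite qN; apply: (H4 D G dD mG GN tang) => //; exact: aCN.
    have [pN|[p' E']] := emb_lastP HN p.
      apply: (adm_le (K := K3) (N := 0)) => //; first by rewrite lerDl.
      by rewrite pN; exact: aCN.
    have [i' E''] : exists i', i = emb i'.
      by case: (embP i) => [bn|[a' ->]]; [move: ti; rewrite /tang bn eqxx|exists a'].
    rewrite E E' E''; apply/adm_slice; apply: (adm_le (K := K1) (N := M)) => //; first by apply: le_trans K13 _; rewrite lerDl.
    apply: (adm_ext Du (f := fun y => christoffel (slice D) (slice_met G) y p' i' q')) => [y Dy|]; last exact: aC.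
    by rewrite (chr_slice HN dD mG GN).
  - by apply: le_trans (cR a t'' aj) (le_trans K_3 _); rewrite lerDl.
apply: (adm_le (K := K6) (N := M)) => //; first by rewrite lerDl.
pose L1 y := sff D G y [tuple tnth t 0; tnth t 3] * sff D G y [tuple tnth t 1; tnth t 2].
pose L2 y := sff D G y [tuple tnth t 1; tnth t 3] * sff D G y [tuple tnth t 0; tnth t 2].
have sL1 : sm (slice D) L1 by exact: (sm_mul dD0).
have sL2 : sm (slice D) L2 by exact: (sm_mul dD0).
have sR1 : sm (slice D) (fun y => riem D G (pt y) [tuple of map (@emb n) t]).
  by apply: (@sm_slice _ _ D (fun y => riem D G y [tuple of map (@emb n) t])) => //; exact: sm_riem.
apply: (adm_ext Du (f := fun y => riem D G (pt y) [tuple of map (@emb n) t] + (L1 y + - L2 y))) => [y Dy|].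
  by rewrite (riem_slice HN dD mG GN).
have sL2n : sm (slice D) (fun y => - L2 y) by exact: (sm_opp dD0).
apply: adm_add => //; first exact: (sm_add dD0).
  by apply/(@adm_slice D u j K5 M (fun y => riem D G y [tuple of map (@emb n) t])).
by apply: adm_add => //; [apply: adm_mul|apply: adm_opp => //; apply: adm_mul].
Qed.

End SliceControl.

Section CollarDomain.
Variables (R : realType) (n : nat) (N : 'I_n) (HN : N.+1 = n).

Let n0 : (0 < n)%N. Proof. exact: leq_trans (ltn_ord N). Qed.

Lemma collar_pt (r1 r2 : R) u t : collar r1 r2 (snoc u t : 'rV[R]_n) <-> eball r1 u /\ 0 <= t < r2.
Proof. by rewrite /collar /= front_snoc lastc_snoc. Qed.

Lemma slice_collar (r1 r2 : R) : 0 < r2 -> slice (collar r1 r2 : set 'rV[R]_n) = eball r1.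
Proof.
move=> r20; apply/seteqP; split=> u; rewrite /slice /=.
  by case/collar_pt.
by move=> Du; apply/collar_pt; rewrite lexx.
Qed.

Lemma collar_half (r1 r2 : R) : exists2 U, open U & (collar r1 r2 : set 'rV[R]_n) = @halfspace R n `&` U.
Proof.
pose U : set 'rV[R]_n := [set x | enorm (front x) < r1 /\ lastc x < r2].
exists U.
  have dT : dom (setT : set 'rV[R]_n) by apply: dom_open; exact: openT.
  rewrite openE => x [x1 x2].
  have sf : sm setT (fun y : 'rV[R]_n => esq (front y)).
    apply: (sm_ext (f := fun y => \sum_(j < n.-1) y 0 (emb j) * y 0 (emb j))) => [y _|].
      by apply: eq_bigr => i _; rewrite mxE expr2.
    by apply: (sm_sum dT) => i _; apply: (sm_mul dT); exact: sm_coord.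
  have [||d d0 Hd] := @cw_sqrt R n setT (fun y => esq (front y)) x _ (r1 - enorm (front x)).
  - exact: (sm_cw sf).
  - by rewrite subr_gt0.
  have [|d' d'0 Hd'] := @cw_coord R n setT N x (r2 - x 0 N).
    by rewrite subr_gt0 -(lastcE x HN).
  apply/nbhs_ballP; exists (Num.min d d') => [|y] /=; first by rewrite lt_min d0.
  rewrite -ball_normE /= distrC lt_min => /andP[h1 h2]; split.
    by have := Hd y I h1; rewrite ltr_norml -!enormE => /andP[_]; rewrite ltrD2r.
  by have := Hd' y I h2; rewrite (lastcE y HN) ltr_norml => /andP[_]; rewrite ltrD2r.
apply/seteqP; split=> x; rewrite /collar /halfspace /U /=.
  by case=> a /andP[b c].
by case=> a [b c]; split=> //; rewrite a c.
Qed.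

Lemma collar_dom (r1 r2 : R) : dom (collar r1 r2 : set 'rV[R]_n).
Proof. by have [U oU ->] := collar_half r1 r2; exists (@halfspace R n), U; split=> //; exact: orth_half. Qed.

Lemma isd_nor (r1 r2 : R) f u tau t : sm (collar r1 r2 : set 'rV[R]_n) f -> eball r1 u -> tau < r2 -> 0 <= t <= tau ->
  isd (seg tau) (fun s => f (snoc u s)) t (pd (collar r1 r2) N f (snoc u t)).
Proof.
move=> sf Du tr tI.
have Ds s : 0 <= s <= tau -> collar r1 r2 (snoc u s : 'rV[R]_n).
  by case/andP=> s0 s1; apply/collar_pt; split=> //; rewrite s0 (le_lt_trans s1).
have := isd_curve (S := seg tau) (c := fun s => snoc u s : 'rV[R]_n) (t := t) (v := fun i => (i == N)%:R)
  (collar_dom r1 r2) sf.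
rewrite (sum_delta_r (fun i => pd (collar r1 r2) i f (snoc u t))); apply=> // [|i]; first exact: Ds.
case: (emb_lastP HN i) => [->|[j ->]].
  rewrite eqxx; apply: (isd_ext (f := id)) (isd_id _ _) => [s _|]; by rewrite snoc_last.
rewrite (emb_N HN); apply: (isd_ext (f := fun=> u 0 j)) (isd_cst _ _ _) => [s _|]; by rewrite snoc_emb.
Qed.

Lemma collarP (r1 r2 : R) (x : 'rV[R]_n) : collar r1 r2 x -> exists u t, [/\ x = snoc u t, eball r1 u & 0 <= t < r2].
Proof. by move=> [h1 h2]; exists (front x), (lastc x); rewrite snoc_front. Qed.

End CollarDomain.

(** * Higher derivatives in a collar *)

Section CollarHigher.
Variables (R : realType) (n : nat) (N : 'I_n) (HN : N.+1 = n).

Definition nor_hyp (r1 r2 : R) (G : 'rV[R]_n -> 'M[R]_n) : Prop :=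
  is_metric (collar r1 r2) G /\ (forall x i, collar r1 r2 x -> G x i N = (i == N)%:R).

Definition zero_hyp (r1 r2 : R) (G : 'rV[R]_n -> 'M[R]_n) k K : Prop :=
  forall x, collar r1 r2 x -> [/\ forall a b, `|G x a b| <= K, forall a b, `|invmx (G x) a b| <= K,
    forall a b, `|nor_B (collar r1 r2) G N a b x| <= K &
    forall a t, (a <= k)%N -> `|covDn (collar r1 r2) G (riem (collar r1 r2) G) a x t| <= K].

(** Induction on the order, with [ode_linear] along the normals. Tangential derivatives commute with
    d_N, and their values at the boundary are given. *)
Lemma collar_tang k C : 0 <= C -> exists2 K, 0 <= K & forall r1 r2 G, 0 < r2 -> r2 <= 1 -> nor_hyp r1 r2 G ->
  zero_hyp r1 r2 G k C ->
  (forall u s a b, eball r1 u -> all (@tang n) s -> (size s <= k)%N ->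
     `|pds (collar r1 r2) s (fun y => G y a b) (snoc u 0)| <= C /\
     `|pds (collar r1 r2) s (nor_B (collar r1 r2) G N a b) (snoc u 0)| <= C) ->
  forall s x a b, collar r1 r2 x -> all (@tang n) s -> (size s <= k)%N ->
    `|pds (collar r1 r2) s (fun y => G y a b) x| <= K /\ `|pds (collar r1 r2) s (nor_B (collar r1 r2) G N a b) x| <= K.
Proof.
move=> C0; elim: k => [|k [K K0 IH]].
  exists C => // r1 r2 G r20 r21 _ HZ _ s x a b Dx _; rewrite leqn0 size_eq0 => /eqP -> /=.
  by have [h1 _ h2 _] := HZ x Dx.
pose K1 := K + C + 1.
have K10 : 0 <= K1 by rewrite !addr_ge0.
have K11 : 1 <= K1 by rewrite /K1; lra.
have [Kr Kr0 HR] := @ctl_covD R n k.+1 K1 K10.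
pose K2 := K1 + Kr.
have K12 : K1 <= K2 by rewrite lerDl.
have K20 : 0 <= K2 by apply: le_trans K12.
have [K3 K30 H3] := @core_top R n k K2 K20.
pose L := 2 * (n%:R * K2) + 3 * K3.
have n0 : 0 <= n%:R :> R by rewrite ler0n.
have nK : 0 <= n%:R * K2 by rewrite mulr_ge0.
have L0 : 0 <= L by rewrite addr_ge0 ?mulr_ge0.
pose K4 := expR (L + 1) * (2 * K3 + C).
have K40 : 0 <= K4 by rewrite mulr_ge0 ?expR_ge0 // addr_ge0 // mulr_ge0.
exists (K + K4) => [|r1 r2 G r20 r21 [mG GN] HZ HI s x a b Dx Ts]; first exact: addr_ge0.
set D := collar r1 r2 in mG GN HZ HI Dx *.
have dD : dom D by exact: (collar_dom HN).
have {}IH s' y p q : D y -> all (@tang n) s' -> (size s' <= k)%N ->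
    `|pds D s' (fun y => G y p q) y| <= K /\ `|pds D s' (nor_B D G N p q) y| <= K.
  move=> Dy; apply: (IH r1 r2 G) => // [z Dz|u s'' p' q' Du Ts'' sk].
    by have [z1 z2 z3 z4] := HZ z Dz; split=> // i t ik; apply: z4; exact: leqW.
  by apply: HI => //; exact: leqW.
rewrite leq_eqVlt ltnS => /orP[/eqP ss|ss]; last first.
  by have [h1 h2] := IH s x a b Dx Ts ss; split; [apply: le_trans h1 _|apply: le_trans h2 _]; rewrite lerDl.
have FL := nor_flow dD mG GN (T := @tang n) (tangP HN).
have sG p q : sm D (fun y => G y p q) by exact: sm_met.
have sB p q : sm D (nor_B D G N p q) by exact: flow_smB FL _ _.
have sxi i : sm D (nor_xi N i) by exact: flow_smxi FL _.
have sQ p q : sm D (Qend D G (nor_xi N) p q).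
  by apply: (sm_ext (f := fun x => curv D G x N q N p)) => [y Dy|]; [rewrite nor_Qend|exact: sm_curv].
pose Aix := (bool * {t : (k.+1).-tuple 'I_n | all (@tang n) t} * 'I_n * 'I_n)%type.
pose h (z : Aix) : 'rV[R]_n -> R := let: (b0, t, p, q) := z in
  pds D (val t) (if b0 then (fun y => G y p q) else nor_B D G N p q).
have sh z : sm D (h z) by case: z => [[[[] t] p] q] /=; exact: sm_pds.
have sGB p q : sm D (fun y => \sum_l G y p l * nor_B D G N l q y).
  by apply: (sm_sum dD) => l _; apply: (sm_mul dD).
have sBB p q : sm D (fun y => \sum_l nor_B D G N p l y * nor_B D G N l q y).
  by apply: (sm_sum dD) => l _; apply: (sm_mul dD).
have comm s' f y : sm D f -> D y -> pd D N (pds D s' f) y = pds D s' (pd D N f) y.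
  by move=> sf Dy; rewrite -pds_rcons -cats1 (pds_mid dD N s' [::] sf Dy) cats0.
have [u [tau [xE Du tI]]] := collarP Dx.
have Dt t : 0 <= t <= tau -> D (snoc u t).
  case/andP=> t0 t1; apply/(collar_pt N); split=> //; rewrite t0 /=; apply: le_lt_trans t1 _.
  by case/andP: tI.
have t2 : tau < r2 by case/andP: tI.
have t0 : 0 <= tau by case/andP: tI.
have main z : `|h z x| <= K4.
  rewrite xE; apply: le_trans (_ : expR ((L + 1) * tau) * (2 * K3 + C) <= _); last first.
    apply: ler_wpM2r; first by rewrite addr_ge0 // mulr_ge0.
    rewrite ler_expR -[leRHS]mulr1; apply: ler_wpM2l; first by rewrite addr_ge0.
    by apply: ltW; apply: lt_le_trans r21.
  apply: (@ode_linear R Aix (fun z t => h z (snoc u t)) (fun z t => pd D N (h z) (snoc u t)) tau (2 * K3) C L) => //.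
  - by rewrite mulr_ge0.
  - by move=> w t tI'; exact: (isd_nor HN (sh w) Du t2 tI').
  - move=> w t mu tI' Hmu; have Dy := Dt t tI'; set y := snoc u t in Dy Hmu *.
    have mu0 : 0 <= mu by apply: le_trans (Hmu w); exact: normr_ge0.
    have [z1 z2 z3 z4] := HZ y Dy.
    have Ntop t' p q : all (@tang n) t' -> size t' = k.+1 -> `|pds D t' (fun y => G y p q) y| <= mu.
      move=> Tt st; have Tt' : all (@tang n) (tcast st (in_tuple t')) by rewrite val_tcast.
      by have := Hmu (true, exist _ (tcast st (in_tuple t')) Tt', p, q); rewrite /= val_tcast.
    have Mtop t' p q : all (@tang n) t' -> size t' = k.+1 -> `|pds D t' (nor_B D G N p q) y| <= mu.
      move=> Tt st; have Tt' : all (@tang n) (tcast st (in_tuple t')) by rewrite val_tcast.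
      by have := Hmu (false, exist _ (tcast st (in_tuple t')) Tt', p, q); rewrite /= val_tcast.
    have KK1 : K <= K1 by rewrite /K1 -addrA lerDl addr_ge0.
    have CK1 : C <= K1 by rewrite /K1 addrAC lerDr addr_ge0.
    have aG K' p q : K1 <= K' -> adm D (@tang n) y k.+1 K' mu (fun y => G y p q).
      move=> KK; have KK' := le_trans KK1 KK; apply: (adm_top _ KK') => // [|s' Ts' s'k|s' Ts' s'k].
      - exact: le_trans K11 KK.
      - exact: Ntop.
      - by have [] := IH s' y p q Dy Ts' s'k.
    have aB K' p q : K1 <= K' -> adm D (@tang n) y k K' 0 (nor_B D G N p q).
      move=> KK; apply: adm_bound => s' Ts' s'k.
      have [_ +] := IH s' y p q Dy Ts' s'k; move/le_trans; apply; exact: le_trans KK.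
    have aI K' p q : K1 <= K' -> `|invmx (G y) p q| <= K'.
      by move=> KK; apply: le_trans (z2 p q) _; apply: le_trans KK.
    have aR t' : adm D (@tang n) y k.+1 K2 mu (fun z => riem D G z t').
      apply: (@adm_le _ _ _ _ _ k.+1 Kr K2 mu mu) => //; first by rewrite /K2 lerDr.
      apply: (HR D G (nor_B D G N) (nor_xi N) 0 0 (@tang n) y mu dD mG FL Dy mu0) => //.
      - by move=> p q; exact: aG.
      - by move=> _ p q; exact: aB.
      - by move=> p q; exact: aI.
      - by move=> i t'' ij; apply: le_trans (z4 i t'' ij) _.
    case: w => [[[b0 [t' Tt']] p] q].
    have core : [/\ `|pds D t' (fun y => \sum_l G y p l * nor_B D G N l q y) y| <= n%:R * (K2 * mu) + K3 + K3 * (1 * mu),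
        `|pds D t' (fun y => \sum_l nor_B D G N p l y * nor_B D G N l q y) y| <= K3 * (1 * mu) + K3 &
        `|pds D t' (Qend D G (nor_xi N) p q) y| <= K3 * (1 * mu) + K3].
      apply: (H3 D G (nor_B D G N) (nor_xi N) (@tang n) y 1 mu mu t') => //.
      - exact: size_tuple.
      - by move=> p' q'; exact: aG.
      - by move=> p' q'; exact: aB.
      - by move=> p' q'; apply: Mtop => //; exact: size_tuple.
      - by move=> p' q'; rewrite mulr1; apply: le_trans (z3 p' q') _; apply: le_trans K12.
      - by move=> p' q'; exact: aI.
      - by move=> i j s' _ s'0; rewrite /nor_xi (pds_cst dD) // normr0.
      - by move=> i j; rewrite /nor_xi -natrM; case: (_ * _)%N (leq_mul (leq_b1 (i == N)) (leq_b1 (j == N))) => [|[|]]; rewrite ?normr0 ?normr1.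
    case: core; rewrite mul1r => c1 c2 c3.
    have K3m : 0 <= K3 * mu by rewrite mulr_ge0.
    have nKm : 0 <= n%:R * (K2 * mu) by rewrite !mulr_ge0.
    have LE : L * mu = 2 * (n%:R * (K2 * mu)) + 3 * (K3 * mu) by rewrite /L; ring.
    rewrite LE /h; case: b0; rewrite comm //=.
      rewrite (pds_ext (g := fun y => 2 * \sum_l G y p l * nor_B D G N l q y)) => [|w Dw|]; last 2 first.
      - exact: nor_met.
      - exact: Dy.
      rewrite (pds_scale dD) // normrM gtr0_norm //; move: c1.
      by move: `|_| (n%:R * (K2 * mu)) (K3 * mu) K3m nKm K30 mu0 => a1 a2 a3; clear; lra.
    rewrite (pds_ext (g := fun y => - (\sum_l nor_B D G N p l y * nor_B D G N l q y) + Qend D G (nor_xi N) p q y)) => [|w Dw|]; last 2 first.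
    - exact: nor_ric.
    - exact: Dy.
    have sBBn : sm D (fun y => - \sum_l nor_B D G N p l y * nor_B D G N l q y) by exact: sm_opp.
    rewrite (pds_add dD) // (pds_opp dD) //; apply: le_trans (ler_normD _ _) _; rewrite normrN.
    by move: c2 c3; move: `|_| `|_| (n%:R * (K2 * mu)) (K3 * mu) K3m nKm K30 mu0 => a1 a2 a3 a4; clear; lra.
  - case=> [[[b0 [t' Tt']] p] q]; have := HI u t' p q Du Tt'; rewrite size_tuple => /(_ (leqnn _))[h1 h2].
    by rewrite /h; case: b0.
  - by rewrite t0 lexx.
have Tx : all (@tang n) (tcast ss (in_tuple s)) by rewrite val_tcast.
split.
  have := main (true, exist _ (tcast ss (in_tuple s)) Tx, a, b); rewrite /= val_tcast => /le_trans; apply.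
  by rewrite lerDr.
have := main (false, exist _ (tcast ss (in_tuple s)) Tx, a, b); rewrite /= val_tcast => /le_trans; apply.
by rewrite lerDr.
Qed.

(** One normal derivative is replaced by the right-hand side of the flow equation, which is of order
    zero in g, B and R. This lowers the total order by one, so the induction also deals with
    repeated normal derivatives. *)
Lemma collar_all k C : 0 <= C -> exists2 K, 0 <= K & forall r1 r2 G, nor_hyp r1 r2 G ->
  zero_hyp r1 r2 G k C ->
  (forall s x a b, collar r1 r2 x -> all (@tang n) s -> (size s <= k)%N ->
    `|pds (collar r1 r2) s (fun y => G y a b) x| <= C /\ `|pds (collar r1 r2) s (nor_B (collar r1 r2) G N a b) x| <= C) ->
  forall s x a b, collar r1 r2 x -> (size s <= k)%N ->
    `|pds (collar r1 r2) s (fun y => G y a b) x| <= K /\ `|pds (collar r1 r2) s (nor_B (collar r1 r2) G N a b) x| <= K.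
Proof.
move=> C0; elim: k => [|k [K K0 IH]].
  exists C => // r1 r2 G _ HZ _ s x a b Dx; rewrite leqn0 size_eq0 => /eqP -> /=.
  by have [h1 _ h2 _] := HZ x Dx.
pose K1 := K + C; have K10 : 0 <= K1 by rewrite addr_ge0.
have [Kr Kr0 HR] := @ctl_covD R n k K1 K10.
have [Ki Ki0 HI] := @adm_imet R n k K1 K10.
pose Kp := n%:R * (2 ^+ k * (K1 * K1)).
pose Kq := n%:R * (2 ^+ k * (Ki * Kr)).
have Kp0 : 0 <= Kp by rewrite !mulr_ge0 ?ler0n ?exprn_ge0.
have Kq0 : 0 <= Kq by rewrite !mulr_ge0 ?ler0n ?exprn_ge0.
exists (C + 2 * Kp + Kq) => [|r1 r2 G [mG GN] HZ HT s x a b Dx]; first by rewrite !addr_ge0 // mulr_ge0.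
have HZ' := HZ; have HT' := HT.
have nh : nor_hyp r1 r2 G by split.
set D := collar r1 r2 in mG GN HZ HT Dx *.
have dD : dom D by exact: (collar_dom HN).
have {}IH s' y p q : D y -> (size s' <= k)%N ->
    `|pds D s' (fun y => G y p q) y| <= K /\ `|pds D s' (nor_B D G N p q) y| <= K.
  move=> Dy; apply: (IH r1 r2 G) => // [z Dz|s'' z p' q' Dz Ts'' sk].
    by have [z1 z2 z3 z4] := HZ z Dz; split=> // i t ik; apply: z4; exact: leqW.
  by apply: HT => //; exact: leqW.
move=> sk; have [Ts|] := boolP (all (@tang n) s).
  have [h1 h2] := HT s x a b Dx Ts sk.
  by split; [apply: le_trans h1 _|apply: le_trans h2 _]; rewrite -addrA lerDl addr_ge0 // mulr_ge0.
rewrite -has_predC => /hasP[i iS /= iT].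
have {iT} iN : i = N by case: (tangP HN i) => // ti; rewrite ti in iT.
(* One letter N of the word is moved to the innermost place, where it acts directly on g or B. *)
pose s' := rem N s.
have ps : perm_eq s (N :: s') by apply: perm_to_rem; rewrite -iN.
have s'k : (size s' <= k)%N by have := perm_size ps; rewrite /= => E; rewrite -ltnS -E.
have sG p q : sm D (fun y => G y p q) by exact: sm_met.
have sB p q : sm D (nor_B D G N p q) by exact: sm_nor_B.
have sI p q : sm D (fun y => invmx (G y) p q) by exact: sm_imet.
have FL := nor_flow dD mG GN (T := predT) (fun i => or_introl isT).
have comm f : sm D f -> pds D s f x = pds D s' (pd D N f) x.
  move=> sf; rewrite (pds_perm dD sf ps Dx) /= -pds_rcons -cats1.
  by rewrite (pds_mid dD N s' [::] sf Dx) cats0.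
have [z1 z2 z3 z4] := HZ x Dx.
have aG p q : adm D predT x k K1 0 (fun y => G y p q).
  by apply: adm_bound => t _ tk; have [h _] := IH t x p q Dx tk; apply: le_trans h _; rewrite lerDl.
have aB p q : adm D predT x k K1 0 (nor_B D G N p q).
  by apply: adm_bound => t _ tk; have [_ h] := IH t x p q Dx tk; apply: le_trans h _; rewrite lerDl.
have bI p q : `|invmx (G x) p q| <= K1 by apply: le_trans (z2 p q) _; rewrite lerDr.
have aR t' : adm D predT x k Kr 0 (fun z => riem D G z t').
  apply: (HR D G (nor_B D G N) (nor_xi N) 0 0 predT x 0 dD mG FL Dx) => //.
    by move=> k0 p q; apply: adm_lift (aB p q) => //; rewrite leq_pred.
  by move=> c t'' ij; apply: le_trans (z4 c t'' (leqW ij)) _; rewrite lerDr.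
have aI p q : adm D predT x k Ki 0 (fun y => invmx (G y) p q).
  by apply: (HI D G predT x 0 dD mG Dx).
split; rewrite comm //.
  rewrite (pds_ext (g := fun y => 2 * \sum_l G y a l * nor_B D G N l b y)) => [|w Dw|]; last 2 first.
  - exact: nor_met.
  - exact: Dx.
  have sGB l : sm D (fun y => G y a l * nor_B D G N l b y) by apply: (sm_mul dD).
  have aS : adm D predT x k Kp 0 (fun y => \sum_l G y a l * nor_B D G N l b y).
    rewrite /Kp; apply: adm_sum => // l; exact: adm_mul0.
  rewrite (pds_scale dD) //; last exact: sm_sum.
  rewrite normrM gtr0_norm //; have := adm_boundP aS (all_predT s') s'k.
  by move: Kp0 Kq0 C0; clear; move: Kp Kq `|_| => a1 a2 a3; lra.
rewrite (pds_ext (g := fun y => - (\sum_l nor_B D G N a l y * nor_B D G N l b y) + curv D G y N b N a)) => [|w Dw|]; last 2 first.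
- by rewrite nor_ric // nor_Qend.
- exact: Dx.
have sBB l : sm D (fun y => nor_B D G N a l y * nor_B D G N l b y) by apply: (sm_mul dD).
have sBBs : sm D (fun y => \sum_l nor_B D G N a l y * nor_B D G N l b y) by exact: sm_sum.
have sBBn : sm D (fun y => - \sum_l nor_B D G N a l y * nor_B D G N l b y) by exact: sm_opp.
have aS : adm D predT x k Kp 0 (fun y => \sum_l nor_B D G N a l y * nor_B D G N l b y).
  rewrite /Kp; apply: adm_sum => // l; exact: adm_mul0.
have sR t : sm D (fun y => riem D G y t) by exact: sm_riem.
have sIR l : sm D (fun y => invmx (G y) a l * riem D G y [tuple N; b; N; l]) by apply: (sm_mul dD).
have aQ : adm D predT x k Kq 0 (fun y => curv D G y N b N a).
  apply: (adm_ext Dx (f := fun y => \sum_l invmx (G y) a l * riem D G y [tuple N; b; N; l])) => [y Dy|].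
    rewrite -(nor_Qend N mG) // /Qend; apply: eq_bigr => l _.
    rewrite -[LHS](sum_delta_r (fun i => invmx (G y) a l * riem D G y [tuple i; b; N; l])) //.
    apply: eq_bigr => j _; rewrite -[LHS](sum_delta_r (fun k => invmx (G y) a l * riem D G y [tuple j; b; k; l] * (j == N)%:R)) //.
    by apply: eq_bigr => c _; rewrite /nor_xi; ring.
  rewrite /Kq; apply: adm_sum => // l; exact: adm_mul0.
have sCv : sm D (fun y => curv D G y N b N a) by exact: sm_curv.
rewrite (pds_add dD) // (pds_opp dD) //.
apply: le_trans (ler_normD _ _) _; rewrite normrN.
have := adm_boundP aS (all_predT s') s'k; have := adm_boundP aQ (all_predT s') s'k.
by move: Kp0 Kq0 C0; clear; move: Kp Kq `|_| `|_| => a1 a2 a3 a4; lra.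
Qed.

End CollarHigher.

(** * Constants and estimates of order zero in a collar *)

Section CollarBounds.
Variables (R : realType) (n : nat) (N : 'I_n) (HN : N.+1 = n).

(* Bounds at order zero, all depending only on a bound [C] for |R| and |l|: for the curvature and for
   the second fundamental form of the boundary, for the Weingarten map at the boundary and (after
   squaring) in the collar. *)
Definition bd_curv (C : R) : R := (n.-1 ^ 4)%:R * (C + 2 * C ^+ 2).
Definition bd_B (C : R) : R := n%:R * (3 * comp_cst n.-1 2 0 C).
Definition bd_C1 (C : R) : R := 3 * n%:R ^+ 3 * bd_B C ^+ 2.
Definition col_r1 (C : R) : R := (1 + 8 * (n.-1 ^ 4)%:R * bd_curv C)^-1.
Definition col_r2 (C : R) : R := (1 + (2 * (1 + (n ^ 4)%:R * C) + 6 * (1 + bd_C1 C)))^-1.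
Definition col_B (C : R) : R := 8 * (1 + bd_C1 C).

Lemma bd_curv_ge0 C : 0 <= C -> 0 <= bd_curv C.
Proof. by move=> C0; rewrite mulr_ge0 ?ler0n // addr_ge0 // mulr_ge0 // sqr_ge0. Qed.

Lemma bd_B_ge0 C : 0 <= C -> 0 <= bd_B C.
Proof. by move=> C0; rewrite mulr_ge0 ?ler0n // mulr_ge0 // comp_cst_ge0. Qed.

Lemma bd_C1_ge0 C : 0 <= C -> 0 <= bd_C1 C.
Proof. by move=> C0; rewrite mulr_ge0 ?sqr_ge0 // mulr_ge0 // exprn_ge0 // ler0n. Qed.

Lemma col_r1_gt0 C : 0 <= C -> 0 < col_r1 C.
Proof.
move=> C0; have h := bd_curv_ge0 C0; rewrite /col_r1 invr_gt0 ltr_pwDl //.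
by apply: mulr_ge0 h; rewrite mulr_ge0.
Qed.

Lemma col_r2_gt0 C : 0 <= C -> 0 < col_r2 C.
Proof.
move=> C0; have h := bd_C1_ge0 C0; rewrite /col_r2 invr_gt0.
have : 0 <= (n ^ 4)%:R * C by rewrite mulr_ge0.
move: h; move: (bd_C1 C) (_ * C) => a b; lra.
Qed.

Lemma small_time (A r t : R) : 0 <= A -> 0 <= t -> t < r -> r <= (1 + A)^-1 -> A * t <= 1 /\ r <= 1.
Proof.
move=> A0 t0 tr rA; have r1 : r * (1 + A) <= 1 by rewrite -ler_pdivlMr ?mul1r // ltr_pwDl.
have Ar : A * t <= A * r by rewrite ler_wpM2l // ltW.
have Ar0 : 0 <= A * t by rewrite mulr_ge0.
move: r1; rewrite mulrDr mulr1 [r * A]mulrC; lra.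
Qed.

Lemma esq_app (B : 'I_n -> 'I_n -> 'rV[R]_n -> R) v x b : 0 <= b -> (forall i j, `|B i j x| <= b) ->
  esq (app B v x) <= n%:R ^+ 3 * b ^+ 2 * esq v.
Proof.
move=> b0 Hb; have e0 := esq_ge0 v.
have cv j : `|v 0 j| <= Num.sqrt (esq v).
  by rewrite -sqrtr_sqr ler_sqrt //; exact: esq_coord.
have ca p : `|app B v x 0 p| <= n%:R * (b * Num.sqrt (esq v)).
  rewrite mxE; apply: le_trans (ler_norm_sum _ _ _) _; rewrite -sum_ord_const.
  by apply: ler_sum => j _; rewrite normrM; apply: ler_pM.
apply: (@le_trans _ _ (\sum_(p < n) (n%:R * (b * Num.sqrt (esq v))) ^+ 2)).
  apply: ler_sum => p _; rewrite -[X in X <= _]real_normK ?num_real // ler_pXn2r ?nnegrE //.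
  by rewrite !mulr_ge0 ?ler0n ?sqrtr_ge0.
rewrite sum_ord_const !exprMn sqr_sqrtr // exprS !mulrA //.
Qed.

Section Zero.
Variables (r1 r2 : R) (G : 'rV[R]_n -> 'M[R]_n) (C : R).
Notation D := (collar r1 r2 : set 'rV[R]_n).
Notation D0 := (eball r1 : set 'rV[R]_n.-1).
Notation H := (slice_met G).
Notation B := (nor_B D G N).
Hypotheses (r10 : 0 < r1) (r20 : 0 < r2) (C0 : 0 <= C).
Hypotheses (r1C : r1 <= col_r1 C) (r2C : r2 <= col_r2 C).
Hypotheses (mG : is_metric D G) (GN : forall x i, D x -> G x i N = (i == N)%:R).
Hypothesis H0 : H 0 = 1%:M.
Hypothesis Hxx : radial_chr D0 H.
Hypothesis HR : forall x, D x -> tnorm G (riem D G) x <= C.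
Hypothesis HL : forall u, D0 u -> tnorm H (sff D G) u <= C.

Let dD : dom D. Proof. exact: (collar_dom HN). Qed.
Let sD : slice D = D0. Proof. exact: (slice_collar N). Qed.

Lemma collar_slice_metric : is_metric D0 H.
Proof. by rewrite -sD; exact: (slice_metric HN). Qed.

Let ptD u : D0 u -> D (snoc u 0). Proof. by rewrite -sD. Qed.

Lemma bd_curvP u : D0 u -> tnorm H (riem D0 H) u <= bd_curv C.
Proof.
move=> Du; have := slice_curv_bound HN dD mG GN C0 (u := u); rewrite sD; apply=> //.
- by apply: HR; exact: ptD.
- exact: HL.
Qed.

Let r1s : r1 <= 1 /\ 8 * (n.-1 ^ 4)%:R * bd_curv C * r1 ^+ 2 <= 1.
Proof. by apply: small_radius => //; rewrite !mulr_ge0 ?ler0n // addr_ge0 // mulr_ge0 // sqr_ge0. Qed.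

Let rr : 8 * ((n.-1 ^ 4)%:R * bd_curv C * r1 ^+ 2) <= 1.
Proof. by case: r1s => _; rewrite (_ : 8 * (_ * _) = 8 * (n.-1 ^ 4)%:R * bd_curv C * r1 ^+ 2) //; ring. Qed.

Lemma bd_zero u : D0 u -> [/\ forall i j, `|H u i j| <= 2, forall i j, `|invmx (H u) i j| <= 3 &
  forall i j, `|rad_B r1 H i j u| <= 2 * (n.-1 ^ 4)%:R * bd_curv C * esq u].
Proof. exact: (radial_zero r10 collar_slice_metric H0 Hxx (bd_curv_ge0 C0) rr bd_curvP). Qed.

Lemma qf_pt u t v : D (snoc u t) -> qf (G (snoc u t)) v v =
  qf (\matrix_(i, j) G (snoc u t) (emb i) (emb j)) (front v) (front v) + v 0 N ^+ 2.
Proof.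
move=> Dx; rewrite !qfE (sum_emb _ HN); congr (_ + _).
  apply: eq_bigr => i _; rewrite (sum_emb _ HN) GN // (emb_N HN) mulr0 mul0r addr0.
  by apply: eq_bigr => j _; rewrite !mxE.
rewrite (sum_emb _ HN) GN // eqxx mulr1 expr2 big1 ?add0r // => j _.
by rewrite (GN' mG GN) // (emb_N HN) mulr0 mul0r.
Qed.

Lemma esq_front (v : 'rV[R]_n) : esq v = esq (front v) + v 0 N ^+ 2.
Proof. by rewrite /esq (sum_emb _ HN); congr (_ + _); apply: eq_bigr => i _; rewrite mxE. Qed.

Lemma bd_qf u v : D0 u -> `|qf (G (snoc u 0)) v v - esq v| <= esq v / 3.
Proof.
move=> Du; have [+ _] := radial_qf r10 collar_slice_metric H0 Hxx (bd_curv_ge0 C0) rr bd_curvP (front v) Du.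
rewrite (qf_pt v (ptD Du)) (esq_front v) => h.
have := sqr_ge0 (v 0 N); move: h; rewrite -/(slice_met G u) !ler_norml.
move: (qf _ _ _) (esq _) (v 0 N ^+ 2) => a b c; lra.
Qed.

Lemma bd_BP u i j : D0 u -> `|B i j (snoc u 0)| <= bd_B C.
Proof.
move=> Du; have Dx := ptD Du; have [h1 h2 _] := bd_zero Du.
have Du' : slice D u by rewrite sD.
have cl s : `|sff D G u s| <= comp_cst n.-1 2 0 C.
  have := @comp_cstP R n.-1 D0 H 2 (sff D G) 0 C u collar_slice_metric Du C0 (fun i => h1 i i).
  move=> /(_ _ 0 s (leqnn _)); apply=> a; rewrite leqn0 => /eqP ->; exact: HL.
have c0 : 0 <= comp_cst n.-1 2 0 C by exact: comp_cst_ge0.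
have iG a b : `|invmx (G (snoc u 0)) a b| <= 3.
  have o (x y : 'I_n) : `|(x == y)%:R : R| <= 3 by case: (x == y); rewrite ?normr0 ?normr1 //; lra.
  case: (emb_lastP HN a) => [->|[a' ->]]; last case: (emb_lastP HN b) => [->|[b' ->]].
  - by rewrite (imet_symE mG) // (imet_N mG GN).
  - by rewrite (imet_N mG GN).
  - by rewrite -(imet_slice HN dD mG GN).
have cC a b : `|christoffel D G (snoc u 0) N a b| <= comp_cst n.-1 2 0 C.
  case: (emb_lastP HN a) => [->|[a' ->]]; last case: (emb_lastP HN b) => [->|[b' ->]].
  - by rewrite (chr_sym mG) // (chr_NN' dD mG GN) // normr0.
  - by rewrite (chr_NN' dD mG GN) // normr0.
  - by have := cl [tuple a'; b']; rewrite (sff_chr HN mG GN) // !(tnth_nth a').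
rewrite /nor_B chrE /bd_B -sum_ord_const; apply: le_trans (ler_norm_sum _ _ _) _.
apply: ler_sum => l _; rewrite (chr1_N dD mG GN) // normrM; apply: ler_pM => //.
by have := cC j l; rewrite (chr_N dD mG GN) // normrN.
Qed.

(** [zero_collar] along the normal through x. Its initial data come from the boundary: the metric
    there is compared with the Euclidean one by the radial estimate, and B is bounded through l. *)
Lemma collar_zero x : D x -> [/\ forall i j, `|G x i j| <= 2, forall i j, `|invmx (G x) i j| <= 3 &
  forall i j, `|B i j x| <= col_B C].
Proof.
move=> Dx; have [u [tau [xE Du tI]]] := collarP Dx.
have [t0 t2] := andP tI.
have B0 := bd_B_ge0 C0; have C10 := bd_C1_ge0 C0.
have Dt t : 0 <= t <= tau -> D (snoc u t).
  by case/andP=> a b; apply/(collar_pt N); split=> //; rewrite a (le_lt_trans b).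
pose c := (n ^ 4)%:R * C; have c0 : 0 <= c by rewrite mulr_ge0 ?ler0n.
have FL := nor_flow dD mG GN (T := predT) (fun i => or_introl isT).
have pG t : 0 <= t <= tau -> posdef (G (snoc u t)) by move=> /Dt; case: mG => _ _; exact.
have sG t : 0 <= t <= tau -> (G (snoc u t))^T = G (snoc u t) by move=> /Dt; case: mG => _ + _; exact.
have [h1 h2] : 2 * tau * (1 + c) <= 1 /\ 6 * tau * (1 + bd_C1 C) <= 1.
  have c1 : 0 <= 2 * (1 + c) by rewrite mulr_ge0 // addr_ge0.
  have c2 : 0 <= 6 * (1 + bd_C1 C) by rewrite mulr_ge0 // addr_ge0.
  have [+ _] := small_time (addr_ge0 c1 c2) t0 t2 r2C.
  have := mulr_ge0 c1 t0; have := mulr_ge0 c2 t0.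
  rewrite mulrDl -![_ * (1 + _) * tau]mulrAC; lra.
(* Changing between g and the Euclidean norm on both sides costs 4/3 and 3/2, whose product 2 lies
   below the 3 in [bd_C1]. *)
have q0 v : let w := app B v (snoc u 0) in qf (G (snoc u 0)) w w <= bd_C1 C * qf (G (snoc u 0)) v v.
  move=> w; have hw := bd_qf w Du; have hv := bd_qf v Du.
  have ew := esq_app v B0 (fun i j => bd_BP i j Du); rewrite -/w in ew.
  rewrite /bd_C1; have n3 : 0 <= n%:R ^+ 3 * bd_B C ^+ 2 :> R by rewrite mulr_ge0 ?sqr_ge0 // exprn_ge0 // ler0n.
  rewrite -[3 * _ * _]mulrA -[3 * _ * _]mulrA; move: (n%:R ^+ 3 * bd_B C ^+ 2) n3 ew hw hv (esq_ge0 w) (esq_ge0 v) => K K0.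
  rewrite !ler_norml; move: (esq w) (esq v) (qf _ w w) (qf _ v v) => a b d e h3 /andP[_ h4] /andP[h5 _] a0 b0'.
  have : K * b <= K * (3 / 2 * e) by apply: ler_wpM2l => //; lra.
  lra.
have main v : `|qf (G x) v v - qf (G (snoc u 0)) v v| <= qf (G (snoc u 0)) v v / 3 /\
    qf (G x) (app B v x) (app B v x) <= 2 * (1 + bd_C1 C) * qf (G (snoc u 0)) v v.
  have sf : sm D (fun y => qf (G y) v v) by apply: (sm_qf dD mG) => p; exact: sm_cst.
  have sw p : sm D (fun y => app B v y 0 p) by exact: (sm_app dD FL).
  have sp : sm D (fun y => qf (G y) (app B v y) (app B v y)) by apply: (sm_qf dD mG).
  pose Qv y := \row_p \sum_j Qend D G (nor_xi N) p j y * v 0 j.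
  rewrite xE; apply: (@zero_collar R (fun t => qf (G (snoc u t)) v v)
    (fun t => pd D N (fun y => qf (G y) v v) (snoc u t))
    (fun t => qf (G (snoc u t)) (app B v (snoc u t)) (app B v (snoc u t)))
    (fun t => pd D N (fun y => qf (G y) (app B v y) (app B v y)) (snoc u t))
    (fun t => qf (G (snoc u t)) v (app B v (snoc u t)))
    (fun t => qf (G (snoc u t)) (app B v (snoc u t)) (Qv (snoc u t))) tau c (bd_C1 C) c0 C10 t0 h1 h2).
  - by move=> t tI'; exact: (isd_nor HN sf Du t2 tI').
  - by move=> t tI'; exact: (isd_nor HN sp Du t2 tI').
  - by move=> t tI'; rewrite -(along_nor D N); apply: (along_met dD mG FL); exact: Dt.
  - move=> t tI'; rewrite -(along_nor D N (fun y => qf (G y) (app B v y) (app B v y))).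
    by rewrite (along_app2 dD mG FL v (Dt _ tI')) mulr0 mul0r add0r.
  - by move=> t tI'; apply: qf_ge0; exact: pG.
  - by move=> t tI'; apply: qf_ge0; exact: pG.
  - by move=> t tI'; apply: qf_CS; [exact: sG|exact: pG].
  - move=> t tI'; have := qf_Q_bound (nor_xi N) mG v (app B v (snoc u t)) (Dt _ tI') (HR (Dt _ tI')).
    suff -> : qf (G (snoc u t)) (\row_i nor_xi N i (snoc u t)) (\row_i nor_xi N i (snoc u t)) = 1 by rewrite mulr1.
    have -> : \row_i nor_xi N i (snoc u t) = delta_mx 0 N by apply/rowP => i; rewrite !mxE eqxx.
    by rewrite qf_delta GN ?eqxx //; exact: Dt.
  - exact: q0.
  - by rewrite t0 lexx.
(* Two comparisons, each within one third: Euclidean form against g at the boundary point, and g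
   there against g at x. *)
have b v : esq v <= 9 / 4 * qf (G x) v v /\ qf (G x) v v <= 16 / 9 * esq v.
  have [+ _] := main v; have := bd_qf v Du; have := esq_ge0 v; rewrite !ler_norml.
  move: (qf (G x) v v) (qf _ _ _) (esq v) => a1 a2 a3 a30 /andP[h3 h4] /andP[h5 h6]; split; lra.
have sGx : (G x)^T = G x by case: mG => _ + _; exact.
have pGx : posdef (G x) by case: mG => _ _; exact.
split=> [i j|i j|i j].
- by apply: met_entry => // v; have [_ h] := b v; have := esq_ge0 v; lra.
- by apply: imet_entry => // v; have [h _] := b v; have := qf_ge0 v pGx; lra.
have [_ h] := main (delta_mx 0 j).
have [h3 _] := b (app B (delta_mx 0 j) x).
have := bd_qf (delta_mx 0 j) Du; rewrite esq_delta ler_norml => /andP[_ h4].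
have -> : B i j x = app B (delta_mx 0 j) x 0 i.
  rewrite mxE -[LHS](sum_delta_r (fun k => B i k x)); apply: eq_bigr => k _.
  by rewrite mxE eqxx.
have h5 := esq_coord (app B (delta_mx 0 j) x) i.
have cB : 0 <= col_B C by rewrite mulr_ge0 // addr_ge0.
rewrite -(ler_pXn2r (ltn0Sn 1)) ?nnegrE // real_normK ?num_real //.
(* The square of the entry is at most 9/4 times 2 (1 + C1) times 4/3, that is 6 (1 + C1), and this
   is below (8 (1 + C1))^2. *)
apply: le_trans h5 _; apply: le_trans h3 _; rewrite /col_B.
move: (bd_C1 C) C10 h => K K0 h.
have h6 : 2 * (1 + K) * qf (G (snoc u 0)) (delta_mx 0 j) (delta_mx 0 j) <= 2 * (1 + K) * (4 / 3).
  by apply: ler_wpM2l; [rewrite mulr_ge0 // addr_ge0|lra].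
have h7 : 1 * (1 + K) <= (1 + K) * (1 + K) by apply: ler_wpM2r; lra.
rewrite exprMn; lra.
Qed.

End Zero.

Lemma adm_tang2 (D : set 'rV[R]_n) (F : 'I_n -> 'I_n -> 'rV[R]_n -> R) u j K M :
  (forall a, adm D (@tang n) (snoc u 0) j K M (F a N)) -> (forall b, adm D (@tang n) (snoc u 0) j K M (F N b)) ->
  (forall a b, adm (slice D) predT u j K M (fun y => F (emb a) (emb b) (snoc y 0))) ->
  forall a b, adm D (@tang n) (snoc u 0) j K M (F a b).
Proof.
move=> H1 H2 H3 a b.
case: (emb_lastP HN a) => [->|[a' ->]]; last case: (emb_lastP HN b) => [->|[b' ->]].
- by [].
- by [].
- by apply/adm_slice.
Qed.

(** As in [gauss_bounds], the widths depend on [C0] only, and [C] enters the final bound alone. *)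
Lemma collar_bounds k C0 C : 0 <= C0 -> C0 <= C -> exists2 K, 0 <= K & forall r1 r2 G,
  0 < r1 -> 0 < r2 -> r1 <= col_r1 C0 -> r2 <= col_r2 C0 ->
  nor_hyp N r1 r2 G -> slice_met G 0 = 1%:M ->
  radial_chr (eball r1) (slice_met G) ->
  (forall x, collar r1 r2 x -> tnorm G (riem (collar r1 r2) G) x <= C0) ->
  (forall u, eball r1 u -> tnorm (slice_met G) (sff (collar r1 r2) G) u <= C0) ->
  (forall i x, (i <= k)%N -> collar r1 r2 x -> tnorm G (covDn (collar r1 r2) G (riem (collar r1 r2) G) i) x <= C) ->
  (forall i u, (i <= k)%N -> eball r1 u ->
     tnorm (slice_met G) (covDn (eball r1) (slice_met G) (sff (collar r1 r2) G) i) u <= C) ->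
  forall s x a b, collar r1 r2 x -> (size s <= k)%N ->
    `|pds (collar r1 r2) s (fun y => G y a b) x| <= K /\ `|pds (collar r1 r2) s (fun y => invmx (G y) a b) x| <= K.
Proof.
move=> C00 C0C; have C'0 : 0 <= C := le_trans C00 C0C.
pose Cm := comp_cst n 4 k C + comp_cst n.-1 2 k C.
have [cm1 cm2] := (comp_cst_ge0 n 4 k C'0, comp_cst_ge0 n.-1 2 k C'0).
have Cm0 : 0 <= Cm by rewrite addr_ge0.
have [f Hf] := choice_bound (@slice_ctl R n N HN).
pose Kc j K := f j (K + Cm).
have Kc0 j K : 0 <= K -> 0 <= Kc j K.
  by move=> K0; have [] := Hf j (K + Cm) (addr_ge0 K0 Cm0).
have bc0 := bd_curv_ge0 C00.
pose Ca := 3 + 2 * (n.-1 ^ 4)%:R * bd_curv C0; have m0 : 0 <= 2 * (n.-1 ^ 4)%:R * bd_curv C0.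
  by apply: mulr_ge0 => //; rewrite mulr_ge0 // ler0n.
have Ca0 : 0 <= Ca by rewrite addr_ge0.
have Ca3 : 3 <= Ca by rewrite lerDl.
have Ca2 : 2 <= Ca by apply: le_trans Ca3; rewrite ler_nat.
have [K1 K10 HK1] := radial_higher n.-1 k Ca0 Kc0.
pose K2 := K1 + 3 + Cm; have K20 : 0 <= K2 by rewrite !addr_ge0.
have K12 : K1 <= K2 by rewrite /K2 -addrA lerDl addr_ge0.
have K23 : 3 <= K2 by rewrite /K2 addrAC lerDr addr_ge0.
pose Kf := f k K2; have [Kf0 HKf] : 0 <= Kf /\ _ := Hf k K2 K20.
pose K3 := K1 + Kf + 3; have K30 : 0 <= K3 by rewrite !addr_ge0.
have Kf3 : Kf <= K3 by rewrite /K3 addrAC lerDr addr_ge0.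
have K33 : 3 <= K3 by rewrite lerDr addr_ge0.
have K32 : 2 <= K3 by apply: le_trans K33; rewrite ler_nat.
have K31 : 1 <= K3 by apply: le_trans K33; rewrite ler1n.
have [K4 K40 HK4] := adm_nor_B N k K30.
have cB0 : 0 <= col_B C0 by rewrite mulr_ge0 // addr_ge0 // bd_C1_ge0.
pose K5 := K3 + K4 + col_B C0 + Cm; have K50 : 0 <= K5 by rewrite !addr_ge0.
have K35 : K3 <= K5 by rewrite /K5 -addrA -addrA lerDl !addr_ge0.
have K45 : K4 <= K5 by rewrite /K5 -addrA -addrA addrCA lerDl !addr_ge0.
have B5 : col_B C0 <= K5 by rewrite /K5 addrAC lerDr !addr_ge0.
have Cm5 : Cm <= K5 by rewrite lerDr !addr_ge0.
have [K6 K60 HK6] := collar_tang HN k K50.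
have K560 : 0 <= K5 + K6 by rewrite addr_ge0.
have [K7 K70 HK7] := collar_all HN k K560.
have K73 : 0 <= K7 + 3 by rewrite addr_ge0.
have [K8 K80 HK8] := @adm_imet R n k (K7 + 3) K73.
exists (K7 + K8) => [|r1 r2 G r10 r20 r1C r2C [mG GN] H0 Hxx HR HL HRk HLk s x a b Dx sk]; first exact: addr_ge0.
set D := collar r1 r2 in mG GN HR HL HRk HLk Dx *; set D0 := eball r1 in Hxx HL HLk.
have dD : dom D by exact: (collar_dom HN).
have sD : slice D = D0 by exact: (slice_collar N).
have mH : is_metric D0 (slice_met G) by exact: (collar_slice_metric (r1 := r1) r20 mG).
have HZ := collar_zero r10 r20 C00 r1C r2C mG GN H0 Hxx HR HL.
have HB := bd_zero r10 r20 C00 r1C mG GN H0 Hxx HR HL.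
have r11 : r1 <= 1.
  by have [] := small_radius (mulr_ge0 (mulr_ge0 (ler0n _ 8) (ler0n _ _)) bc0) r10 r1C.
have r21 : r2 <= 1.
  have c0 : 0 <= 2 * (1 + (n ^ 4)%:R * C0) + 6 * (1 + bd_C1 C0).
    by rewrite addr_ge0 // mulr_ge0 // addr_ge0 // ?bd_C1_ge0 // mulr_ge0 // ler0n.
  by have [_] := small_time c0 (lexx 0) r20 r2C.
have FL := rad_flow mH H0 Hxx.
have cR y i t : D y -> (i <= k)%N -> `|covDn D G (riem D G) i y t| <= Cm.
  move=> Dy ik; have [h1 _ _] := HZ y Dy.
  apply: le_trans (comp_cstP mG Dy C'0 (fun l => h1 l l) (k := k) _ _ ik) _; last by rewrite lerDl.
  by move=> l lk; exact: HRk.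
have cL u i t : D0 u -> (i <= k)%N -> `|covDn D0 (slice_met G) (sff D G) i u t| <= Cm.
  move=> Du ik; have [h1 _ _] := HB u Du.
  apply: le_trans (comp_cstP mH Du C'0 (fun l => h1 l l) (k := k) _ _ ik) _; last by rewrite lerDr.
  by move=> l lk; exact: HLk.
have ptD u : D0 u -> D (snoc u 0) by rewrite -sD.
(* The boundary metric is in Gaussian coordinates of its own, so [radial_higher] applies in
   dimension n - 1. *)
have S1 := HK1 r1 (slice_met G) r10 r11 mH H0 Hxx.
have {}S1 : forall s u a b, D0 u -> (size s <= k)%N ->
    `|pds D0 s (fun y => slice_met G y a b) u| <= K1 /\ `|pds D0 s (rad_B r1 (slice_met G) a b) u| <= K1.
  apply: S1 => [u Du|u Du].
    have [h1 h2 h3] := HB u Du; split=> [i j|i j|i j].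
    - exact: le_trans (h1 i j) _.
    - exact: le_trans (h2 i j) _.
    - by apply: le_trans (h3 i j) _; apply: ler_wpM2r; [exact: esq_ge0|rewrite lerDr].
  move=> j K' M jk K'0 M0 jM aG aB aI t.
  have KC : K' <= K' + Cm by rewrite lerDl.
  have [_ h] := Hf j (K' + Cm) (addr_ge0 K'0 Cm0).
  have := h D G dD mG GN; rewrite sD => {}h.
  have [|||||h1 _] := h (rad_B r1 (slice_met G)) _ 1 1 u M FL Du M0 jM; last exact: h1.
  - by move=> p q; apply: (adm_le (K := K') (N := M)).
  - by move=> j0 p q; apply: (adm_le (K := K') (N := 0)) => //; exact: aB.
  - by move=> p q; apply: le_trans (aI p q) _.
  - by move=> i t' ij; apply: le_trans (cR _ i t' (ptD u Du) (leq_trans ij jk)) _; rewrite lerDr.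
  - by move=> i t' ij; apply: le_trans (cL u i t' Du (leq_trans ij jk)) _; rewrite lerDr.
have aL u : D0 u -> forall t, adm D0 predT u k Kf 0 (fun y => sff D G y t).
  move=> Du; have := HKf D G dD mG GN; rewrite sD => h.
  have [||||||_ //] := h (rad_B r1 (slice_met G)) _ 1 1 u 0 FL Du (lexx 0).
  - by [].
  - move=> p q; apply: adm_bound => s' _ s'k; have [h1 _] := S1 s' u p q Du s'k; exact: le_trans h1 _.
  - move=> j0 p q; apply: adm_bound => s' _ s'k.
    by have [_ h1] := S1 s' u p q Du (leq_trans s'k (leq_pred k)); exact: le_trans h1 _.
  - by move=> p q; have [_ h1 _] := HB u Du; exact: le_trans (h1 p q) K23.
  - by move=> i t' ij; apply: le_trans (cR _ i t' (ptD u Du) ij) _; rewrite lerDr addr_ge0.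
  - by move=> i t' ij; apply: le_trans (cL u i t' Du ij) _; rewrite lerDr addr_ge0.
have o (p q : 'I_n) : `|(p == q)%:R : R| <= K3 by case: (p == q); rewrite ?normr0 ?normr1.
(* Initial values for the normal flow: components with an index N are constant, the others are those
   of the boundary metric. *)
have aG u : D0 u -> forall p q, adm D (@tang n) (snoc u 0) k K3 0 (fun y => G y p q).
  move=> Du; have Dp := ptD u Du; apply: (adm_tang2 (F := fun p q y => G y p q)) => [p|q|p q].
  - by apply: (adm_ext Dp (f := fun=> (p == N)%:R)) => [y Dy|]; [rewrite GN|exact: adm_cst].
  - by apply: (adm_ext Dp (f := fun=> (q == N)%:R)) => [y Dy|]; [rewrite (GN' mG GN)|exact: adm_cst].
  - rewrite sD; apply: (adm_ext Du (f := fun y => slice_met G y p q)) => [y _|]; first by rewrite mxE.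
    apply: adm_bound => s' _ s'k; have [h1 _] := S1 s' u p q Du s'k; apply: le_trans h1 _.
    by rewrite /K3 -addrA lerDl addr_ge0.
have aC u : D0 u -> forall p q, adm D (@tang n) (snoc u 0) k K3 0 (fun y => christoffel D G y N p q).
  move=> Du; have Dp := ptD u Du; apply: (adm_tang2 (F := fun p q y => christoffel D G y N p q)) => [p|q|p q].
  - apply: (adm_ext Dp (f := fun=> 0)) => [y Dy|]; first by rewrite (chr_NN' dD mG GN).
    by apply: adm_cst => //; rewrite normr0.
  - apply: (adm_ext Dp (f := fun=> 0)) => [y Dy|]; first by rewrite (chr_sym mG) // (chr_NN' dD mG GN).
    by apply: adm_cst => //; rewrite normr0.
  - rewrite sD; apply: (adm_ext Du (f := fun y => sff D G y [tuple p; q])) => [y Dy|].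
      by rewrite (sff_chr HN mG GN) ?sD // !(tnth_nth p).
    apply: (adm_le (K := Kf) (N := 0)) => //; exact: aL.
have nh : nor_hyp N r1 r2 G by split.
have zh : zero_hyp N r1 r2 G k K5.
  move=> y Dy; have [h1 h2 h3] := HZ y Dy; split=> [p q|p q|p q|i t ik].
  - by exact: le_trans (h1 p q) (le_trans K32 K35).
  - by exact: le_trans (h2 p q) (le_trans K33 K35).
  - by exact: le_trans (h3 p q) B5.
  - by exact: le_trans (cR y i t Dy ik) Cm5.
have S2 := HK6 r1 r2 G r20 r21 nh zh.
have {}S2 : forall s x a b, D x -> all (@tang n) s -> (size s <= k)%N ->
    `|pds D s (fun y => G y a b) x| <= K6 /\ `|pds D s (nor_B D G N a b) x| <= K6.
  apply: S2 => u s' p q Du Ts s'k; have Dp := ptD u Du; split.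
    by exact: le_trans (adm_boundP (aG u Du p q) Ts s'k) K35.
  have aB : forall p q, adm D (@tang n) (snoc u 0) k K4 0 (nor_B D G N p q).
    apply: (HK4 D G dD mG GN (@tang n)) => // [p' q'||p' q']; [exact: aG| |exact: aC].
    by move=> p' q'; have [_ h _] := HZ _ Dp; exact: le_trans (h p' q') K33.
  by exact: le_trans (adm_boundP (aB p q) Ts s'k) K45.
have S3 := HK7 r1 r2 G nh.
have {}S3 : forall s x a b, D x -> (size s <= k)%N ->
    `|pds D s (fun y => G y a b) x| <= K7 /\ `|pds D s (nor_B D G N a b) x| <= K7.
  apply: S3 => [y Dy|s' y p q Dy Ts s'k].
    by have [h1 h2 h3 h4] := zh y Dy; split=> [p q|p q|p q|i t ik];
      [apply: le_trans (h1 p q) _|apply: le_trans (h2 p q) _|apply: le_trans (h3 p q) _|apply: le_trans (h4 i t ik) _];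
      rewrite lerDl.
  by have [h1 h2] := S2 s' y p q Dy Ts s'k; split; [apply: le_trans h1 _|apply: le_trans h2 _]; rewrite lerDr.
have [h1 _] := S3 s x a b Dx sk.
split; first by apply: le_trans h1 _; rewrite lerDl.
have [_ z2 _] := HZ x Dx.
have aI := HK8 D G predT x 0 dD mG Dx (lexx 0) (fun _ => erefl).
have {}aI : forall a b, adm D predT x k K8 0 (fun y => invmx (G y) a b).
  apply: aI => [p q|p q]; last by apply: le_trans (z2 p q) _; rewrite lerDr.
  apply: adm_bound => s' _ s'k; have [h _] := S3 s' x p q Dx s'k; apply: le_trans h _; by rewrite lerDl.
by apply: le_trans (adm_boundP (aI a b) (all_predT s) sk) _; rewrite lerDr.
Qed.

End CollarBounds.

(** * Charts and geodesics *)

Section RelOpen.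
Variables (R : realType) (n : nat).
Implicit Types (D : set 'rV[R]_n) (G : 'rV[R]_n -> 'M[R]_n) (f : 'rV[R]_n -> R).

(** Relative openness in metric form. The part of a coordinate domain that is mapped into a given
    chart is of this kind, and derivatives do not change on passing to it. *)
Definition relopen D D' := D' `<=` D /\
  forall x, D' x -> exists2 e : R, 0 < e & forall y, D y -> `|y - x| < e -> D' y.

Lemma relopen_dom D D' : dom D -> relopen D D' -> dom D'.
Proof.
move=> [H [U [oH oU DE]]] [sub ro].
pose V := [set y : 'rV[R]_n | exists x e, [/\ D' x, 0 < e, forall y, D y -> `|y - x| < e -> D' y & `|y - x| < e]].
exists H, (U `&` V); split=> //.
  apply: openI => //; rewrite openE => y [x [e [D'x e0 He yx]]].
  apply/nbhs_ballP; exists (e - `|y - x|) => /=; first by rewrite subr_gt0.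
  move=> z; rewrite -ball_normE /= distrC => zy; exists x, e; split=> //.
  rewrite -(subrKA y); apply: le_lt_trans (ler_normD _ _) _; rewrite -ltrBrDr //.
apply/seteqP; split=> x.
  move=> D'x; have := sub _ D'x; rewrite DE => -[Hx Ux]; split=> //; split=> //.
  by have [e e0 He] := ro _ D'x; exists x, e; rewrite subrr normr0.
by move=> [Hx [Ux [z [e [_ _ He xz]]]]]; apply: He => //; rewrite DE.
Qed.

Lemma pd_rel D D' f x i : relopen D D' -> D' x -> pd D i f x = pd D' i f x.
Proof.
move=> [sub ro] D'x; have [e e0 He] := ro _ D'x.
have [] // := @pd_loc R n D D' f f x e i e0 (sub _ D'x) _.
by move=> y yx; split=> //; split; [move=> Dy; exact: He|exact: sub].
Qed.

Lemma sm_rel D D' f : sm D f -> relopen D D' -> sm D' f.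
Proof. by move=> sf [sub ro]; exact: sm_sub sf sub ro. Qed.

Lemma sm_rel_loc D f : (forall x, D x -> exists D', [/\ relopen D D', D' x & sm D' f]) -> sm D f.
Proof.
move=> H; apply: sm_loc => x Dx; have [D' [[sub ro] D'x sf]] := H x Dx.
have [e e0 He] := ro _ D'x; exists e, D', f; split=> // y yx.
by split=> //; split; [move=> Dy; exact: He|exact: sub].
Qed.

Lemma relopenI D D1 D2 : relopen D D1 -> relopen D D2 -> relopen D (D1 `&` D2).
Proof.
move=> [s1 r1] [s2 r2]; split=> [x [/s1]//|x [/r1[e e0 He] /r2[e' e'0 He']]].
exists (Num.min e e') => [|y Dy]; first by rewrite lt_min e0.
by rewrite lt_min => /andP[h h']; split; [exact: He|exact: He'].
Qed.

Lemma relopen_sub D D' D'' : relopen D D'' -> D'' `<=` D' -> D' `<=` D -> relopen D' D''.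
Proof. by move=> [s r] s1 s2; split=> // x /r[e e0 He]; exists e => // y /s2; exact: He. Qed.

Lemma is_metric_rel D D' G : is_metric D G -> relopen D D' -> is_metric D' G.
Proof.
move=> [sG yG pG] ro; have [sub _] := ro; split=> [i j|x /sub|x /sub]; [exact: sm_rel ro|exact: yG|exact: pG].
Qed.

Lemma chr_rel D D' G x k i j : relopen D D' -> D' x -> christoffel D G x k i j = christoffel D' G x k i j.
Proof.
by move=> ro D'x; rewrite !chrE; apply: eq_bigr => l _; rewrite /chr1 !(pd_rel _ _ ro D'x).
Qed.

Lemma riem_rel D D' G x t : relopen D D' -> D' x -> riem D G x t = riem D' G x t.
Proof.
move=> ro D'x; apply: eq_bigr => p _; congr (_ * _).
rewrite /curv !(pd_rel _ _ ro D'x).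
have e a b c : (forall y, D' y -> christoffel D G y a b c = christoffel D' G y a b c).
  by move=> y Dy; exact: chr_rel.
have e1 i a b c : pd D' i (fun y => christoffel D G y a b c) x = pd D' i (fun y => christoffel D' G y a b c) x.
  by apply: pd_ext => // y; exact: e.
rewrite (e1 (tnth t 0)) (e1 (tnth t 1)); congr (_ + _).
by apply: eq_bigr => q _; rewrite !e.
Qed.

Lemma covD_rel D D' G k (T T' : tensor R n k) x s : relopen D D' -> (forall y t, D' y -> T y t = T' y t) ->
  D' x -> covD D G T x s = covD D' G T' x s.
Proof.
move=> ro TT D'x; rewrite /covD (pd_rel _ _ ro D'x); congr (_ - _); first by apply: pd_ext => // y; exact: TT.
apply: eq_bigr => l _; apply: eq_bigr => p _; by rewrite (chr_rel _ _ _ _ ro D'x) TT.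
Qed.

Lemma covDn_rel D D' G k (T T' : tensor R n k) i x s : relopen D D' -> (forall y t, D' y -> T y t = T' y t) ->
  D' x -> covDn D G T i x s = covDn D' G T' i x s.
Proof.
move=> ro TT; elim: i x s => [|i IH] x s D'x; first exact: TT.
by apply: covD_rel => // y t; exact: IH.
Qed.

Lemma eq_tnorm k G (T T' : tensor R n k) x : (forall t, T x t = T' x t) -> tnorm G T x = tnorm G T' x.
Proof.
by move=> E; congr (Num.sqrt _); apply: eq_bigr => s _; apply: eq_bigr => t _; rewrite !E.
Qed.

Lemma jac_rel D D' (F : 'rV[R]_n -> 'rV[R]_n) x : relopen D D' -> D' x -> jac D F x = jac D' F x.
Proof. by move=> ro D'x; apply/matrixP => i j; rewrite !mxE (pd_rel _ _ ro D'x). Qed.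

Lemma jac_ext p D (F F' : 'rV[R]_n -> 'rV[R]_p) x : (forall y, D y -> F y = F' y) -> D x -> jac D F x = jac D F' x.
Proof. by move=> E Dx; apply/matrixP => i j; rewrite !mxE; apply: pd_ext => // y Dy; rewrite E. Qed.

End RelOpen.

Section RelSlice.
Variables (R : realType) (n : nat).
Implicit Types (D : set 'rV[R]_n) (G : 'rV[R]_n -> 'M[R]_n).

Lemma relopen_slice D D' : relopen D D' -> relopen (slice D) (slice D').
Proof.
move=> [sub ro]; split=> [u|u D'u]; first exact: sub.
have [e e0 He] := ro _ D'u; exists e => // v Dv vu; apply: He => //.
exact: le_lt_trans (snoc_dist _ _ _) _.
Qed.

Lemma sff_rel D D' G u s : relopen D D' -> slice D' u -> sff D G u s = sff D' G u s.
Proof. by move=> ro D'u; apply: eq_bigr => k _; rewrite (chr_rel _ _ _ _ ro D'u). Qed.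

End RelSlice.

Section WithinOpen.
Variables (R : realType).

Lemma within_open (V : normedModType R) (Y : topologicalType) (A : set V) (f : V -> Y) x (U : set Y) :
  {within A, continuous f} -> A x -> open U -> U (f x) ->
  exists2 e : R, 0 < e & forall y, A y -> `|y - x| < e -> U (f y).
Proof.
move=> /subspace_continuousP Hf Ax oU Ux.
have := Hf x Ax U; rewrite nbhsE /= => H.
have : nbhs (f x) U by rewrite nbhsE; exists U.
move=> /(Hf x Ax); rewrite /= /within /= => /nbhs_ballP[e e0 He]; exists e => // y Ay yx.
by apply: (He y) => //; rewrite -ball_normE /= distrC.
Qed.

Lemma within_of_open (V : normedModType R) (Y : topologicalType) (A : set V) (f : V -> Y) :
  (forall x U, A x -> open U -> U (f x) -> exists2 e : R, 0 < e & forall y, A y -> `|y - x| < e -> U (f y)) ->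
  {within A, continuous f}.
Proof.
move=> H; apply/subspace_continuousP => x Ax W; rewrite nbhsE /= => -[U [oU Ux] UW].
have [e e0 He] := H x U Ax oU Ux.
apply/nbhs_ballP; exists e => // y; rewrite -ball_normE /= distrC => yx Ay; apply: UW; exact: He.
Qed.

Lemma open_rel n (A U : set 'rV[R]_n) : open U -> relopen A (A `&` U).
Proof.
move=> oU; split=> [x []//|x [Ax Ux]].
have := oU; rewrite openE => /(_ x Ux) /nbhs_ballP[e e0 He]; exists e => // y Ay yx; split=> //.
by apply: He; rewrite -ball_normE /= distrC.
Qed.

Lemma relopen_open n (A A' : set 'rV[R]_n) : relopen A A' -> exists2 U, open U & A' = A `&` U.
Proof.
move=> [sub ro].
pose V := [set y : 'rV[R]_n | exists x e, [/\ A' x, 0 < e, forall y, A y -> `|y - x| < e -> A' y & `|y - x| < e]].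
exists V.
  rewrite openE => y [x [e [D'x e0 He yx]]].
  apply/nbhs_ballP; exists (e - `|y - x|) => /=; first by rewrite subr_gt0.
  move=> z; rewrite -ball_normE /= distrC => zy; exists x, e; split=> //.
  rewrite -(subrKA y); apply: le_lt_trans (ler_normD _ _) _; rewrite -ltrBrDr //.
apply/seteqP; split=> x.
  move=> D'x; split; first exact: sub.
  by have [e e0 He] := ro _ D'x; exists x, e; rewrite subrr normr0.
by move=> [Hx [z [e [_ _ He xz]]]]; exact: He.
Qed.

End WithinOpen.

Section Nice.
Variables (R : realType) (n : nat).

(* Riemannian manifolds modelled on an orthant-like set [H] of R^n: a half space in the case of a
   manifold with boundary, the whole space in the case of the boundary itself. *)
Record nice (H : set 'rV[R]_n) (X : metric_chart_space R n) : Prop := Nice {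
  n_orth : orth H ;
  n_haus : hausdorff_space X ;
  n_open : forall a : chart X, open (chart_dom a) ;
  n_at : forall p : X, chart_dom (chart_at p) p ;
  n_inj : forall a : chart X, {in chart_dom a &, injective (chart_map a)} ;
  n_img : forall (a : chart X) (V : set X), open V -> V `<=` chart_dom a ->
    exists2 U : set 'rV[R]_n, open U & chart_map a @` V = H `&` U ;
  n_met : forall a : chart X, is_metric (chart_image a) (met a) ;
  n_trans : forall a b : chart X, let W := chart_dom a `&` chart_dom b in
    exists tau : 'rV[R]_n -> 'rV[R]_n,
    [/\ forall j, sm (chart_map a @` W) (fun x => tau x 0 j),
        forall p, W p -> tau (chart_map a p) = chart_map b p &
        forall p, W p ->
          let J := jac (chart_map a @` W) tau (chart_map a p) in
          met a (chart_map a p) = J *m met b (chart_map b p) *m J^T] }.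

Lemma nice_manifold (M : riemannian_manifold R n) : nice (@halfspace R n) M.
Proof.
split.
- exact: orth_half.
- exact: m_hausdorff.
- exact: m_dom_open.
- exact: m_chart_at.
- exact: m_coord_inj.
- exact: m_coord_open.
- move=> a; split=> [i j|x Dx|x Dx].
  + by apply/smP; exact: m_met_smooth.
  + exact: m_met_sym.
  + exact: m_met_pos.
- move=> a b; have [tau [h1 h2 h3]] := m_transition a b; exists tau; split=> // j.
  by apply/smP; exact: h1.
Qed.

Section Charts.
Variables (H : set 'rV[R]_n) (X : metric_chart_space R n) (nX : nice H X).

Lemma img_dom (a : chart X) V : open V -> V `<=` chart_dom a -> dom (chart_map a @` V).
Proof.
move=> oV sV; have [U oU ->] := n_img nX oV sV; exists H, U; split=> //; exact: n_orth nX.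
Qed.

Lemma img_relopen (a : chart X) V V' : open V -> open V' -> V' `<=` V -> V `<=` chart_dom a ->
  relopen (chart_map a @` V) (chart_map a @` V').
Proof.
move=> oV oV' sV sa; have [U oU E] := n_img nX oV sa.
have [U' oU' E'] := n_img nX oV' (subset_trans sV sa).
split; first exact: image_subset.
rewrite E E' => x [Hx U'x].
have := oU'; rewrite openE => /(_ x U'x) /nbhs_ballP[e e0 He]; exists e => // y [Hy _] yx; split=> //.
by apply: He; rewrite -ball_normE /= distrC.
Qed.

Lemma image_dom (a : chart X) : dom (chart_image a).
Proof. by apply: img_dom => //; exact: n_open nX a. Qed.

Lemma image_sub (a : chart X) : chart_image a `<=` H.
Proof.
have [U oU E] := n_img nX (n_open nX a) (@subset_refl _ (chart_dom a)).
by move=> x; rewrite /chart_image E => -[].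
Qed.

End Charts.
End Nice.

(** * Uniqueness and rescaling of geodesics *)

Section Geodesics.
Variables (R : realType) (n : nat) (H : set 'rV[R]_n) (X : metric_chart_space R n) (nX : nice H X).
Implicit Types (c : R -> X) (a : chart X).
Notation I01 := (@unit_interval R).
Notation cI c a := (I01 `&` c @^-1` chart_dom a).

Lemma I01E (t : R) : I01 t <-> 0 <= t <= 1.
Proof. by rewrite /unit_interval /= in_itv. Qed.

(** Slope 1 gives a shift of time, and offset 0 a change of speed. *)
Lemma isd_affine (S S' : set R) (f : R -> R) b s t l : isd S f (b + s * t) l ->
  (forall r, S' r -> S (b + s * r)) -> isd S' (fun r => f (b + s * r)) t (s * l).
Proof.
move=> /isdP Hf HS; apply/isdP => e e0; pose s' := 1 + `|s|.
have s'0 : 0 < s' by rewrite ltr_pwDl.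
have ss : `|s| <= s' by rewrite lerDr.
have [d d0 Hd] := Hf (e / s') (divr_gt0 e0 s'0).
exists (d / s') => [|h hd Sh]; first exact: divr_gt0.
have -> : b + s * (t + h) = b + s * t + s * h by ring.
have -> : s * l * h = l * (s * h) by ring.
have shd : `|s * h| < d.
  rewrite normrM; apply: le_lt_trans (ler_wpM2r (normr_ge0 h) ss) _.
  by rewrite mulrC -ltr_pdivlMr.
apply: le_trans (Hd _ shd _) _.
  by have := HS _ Sh; rewrite (_ : b + s * (t + h) = b + s * t + s * h) //; ring.
rewrite normrM mulrA ler_wpM2r // -mulrA ler_piMr ?(ltW e0) //.
by rewrite mulrC ler_pdivrMr // mul1r.
Qed.

Lemma geo_chart c a t : {within I01, continuous c} -> I01 t -> chart_dom a (c t) ->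
  exists2 d : R, 0 < d & forall s, I01 s -> `|s - t| < d -> chart_dom a (c s).
Proof. by move=> cc It ct; exact: (within_open cc It (n_open nX a) ct). Qed.

Lemma accum_I c a t : {within I01, continuous c} -> cI c a t -> accum (cI c a) t.
Proof.
move=> cc [It ct] d d0; have [d' d'0 Hd] := geo_chart cc It ct.
have t01 : 0 <= t <= 1 by apply/I01E.
have [|h [h0 hd h1]] := accum_itv ltr01 t01 (d := Num.min d d'); first by rewrite lt_min d0.
move: hd; rewrite lt_min => /andP[h2 h3]; exists h; split=> //; split; first by apply/I01E.
by apply: Hd; [apply/I01E|rewrite addrC addKr].
Qed.

Section Params.
Variables (c : R -> X) (gc : geodesic c) (a : chart X).
Let x (j : 'I_n) s := chart_map a (c s) 0 j.

Definition gvel j t := dwithin (cI c a) (fun s => chart_map a (c s) 0 j) t.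
Definition gacc k (y v : 'rV[R]_n) := - \sum_i \sum_j christoffel (chart_image a) (met a) y k i j * v 0 i * v 0 j.

Lemma isd_pos j t : cI c a t -> isd (cI c a) (fun s => chart_map a (c s) 0 j) t (gvel j t).
Proof. by move=> [It ct]; have [h _ _] := gc.2 a t It ct j; exact: dable_isd. Qed.

Lemma isd_vel k t : cI c a t -> isd (cI c a) (gvel k) t (gacc k (chart_map a (c t)) (\row_j gvel j t)).
Proof.
move=> [It ct]; have [_ h /eqP] := gc.2 a t It ct k; rewrite addr_eq0 => /eqP e.
have := dable_isd h; rewrite e; congr isd; rewrite /gacc; congr (- _).
by apply: eq_bigr => i _; apply: eq_bigr => j _; rewrite !mxE.
Qed.

End Params.

(** The geodesic acceleration is locally Lipschitz in position and velocity, with a common radius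
    for the finitely many Christoffel symbols. *)
Lemma gacc_lip a x0 (V : R) : chart_image a x0 -> 0 <= V -> exists L d, [/\ 0 < d, 0 <= L &
  forall (y y' v v' : 'rV[R]_n) mu k, chart_image a y -> chart_image a y' -> `|y - x0| < d -> `|y' - x0| < d ->
  (forall j, `|v 0 j| <= V) -> (forall j, `|v' 0 j| <= V) ->
  (forall j, `|y 0 j - y' 0 j| <= mu) -> (forall j, `|v 0 j - v' 0 j| <= mu) ->
  `|gacc a k y v - gacc a k y' v'| <= L * mu].
Proof.
move=> Dx V0; have dD := image_dom nX a; have mG := n_met nX a.
have sC k i j : sm (chart_image a) (fun y => christoffel (chart_image a) (met a) y k i j) by exact: sm_chr.
pose P (z : 'I_n * 'I_n * 'I_n) d := exists L, 0 <= L /\ forall y y', chart_image a y -> chart_image a y' ->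
  `|y - x0| < d -> `|y' - x0| < d ->
  `|christoffel (chart_image a) (met a) y z.1.1 z.1.2 z.2 - christoffel (chart_image a) (met a) y' z.1.1 z.1.2 z.2| <= L * `|y - y'|
  /\ `|christoffel (chart_image a) (met a) y z.1.1 z.1.2 z.2| <= L.
have [||d d0 Hd] := @fin_pos R _ P.
- move=> z d d' d'0 dd [L [L0 HL]]; exists L; split=> // y y' Dy Dy' yd yd'.
  by apply: HL => //; apply: lt_le_trans dd.
- move=> [[k i] j]; have [L [d [d0 L0 HL]]] := C1_lip dD (sm_C1 (sC k i j)) Dx.
  exists d => //; pose g y := christoffel (chart_image a) (met a) y k i j.
  exists (L + (`|g x0| + L * d)); split=> [|y y' Dy Dy' yd yd' /=].
    by rewrite !addr_ge0 // mulr_ge0 // ltW.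
  split.
    apply: le_trans (HL y y' Dy Dy' yd yd') _; apply: ler_wpM2r => //.
    by rewrite lerDl addr_ge0 // mulr_ge0 // ltW.
  have := HL y x0 Dy Dx yd; rewrite subrr normr0 => /(_ d0) h.
  have h2 : L * `|y - x0| <= L * d by rewrite ler_wpM2l // ltW.
  have h1 : `|g y| <= `|g x0| + `|g y - g x0| by rewrite -{1}(subrKC (g x0) (g y)); exact: ler_normD.
  move: h h1 h2; rewrite -/(g y) -/(g x0); move: `|_| `|_| `|_| => a1 a2 a3; lra.
have /choice[Lz HLz] := Hd; pose L := \sum_z Lz z.
have L0 : 0 <= L by apply: sumr_ge0 => z _; case: (HLz z).
have LzL z : Lz z <= L.
  by rewrite /L (bigD1 z) //= lerDl; apply: sumr_ge0 => w _; case: (HLz w).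
exists (n%:R * (n%:R * (L * V * V + L * V + L * V))), d; split=> // [|y y' v v' mu k Dy Dy' yd yd' vV v'V yy vv].
  by rewrite !mulr_ge0 ?ler0n // !addr_ge0 // !mulr_ge0.
rewrite /gacc opprK addrC distrC -sumrB -[leRHS]mulrA -[X in _ <= _ * X]mulrA.
have mu0 : 0 <= mu by apply: le_trans (yy k); exact: normr_ge0.
have ny : `|y - y'| <= mu by apply: rv_norm_le => // j; rewrite !mxE.
apply: le_trans (ler_norm_sum _ _ _) _; rewrite -sum_ord_const; apply: ler_sum => i _.
rewrite -sumrB; apply: le_trans (ler_norm_sum _ _ _) _; rewrite -sum_ord_const; apply: ler_sum => j _.
have [_ /(_ y y' Dy Dy' yd yd')[/= h1 h2]] := HLz (k, i, j).
have [_ /(_ y' y Dy' Dy yd' yd)[/= _ h3]] := HLz (k, i, j).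
have Lk := LzL (k, i, j).
move: (christoffel _ _ y k i j) (christoffel _ _ y' k i j) h1 h2 h3 => g g' h1 h2 h3.
have -> : g * v 0 i * v 0 j - g' * v' 0 i * v' 0 j =
  (g - g') * v 0 i * v 0 j + g' * (v 0 i - v' 0 i) * v 0 j + g' * v' 0 i * (v 0 j - v' 0 j) by ring.
have b1 : `|g - g'| <= L * mu.
  by apply: le_trans h1 _; apply: ler_pM => //; case: (HLz (k, i, j)).
have b2 : `|g'| <= L by exact: le_trans h3 _.
have c1 : `|(g - g') * v 0 i * v 0 j| <= L * mu * V * V by rewrite !normrM; do 2 (apply: ler_pM => //).
have c2 : `|g' * (v 0 i - v' 0 i) * v 0 j| <= L * mu * V by rewrite !normrM; do 2 (apply: ler_pM => //).
have c3 : `|g' * v' 0 i * (v 0 j - v' 0 j)| <= L * V * mu by rewrite !normrM; do 2 (apply: ler_pM => //).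
apply: le_trans (ler_normD _ _) _; rewrite [leRHS]mulrDl; apply: lerD; last exact: c3.
apply: le_trans (ler_normD _ _) _; rewrite [leRHS]mulrDl; apply: lerD.
  by apply: le_trans c1 _; rewrite le_eqVlt; apply/orP; left; apply/eqP; ring.
by apply: le_trans c2 _; rewrite mulrAC.
Qed.

(** Velocities are compared through the derivative from the left, on a short interval before t that
    stays in the chart and on which the curves agree. *)
Lemma vel_ext c c' a j t t0 : geodesic c -> geodesic c' -> 0 <= t0 -> t0 < t -> t <= 1 -> c t = c' t ->
  (forall s, t0 <= s <= t -> c s = c' s) -> chart_dom a (c t) -> gvel c a j t = gvel c' a j t.
Proof.
move=> gc gc' t00 tt t1 ct Hs at_.
have It : I01 t by apply/I01E; rewrite t1 (le_trans t00 (ltW tt)).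
have [d1 d10 Hd1] := geo_chart gc.1 It at_.
pose u := Num.max t0 (t - d1 / 2).
have ut : u < t by rewrite gt_max tt ltrBlDr ltrDl divr_gt0.
have uI s : u <= s <= t -> I01 s /\ chart_dom a (c s).
  rewrite ge_max => /andP[/andP[h1 h2] h3]; have Is : I01 s by apply/I01E; rewrite (le_trans t00 h1) (le_trans h3 t1).
  by split=> //; apply: Hd1 => //; rewrite ltr_norml; apply/andP; split; lra.
apply: (@isd_unique R [set s | u <= s <= t] (fun s => chart_map a (c s) 0 j) t).
- by apply: accum_itv; rewrite ?lexx ?(ltW ut).
- apply: (isd_sub _ (isd_pos gc (a := a) (j := j) (conj It at_))) => s /= /uI[Is as_]; by split.
- apply: (isd_ext (f := fun s => chart_map a (c' s) 0 j)) => [s /= /andP[h1 h2]||].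
  + by rewrite Hs // h2 andbT; apply: le_trans h1; rewrite le_max lexx.
  + by rewrite ct.
  + have at' : chart_dom a (c' t) by rewrite -ct.
    apply: (isd_sub _ (isd_pos gc' (a := a) (j := j) (conj It at'))) => s /= su; have [Is as_] := uI _ su; split=> //.
    rewrite /= -Hs //; case/andP: su => h1 ->; rewrite andbT; apply: le_trans h1.
    by rewrite le_max lexx.
Qed.

(** Uniqueness for the second order equation, as a Gronwall estimate for the differences of
    positions and velocities in one chart. *)
Lemma geo_local c c' a T : geodesic c -> geodesic c' -> 0 <= T -> T < 1 -> c T = c' T -> chart_dom a (c T) ->
  (forall j, gvel c a j T = gvel c' a j T) ->
  exists2 d : R, 0 < d & forall t, T <= t <= T + d -> t <= 1 /\ c t = c' t.
Proof.
move=> gc gc' T0 T1 cT aT Hv.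
have IT : I01 T by apply/I01E; rewrite T0 ltW.
have aT' : chart_dom a (c' T) by rewrite -cT.
have [d1 d10 Hd1] := geo_chart gc.1 IT aT.
have [d2 d20 Hd2] := geo_chart gc'.1 IT aT'.
pose x0 := chart_map a (c T).
pose V : R := \sum_j `|gvel c a j T| + 1.
have V0 : 0 <= V by rewrite addr_ge0 // sumr_ge0.
have Dx0 : chart_image a x0 by exists (c T).
have [L [d3 [d30 L0 HL]]] := gacc_lip Dx0 V0.
pose P (z : 'I_n) (d : R) := forall s, 0 <= s < d -> cI c a (T + s) -> cI c' a (T + s) ->
  [/\ `|chart_map a (c (T + s)) 0 z - x0 0 z| < d3, `|chart_map a (c' (T + s)) 0 z - x0 0 z| < d3,
      `|gvel c a z (T + s) - gvel c a z T| < 1 & `|gvel c' a z (T + s) - gvel c' a z T| < 1].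
have [||d4 d40 Hd4] := @fin_pos R _ P.
- move=> z d d' d'0 dd Hz s /andP[s0 sd]; apply: Hz; by rewrite s0 (lt_le_trans sd).
- move=> z.
  have [e1 e10 He1] := isd_cts (isd_pos gc (j := z) (conj IT aT)) d30.
  have [e2 e20 He2] := isd_cts (isd_pos gc' (j := z) (conj IT aT')) d30.
  have [e3 e30 He3] := isd_cts (isd_vel gc (k := z) (conj IT aT)) ltr01.
  have [e4 e40 He4] := isd_cts (isd_vel gc' (k := z) (conj IT aT')) ltr01.
  exists (Num.min (Num.min e1 e2) (Num.min e3 e4)) => [|s]; first by rewrite !lt_min e10 e20 e30.
  rewrite !lt_min => /andP[s0 /andP[/andP[h1 h2] /andP[h3 h4]]] Is Is'.
  rewrite -(ger0_norm s0) in h1 h2 h3 h4.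
  split; [exact: He1|rewrite /x0 cT; exact: He2|exact: He3|exact: He4].
pose d := Num.min (Num.min (d1 / 2) (d2 / 2)) (Num.min (d4 / 2) (1 - T)).
have dd0 : 0 < d by rewrite !lt_min !divr_gt0 //= subr_gt0.
have dle : [/\ d <= d1 / 2, d <= d2 / 2, d <= d4 / 2 & d <= 1 - T].
  have := lexx d; rewrite {2}/d !le_min => /andP[/andP[h1 h2] /andP[h3 h4]]; by split.
case: dle => dle1 dle2 dle3 dle4.
have half (e : R) : 0 < e -> d <= e / 2 -> d < e by move=> e0 de; apply: le_lt_trans de _; rewrite ltr_pdivrMr // ltr_pMr // ltr1n.
have [dd1 dd2 dd4] : [/\ d < d1, d < d2 & d < d4] by split; exact: half.
have sI s : 0 <= s <= d -> cI c a (T + s) /\ cI c' a (T + s).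
  move=> /andP[s0 sd]; have Is : I01 (T + s).
    by apply/I01E; rewrite addr_ge0 // -lerBrDl (le_trans sd).
  have [n1 n2] : `|T + s - T| < d1 /\ `|T + s - T| < d2.
    by rewrite addrC addKr ger0_norm //; split; exact: le_lt_trans sd _.
  by split; split=> //; [exact: Hd1|exact: Hd2].
have s4 s : 0 <= s <= d -> 0 <= s < d4 by move=> /andP[s0 sd]; rewrite s0 (le_lt_trans sd).
pose f (z : bool * 'I_n) s := if z.1 then chart_map a (c (T + 1 * s)) 0 z.2 - chart_map a (c' (T + 1 * s)) 0 z.2
  else gvel c a z.2 (T + 1 * s) - gvel c' a z.2 (T + 1 * s).
pose f' (z : bool * 'I_n) s := if z.1 then 1 * gvel c a z.2 (T + 1 * s) - 1 * gvel c' a z.2 (T + 1 * s)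
  else 1 * gacc a z.2 (chart_map a (c (T + 1 * s))) (\row_j gvel c a j (T + 1 * s)) -
       1 * gacc a z.2 (chart_map a (c' (T + 1 * s))) (\row_j gvel c' a j (T + 1 * s)).
have Hf z s : 0 <= s <= d -> isd (seg d) (f z) s (f' z s).
  move=> sd; have [i1 i2] := sI s sd; rewrite -[s in T + s]mul1r in i1 i2.
  have m1 r : seg d r -> cI c a (T + 1 * r) by move=> /sI[]; rewrite mul1r.
  have m2 r : seg d r -> cI c' a (T + 1 * r) by move=> /sI[]; rewrite mul1r.
  case: z => [[] z]; rewrite /f /f' /=; apply: isdB.
  - exact: (isd_affine (isd_pos gc (j := z) i1) m1).
  - exact: (isd_affine (isd_pos gc' (j := z) i2) m2).
  - exact: (isd_affine (isd_vel gc (k := z) i1) m1).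
  - exact: (isd_affine (isd_vel gc' (k := z) i2) m2).
have main z s : 0 <= s <= d -> f z s = 0.
  (* The differences vanish initially and their derivatives are at most (L + 1) mu: mu for the
     positions and L mu for the velocities. With K0 = K1 = 0 the bound of [ode_linear] is 0. *)
  move=> sd; have Lm : 0 <= L + 1 by rewrite addr_ge0.
  have := @ode_linear R _ f f' d 0 0 (L + 1) (ltW dd0) (lexx 0) (lexx 0) Lm Hf _ _ z s sd.
  rewrite addr0 mulr0 normr_le0 => h; apply/eqP; apply: h => [{}z {sd}s mu sd Hmu|{}z].
  - have [i1 i2] := sI s sd; have mu0 : 0 <= mu by apply: le_trans (Hmu z); exact: normr_ge0.
    have Lmu : 0 <= L * mu by rewrite mulr_ge0.
    case: z => [[] z]; rewrite add0r /f' /= !mul1r mulrDl mul1r.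
      by apply: le_trans (_ : mu <= _); [have := Hmu (false, z); rewrite /f /= mul1r|rewrite lerDr].
    apply: le_trans (_ : L * mu <= _); last by rewrite lerDl.
    have vb c1 : (forall j, `|gvel c1 a j (T + s) - gvel c1 a j T| < 1) -> (forall j, gvel c1 a j T = gvel c a j T) ->
        forall j, `|(\row_j gvel c1 a j (T + s)) 0 j| <= V.
      move=> h1 h2 j; rewrite mxE /V; have := h1 j; rewrite h2 => h3.
      rewrite (bigD1 j) //=; have : 0 <= \sum_(i < n | i != j) `|gvel c a i T| by apply: sumr_ge0.
      have : `|gvel c1 a j (T + s)| <= `|gvel c a j T| + `|gvel c1 a j (T + s) - gvel c a j T|.
        by rewrite -{1}(subrKC (gvel c a j T) (gvel c1 a j (T + s))); exact: ler_normD.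
      lra.
    apply: HL.
    + by exists (c (T + s)) => //; case: i1.
    + by exists (c' (T + s)) => //; case: i2.
    + by apply: rv_norm_lt => // j; rewrite !mxE; have [] := Hd4 j s (s4 s sd) i1 i2.
    + by apply: rv_norm_lt => // j; rewrite !mxE; have [] := Hd4 j s (s4 s sd) i1 i2.
    + by apply: vb => // j; have [] := Hd4 j s (s4 s sd) i1 i2.
    + by apply: vb => // j; have [] := Hd4 j s (s4 s sd) i1 i2.
    + by move=> j; have := Hmu (true, j); rewrite /f /= mul1r.
    + by move=> j; rewrite !mxE; have := Hmu (false, j); rewrite /f /= mul1r.
  - by case: z => [[] z]; rewrite /f /= mulr0 addr0 ?cT ?Hv subrr normr0.
exists d => // t /andP[t1 t2].
have td : 0 <= t - T <= d by rewrite subr_ge0 t1 lerBlDl.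
split; first by apply: le_trans t2 _; rewrite -lerBrDl.
have [i1 i2] := sI _ td; rewrite subrKC in i1 i2.
apply: (n_inj nX (a := a)); rewrite ?inE; [by case: i1|by case: i2|].
apply/rowP => j; have := main (true, j) _ td; rewrite /f /= mul1r subrKC => /eqP.
by rewrite subr_eq0 => /eqP.
Qed.

(** The supremum of the times up to which the curves agree is attained, because the space is
    Hausdorff, and it must be 1, because agreement extends by [geo_local]. *)
Lemma geo_unique c c' : geodesic c -> geodesic c' -> c 0 = c' 0 ->
  (forall j, gvel c (chart_at (c 0)) j 0 = gvel c' (chart_at (c 0)) j 0) ->
  forall t, 0 <= t <= 1 -> c t = c' t.
Proof.
move=> gc gc' c00 cv.
pose S := [set t : R | 0 <= t <= 1 /\ forall s, 0 <= s <= t -> c s = c' s].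
have S0 : S 0.
  by split=> [|s /andP[h1 h2]]; [rewrite lexx ler01|have -> : s = 0 by apply/eqP; rewrite eq_le h1 h2].
have hS : has_sup S by split; [exists 0|exists 1 => s [/andP[]]].
pose T := sup S.
have T0 : 0 <= T by exact: (ub_le_sup hS.2).
have T1 : T <= 1 by apply: ge_sup => [|s [/andP[]]] //; exists 0.
have below s : 0 <= s < T -> c s = c' s.
  move=> /andP[s0 sT].
  have [t [t01 Ht] st] : exists2 t, S t & s < t.
    have sT0 : 0 < T - s by rewrite subr_gt0.
    by have [t St h] := sup_adherent sT0 hS; exists t => //; rewrite subKr in h.
  by apply: Ht; rewrite s0 ltW.
have IT : I01 T by apply/I01E; rewrite T0.
have cT : c T = c' T.
  have [T00|Tn0] := eqVneq T 0; first by rewrite T00.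
  have Tp : 0 < T by rewrite lt_neqAle eq_sym Tn0.
  (* If the curves differed at T, disjoint neighbourhoods would separate them slightly before T,
     where they still agree. *)
  apply/eqP/negPn/negP => ne; have := n_haus nX; rewrite open_hausdorff => /(_ _ _ ne)[[U U'] /= [Uc Uc'] [oU oU' /eqP UU]].
  have [d d0 Hd] := within_open gc.1 IT oU (set_mem Uc).
  have [d' d'0 Hd'] := within_open gc'.1 IT oU' (set_mem Uc').
  pose mm := Num.min (Num.min (d / 2) (d' / 2)) T; pose s := T - mm.
  have m0 : 0 < mm by rewrite !lt_min !divr_gt0.
  have [m1 m2 m3] : [/\ mm <= d / 2, mm <= d' / 2 & mm <= T] by rewrite /mm !ge_min !lexx !orbT.
  have sI : I01 s by apply/I01E; apply/andP; split; rewrite /s; lra.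
  have cs : c s = c' s by apply: below; apply/andP; split; rewrite /s; lra.
  have n1 : `|s - T| = mm by rewrite /s addrAC subrr add0r normrN gtr0_norm.
  have h1 : U (c s) by apply: Hd => //; rewrite n1; lra.
  have h2 : U' (c s) by rewrite cs; apply: Hd' => //; rewrite n1; lra.
  by have : (U `&` U') (c s) by []; rewrite UU.
have upto s : 0 <= s <= T -> c s = c' s.
  by move=> /andP[s0]; rewrite le_eqVlt => /orP[/eqP ->//|sT]; apply: below; rewrite s0.
have T1e : T = 1.
  apply/eqP; rewrite eq_le T1 leNgt; apply/negP => T1'.
  have aT := n_at nX (c T).
  have Hv j : gvel c (chart_at (c T)) j T = gvel c' (chart_at (c T)) j T.
    have [T00|Tn0] := eqVneq T 0; first by rewrite T00 cv.
    have Tp : 0 < T by rewrite lt_neqAle eq_sym Tn0.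
    by apply: (@vel_ext c c' (chart_at (c T)) j T 0 gc gc').
  have [d d0 Hd] := geo_local gc gc' T0 T1' cT aT Hv.
  have : S (T + d).
    split; first by rewrite addr_ge0 ?(ltW d0) //; have [] := Hd (T + d); rewrite ?lexx ?lerDl ?(ltW d0).
    move=> s /andP[s0 s1]; have [sT|Ts] := leP s T; first by apply: upto; rewrite s0.
    by have [] := Hd s; rewrite ?s1 ?(ltW Ts).
  by move/(ub_le_sup hS.2); rewrite -/T gerDl leNgt d0.
by move=> t t01; apply: upto; rewrite T1e.
Qed.

Lemma isd_scale (S S' : set R) (f : R -> R) s t l : isd S f (s * t) l ->
  (forall r, S' r -> S (s * r)) -> isd S' (fun r => f (s * r)) t (s * l).
Proof.
move=> Hf HS; have E r : 0 + s * r = s * r by rewrite add0r.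
have Hf0 : isd S f (0 + s * t) l by rewrite E.
have := isd_affine Hf0 (S' := S'); under [fun r => f (0 + s * r)]eq_fun do rewrite E.
by apply=> r /HS; rewrite E.
Qed.

Section Scale.
Variables (c c1 : R -> X) (s : R).
Hypotheses (gc : geodesic c) (s01 : 0 <= s <= 1) (c1E : forall t, 0 <= t <= 1 -> c1 t = c (s * t)).

Let sI t : I01 t -> I01 (s * t).
Proof.
case/andP: s01 => s0 s1 /I01E/andP[t0 t1]; apply/I01E; by rewrite mulr_ge0 // -[1]mul1r ler_pM.
Qed.

Let c1I t : I01 t -> c1 t = c (s * t). Proof. by move/I01E; exact: c1E. Qed.

Let gc1 : {within I01, continuous c1}.
Proof.
apply: within_of_open => t U It oU; rewrite c1I // => Ut.
have [d d0 Hd] := within_open gc.1 (sI It) oU Ut.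
exists d => // t' It' td; rewrite c1I //; apply: Hd; first exact: sI.
rewrite -mulrBr normrM; apply: le_lt_trans td; case/andP: s01 => s0 s1.
by rewrite ler_piMl // ger0_norm.
Qed.

Let II a r : cI c1 a r -> cI c a (s * r).
Proof. by move=> [Ir h]; split; [exact: sI|rewrite /= -c1I]. Qed.

Let isd1 a (f : X -> R) r l : cI c1 a r -> isd (cI c a) (fun q => f (c q)) (s * r) l ->
  isd (cI c1 a) (fun q => f (c1 q)) r (s * l).
Proof.
move=> Ir Hf; apply: (isd_ext (f := fun q => f (c (s * q)))) => [q [Iq _]||].
- by rewrite c1I.
- by rewrite c1I //; case: Ir.
- exact: (isd_scale (f := fun q => f (c q)) Hf (@II a)).
Qed.

Lemma scale_vel a j r : cI c1 a r -> isd (cI c1 a) (fun q => chart_map a (c1 q) 0 j) r (s * gvel c a j (s * r)).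
Proof. by move=> Ir; apply: (isd1 (f := fun p => chart_map a p 0 j) Ir); apply: isd_pos => //; exact: II. Qed.

Lemma gvel_scale a j r : cI c1 a r -> gvel c1 a j r = s * gvel c a j (s * r).
Proof. by move=> Ir; apply: isd_dwithin (scale_vel Ir); exact: accum_I. Qed.

(** Acceleration and the quadratic term both scale with s^2. The case s = 1 shows that only values
    on the unit interval matter ([geodesic_ext]). *)
Lemma geo_scale : geodesic c1.
Proof.
split=> // a t It ct I x k; rewrite /x /I.
have Ic : cI c1 a t by [].
have acc : accum (cI c1 a) t by exact: accum_I.
have p2 : isd (cI c1 a) (gvel c1 a k) t (s * (s * gacc a k (chart_map a (c (s * t))) (\row_j gvel c a j (s * t)))).
  apply: (isd_ext (f := fun r => s * gvel c a k (s * r))) => [q Iq||].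
  - by rewrite gvel_scale.
  - by rewrite gvel_scale.
  apply: isdZ; apply: (isd_scale (f := fun r => gvel c a k r)) (@II a).
  by apply: isd_vel => //; exact: II.
split; [exact: isd_dable (scale_vel Ic)|exact: isd_dable p2|].
rewrite (isd_dwithin acc p2) /gacc.
rewrite mulrN mulrN addrC; apply/eqP; rewrite subr_eq0; apply/eqP.
rewrite !mulr_sumr; apply: eq_bigr => i _; rewrite !mulr_sumr; apply: eq_bigr => j _.
rewrite -/(gvel c1 a i t) -/(gvel c1 a j t) !gvel_scale // !mxE c1I //; ring.
Qed.

End Scale.

Lemma geodesic_ext c c' : (forall t, 0 <= t <= 1 -> c' t = c t) -> geodesic c -> geodesic c'.
Proof.
move=> E gc; apply: (geo_scale (s := 1) gc) => [|t t01]; first by rewrite ler01 lexx.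
by rewrite mul1r E.
Qed.

Lemma I0 : I01 0. Proof. by apply/I01E; rewrite lexx ler01. Qed.

Lemma exp_unique (p q q' : X) v : is_exp p v q -> is_exp p v q' -> q = q'.
Proof.
move=> [c [gc c0 <- cv]] [c' [gc' c0' <- cv']].
apply: (geo_unique gc gc'); rewrite ?lexx ?ler01 ?c0 ?c0' // => j.
by rewrite /gvel cv cv'.
Qed.

Lemma exp_scale (c : R -> X) p (v : 'rV[R]_n) s : geodesic c -> c 0 = p ->
  (forall j, gvel c (chart_at p) j 0 = v 0 j) -> 0 <= s <= 1 -> is_exp p (s *: v) (c s).
Proof.
move=> gc c0 cv s01; exists (fun t => c (s * t)).
have gs : geodesic (fun t => c (s * t)) by exact: (geo_scale gc s01).
split; rewrite ?mulr0 ?mulr1 // => a j.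
have Ia : cI (fun t => c (s * t)) a 0 by split; [exact: I0|rewrite /= mulr0 c0; exact: n_at nX p].
have := gvel_scale gc s01 (c1 := fun t => c (s * t)) (fun t _ => erefl) j Ia.
by rewrite mulr0 cv mxE.
Qed.

Lemma exp_geo (p : X) v q : is_exp p v q -> exists2 c, geodesic c & [/\ c 0 = p, c 1 = q,
  forall j, gvel c (chart_at p) j 0 = v 0 j & forall s, 0 <= s <= 1 -> is_exp p (s *: v) (c s)].
Proof.
by move=> [c [gc c0 c1 cv]]; exists c => //; split=> // s s01; exact: exp_scale.
Qed.

Lemma const_geodesic (p : X) : geodesic (fun=> p).
Proof.
split; first by apply: within_of_open => t U It oU Ut; exists 1.
move=> a t It ct I x k.
have IE : I = I01 by apply/seteqP; split=> [s []|s Is].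
have acc s : I01 s -> accum I s.
  by move/I01E => h; rewrite IE => d d0; have [h0 [h1 h2 h3]] := accum_itv ltr01 h d0; exists h0; split=> //; apply/I01E.
have d0 j s : I01 s -> dwithin I (x j) s = 0 by move=> Is; apply: isd_dwithin; [exact: acc|exact: isd_cst].
have p2 : isd I (dwithin I (x k)) t 0.
  apply: (isd_ext (f := fun=> 0)) (isd_cst _ _ _) => [s|]; last by rewrite d0.
  by move=> Is; rewrite d0 // -IE.
split; [exact: isd_dable (isd_cst _ _ _)|exact: isd_dable p2|].
rewrite (isd_dwithin (acc _ It) p2) add0r big1 // => i _; rewrite big1 // => j _.
by rewrite d0 // mulr0 mul0r.
Qed.

Lemma exp_const (p : X) : is_exp p 0 p.
Proof.
exists (fun=> p); split=> // [|a j]; first exact: const_geodesic.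
rewrite mxE; apply: isd_dwithin; last exact: isd_cst.
apply: (accum_I (const_geodesic p).1 (c := fun=> p)); split; [exact: I0|exact: n_at nX p].
Qed.

(** A chart is only known to be an exponential point by point, and each point comes with its own
    geodesic. Uniqueness of the exponential identifies the image of the whole ray with a single
    one. *)
Lemma ray_geodesic (D : set 'rV[R]_n) (kap : 'rV[R]_n -> X) (p : X) (E : 'M[R]_n) v :
  (forall w s, D w -> 0 <= s <= 1 -> D (s *: w)) -> (forall w, D w -> is_exp p (w *m E) (kap w)) -> D v ->
  [/\ geodesic (fun s => kap (s *: v)), kap 0 = p &
    forall j, gvel (fun s => kap (s *: v)) (chart_at p) j 0 = (v *m E) 0 j].
Proof.
move=> star ex Dv; have [c gc [c0 c1 cv Hs]] := exp_geo (ex v Dv).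
have cE s : 0 <= s <= 1 -> kap (s *: v) = c s.
  move=> s01; apply: exp_unique (Hs s s01); rewrite scalemxAl; apply: ex; exact: star.
have cE1 s : 0 <= s <= 1 -> kap (s *: v) = c (1 * s) by move=> s01; rewrite mul1r; exact: cE.
have s1 : 0 <= (1 : R) <= 1 by rewrite ler01 lexx.
have k0 : kap 0 = p by rewrite -(scale0r v) cE ?lexx ?ler01.
split=> //; first exact: (geodesic_ext cE gc).
move=> j; rewrite (gvel_scale gc s1 cE1) ?mul1r ?mulr0 ?cv //.
by split; [exact: I0|rewrite /= scale0r k0; exact: n_at nX p].
Qed.

End Geodesics.

(** * Coordinates on a manifold as isometries *)

Section Isometries.
Variables (R : realType) (n : nat) (H : set 'rV[R]_n) (X : metric_chart_space R n) (nX : nice H X).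
Implicit Types (D : set 'rV[R]_n) (G : 'rV[R]_n -> 'M[R]_n) (kap : 'rV[R]_n -> X) (a b : chart X).

Definition dsub D kap a : set 'rV[R]_n := D `&` kap @^-1` chart_dom a.
Definition crd kap a (y : 'rV[R]_n) : 'rV[R]_n := chart_map a (kap y).

(** A smooth parametrization in which [G] is the pulled back metric, tested in every chart on the
    part of D it covers. No injectivity is included: the invariance of norms and the geodesic
    equation are local. *)
Record isom D G kap : Prop := Isom {
  i_dom : dom D ;
  i_met : is_metric D G ;
  i_rel : forall a, relopen D (dsub D kap a) ;
  i_sm : forall a j, sm (dsub D kap a) (fun y => crd kap a y 0 j) ;
  i_law : forall a x, dsub D kap a x -> G x = jac (dsub D kap a) (crd kap a) x *m
    met a (crd kap a x) *m (jac (dsub D kap a) (crd kap a) x)^T }.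

Lemma jac_comp p D (D' : set 'rV[R]_p) (F1 : 'rV[R]_n -> 'rV[R]_p) (F2 : 'rV[R]_p -> 'rV[R]_n) x :
  dom D -> dom D' -> (forall y, D y -> D' (F1 y)) -> (forall j, sm D (fun y => F1 y 0 j)) ->
  (forall j, sm D' (fun y => F2 y 0 j)) -> D x ->
  jac D (fun y => F2 (F1 y)) x = jac D F1 x *m jac D' F2 (F1 x).
Proof.
move=> dD dD' DD s1 s2 Dx; apply/matrixP => i j; rewrite !mxE.
rewrite (pd_comp dD (f := fun y => F2 y 0 j) i dD' DD s1 (s2 j) Dx).
by apply: eq_bigr => l _; rewrite !mxE mulrC.
Qed.

Section Isom.
Variables (D : set 'rV[R]_n) (G : 'rV[R]_n -> 'M[R]_n) (kap : 'rV[R]_n -> X) (iK : isom D G kap).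
Notation Ds := (dsub D kap).
Notation cr := (crd kap).

Lemma isom_dsub a : dom (Ds a). Proof. exact: relopen_dom (i_dom iK) (i_rel iK a). Qed.
Lemma isom_metric a : is_metric (Ds a) G. Proof. exact: is_metric_rel (i_met iK) (i_rel iK a). Qed.
Lemma isom_into a x : Ds a x -> chart_image a (cr a x). Proof. by move=> [_ h]; exists (kap x). Qed.
Lemma isom_at x : D x -> Ds (chart_at (kap x)) x. Proof. by move=> Dx; split=> //; exact: n_at nX _. Qed.

Lemma isom_jac a x : Ds a x -> jac (Ds a) (cr a) x \in unitmx.
Proof. move=> Dx; exact: (jac_unit (isom_metric a) (@i_law _ _ _ iK a) Dx). Qed.

Lemma isom_norm i x : D x -> tnorm G (covDn D G (riem D G) i) x = norm_nabla_riem i (kap x).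
Proof.
move=> Dx; set a := chart_at (kap x); have Dax := isom_at Dx.
have := norm_riem_nat (isom_dsub a) (image_dom nX a) (isom_metric a) (n_met nX a) (@isom_into a)
  (i_sm iK a) (@i_law _ _ _ iK a) i Dax.
rewrite /norm_nabla_riem -/a => <-; apply: eq_tnorm => t.
apply: covDn_rel (i_rel iK a) _ Dax => y s Dy; exact: riem_rel (i_rel iK a) Dy.
Qed.

Section Line.
Variables (z w : 'rV[R]_n).
Hypothesis Dl : forall s, 0 <= s <= 1 -> D (z + s *: w).
Let c s := kap (z + s *: w).
Hypothesis gc : geodesic c.

Let isd_line a f t : sm (Ds a) f -> (@unit_interval R `&` c @^-1` chart_dom a) t ->
  isd (@unit_interval R `&` c @^-1` chart_dom a) (fun s => f (z + s *: w)) t (\sum_i pd (Ds a) i f (z + t *: w) * w 0 i).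
Proof.
move=> sf [It ct]; have D1 s : (@unit_interval R `&` c @^-1` chart_dom a) s -> Ds a (z + s *: w).
  by move=> [/I01E Is cs]; split=> //; exact: Dl.
apply: (isd_curve (c := fun s => z + s *: w) (isom_dsub a) sf D1); first exact: D1.
move=> i; apply: (isd_ext (f := fun s => z 0 i + w 0 i * s)) => [s _||]; rewrite ?mxE; try by rewrite mulrC.
have := isdD (isd_cst (@unit_interval R `&` c @^-1` chart_dom a) (z 0 i) t)
  (isdZ (c := w 0 i) (isd_id (@unit_interval R `&` c @^-1` chart_dom a) t)).
by rewrite add0r mulr1.
Qed.

Lemma isom_vel a t j : (@unit_interval R `&` c @^-1` chart_dom a) t ->
  gvel c a j t = (w *m jac (Ds a) (cr a) (z + t *: w)) 0 j.
Proof.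
move=> It; apply: isd_dwithin; first exact: (accum_I nX gc.1 It).
have := isd_line (i_sm iK a j) It; rewrite mxE; congr isd; apply: eq_bigr => i _.
by rewrite !mxE mulrC.
Qed.

(** The acceleration of the straight line is pushed forward by the invertible Jacobian. By [chr_nat]
    the result is the left side of the geodesic equation in a chart, which vanishes. *)
Lemma isom_geo t k : 0 <= t <= 1 -> \sum_i \sum_j christoffel D G (z + t *: w) k i j * (w 0 i * w 0 j) = 0.
Proof.
move=> t01; have Dt := Dl t01; set x := z + t *: w in Dt *.
pose a := chart_at (kap x); have Dax := isom_at Dt; have ro := i_rel iK a.
have It : (@unit_interval R `&` c @^-1` chart_dom a) t by split; [exact/I01E|case: Dax].
have sd i j : sm (Ds a) (pd (Ds a) i (fun y => cr a y 0 j)) by apply: sm_pd; exact: (i_sm iK).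
pose Vf j y := \sum_i pd (Ds a) i (fun y => cr a y 0 j) y * w 0 i.
have dDa := isom_dsub a.
have sV1 i j : sm (Ds a) (fun y => pd (Ds a) i (fun y => cr a y 0 j) y * w 0 i).
  by apply: (sm_mul dDa) => //; exact: sm_cst.
have sV j : sm (Ds a) (Vf j) by exact: (sm_sum dDa).
have VE j s : (@unit_interval R `&` c @^-1` chart_dom a) s -> gvel c a j s = Vf j (z + s *: w).
  by move=> Is; rewrite isom_vel // mxE; apply: eq_bigr => i _; rewrite !mxE mulrC.
have acc : forall j, \sum_l pd (Ds a) l (Vf j) x * w 0 l +
    \sum_p \sum_q christoffel (chart_image a) (met a) (cr a x) j p q * Vf p x * Vf q x = 0.
  move=> j; have [_ _] := gc.2 a t It.1 It.2 j.
  have -> : dwithin (@unit_interval R `&` c @^-1` chart_dom a)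
     (dwithin (@unit_interval R `&` c @^-1` chart_dom a) (fun s => chart_map a (c s) 0 j)) t = \sum_l pd (Ds a) l (Vf j) x * w 0 l.
    apply: isd_dwithin; first exact: (accum_I nX gc.1 It).
    apply: (isd_ext (f := fun s => Vf j (z + s *: w))) => [s Is||]; rewrite -?VE //.
    exact: isd_line.
  move=> Hc; apply: etrans Hc; congr (_ + _); apply: eq_bigr => p _; apply: eq_bigr => q _.
  by rewrite -/(gvel c a p t) -/(gvel c a q t) !VE.
pose u : 'rV[R]_n := \row_k \sum_i \sum_j christoffel D G x k i j * (w 0 i * w 0 j).
suff u0 : u = 0 by have := congr1 (fun m : 'rV[R]_n => m 0 k) u0; rewrite !mxE.
suff uJ : u *m jac (Ds a) (cr a) x = 0.
  by rewrite -[u]mulmx1 -(mulmxV (isom_jac Dax)) mulmxA uJ mul0mx.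
apply/rowP => s; rewrite !mxE -[RHS](acc s).
have nat i j := chr_nat dDa (image_dom nX a) (isom_metric a) (n_met nX a) (@isom_into a)
  (i_sm iK a) (@i_law _ _ _ iK a) i j s Dax.
transitivity (\sum_i \sum_j (\sum_k christoffel (Ds a) G x k i j * pd (Ds a) k (fun y => cr a y 0 s) x) * (w 0 i * w 0 j)).
  transitivity (\sum_k \sum_i \sum_j christoffel (Ds a) G x k i j * pd (Ds a) k (fun y => cr a y 0 s) x * (w 0 i * w 0 j)).
    apply: eq_bigr => l _; rewrite !mxE mulr_suml; apply: eq_bigr => i _; rewrite mulr_suml; apply: eq_bigr => j _.
    by rewrite (chr_rel _ _ _ _ ro Dax) mulrAC.
  exch => i _; exch => j _.
  by rewrite mulr_suml.
under eq_bigr do under eq_bigr do rewrite nat mulrDl.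
transitivity (\sum_i \sum_j pd (Ds a) i (pd (Ds a) j (fun y => cr a y 0 s)) x * (w 0 i * w 0 j) +
  \sum_i \sum_j (\sum_p \sum_q pd (Ds a) i (fun y => cr a y 0 p) x * pd (Ds a) j (fun y => cr a y 0 q) x *
     christoffel (chart_image a) (met a) (cr a x) s p q) * (w 0 i * w 0 j)).
  by rewrite -big_split /=; apply: eq_bigr => i _; rewrite -big_split.
congr (_ + _).
  apply: eq_bigr => i _; rewrite (pd_sum dDa) // mulr_suml; apply: eq_bigr => j _.
  have -> : pd (Ds a) i (fun y => pd (Ds a) j (fun y => cr a y 0 s) y * w 0 j) x =
     w 0 j * pd (Ds a) i (pd (Ds a) j (fun y => cr a y 0 s)) x.
    by rewrite -(pd_scale dDa) //; apply: pd_ext => // y _; rewrite mulrC.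
  gring.
transitivity (\sum_p \sum_q \sum_i \sum_j christoffel (chart_image a) (met a) (cr a x) s p q *
  (pd (Ds a) i (fun y => cr a y 0 p) x * w 0 i) * (pd (Ds a) j (fun y => cr a y 0 q) x * w 0 j)).
  transitivity (\sum_i \sum_p \sum_q \sum_j christoffel (chart_image a) (met a) (cr a x) s p q *
  (pd (Ds a) i (fun y => cr a y 0 p) x * w 0 i) * (pd (Ds a) j (fun y => cr a y 0 q) x * w 0 j)).
    apply: eq_bigr => i _; under eq_bigr do rewrite mulr_suml.
    exch => p _; under eq_bigr do rewrite mulr_suml.
    exch => q _; apply: eq_bigr => j _.
    move: (christoffel _ _ _ _ _ _) => g; gring.
  exch => p _; exact: exchange_big.
apply: eq_bigr => p _; apply: eq_bigr => q _.
rewrite -mulrA /Vf big_distrlr /= mulr_sumr; apply: eq_bigr => i _; rewrite mulr_sumr; apply: eq_bigr => j _.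
by rewrite -!mulrA.
Qed.

End Line.
End Isom.

Lemma imgid T (A : set T) : id @` A = A.
Proof. by apply/seteqP; split=> [x [y Ay <-]//|x Ax]; exists x. Qed.

Section Diffeo.
Variables (D : set 'rV[R]_n) (kap : 'rV[R]_n -> X) (dD : dom D).
Hypothesis dK : diffeo_on (X := euclid R n) D kap.

Lemma diffeo_rel a : relopen D (dsub D kap a).
Proof.
split=> [x []//|x [Dx ax]]; case: dK => _ cK _ _.
have [e e0 He] := within_open cK Dx (n_open nX a) ax.
by exists e => // y Dy yx; split=> //; exact: He.
Qed.

Lemma diffeo_sm a : (forall j, sm (dsub D kap a) (fun y => crd kap a y 0 j)) /\
  exists F' : 'rV[R]_n -> 'rV[R]_n, (forall j, sm (chart_map a @` (kap @` dsub D kap a)) (fun y => F' y 0 j)) /\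
    forall x, dsub D kap a x -> F' (crd kap a x) = x.
Proof.
case: dK => _ _ _ /(_ (tt : chart (euclid R n)) a) /=.
have -> : D `&` setT `&` kap @^-1` chart_dom a = dsub D kap a by rewrite setIT.
move=> [F [F' [sF sF' E0]]]; have E p (h : dsub D kap a p) := E0 p (conj (conj h.1 I) h.2).
split=> [j|].
  apply: (sm_ext (f := fun y => F y 0 j)) => [y Dy|]; first by have [-> _] := E y Dy.
  by have := sF j; rewrite imgid => /smP.
exists F'; split=> [j|x Dx]; last by have [_] := E x Dx.
by apply/smP; exact: sF'.
Qed.

Lemma diffeo_img_dom a : dom (chart_map a @` (kap @` dsub D kap a)).
Proof.
have [U oU E] := relopen_open (diffeo_rel a); case: dK => _ _ oK _.
apply: (img_dom nX); first by rewrite E; exact: oK.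
by move=> _ [x [_ ax] <-].
Qed.

Lemma diffeo_jac a x : dsub D kap a x -> jac (dsub D kap a) (crd kap a) x \in unitmx.
Proof.
move=> Dx; have [s1 [F' [s2 E]]] := diffeo_sm a.
have dDa := relopen_dom dD (diffeo_rel a).
have h : jac (dsub D kap a) (crd kap a) x *m jac (chart_map a @` (kap @` dsub D kap a)) F' (crd kap a x) = 1%:M.
  rewrite -(jac_comp (F1 := crd kap a) (F2 := F') dDa (diffeo_img_dom a)) // => [|y Dy].
    by apply/matrixP => i j; rewrite !mxE (pd_ext i (g := fun y => y 0 j)) ?(pd_coord dDa) // => y Dy; rewrite E.
  by exists (kap y) => //; exists y.
by have [] := mulmx1_unit h.
Qed.

(** [pullback_metric] uses the preferred chart around the image point, which changes with x. The
    transition law exchanges it for a fixed chart [a], in which smoothness can be read off. *)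
Lemma pullback_law a x : dsub D kap a x -> pullback_metric D kap x =
  jac (dsub D kap a) (crd kap a) x *m met a (crd kap a x) *m (jac (dsub D kap a) (crd kap a) x)^T.
Proof.
move=> Dax; have [Dx ax] := Dax; pose c := chart_at (kap x).
have Dcx : dsub D kap c x by split=> //; exact: n_at nX _.
rewrite /pullback_metric /metric_at -/c.
have -> : jac D (chart_map c \o kap) x = jac (dsub D kap c) (crd kap c) x by exact: jac_rel (diffeo_rel c) Dcx.
pose D' := dsub D kap a `&` dsub D kap c.
have roa : relopen (dsub D kap a) D'.
  by apply: (relopen_sub (relopenI (diffeo_rel a) (diffeo_rel c))) => y [] // _ [].
have roc : relopen (dsub D kap c) D'.
  by apply: (relopen_sub (relopenI (diffeo_rel a) (diffeo_rel c))) => y [] // _ [].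
have D'x : D' x by [].
have dD' : dom D' by apply: relopen_dom roa; exact: relopen_dom (diffeo_rel a).
rewrite (jac_rel _ roa D'x) (jac_rel _ roc D'x).
have [tau [st tE tl]] := n_trans nX a c.
have oW : open (chart_dom a `&` chart_dom c) by apply: openI; exact: n_open nX _.
have Wx : (chart_dom a `&` chart_dom c) (kap x) by split=> //; exact: n_at nX _.
have -> : jac D' (crd kap c) x = jac D' (fun y => tau (crd kap a y)) x.
  by apply: jac_ext => // y [[_ ay] [_ cy]]; rewrite /crd tE.
have [sa _] := diffeo_sm a.
have sW : chart_dom a `&` chart_dom c `<=` chart_dom a by move=> p [].
rewrite (jac_comp (F1 := crd kap a) (F2 := tau) dD' (img_dom nX oW sW)) //.
- by rewrite /crd (tl _ Wx) trmx_mul !mulmxA.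
- by move=> y [[_ ay] [_ cy]]; exists (kap y).
- by move=> j; exact: sm_rel (sa j) roa.
Qed.

Lemma diffeo_isom : isom D (pullback_metric D kap) kap.
Proof.
split=> //; [|exact: diffeo_rel|by move=> a; case: (diffeo_sm a)|exact: pullback_law].
have Dc x : D x -> dsub D kap (chart_at (kap x)) x by move=> Dx; split=> //; exact: n_at nX _.
split=> [i j|x Dx|x Dx].
- apply: sm_rel_loc => x Dx; pose c := chart_at (kap x); exists (dsub D kap c); split; [exact: diffeo_rel|exact: Dc|].
  have dDc := relopen_dom dD (diffeo_rel c); have [sc _] := diffeo_sm c.
  apply: (sm_ext (f := fun y => \sum_l (\sum_k jac (dsub D kap c) (crd kap c) y i k * met c (crd kap c y) k l) *
     jac (dsub D kap c) (crd kap c) y j l)) => [y Dy|].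
    rewrite (pullback_law Dy) !mxE; apply: eq_bigr => l _; rewrite !mxE.
    by congr (_ * _); apply: eq_bigr => k _.
  have sJ p q : sm (dsub D kap c) (fun y => jac (dsub D kap c) (crd kap c) y p q).
    by apply: (sm_ext (f := pd (dsub D kap c) p (fun y => crd kap c y 0 q))) => [y _|]; [rewrite mxE|exact: sm_pd].
  have [sm_m _ _] := n_met nX c.
  have sM p q : sm (dsub D kap c) (fun y => met c (crd kap c y) p q).
    apply: (sm_comp dDc (F := crd kap c) (f := fun y => met c y p q) (image_dom nX c)) => // y [_ cy].
    by exists (kap y).
  by apply: (sm_sum dDc) => l _; apply: (sm_mul dDc) => //; apply: (sm_sum dDc) => k _; apply: (sm_mul dDc).
- have Dx' := Dc x Dx; rewrite (pullback_law Dx'); have [_ sy _] := n_met nX (chart_at (kap x)).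
  rewrite !trmx_mul trmxK sy ?mulmxA //.
  by exists (kap x) => //; exact: n_at nX _.
- have Dx' := Dc x Dx; rewrite (pullback_law Dx'); have [_ _ pm] := n_met nX (chart_at (kap x)).
  apply: posdef_congr; first exact: diffeo_jac.
  by apply: pm; exists (kap x) => //; exact: n_at nX _.
Qed.

End Diffeo.

(** The initial velocities of the rays show that the Jacobian at the centre is the orthonormal frame
    [E], so the metric there is the identity; the rays themselves give the radial geodesic
    equation. *)
Lemma isom_origin r G kap (p : X) E : 0 < r -> isom (eball r) G kap -> orthonormal_frame p E ->
  (forall v, eball r v -> is_exp p (v *m E) (kap v)) ->
  [/\ kap 0 = p, G 0 = 1%:M & radial_chr (eball r) G].
Proof.
move=> r0 iK oE ex.
have star (w : 'rV[R]_n) s : eball r w -> 0 <= s <= 1 -> eball r (s *: w) by exact: eball_scale.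
have ray (v : 'rV[R]_n) (Dv : eball r v) := ray_geodesic nX star ex Dv.
have k0 : kap 0 = p by have [_ ->] := ray 0 (eball0 _ r0).
have geo (v : 'rV[R]_n) (Dv : eball r v) : geodesic (fun s => kap (0 + s *: v)).
  by have [g _ _] := ray v Dv; apply: (geodesic_ext nX _ g) => t _; rewrite add0r.
have Dl (v : 'rV[R]_n) (Dv : eball r v) (s : R) : 0 <= s <= 1 -> eball r (0 + s *: v) by move=> s01; rewrite add0r; exact: (star v s Dv s01).
split=> //; last first.
  move=> x k Dx; have I1 : 0 <= (1 : R) <= 1 by rewrite ler01 lexx.
  have := isom_geo iK (Dl x Dx) (geo x Dx) k I1; by rewrite scale1r add0r.
set a := chart_at (kap 0).
have Da0 : dsub (eball r) kap a 0 by split; [exact: eball0|exact: n_at nX _].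
have JE : jac (dsub (eball r) kap a) (crd kap a) 0 = E.
  have H1 v : eball r v -> v *m jac (dsub (eball r) kap a) (crd kap a) 0 = v *m E.
    move=> Dv; apply/rowP => j; have [_ _ h3] := ray v Dv; rewrite -h3.
    have Ia : (@unit_interval R `&` (fun s => kap (0 + s *: v)) @^-1` chart_dom a) 0.
      split; [exact: I0|rewrite /= scale0r addr0; exact: n_at nX _].
    have := isom_vel iK (Dl v Dv) (geo v Dv) j Ia; rewrite scale0r addr0 => <-.
    rewrite -k0 -/a (_ : (fun s => kap (s *: v)) = (fun s => kap (0 + s *: v))) //.
    by apply/funext => s; rewrite add0r.
  (* The basis vectors need not lie in the ball; multiples by r/2 do. *)
  apply/row_matrixP => i; rewrite !rowE.
  have e0 : 0 < r / 2 by rewrite divr_gt0.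
  have De : eball r ((r / 2) *: (delta_mx 0 i : 'rV[R]_n)).
    rewrite /eball /= enormZ ?(ltW e0) // enormE esq_delta sqrtr1 mulr1.
    by rewrite ltr_pdivrMr // ltr_pMr // ltr1n.
  have := H1 _ De; rewrite -!scalemxAl => /(congr1 (fun m => (r / 2)^-1 *: m)).
  by rewrite !scalerA mulVf ?scale1r // gt_eqF.
rewrite (i_law iK Da0) JE; apply/matrixP => i j; rewrite [RHS]mxE -oE /inner.
rewrite /metric_at -k0 -/a -/(crd kap a 0) !mxE; apply: eq_bigr => l _; rewrite !mxE; congr (_ * _).
by apply: eq_bigr => q _; rewrite !mxE.
Qed.

End Isometries.

(** * Invariance of the boundary and its manifold structure *)

Section Boundary.
Variables (R : realType) (n : nat) (N : 'I_n) (HN : N.+1 = n).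
Local Notation half := (@halfspace R n).

Let n0 : (0 < n)%N. Proof. exact: leq_trans (ltn_ord N). Qed.

Lemma half_interior (D : set 'rV[R]_n) x : relopen half D -> D x -> 0 < lastc x ->
  exists2 e : R, 0 < e & forall z, `|z - x| < e -> D z.
Proof.
move=> [sub ro] Dx x0; have [e e0 He] := ro _ Dx.
exists (Num.min e (lastc x)) => [|z]; first by rewrite lt_min e0.
rewrite lt_min => /andP[h1 h2]; apply: He => //; rewrite /halfspace /=.
have := le_lt_trans (rv_norm_coord (z - x) N) h2; rewrite !mxE -!(lastcE _ HN) ltr_norml => /andP[h _]; lra.
Qed.

(* At an interior point sent to the boundary, the last coordinate would have a minimum, hence a critical point. *)
Lemma jac_interior (D : set 'rV[R]_n) (Phi : 'rV[R]_n -> 'rV[R]_n) x e : dom D -> D x ->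
  (forall j, sm D (fun y => Phi y 0 j)) -> (forall y, D y -> 0 <= lastc (Phi y)) ->
  jac D Phi x \in unitmx -> 0 < e -> (forall y, `|y - x| < e -> D y) -> lastc (Phi x) != 0.
Proof.
move=> dD Dx sP HP uJ e0 He; apply/eqP => P0.
have col i : jac D Phi x i N = 0.
  rewrite mxE; apply: (pd_min_eq0 dD Dx _ e0); first exact: sm_pdable.
    move=> h he; apply: He; exact: le_lt_trans (on_line_dist _ _ _) he.
  by move=> y Dy; rewrite -!(lastcE _ HN) P0; exact: HP.
have : invmx (jac D Phi x) *m jac D Phi x *m delta_mx N (0 : 'I_1) = 0.
  rewrite -mulmxA (_ : jac D Phi x *m delta_mx N (0 : 'I_1) = 0) ?mulmx0 //.
  by apply/matrixP => i j; rewrite -colE mxE col mxE.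
rewrite mulVmx // mul1mx => /(congr1 (fun m : 'cV[R]_n => m N 0)); rewrite !mxE !eqxx => /eqP.
by rewrite oner_eq0.
Qed.

Variables (X : metric_chart_space R n) (nX : nice half X).

Lemma open_img_rel (a : chart X) V : open V -> V `<=` chart_dom a -> relopen half (chart_map a @` V).
Proof. by move=> oV sV; have [U oU ->] := n_img nX oV sV; exact: open_rel. Qed.

Lemma lastc_ge0 (a : chart X) p : chart_dom a p -> 0 <= lastc (chart_map a p).
Proof. by move=> ap; apply: (image_sub nX (a := a)); exists p. Qed.

(** Otherwise the point would be interior in chart [b], and the transition to [a] would send it to
    last coordinate 0, against [jac_interior]. *)
Lemma bd_indep (a b : chart X) p : chart_dom a p -> chart_dom b p ->
  lastc (chart_map a p) = 0 -> lastc (chart_map b p) = 0.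
Proof.
move=> ap bp a0; apply/eqP/negPn/negP => bn.
have b0 : 0 < lastc (chart_map b p) by rewrite lt_neqAle eq_sym bn lastc_ge0.
have [tau [st tE tl]] := n_trans nX b a.
have oW : open (chart_dom b `&` chart_dom a) by apply: openI; exact: n_open nX _.
have sW : chart_dom b `&` chart_dom a `<=` chart_dom b by move=> q [].
have Wp : (chart_dom b `&` chart_dom a) p by [].
set D := chart_map b @` _ in st tl.
have Dp : D (chart_map b p) by exists p.
have dD : dom D := img_dom nX oW sW.
have mD : is_metric D (met b).
  by apply: is_metric_rel (n_met nX b) _; apply: (img_relopen nX (n_open nX b) oW).
have [e e0 He] := half_interior (open_img_rel oW sW) Dp b0.
have HG x : D x -> met b x = jac D tau x *m met a (tau x) *m (jac D tau x)^T.
  by move=> [q Wq <-]; rewrite (tE _ Wq); exact: tl.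
have := jac_interior dD Dp st _ (jac_unit mD HG Dp) e0 He.
rewrite (tE _ Wp) a0 eqxx; suff h : forall y, D y -> 0 <= lastc (tau y) by move/(_ h).
by move=> y [q Wq <-]; rewrite (tE _ Wq) lastc_ge0 //; case: Wq.
Qed.

Lemma boundaryP (a : chart X) p : chart_dom a p -> boundary p <-> lastc (chart_map a p) = 0.
Proof.
move=> ap; split=> [[_ h]|h]; first exact: bd_indep (n_at nX p) ap h.
by split=> //; exact: bd_indep ap (n_at nX p) h.
Qed.

(** [jac_interior] for the parametrization in the preferred chart of the image point; it shows that
    a collar chart meets the boundary only at t = 0. *)
Lemma isom_interior D G (kap : 'rV[R]_n -> X) x e : isom D G kap -> D x -> 0 < e -> (forall y, `|y - x| < e -> D y) ->
  ~ boundary (kap x).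
Proof.
move=> iK Dx e0 He /= [_]; set a := chart_at (kap x).
have Dax := isom_at nX kap Dx.
have [sub ro] := i_rel iK a; have [e' e'0 He'] := ro _ Dax.
have m0 : 0 < Num.min e e' by rewrite lt_min e0.
have := jac_interior (isom_dsub iK a) Dax (i_sm iK a) _ (isom_jac iK Dax) m0 _.
rewrite -/(crd kap a x) => h E; move: h; rewrite E eqxx => h.
have : false; last by []. apply: h => [y [_ ay]|y]; first exact: lastc_ge0.
by rewrite lt_min => /andP[h1 h2]; apply: He' => //; exact: He.
Qed.

Local Notation BX := (bdry X).

Lemma val_boundary (y : BX) : boundary (bdry_val y).
Proof. exact: (set_mem (valP y)). Qed.

Lemma lastc_bd (a : chart X) (y : BX) : chart_dom a (bdry_val y) -> lastc (chart_map a (bdry_val y)) = 0.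
Proof. by move=> ay; apply/(boundaryP ay); exact: val_boundary. Qed.

Lemma snoc_bd (a : chart BX) (y : BX) : chart_dom a y -> snoc (chart_map a y) 0 = chart_map (a : chart X) (bdry_val y).
Proof. by move=> ay; rewrite /= -(lastc_bd ay) snoc_front. Qed.

Lemma open_bdP (V : set BX) : open V <-> exists2 U : set X, open U & V = @bdry_val R n X @^-1` U.
Proof. by split=> [[U oU <-]|[U oU ->]]; exists U. Qed.

Lemma bd_point p : boundary p -> exists y : BX, bdry_val y = p.
Proof. by move=> bp; exists (exist _ p (mem_set bp) : BX). Qed.

(** A point with vanishing last coordinate in [a] lies on the boundary because this does not depend
    on the chart. *)
Lemma bd_image (a : chart X) (U : set X) : U `<=` chart_dom a ->
  (chart_map (a : chart BX)) @` (@bdry_val R n X @^-1` U) = slice (chart_map a @` U).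
Proof.
move=> sU; apply/seteqP; split=> u.
  by move=> [y Uy <-]; exists (bdry_val y) => //; rewrite -(snoc_bd (sU _ Uy)).
move=> [p Up E]; have bp : boundary p.
  by apply/(boundaryP (sU _ Up)); rewrite E lastc_snoc.
have [y yp] := bd_point bp; have yp' : sval y = p := yp; exists y => /=; first by rewrite yp.
by rewrite yp' E front_snoc.
Qed.

Lemma bd_chart_image (a : chart X) : chart_image (a : chart BX) = slice (chart_image a).
Proof. exact: bd_image. Qed.

Lemma cts_val (U : set X) : open U -> open (@bdry_val R n X @^-1` U).
Proof. by move=> oU; apply/open_bdP; exists U. Qed.

Lemma bd_val_inj : injective (@bdry_val R n X).
Proof. exact: val_inj. Qed.

(** The model set is all of R^(n-1), so the results on geodesics and isometries apply to the
    boundary as well. Transitions are tangential parts of those of X. *)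
Lemma nice_bdry : nice setT BX.
Proof.
split.
- by split.
- rewrite open_hausdorff => x y xy.
  have vxy : bdry_val x != bdry_val y by apply: contra_neq xy; exact: bd_val_inj.
  have := n_haus nX; rewrite open_hausdorff => /(_ _ _ vxy)[[U V] /= [/set_mem Ux /set_mem Vy] [oU oV /eqP UV]].
  exists (@bdry_val R n X @^-1` U, @bdry_val R n X @^-1` V) => /=; first by split; apply: mem_set.
  split; [exact: cts_val|exact: cts_val|].
  by apply/eqP/seteqP; split=> z //= -[h1 h2]; have : (U `&` V) (bdry_val z) by []; rewrite UV.
- by move=> a; apply: cts_val; exact: n_open nX a.
- by move=> y; exact: n_at nX _.
- move=> a y z /set_mem ay /set_mem az E; apply: bd_val_inj; apply: (n_inj nX (a := a)); rewrite ?inE //.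
  by rewrite -(snoc_bd ay) -(snoc_bd az) E.
- move=> a V /open_bdP[U oU ->] sV.
  have oUa : open (U `&` chart_dom (a : chart X)) by apply: openI => //; exact: n_open nX _.
  have sUa : U `&` chart_dom (a : chart X) `<=` chart_dom (a : chart X) by move=> p [].
  have -> : @bdry_val R n X @^-1` U = @bdry_val R n X @^-1` (U `&` chart_dom (a : chart X)).
    by apply/seteqP; split=> y //= => [Uy|[]//]; split=> //; exact: (sV y).
  rewrite bd_image //; have ro := relopen_slice (open_img_rel oUa sUa).
  have [U' oU' ->] := relopen_open ro; exists U' => //; congr (_ `&` _).
  apply/seteqP; split=> u // _; rewrite /slice /halfspace /= lastc_snoc //.
- move=> a; rewrite bd_chart_image; exact: (slice_metric HN (image_dom nX _) (n_met nX _)).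
- move=> a b W; have [tau [st tE tl]] := n_trans nX a b.
  pose W' := chart_dom (a : chart X) `&` chart_dom (b : chart X).
  have oW : open W' by apply: openI; exact: n_open nX _.
  have sW : W' `<=` chart_dom (a : chart X) by move=> p [].
  have WE : chart_map a @` W = slice (chart_map (a : chart X) @` W') by exact: bd_image.
  set D := chart_map (a : chart X) @` W' in st tl WE.
  have dD : dom D by exact: (img_dom nX oW sW).
  have Hbd x : D x -> lastc x = 0 -> lastc (tau x) = 0.
    by move=> [p Wp <-] h; rewrite (tE _ Wp); exact: bd_indep Wp.1 Wp.2 h.
  exists (fun u => front (tau (snoc u 0))); rewrite WE; split=> [j|y Wy|y Wy J].
  + exact: (sm_phi dD st).
  + by rewrite (snoc_bd Wy.1) (tE _ Wy).
  + have HG x : D x -> met (a : chart X) x = jac D tau x *m met (b : chart X) (tau x) *m (jac D tau x)^T.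
      by move=> [q Wq <-]; rewrite (tE _ Wq); exact: tl.
    have Dy : slice D (chart_map a y) by rewrite -WE; exists y.
    have := slice_metE HN dD HG Hbd Dy.
    by rewrite /J /slice_met /= (snoc_bd (a := a) Wy.1) (tE _ Wy).
Qed.

End Boundary.

Section SliceIsometry.
Variables (R : realType) (n : nat) (N : 'I_n) (HN : N.+1 = n).
Variables (X : metric_chart_space R n) (nX : nice (@halfspace R n) X).
Variables (D : set 'rV[R]_n) (G : 'rV[R]_n -> 'M[R]_n) (kap : 'rV[R]_n -> X) (iK : isom D G kap).
Variable kap0 : 'rV[R]_n.-1 -> bdry X.
Hypothesis kap0E : forall u, slice D u -> kap (snoc u 0) = bdry_val (kap0 u).

Lemma crd_bd (a : chart X) x : dsub D kap a x -> lastc x = 0 -> lastc (crd kap a x) = 0.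
Proof.
move=> [Dx ax] x0; have xE : x = snoc (front x) 0 by rewrite -x0 snoc_front.
have kE : kap x = bdry_val (kap0 (front x)) by rewrite {1}xE kap0E // /slice /= -xE.
by rewrite /crd kE; apply: (lastc_bd HN nX); rewrite -kE.
Qed.

Lemma dsub_slice (a : chart X) : dsub (slice D) kap0 (a : chart (bdry X)) = slice (dsub D kap a).
Proof.
by apply/seteqP; split=> u [Du au]; split=> //; move: au; rewrite /= kap0E.
Qed.

Lemma isom_slice : isom (slice D) (slice_met G) kap0.
Proof.
have crdE (a : chart X) u : slice (dsub D kap a) u -> crd kap0 (a : chart (bdry X)) u = front (crd kap a (snoc u 0)).
  by move=> [Du _]; rewrite /crd kap0E.
split.
- exact: dom_slice (i_dom iK).
- exact: (slice_metric HN (i_dom iK) (i_met iK)).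
- by move=> a; rewrite dsub_slice; apply: relopen_slice; exact: (i_rel iK a).
- move=> a j; rewrite dsub_slice.
  apply: (sm_ext (f := fun u => front (crd kap a (snoc u 0)) 0 j)) => [u Du|]; first by rewrite crdE.
  exact: (sm_phi (isom_dsub iK a) (i_sm iK a)).
- move=> a u; rewrite dsub_slice => Du.
  rewrite (slice_metE HN (isom_dsub iK a) (@i_law _ _ _ _ _ _ iK a) (@crd_bd a) Du).
  have -> : jac (slice (dsub D kap a)) (crd kap0 a) u = jac (slice (dsub D kap a)) (fun u => front (crd kap a (snoc u 0))) u.
    by apply: jac_ext => // v Dv; rewrite crdE.
  by rewrite crdE.
Qed.

Lemma isom_norm_l i u : slice D u ->
  tnorm (slice_met G) (covDn (slice D) (slice_met G) (sff D G) i) u = norm_nabla_l i (kap0 u).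
Proof.
move=> Du; pose a : chart X := chart_at (kap (snoc u 0)).
have Dau : slice (dsub D kap a) u by exact: (isom_at nX kap Du).
rewrite /norm_nabla_l.
have -> : chart_at (kap0 u) = a by rewrite /a kap0E.
rewrite (bd_chart_image HN nX).
have := norm_sff_nat HN (isom_dsub iK a) (image_dom nX a) (isom_metric iK a) (n_met nX a) (@isom_into _ _ _ D kap a)
  (i_sm iK a) (@i_law _ _ _ _ _ _ iK a) (@crd_bd a) (image_sub nX (a := a)) i Dau.
have -> : front (crd kap a (snoc u 0)) = chart_map (a : chart (bdry X)) (kap0 u) by rewrite /crd kap0E.
move=> E; rewrite -[RHS]E; apply: eq_tnorm => t.
apply: covDn_rel (relopen_slice (i_rel iK a)) _ Dau => y s Dy; exact: sff_rel (i_rel iK a) Dy.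
Qed.

End SliceIsometry.

(** * Collar charts have the form d t^2 + h_t *)

Section CollarFacts.
Variables (R : realType) (n : nat) (N : 'I_n) (HN : N.+1 = n) (M : riemannian_manifold R n).
Let nX : nice (@halfspace R n) M := nice_manifold M.
Let nB : nice setT (bdry M) := nice_bdry HN nX.
Variables (x' : bdry M) (r1 r2 : R) (kap : 'rV[R]_n -> M).
Hypotheses (r10 : 0 < r1) (r20 : 0 < r2) (cK : collar_chart x' r1 r2 kap).
Notation D := (collar r1 r2 : set 'rV[R]_n).
Notation G := (pullback_metric D kap).

Lemma collar_isom : isom D G kap.
Proof. by apply: (diffeo_isom nX (collar_dom HN r1 r2)); case: cK. Qed.

Lemma snoc_path (u : 'rV[R]_n.-1) s t : (snoc u 0 : 'rV[R]_n) + s *: snoc 0 t = snoc u (s * t).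
Proof.
apply/rowP => i; rewrite !mxE; case: insubP => [j _ _|_]; last by rewrite add0r.
by rewrite mxE mulr0 addr0.
Qed.

Lemma snoc0E t : (snoc 0 t : 'rV[R]_n) = t *: delta_mx 0 N.
Proof.
apply/rowP => i; case: (emb_lastP HN i) => [->|[j ->]].
  by rewrite snoc_last // !mxE !eqxx mulr1.
by rewrite snoc_emb !mxE (emb_N HN) andbF mulr0.
Qed.

(** The definition of a collar chart provides a foot point for each point z separately. Uniqueness
    of the boundary exponential shows that it depends on [front z] only. *)
Lemma collar_kap0 : exists kap0 : 'rV[R]_n.-1 -> bdry M,
  [/\ forall u, eball r1 u -> kap (snoc u 0) = bdry_val (kap0 u),
      exists2 E, orthonormal_frame x' E & forall u, eball r1 u -> is_exp x' (u *m E) (kap0 u) &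
      forall u t, eball r1 u -> 0 <= t < r2 -> is_normal_exp (kap0 u) t (kap (snoc u t))].
Proof.
case: cK => -[E oE HE] _.
have {}HE z : exists y : bdry M, D z -> is_exp x' (front z *m E) y /\ is_normal_exp y (lastc z) (kap z).
  have [Dz|nD] := pselect (D z); last by exists x'.
  by have [y h1 h2] := HE z Dz; exists y.
have /choice[y Hy] := HE.
have n0 : (0 < n)%N by exact: leq_trans (ltn_ord N).
have Dp u t : eball r1 u -> 0 <= t < r2 -> D (snoc u t) by move=> h1 h2; apply/(collar_pt N).
have I0' : 0 <= (0 : R) < r2 by rewrite lexx.
pose kap0 u := y (snoc u 0).
have H1 u : eball r1 u -> is_exp x' (u *m E) (kap0 u).
  by move=> Du; have [] := Hy _ (Dp u 0 Du I0'); rewrite front_snoc.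
have H2 u t : eball r1 u -> 0 <= t < r2 -> is_normal_exp (kap0 u) t (kap (snoc u t)).
  move=> Du tI; have [h1 h2] := Hy _ (Dp u t Du tI); rewrite front_snoc lastc_snoc // in h1 h2.
  by rewrite (exp_unique nB (H1 u Du) h1).
exists kap0; split=> //; last by exists E.
move=> u Du; have := H2 u 0 Du I0'; rewrite /is_normal_exp scale0r => h.
exact: (exp_unique nX h (exp_const nX _)).
Qed.

Section Kap0.
Variable kap0 : 'rV[R]_n.-1 -> bdry M.
Hypotheses (kE : forall u, eball r1 u -> kap (snoc u 0) = bdry_val (kap0 u))
  (nE : forall u t, eball r1 u -> 0 <= t < r2 -> is_normal_exp (kap0 u) t (kap (snoc u t))).

Let dD : dom D := collar_dom HN r1 r2.
Let iK := collar_isom.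
Let mG : is_metric D G := i_met collar_isom.

Lemma normal_ray u t : eball r1 u -> 0 < t < r2 ->
  [/\ geodesic (fun s => kap (snoc u 0 + s *: snoc 0 t)), forall s, 0 <= s <= 1 -> D (snoc u 0 + s *: snoc 0 t) &
   forall j, gvel (fun s => kap (snoc u 0 + s *: snoc 0 t)) (chart_at (bdry_val (kap0 u))) j 0 =
     t * inward_normal (metric_at (bdry_val (kap0 u))) 0 j].
Proof.
move=> Du /andP[t0 t2]; have tI : 0 <= t < r2 by rewrite ltW.
have st s : 0 <= s <= 1 -> 0 <= s * t < r2.
  move=> /andP[s0 s1]; rewrite mulr_ge0 ?(ltW t0) //=; apply: le_lt_trans t2.
  by rewrite ler_piMl // ltW.
have [c gc [c0 c1 cv Hs]] := exp_geo nX (nE Du tI).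
have cE s : 0 <= s <= 1 -> kap (snoc u 0 + s *: snoc 0 t) = c (1 * s).
  move=> s01; rewrite mul1r snoc_path; apply: (exp_unique nX _ (Hs s s01)).
  by rewrite scalerA; apply: nE => //; exact: st.
have I1 : 0 <= (1 : R) <= 1 by rewrite ler01 lexx.
split.
- exact: (geo_scale nX gc I1 cE).
- by move=> s s01; rewrite snoc_path; apply/(collar_pt N); split=> //; exact: st.
- move=> j; rewrite (gvel_scale nX gc I1 cE) ?mul1r ?mulr0 ?cv ?mxE //.
  split; [exact: I0|rewrite /= scale0r addr0 kE //; exact: n_at nX _].
Qed.

(** The normal segments are geodesics traversed at constant coordinate speed. A point at t = 0 lies
    at the start of a segment of length r2/2, any other at the end of its own. *)
Lemma chr_NN_collar x k : D x -> christoffel D G x k N N = 0.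
Proof.
move=> Dx; have [u [t [-> Du /andP[t0 t2]]]] := collarP Dx.
suff [tau [s [tauI sI E]]] : exists tau s, [/\ 0 < tau < r2, 0 <= s <= 1 & t = s * tau].
  have [g Dl _] := normal_ray Du tauI; have := isom_geo nX iK Dl g k sI.
  rewrite snoc_path -E; case/andP: tauI => tau0 _.
  have -> : \sum_i \sum_j christoffel D G (snoc u t) k i j * (snoc 0 tau 0 i * snoc 0 tau 0 j) =
     christoffel D G (snoc u t) k N N * (tau * tau).
    rewrite -[RHS](sum_delta_r (fun i => christoffel D G (snoc u t) k i N * (tau * tau))); apply: eq_bigr => i _.
    rewrite -[RHS](sum_delta_r (fun j => christoffel D G (snoc u t) k i j * (tau * tau) * (i == N)%:R)).
    by apply: eq_bigr => j _; rewrite snoc0E !mxE !eqxx /=; ring.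
  by move/eqP; rewrite mulf_eq0 => /orP[/eqP //|]; rewrite mulf_eq0 gt_eqF.
have [t00|tn0] := eqVneq t 0.
  exists (r2 / 2), 0; rewrite t00 mul0r lexx ler01; split=> //.
  by rewrite divr_gt0 //= ltr_pdivrMr // ltr_pMr // ltr1n.
exists t, 1; rewrite mul1r lexx ler01; split=> //.
by rewrite t2 andbT lt_neqAle eq_sym tn0.
Qed.

Lemma inward_N (A : 'M[R]_n) : inward_normal A 0 N = (Num.sqrt (invmx A N N))^-1 * invmx A N N.
Proof.
rewrite /inward_normal snoc0E scale1r -rowE (lastcE _ HN) !mxE; by [].
Qed.

(** At the boundary the N-th row of the Jacobian is the unit normal, which lowers to a multiple of d
    x^N, while the other rows are tangent to the boundary. *)
Lemma collar_GN0 u i : eball r1 u -> G (snoc u 0) i N = (i == N)%:R.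
Proof.
move=> Du; have r22 : 0 < r2 / 2 < r2.
  by rewrite divr_gt0 //= ltr_pdivrMr // ltr_pMr // ltr1n.
have [g Dl gv] := normal_ray Du r22; case/andP: r22 => rp _.
have D0 : D (snoc u 0) by apply/(collar_pt N); rewrite lexx.
pose a := chart_at (kap (snoc u 0)).
have Da : dsub D kap a (snoc u 0) by exact: (isom_at nX kap D0).
pose J := jac (dsub D kap a) (crd kap a) (snoc u 0).
have aE : a = chart_at (bdry_val (kap0 u)) by rewrite /a kE.
have mE : metric_at (bdry_val (kap0 u)) = met a (crd kap a (snoc u 0)) by rewrite /metric_at /crd -kE.
set nu := inward_normal (metric_at (bdry_val (kap0 u))) in gv.
have JN j : J N j = nu 0 j.
  have Ia : (@unit_interval R `&` (fun s => kap (snoc u 0 + s *: snoc 0 (r2 / 2))) @^-1` chart_dom a) 0.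
    split; [exact: I0|rewrite /= scale0r addr0; exact: n_at nX _].
  have := isom_vel nX iK Dl g j Ia; rewrite aE gv scale0r addr0 -aE snoc0E -scalemxAl -rowE [RHS]mxE [row _ _ _ _]mxE.
  by move/(mulfI (lt0r_neq0 rp)) => ->.
have mm := n_met nX a; have ia := isom_into Da.
have [_ sy ps] := mm; have syx := sy _ ia; have psx := ps _ ia.
have low k : (met a (crd kap a (snoc u 0)) *m nu^T) k 0 =
   (Num.sqrt (invmx (met a (crd kap a (snoc u 0))) N N))^-1 * (k == N)%:R.
  by rewrite /nu mE; exact: (lower_normal HN).
have iNN : 0 < invmx (met a (crd kap a (snoc u 0))) N N by apply: posdef_diag; exact: posdef_inv.
rewrite (i_law iK Da) -/J -mulmxA mxE.
have -> : \sum_j J i j * (met a (crd kap a (snoc u 0)) *m J^T) j N =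
    J i N * (Num.sqrt (invmx (met a (crd kap a (snoc u 0))) N N))^-1.
  rewrite -[RHS](sum_delta_r (fun j => J i j * (Num.sqrt (invmx (met a (crd kap a (snoc u 0))) N N))^-1)).
  apply: eq_bigr => j _; rewrite -mulrA -low; congr (_ * _); rewrite !mxE; apply: eq_bigr => l _.
  by rewrite [J^T _ _]mxE JN [nu^T _ _]mxE.
case: (emb_lastP HN i) => [->|[j ->]].
  rewrite eqxx JN /nu inward_N -mE -mulrA mulrC -mulrA -invfM -expr2 sqr_sqrtr; last by rewrite mE ltW.
  by rewrite divff // mE gt_eqF.
have Hbd x : dsub D kap a x -> lastc x = 0 -> lastc (crd kap a x) = 0.
  apply: (crd_bd HN nX (kap0 := kap0)) => v; rewrite (slice_collar N) //; exact: kE.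
by rewrite /J (jac_last0 HN (isom_dsub iK a) Hbd) // mul0r (emb_N HN).
Qed.

Lemma collar_const f : sm D f -> (forall x, D x -> pd D N f x = 0) -> forall u t, D (snoc u t) -> f (snoc u t) = f (snoc u 0).
Proof.
move=> sf H u t /(collar_pt N)[Du /andP[t0 t2]]; apply/esym.
have tt s : 0 <= s <= t -> D (snoc u s).
  by move=> /andP[s0 s1]; apply/(collar_pt N); split=> //; rewrite s0 (le_lt_trans s1).
apply: (isd_const (f := fun s => f (snoc u s)) t0 (S := seg t) (f' := fun s => pd D N f (snoc u s))) => // s sI.
  exact: (isd_nor HN sf Du t2 sI).
by apply: H; apply: tt; case/andP: sI => /ltW -> /ltW ->.
Qed.

(** The vanishing symbols with lower indices N, N give first that g_NN is constant along the
    normals, hence 1, and then that g_iN is constant as well. *)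
Lemma collar_GN x i : D x -> G x i N = (i == N)%:R.
Proof.
have sG p q : sm D (fun y => G y p q) by exact: (sm_met mG).
have c0 y l : D y -> chr1 D G y N N l = 0.
  by move=> Dy; rewrite -(chr_low mG) // big1 // => k _; rewrite chr_NN_collar // mul0r.
have NN y : D y -> G y N N = 1.
  move=> Dy; have [u [t [E Du _]]] := collarP Dy; rewrite E in Dy *.
  rewrite (collar_const (f := fun y => G y N N)) ?collar_GN0 ?eqxx // => z Dz.
  by have := c0 z N Dz; rewrite /chr1; move: (pd _ _ _ _) => d; lra.
move=> Dx; have [u [t [E Du _]]] := collarP Dx; rewrite E in Dx *.
rewrite (collar_const (f := fun y => G y i N)) ?collar_GN0 // => z Dz.
have := c0 z i Dz; rewrite /chr1 (pd_ext i (f := fun y => G y N N) (g := fun=> 1)) // (pd_cst dD) //.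
rewrite (pd_ext N (f := fun y => G y N i) (g := fun y => G y i N)) // => [|y Dy]; last by rewrite (met_symE mG).
move: (pd _ _ _ _) => d; lra.
Qed.

End Kap0.
End CollarFacts.

(** * Bounds in normal charts *)

Section MultiIndex.
Variables (R : realType) (n : nat).
Implicit Types (D : set 'rV[R]_n) (G : 'rV[R]_n -> 'M[R]_n).

Lemma mi_seq_size (al : multi_index n) : size (flatten [seq nseq (al i) i | i <- enum 'I_n]) = mi_size al.
Proof.
rewrite size_flatten /shape -map_comp sumnE big_map /mi_size big_enum; apply: eq_bigr => i _ /=; exact: size_nseq.
Qed.

(** The proofs differentiate along words, the bounds are stated for multi-indices; [pds_perm]
    identifies the two. *)
Lemma mi_seq_perm (s : seq 'I_n) : exists2 al : multi_index n, mi_size al = size s &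
  perm_eq s (flatten [seq nseq (al i) i | i <- enum 'I_n]).
Proof.
pose al : multi_index n := [ffun i => count_mem i s].
have ps : perm_eq s (flatten [seq nseq (al i) i | i <- enum 'I_n]).
  apply/allP => j _ /=; rewrite count_flatten -map_comp sumnE big_map big_enum /= (bigD1 j) //=.
  rewrite big1 ?addn0 => [|i ij]; rewrite count_nseq /= ffunE ?eqxx ?mul1n //.
  by rewrite (negbTE ij) mul0n.
by exists al => //; rewrite (perm_size ps) mi_seq_size.
Qed.

Lemma metric_bounds_of_pds D G k K :
  (forall s x a b, D x -> (size s <= k)%N ->
    `|pds D s (fun y => G y a b) x| <= K /\ `|pds D s (fun y => invmx (G y) a b) x| <= K) ->
  metric_bounds D G k K.
Proof. by move=> H al alk i j x Dx; apply: H; rewrite ?mi_seq_size. Qed.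

Lemma pds_of_metric_bounds D G k C : dom D -> is_metric D G -> metric_bounds D G k C ->
  forall s x a b, D x -> (size s <= k)%N ->
    `|pds D s (fun y => G y a b) x| <= C /\ `|pds D s (fun y => invmx (G y) a b) x| <= C.
Proof.
move=> dD mG H s x a b Dx sk; have [al E ps] := mi_seq_perm s.
have := H al _ a b x Dx; rewrite E /Dmulti => /(_ sk)[h1 h2].
have sG := sm_met mG a b; have sI := sm_imet dD mG a b.
by rewrite (pds_perm dD sG ps Dx) (pds_perm dD sI ps Dx).
Qed.

Lemma metric_bounds_le D G k k' K K' : (k' <= k)%N -> K <= K' -> metric_bounds D G k K -> metric_bounds D G k' K'.
Proof.
move=> kk KK H al alk i j x Dx; have [h1 h2] := H al (leq_trans alk kk) i j x Dx.
by split; [exact: le_trans h1 _|exact: le_trans h2 _].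
Qed.

End MultiIndex.

(** * Curvature and second fundamental form bounded by the metric *)

Section CurvatureFromMetric.
Variable (R : realType).

Section Dim.
Variable n : nat.

Lemma adm_chr_met j K : 0 <= K -> exists2 K', 0 <= K' &
  forall (D : set 'rV[R]_n) G x, dom D -> is_metric D G -> D x ->
  (forall a b, adm D predT x j.+1 K 0 (fun y => G y a b)) ->
  (forall a b, adm D predT x j.+1 K 0 (fun y => invmx (G y) a b)) ->
  forall p i q, adm D predT x j K' 0 (fun y => christoffel D G y p i q).
Proof.
move=> K0; exists (n%:R * (2 ^+ j * (K * (`|2^-1| * (K + K + K))))) => [|D G x dD mG Dx HG HI p i q].
  by rewrite !mulr_ge0 ?ler0n ?exprn_ge0 ?addr_ge0.
have sG a b : sm D (fun y => G y a b) by exact: sm_met.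
have sd a b c : sm D (pd D a (fun y => G y b c)) by exact: sm_pd.
have hd a b c : adm D predT x j K 0 (pd D a (fun y => G y b c)) by exact: adm_pd.
have sI a b : sm D (fun y => invmx (G y) a b) by exact: sm_imet.
have sc l : sm D (fun y => chr1 D G y i q l) by exact: sm_chr1.
apply: (adm_ext Dx (f := fun y => \sum_l invmx (G y) p l * chr1 D G y i q l)) => [y _|]; first by rewrite chrE.
apply: adm_sum => // l; first exact: (sm_mul dD).
apply: adm_mul0 => //.
- by rewrite mulr_ge0 // !addr_ge0.
- exact: adm_low (HI p l).
rewrite /chr1; apply: adm_scale => //; first by apply: sm_minus => //; exact: sm_add.
apply: adm_add => //; [exact: sm_add|exact: sm_opp|exact: adm_add|exact: adm_opp].
Qed.

Lemma adm_covD k j K : 0 <= K -> exists2 K', 0 <= K' &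
  forall (D : set 'rV[R]_n) G (U : tensor R n k) x, dom D -> is_metric D G -> D x -> (forall t, sm D (fun y => U y t)) ->
  (forall p i q, adm D predT x j K 0 (fun y => christoffel D G y p i q)) ->
  (forall t, adm D predT x j.+1 K 0 (fun y => U y t)) ->
  forall t, adm D predT x j K' 0 (fun y => covD D G U y t).
Proof.
move=> K0; exists (K + k%:R * (n%:R * (2 ^+ j * (K * K)))) => [|D G U x dD mG Dx sU hC hU t].
  by rewrite !addr_ge0 // !mulr_ge0 ?ler0n ?exprn_ge0.
have sC p i q : sm D (fun y => christoffel D G y p i q) by exact: sm_chr.
pose V l p y := christoffel D G y p (thead t) (tnth [tuple of behead t] l) *
  U y [tuple if q == l then p else tnth [tuple of behead t] q | q < k].
have sV l p : sm D (V l p) by exact: (sm_mul dD).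
have sS l : sm D (fun y => \sum_p V l p y) by apply: (sm_sum dD).
apply: (adm_add dD Dx) => //; first exact: sm_pd.
- by apply: (sm_opp dD); apply: (sm_sum dD) => l _; exact: sS.
- exact: adm_pd.
apply: (adm_opp dD) => //; first by apply: (sm_sum dD) => l _; exact: sS.
apply: (adm_sum dD Dx) => // l.
apply: (adm_sum dD Dx) => // p; first exact: (sm_mul dD).
by apply: (adm_mul0 dD) => //; exact: adm_low (hU _).
Qed.

(** Each covariant derivative consumes one order of control: i + j on input, j on output. *)
Lemma adm_covDn k i j K : 0 <= K -> exists2 K', 0 <= K' &
  forall (D : set 'rV[R]_n) G (U : tensor R n k) x, dom D -> is_metric D G -> D x -> (forall t, sm D (fun y => U y t)) ->
  (forall p a q, adm D predT x (i + j) K 0 (fun y => christoffel D G y p a q)) ->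
  (forall t, adm D predT x (i + j) K 0 (fun y => U y t)) ->
  forall t, adm D predT x j K' 0 (fun y => covDn D G U i y t).
Proof.
move=> K0; elim: i j => [|i IH] j; first by exists K => // D G U x dD mG Dx sU hC hU t; exact: hU.
have [K1 K10 H1] := IH j.+1; have KK : 0 <= K + K1 by rewrite addr_ge0.
have [K2 K20 H2] := @adm_covD (i + k) j (K + K1) KK.
exists K2 => // D G U x dD mG Dx sU hC hU t.
apply: (H2 D G) => //; first exact: sm_covDn.
- by move=> p a q; apply: (adm_lift (T := predT) (j := i.+1 + j)) (adm_le _ _ _ _ (hC p a q)); rewrite ?lerDl // leq_addl.
- move=> t'; apply: (adm_le (K := K1) (N := 0)); rewrite ?lerDr //.
  by apply: (H1 D G) => //; [move=> p a q|move=> t'']; rewrite addnS -addSn; [exact: hC|exact: hU].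
Qed.

Lemma adm_riem j K : 0 <= K -> exists2 K', 0 <= K' &
  forall (D : set 'rV[R]_n) G x, dom D -> is_metric D G -> D x ->
  (forall a b, adm D predT x j K 0 (fun y => G y a b)) ->
  (forall p i q, adm D predT x j.+1 K 0 (fun y => christoffel D G y p i q)) ->
  forall t, adm D predT x j K' 0 (fun y => riem D G y t).
Proof.
move=> K0; pose K1 := 2 ^+ j * (K * K); have K10 : 0 <= K1 by rewrite !mulr_ge0 ?exprn_ge0.
pose K2 := K + K + n%:R * (K1 + K1).
have K20 : 0 <= K2 by rewrite /K2 !addr_ge0 // mulr_ge0 // addr_ge0.
exists (n%:R * (2 ^+ j * (K2 * K))) => [|D G x dD mG Dx hG hC t].
  by rewrite !mulr_ge0 ?exprn_ge0.
have sC p i q : sm D (fun y => christoffel D G y p i q) by exact: sm_chr.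
have sG a b : sm D (fun y => G y a b) by exact: sm_met.
have hC0 p i q : adm D predT x j K 0 (fun y => christoffel D G y p i q) by exact: adm_low (hC p i q).
have sR p : sm D (fun y => curv D G y (tnth t 0) (tnth t 1) (tnth t 2) p) by exact: sm_curv.
apply: (adm_sum dD Dx) => [p|p]; first exact: (sm_mul dD).
apply: (adm_mul0 dD) => //.
have sM a b c d e f : sm D (fun y => christoffel D G y a b c * christoffel D G y d e f) by exact: (sm_mul dD).
have hM a b c d e f : adm D predT x j K1 0 (fun y => christoffel D G y a b c * christoffel D G y d e f).
  exact: (adm_mul0 dD).
apply: (adm_add dD Dx).
- by apply: (sm_minus dD); exact: sm_pd.
- by apply: (sm_sum dD) => q _; exact: (sm_minus dD).
- apply: (adm_add dD Dx); [exact: sm_pd|by apply: (sm_opp dD); exact: sm_pd|exact: adm_pd|].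
  by apply: (adm_opp dD) => //; [exact: sm_pd|exact: adm_pd].
apply: (adm_sum dD Dx) => [q|q]; first exact: (sm_minus dD).
apply: (adm_add dD Dx) => //; first exact: (sm_opp dD).
exact: (adm_opp dD).
Qed.

Lemma tnorm_riem_of_metric i C : 0 <= C -> exists2 K, 0 <= K & forall (D : set 'rV[R]_n) G,
  dom D -> is_metric D G ->
  metric_bounds D G i.+2 C ->
  forall x, D x -> tnorm G (covDn D G (riem D G) i) x <= K.
Proof.
move=> C0; have [K1 K10 H1] := @adm_chr_met i.+1 C C0.
have KK1 : 0 <= C + K1 by rewrite addr_ge0.
have [K2 K20 H2] := @adm_riem i (C + K1) KK1.
have KK2 : 0 <= K1 + K2 by rewrite addr_ge0.
have [K3 K30 H3] := @adm_covDn 4 i 0 (K1 + K2) KK2.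
exists ((n ^ (i + 4))%:R * (1 + C ^+ (i + 4)) * K3) => [|D G dD mG /(pds_of_metric_bounds dD mG) HG x Dx].
  by rewrite !mulr_ge0 // addr_ge0 // exprn_ge0.
apply: tsq_bound => // [a b|t]; first exact: (HG [::] x a b Dx isT).2.
have hG a b : adm D predT x i.+2 C 0 (fun y => G y a b).
  by apply: adm_bound => s _ sk; exact: (HG s x a b Dx sk).1.
have hI a b : adm D predT x i.+2 C 0 (fun y => invmx (G y) a b).
  by apply: adm_bound => s _ sk; exact: (HG s x a b Dx sk).2.
have hC p a q : adm D predT x i.+1 K1 0 (fun y => christoffel D G y p a q) by exact: H1.
have hR t' : adm D predT x i (C + K1) 0 (fun y => G y t'.1 t'.2).
  by apply: (adm_lift (T := predT) (j := i.+2)) (adm_le _ _ _ _ (hG _ _)); rewrite ?lerDl // leqW.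
have {}hR t' : adm D predT x i K2 0 (fun y => riem D G y t').
  apply: (H2 D G) => // [a b|p a q]; first exact: (hR (a, b)).
  by apply: (adm_le (K := K1) (N := 0)) => //; rewrite lerDr.
have := H3 D G (riem D G) x dD mG Dx (sm_riem dD mG) _ _ t.
rewrite addn0 => /(_ _ _)/adm_boundP h; apply: (h _ _ [::]) => //.
- move=> p a q; apply: (adm_lift (T := predT) (j := i.+1)) (adm_le _ _ _ _ (hC p a q)); rewrite ?lerDl //.
- move=> t'; apply: (adm_le (K := K2) (N := 0)) => //; rewrite lerDr //.
Qed.

End Dim.

(** l contains only first derivatives of the metric, so one order less is needed than for the
    curvature. *)
Lemma tnorm_sff_of_metric n (N : 'I_n) (HN : N.+1 = n) i C : 0 <= C -> exists2 K, 0 <= K &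
  forall (D : set 'rV[R]_n) G, dom D -> is_metric D G -> (forall x i, D x -> G x i N = (i == N)%:R) ->
  metric_bounds D G i.+1 C ->
  forall u, slice D u -> tnorm (slice_met G) (covDn (slice D) (slice_met G) (sff D G) i) u <= K.
Proof.
move=> C0; have [K1 K10 H1] := @adm_chr_met n i C C0.
have [K3 K30 H3] := @adm_covDn n.-1 2 i 0 K1 K10.
exists ((n.-1 ^ (i + 2))%:R * (1 + C ^+ (i + 2)) * K3) => [|D G dD mG GN /(pds_of_metric_bounds dD mG) HG u Du].
  by rewrite !mulr_ge0 // addr_ge0 // exprn_ge0.
apply: tsq_bound => // [a b|t].
  by rewrite (imet_slice HN dD mG GN) //; exact: (HG [::] _ _ _ Du isT).2.
have hC p a q : adm D predT (snoc u 0) i K1 0 (fun y => christoffel D G y p a q).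
  by apply: H1 => // a' b'; apply: adm_bound => s _ sk; have [] := HG s _ a' b' Du sk.
have hS f : adm D predT (snoc u 0) i K1 0 f -> adm (slice D) predT u i K1 0 (fun u => f (snoc u 0)).
  by move=> h; apply/adm_slice; exact: (adm_lift (T := predT) (j := i)).
have := H3 (slice D) (slice_met G) (sff D G) u (dom_slice dD) (slice_metric HN dD mG) Du _ _ _ t.
rewrite addn0 => /(_ _ _ _)/adm_boundP h; apply: (h _ _ _ [::]) => //.
- by move=> t'; exact: (sm_sff HN).
- move=> p a q; apply: (adm_ext Du (f := fun u => christoffel D G (snoc u 0) (emb p) (emb a) (emb q))).
    by move=> v Dv; rewrite (chr_slice HN dD mG GN).
  exact: (hS (fun y => christoffel D G y (emb p) (emb a) (emb q)) (hC _ _ _)).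
- move=> t'; apply: (adm_ext Du (f := fun u => christoffel D G (snoc u 0) N (emb (tnth t' 0)) (emb (tnth t' 1)))).
    by move=> v Dv; rewrite (sff_chr HN mG GN).
  exact: (hS (fun y => christoffel D G y N (emb (tnth t' 0)) (emb (tnth t' 1))) (hC _ _ _)).
Qed.

End CurvatureFromMetric.

Section GaussianCharts.
Variables (R : realType) (m : nat).
Implicit Type M : riemannian_manifold R m.

Definition gauss_r C : R := (1 + 8 * (m ^ 4)%:R * C)^-1.

Lemma gauss_r_gt0 C : 0 <= C -> 0 < gauss_r C.
Proof. by move=> C0; rewrite /gauss_r invr_gt0 ltr_pwDl // !mulr_ge0. Qed.

Lemma gauss_isom M (x : M) r kappa : gaussian_chart x r kappa ->
  isom (eball r) (pullback_metric (eball r) kappa) kappa.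
Proof. by move=> [_ _ dK]; exact: (diffeo_isom (nice_manifold M) (@eball_dom R m r) dK). Qed.

Lemma gauss_metric_bounds k C : 0 <= C -> exists2 K, 0 <= K &
  forall M (x : M) r kappa C0, 0 <= C0 -> C0 <= C -> 0 < r -> r <= gauss_r C0 -> gaussian_chart x r kappa ->
  (forall v, eball r v -> norm_nabla_riem 0 (kappa v) <= C0) ->
  (forall i v, (i <= k)%N -> eball r v -> norm_nabla_riem i (kappa v) <= C) ->
  metric_bounds (eball r) (pullback_metric (eball r) kappa) k K.
Proof.
move=> C0; have [K K0 HK] := @gauss_bounds R m k C C0.
exists K => // M x r kappa C1 C10 C1C r0 rC gK H0 Hk; have iK := gauss_isom gK.
have nX := nice_manifold M; case: gK => _ [E oE ex] _.
have [_ G0 xx] := isom_origin nX r0 iK oE ex.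
apply: metric_bounds_of_pds; apply: (HK C1) => //; first exact: i_met iK.
- by move=> v Dv; have := isom_norm nX iK 0 Dv => /= ->; exact: H0.
- by move=> i v ik Dv; rewrite (isom_norm nX iK) //; exact: Hk.
Qed.

Lemma gauss_curv_bounds k C : 0 <= C -> exists2 K, 0 <= K &
  forall M (x : M) r kappa, gaussian_chart x r kappa ->
  metric_bounds (eball r) (pullback_metric (eball r) kappa) k.+2 C ->
  forall i v, (i <= k)%N -> eball r v -> norm_nabla_riem i (kappa v) <= K.
Proof.
move=> C0; have /choice[f Hf] i := (exists2P _ _).1 (@tnorm_riem_of_metric R m i C C0).
exists (\sum_(i < k.+1) f i) => [|M x r kappa gK HG i v ik Dv].
  by apply: sumr_ge0 => i _; case: (Hf i).
have iK := gauss_isom gK; have nX := nice_manifold M; have dD := @eball_dom R m r.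
rewrite -(isom_norm nX iK) //; apply: (@le_trans _ _ (f i)).
  by apply: (Hf i).2 Dv => //; [exact: i_met iK|exact: metric_bounds_le HG].
by rewrite (bigD1 (Ordinal (ik : i < k.+1)%N)) //= lerDl sumr_ge0 // => j _; case: (Hf j).
Qed.

End GaussianCharts.

Section CollarNormalForm.
Variables (R : realType) (m : nat) (N : 'I_m) (HN : N.+1 = m).
Implicit Type M : riemannian_manifold R m.

Lemma collar_nor M (x' : bdry M) r1 r2 kappa : 0 < r1 -> 0 < r2 -> collar_chart x' r1 r2 kappa ->
  let G := pullback_metric (collar r1 r2) kappa in
  [/\ nor_hyp N r1 r2 G, slice_met G 0 = 1%:M,
    radial_chr (eball r1) (slice_met G) &
    exists kap0 : 'rV[R]_m.-1 -> bdry M, [/\ forall u, eball r1 u -> kappa (snoc u 0) = bdry_val (kap0 u) &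
      forall i u, eball r1 u -> tnorm (slice_met G)
        (covDn (eball r1) (slice_met G) (sff (collar r1 r2) G) i) u = norm_nabla_l i (kap0 u)]].
Proof.
move=> r10 r20 cK G; have iK := collar_isom HN cK; have nX := nice_manifold M.
have [kap0 [kE [E oE eE] nE]] := collar_kap0 HN r20 cK.
have sE : slice (collar r1 r2) = eball r1 := slice_collar N r1 r20.
have kE' u : slice (collar r1 r2) u -> kappa (snoc u 0) = bdry_val (kap0 u) by rewrite sE; exact: kE.
have nB := nice_bdry HN nX; have iS := isom_slice HN nX iK kE'; rewrite sE in iS.
have [_ G0 xx] := isom_origin nB r10 iS oE eE.
split=> //; first by split; [exact: i_met iK|move=> x i; exact: (collar_GN HN r20 cK kE nE)].
by exists kap0; split=> // i u Du; rewrite -(isom_norm_l HN nX iK kE') ?sE.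
Qed.

(** A point of the collar with t > 0 is interior in the half space, hence cannot be mapped to the
    boundary. *)
Lemma collar_bd M (x' : bdry M) r1 r2 kappa (kap0 : 'rV[R]_m.-1 -> bdry M) z y : 0 < r2 ->
  collar_chart x' r1 r2 kappa -> (forall u, eball r1 u -> kappa (snoc u 0) = bdry_val (kap0 u)) ->
  collar r1 r2 z -> kappa z = bdry_val y -> eball r1 (front z) /\ y = kap0 (front z).
Proof.
move=> r20 cK kE Dz zy; have nX := nice_manifold M; have iK := collar_isom HN cK.
have [Dz1 /andP[z0 z2]] := Dz.
suff l0 : lastc z = 0.
  split=> //; apply: (@bd_val_inj R m M); rewrite -zy -(kE (front z) Dz1); congr kappa.
  by rewrite -l0 snoc_front.
apply/eqP/negPn/negP => zn; have {}z0 : 0 < lastc z by rewrite lt_neqAle eq_sym zn.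
have ro : relopen (@halfspace R m) (collar r1 r2).
  by have [U oU ->] := collar_half HN r1 r2; exact: open_rel.
have [e e0 He] := half_interior HN ro Dz z0.
apply: (isom_interior HN nX iK Dz e0 He); rewrite zy; exact: val_boundary.
Qed.

End CollarNormalForm.

Section CollarCharts.
Variables (R : realType) (m : nat).
Implicit Type M : riemannian_manifold R m.

(** In dimension 0 there is no last coordinate, and no boundary either, so statements about collars
    are void. *)
Lemma last_or_bdry0 : (forall M, bdry M -> False) \/ exists N : 'I_m, N.+1 = m.
Proof.
have [m0|m0] := leqP m 0; [left => M y|right].
  by have [] := set_mem (valP y); rewrite ltnNge m0.
have lt : (m.-1 < m)%N by rewrite prednK.
by exists (Ordinal lt) => /=; rewrite prednK.
Qed.

Lemma collar_metric_bounds k C0 C : 0 <= C0 -> C0 <= C -> exists2 K, 0 <= K &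
  forall M (x' : bdry M) r1 r2 kappa, 0 < r1 -> 0 < r2 -> r1 <= col_r1 m C0 -> r2 <= col_r2 m C0 ->
  collar_chart x' r1 r2 kappa ->
  (forall z, collar r1 r2 z -> norm_nabla_riem 0 (kappa z) <= C0) ->
  (forall z (y : bdry M), collar r1 r2 z -> kappa z = bdry_val y -> norm_nabla_l 0 y <= C0) ->
  (forall i z, (i <= k)%N -> collar r1 r2 z -> norm_nabla_riem i (kappa z) <= C) ->
  (forall i z (y : bdry M), (i <= k)%N -> collar r1 r2 z -> kappa z = bdry_val y -> norm_nabla_l i y <= C) ->
  metric_bounds (collar r1 r2) (pullback_metric (collar r1 r2) kappa) k K.
Proof.
move=> C00 C0C; case: last_or_bdry0 => [B0|[N HN]]; first by exists 0 => // M x'; case: (B0 M x').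
have [K K0 HK] := collar_bounds HN k C00 C0C.
exists K => // M x' r1 r2 kappa r10 r20 rC1 rC2 cK H0 L0 Hk Lk; have iK := collar_isom HN cK.
have nX := nice_manifold M.
have [nor G0 xx [kap0 [kE HL]]] := collar_nor HN r10 r20 cK.
have Dp u : eball r1 u -> collar r1 r2 (snoc u 0 : 'rV[R]_m) by move=> Du; apply/(collar_pt N); rewrite lexx.
apply: metric_bounds_of_pds; apply: HK => //.
- by move=> v Dv; have := isom_norm nX iK 0 Dv => /= ->; exact: H0.
- by move=> u Du; have := HL 0%N u Du => /= ->; exact: L0 (Dp u Du) (kE u Du).
- by move=> i v ik Dv; rewrite (isom_norm nX iK) //; exact: Hk.
- by move=> i u ik Du; rewrite HL //; exact: Lk ik (Dp u Du) (kE u Du).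
Qed.

Lemma collar_curv_bounds k C : 0 <= C -> exists2 K, 0 <= K &
  forall M (x' : bdry M) r1 r2 kappa, 0 < r1 -> 0 < r2 -> collar_chart x' r1 r2 kappa ->
  metric_bounds (collar r1 r2) (pullback_metric (collar r1 r2) kappa) k.+2 C ->
  (forall i z, (i <= k)%N -> collar r1 r2 z -> norm_nabla_riem i (kappa z) <= K) /\
  (forall i z (y : bdry M), (i <= k)%N -> collar r1 r2 z -> kappa z = bdry_val y -> norm_nabla_l i y <= K).
Proof.
move=> C0; case: last_or_bdry0 => [B0|[N HN]]; first by exists 0 => // M x'; case: (B0 M x').
have /choice[f Hf] i := (exists2P _ _).1 (@tnorm_riem_of_metric R m i C C0).
have /choice[g Hg] i := (exists2P _ _).1 (tnorm_sff_of_metric HN i C0).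
have f0 i : 0 <= f i by case: (Hf i).
have g0 i : 0 <= g i by case: (Hg i).
exists (\sum_(i < k.+1) (f i + g i)) => [|M x' r1 r2 kappa r10 r20 cK HG].
  by apply: sumr_ge0 => i _; rewrite addr_ge0.
have fgK i : (i <= k)%N -> f i + g i <= \sum_(i < k.+1) (f i + g i).
  by move=> ik; rewrite (bigD1 (Ordinal (ik : i < k.+1)%N)) //= lerDl sumr_ge0 // => j _; rewrite addr_ge0.
have iK := collar_isom HN cK; have nX := nice_manifold M; have dD := @collar_dom R m N HN r1 r2.
have [nor _ _ [kap0 [kE HL]]] := collar_nor HN r10 r20 cK.
split=> [i z ik Dz|i z y ik Dz zy].
- rewrite -(isom_norm nX iK) //; apply: le_trans (fgK i ik); apply: ler_wpDr => //.
  by apply: (Hf i).2 Dz => //; [exact: i_met iK|exact: metric_bounds_le HG].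
- have [Du ->] := collar_bd HN r20 cK kE Dz zy.
  rewrite -HL //; apply: le_trans (fgK i ik); apply: ler_wpDl => //.
  have sE : slice (collar r1 r2) = eball r1 := slice_collar N r1 r20.
  have := (Hg i).2 _ _ dD nor.1 nor.2 _ (front z); rewrite sE; apply=> //.
  by apply: metric_bounds_le HG => //; exact: leqW.
Qed.

End CollarCharts.

(** * Existence of normal charts *)

Section Composition.
Variables (R : realType) (n : nat).

Lemma within_preimage (Y Z : topologicalType) (A : set Y) (f : Y -> Z) (U : set Z) :
  {within A, continuous f} -> open U -> exists2 O, open O & A `&` f @^-1` U = A `&` O.
Proof.
move=> /subspace_continuousP cf oU.
exists (\bigcup_(V in [set V : set Y | open V /\ A `&` V `<=` f @^-1` U]) V).
  by apply: bigcup_open => V [].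
apply/seteqP; split=> y [Ay Uy]; split=> //; last by have [V [_ sO] Oy] := Uy; exact: sO.
have : nbhs (f y) U by rewrite nbhsE; exists U.
move=> /(cf y Ay); rewrite /= /within /= nbhsE => -[V [oO Oy] sO]; exists V => //.
by split=> // x [Ax Ox]; exact: sO.
Qed.

Variables (H : set 'rV[R]_n) (Z : metric_chart_space R n) (nZ : nice H Z) (Y : chart_space R n).
Variables (HY : set 'rV[R]_n) (A : set Y) (f : Y -> Z) (D : set 'rV[R]_n) (g : 'rV[R]_n -> Y).
Notation Dg a := (D `&` g @^-1` chart_dom a).
Hypotheses (dD : dom D) (oHY : orth HY) (Yopen : forall a : chart Y, open (chart_dom a))
  (Ycov : forall y : Y, exists a, chart_dom a y)
  (Yimg : forall (a : chart Y) O, open O -> O `<=` chart_dom a ->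
    exists2 U, open U & chart_map a @` (A `&` O) = HY `&` U)
  (fD : diffeo_on A f) (g_inj : {in D &, injective g}) (gA : forall z, D z -> A (g z))
  (g_cont : forall z U, D z -> open U -> U (g z) ->
    exists2 e : R, 0 < e & forall y, D y -> `|y - z| < e -> U (g y))
  (g_open : forall O, open O -> exists2 O', open O' & g @` (D `&` O) = A `&` O')
  (g_sm : forall a : chart Y, (forall j, sm (Dg a) (fun z => chart_map a (g z) 0 j)) /\
    exists F : 'rV[R]_n -> 'rV[R]_n, (forall j, sm (chart_map a @` (g @` Dg a)) (fun w => F w 0 j)) /\
      forall z, Dg a z -> F (chart_map a (g z)) = z).

Let kap z := f (g z).

Let Yimg_dom (a : chart Y) O : open O -> O `<=` chart_dom a -> dom (chart_map a @` (A `&` O)).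
Proof. by move=> oO sO; have [U oU ->] := Yimg oO sO; exists HY, U. Qed.

Let k_cont z U : D z -> open U -> U (kap z) -> exists2 e : R, 0 < e & forall y, D y -> `|y - z| < e -> U (kap y).
Proof.
move=> Dz oU Uz; case: fD => _ cf _ _; have [V oO E] := within_preimage cf oU.
have [_ Oz] : (A `&` V) (g z) by rewrite -E; split=> //; exact: gA.
have [e e0 He] := g_cont Dz oO Oz; exists e => // y Dy yz.
by have [] : (A `&` f @^-1` U) (g y) by rewrite E; split; [exact: gA|exact: He].
Qed.

Let k_rel (U : set Z) : open U -> relopen D (D `&` kap @^-1` U).
Proof.
move=> oU; split=> [z []//|z [Dz Uz]]; have [e e0 He] := k_cont Dz oU Uz.
by exists e => // y Dy yz; split=> //; exact: He.
Qed.

Let g_rel (a : chart Y) : relopen D (Dg a).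
Proof.
split=> [z []//|z [Dz Uz]]; have [e e0 He] := g_cont Dz (Yopen a) Uz.
by exists e => // y Dy yz; split=> //; exact: He.
Qed.

Let g_img D' : relopen D D' -> exists2 O, open O & g @` D' = A `&` O.
Proof. by move=> /relopen_open[U oU ->]; exact: g_open. Qed.

Let k_img D' : relopen D D' -> open (kap @` D').
Proof.
move=> /g_img[V oO E]; have -> : kap @` D' = f @` (g @` D') by rewrite image_comp.
by rewrite E; case: fD => _ _ + _; apply.
Qed.

(** [diffeo_on] asks for one coordinate inverse on the whole image over a chart of Z, while each
    chart of Y sees only a part of it. The inverse is therefore chosen pointwise and its smoothness
    is checked locally, through a chart of Y around the intermediate point. *)
Lemma diffeo_comp : diffeo_on (X := euclid R n) D kap.
Proof.
case: (fD) => f_inj f_cont f_open f_sm.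
have kinj : {in D &, injective kap}.
  move=> y z Dy Dz /f_inj E; apply: g_inj => //; apply: E; apply: mem_set; apply: gA; exact: set_mem.
split=> //.
- by apply: within_of_open => z U; exact: k_cont.
- by move=> V oV; apply: k_img; exact: open_rel.
move=> [] b W; have WE : W = D `&` kap @^-1` chart_dom b by rewrite /W setIT.
have roW : relopen D W by rewrite WE; apply: k_rel; exact: n_open nZ _.
(* Injectivity of the composition makes the pointwise choice the inverse on the image; the value 0
   elsewhere is arbitrary. *)
have /choice[F' HF'] : forall w : 'rV[R]_n, exists z, (chart_map b @` (kap @` W)) w -> W z /\ chart_map b (kap z) = w.
  move=> w; have [[_ [z Wz <-] <-]|nw] := pselect ((chart_map b @` (kap @` W)) w); last by exists 0.
  by exists z.
have F'K z : W z -> F' (chart_map b (kap z)) = z.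
  move=> Wz; have [W1 E] := HF' _ (imageP _ (imageP _ Wz)).
  have kE : kap (F' (chart_map b (kap z))) = kap z.
    apply: (n_inj nZ (a := b)) E; apply: mem_set; [move: W1|move: Wz]; by rewrite WE => -[].
  by apply: kinj kE; apply: mem_set; [case: roW => s _; exact: s W1|case: roW => s _; exact: s Wz].
have sWb : kap @` W `<=` chart_dom b by move=> _ [z Wz <-]; move: Wz; rewrite WE => -[].
have main z : W z -> exists W', [/\ relopen D W', W' `<=` W, W' z,
    forall j, sm W' (fun y => chart_map b (kap y) 0 j) &
    forall j, sm (chart_map b @` (kap @` W')) (fun w => F' w 0 j)].
  move=> Wz; have Dz : D z by case: roW => s _; exact: s Wz.
  have [a az] := Ycov (g z); pose W' := Dg a `&` W.
  have ro' : relopen D W' by apply: relopenI.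
  have sW' : W' `<=` W by move=> y [].
  have [Ff [Ff' [sF sF' HF]]] := f_sm a b.
  set Wf := A `&` chart_dom a `&` f @^-1` chart_dom b in sF sF' HF.
  have [Vf oOf EOf] := within_preimage f_cont (n_open nZ b).
  have oO2 : open (chart_dom a `&` Vf) by apply: openI.
  have WfE : Wf = A `&` (chart_dom a `&` Vf).
    by rewrite /Wf setIAC EOf setIAC setIA.
  have gW y : W' y -> Wf (g y).
    by move=> [[Dy ay]]; rewrite WE => -[_ by_]; split=> //; split=> //; exact: gA.
  have [s1 [Gi [sGi HGi]]] := g_sm a.
  have dW' : dom W' := relopen_dom dD ro'.
  have s1' j : sm W' (fun y => chart_map a (g y) 0 j).
    apply: sm_rel (s1 j) _; apply: (relopen_sub ro'); [by move=> y []|by move=> y []].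
  exists W'; split=> // j.
    apply: (sm_ext (f := fun y => Ff (chart_map a (g y)) 0 j)) => [y W'y|]; first by have [-> _] := HF _ (gW y W'y).
    apply: (sm_comp (D' := chart_map a @` Wf) dW' (F := fun y => chart_map a (g y)) (f := fun w => Ff w 0 j)) => //.
    - by rewrite WfE; apply: Yimg_dom => // y [].
    - by move=> y W'y; exists (g y) => //; exact: gW.
    - by apply/smP; exact: sF.
  have [Vg oOg EOg] := g_img (g_rel a).
  have gaE : g @` Dg a = A `&` (chart_dom a `&` Vg).
    rewrite EOg; apply/seteqP; split=> y [Ay]; last by move=> [ay Oy].
    move=> Oy; split=> //; split=> //.
    by have [x [Dx ax] <-] : (g @` Dg a) y by rewrite EOg.
  have ofW : open (f @` Wf) by rewrite WfE; exact: f_open.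
  have sfW : f @` Wf `<=` chart_dom b by move=> _ [y [_ h] <-].
  have okW' : open (kap @` W') by exact: k_img.
  have skf : kap @` W' `<=` f @` Wf by move=> _ [y W'y <-]; exists (g y) => //; exact: gW.
  apply: (sm_ext (f := fun w => Gi (Ff' w) 0 j)) => [_ [_ [y W'y <-] <-]|].
    have [_ E] := HF _ (gW y W'y); rewrite F'K; last exact: sW'.
    by rewrite /kap E HGi //; case: W'y.
  apply: (sm_comp (D' := chart_map a @` (g @` Dg a)) _ (F := Ff') (f := fun w => Gi w 0 j)) => //.
  - by apply: (img_dom nZ) => //; exact: subset_trans sfW.
  - by rewrite gaE; apply: Yimg_dom; [apply: openI|move=> y []].
  - move=> _ [_ [y W'y <-] <-]; have [_ E] := HF _ (gW y W'y); rewrite /kap E.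
    by exists (g y) => //; exists y => //; case: W'y.
  - move=> l; apply: (@sm_rel _ _ (chart_map b @` (f @` Wf))); first by apply/smP; exact: sF'.
    exact: (img_relopen nZ).
exists (fun y => chart_map b (kap y)), F'; split=> [j|j|z Wz]; last by rewrite F'K.
- rewrite imgid; apply/smP; apply: sm_rel_loc => z Wz; have [W' [r' sW' W'z s1 _]] := main z Wz.
  by exists W'; split=> //; apply: (relopen_sub r') => //; case: roW.
- apply/smP; apply: sm_rel_loc => _ [_ [z Wz <-] <-]; have [W' [r' sW' W'z _ s2]] := main z Wz.
  exists (chart_map b @` (kap @` W')); split=> //; last by apply: imageP; exact: imageP.
  apply: (img_relopen nZ) => //; [exact: k_img|exact: k_img|exact: image_subset].
Qed.

End Composition.

Section LinearCharts.
Variables (R : realType) (n : nat).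

Lemma open_mulmx (B : 'M[R]_n) (U : set 'rV[R]_n) : open U -> open [set x : 'rV[R]_n | U (x *m B)].
Proof.
move=> oU; rewrite openE => x /= Ux; move: (oU); rewrite openE => /(_ _ Ux) /nbhs_ballP[e e0 He].
pose K := 1 + \sum_i \sum_j `|B i j|.
have K0 : 0 < K by rewrite ltr_pwDl // sumr_ge0 // => i _; exact: sumr_ge0.
apply/nbhs_ballP; exists (e / K) => [|y]; first exact: divr_gt0.
rewrite -ball_normE /= distrC ltr_pdivlMr // => yx; apply: He; rewrite -ball_normE /= distrC -mulmxBl.
apply: le_lt_trans yx; set d := y - x; apply: rv_norm_le => [|j]; first by rewrite mulr_ge0 // ltW.
rewrite mxE; apply: le_trans (ler_norm_sum _ _ _) _.
apply: (@le_trans _ _ (`|d| * \sum_i \sum_j `|B i j|)); last by rewrite ler_wpM2l // lerDr.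
rewrite mulr_sumr; apply: ler_sum => i _; rewrite normrM; apply: ler_pM => //; first exact: rv_norm_coord.
by rewrite (bigD1 j) //= lerDl sumr_ge0.
Qed.

Lemma sm_mulmx (D : set 'rV[R]_n) (B : 'M[R]_n) (F : 'rV[R]_n -> 'rV[R]_n) j : dom D ->
  (forall i, sm D (fun x => F x 0 i)) -> sm D (fun x => (F x *m B) 0 j).
Proof.
move=> dD sF; apply: (sm_ext (f := fun x => \sum_i F x 0 i * B i j)) => [x _|]; first by rewrite mxE.
by apply: (sm_sum dD) => i _; apply: (sm_mul dD) => //; exact: sm_cst.
Qed.

Variables (H : set 'rV[R]_n) (X : metric_chart_space R n) (nX : nice H X).

Lemma metric_at_sym (p : X) : (metric_at p)^T = metric_at p.
Proof. by have [_ s _] := n_met nX (chart_at p); apply: s; exists p => //; exact: n_at nX _. Qed.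

Lemma metric_at_pos (p : X) : posdef (metric_at p).
Proof. by have [_ _ s] := n_met nX (chart_at p); apply: s; exists p => //; exact: n_at nX _. Qed.

Lemma orthonormalP (p : X) E : orthonormal_frame p E <-> E *m metric_at p *m E^T = 1%:M.
Proof.
have key i j : inner p (row i E) (row j E) = (E *m metric_at p *m E^T) i j.
  rewrite /inner !mxE; apply: eq_bigr => l _; rewrite !mxE; congr (_ * _).
  by apply: eq_bigr => q _; rewrite !mxE.
split=> [h|h i j]; first by apply/matrixP => i j; rewrite -key h mxE.
by rewrite key h mxE.
Qed.

Lemma orthonormal_exists (p : X) : exists E, orthonormal_frame p E.
Proof.
have [E HE] := frame_exists (metric_at_sym p) (metric_at_pos p); exists E; exact/orthonormalP.
Qed.

Lemma tball_frame (p : X) E r v : orthonormal_frame p E -> tball p r (v *m E) <-> eball r v.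
Proof.
move=> /orthonormalP HE; rewrite /tball /eball /= enormE.
suff -> : inner p (v *m E) (v *m E) = esq v by [].
have -> : inner p (v *m E) (v *m E) = (v *m (E *m metric_at p *m E^T) *m v^T) 0 0.
  by rewrite /inner trmx_mul !mulmxA.
rewrite HE mulmx1 mxE; by apply: eq_bigr => i _; rewrite !mxE expr2.
Qed.

(** [exp_diffeo] speaks of a ball of tangent vectors in chart components. Composition with the frame
    [E] turns it into a Euclidean ball, which may also be shrunk here. *)
Lemma linear_chart (p : X) E rho r (e : 'rV[R]_n -> X) : orthonormal_frame p E -> r <= rho ->
  diffeo_on (X := euclid R n) (tball p rho) e -> diffeo_on (X := euclid R n) (eball r) (fun v => e (v *m E)).
Proof.
move=> oE rr dE; have [uE _ _] := frame_unit ((orthonormalP p E).1 oE).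
have dT : orth (setT : set 'rV[R]_n) by [].
have oA : open (tball p rho).
  rewrite (_ : tball p rho = [set x : 'rV[R]_n | eball rho (x *m invmx E)]); first exact: open_mulmx (@eball_open R n rho).
  apply/seteqP; split=> x /=; first by move=> tx; apply/(tball_frame _ _ oE); rewrite mulmxKV.
  by move/(tball_frame _ _ oE); rewrite mulmxKV.
have rA v : eball r v -> tball p rho (v *m E).
  move=> Dv; apply/(tball_frame _ _ oE); exact: lt_le_trans rr.
have imgE (U : set 'rV[R]_n) : (mulmx^~ E) @` U = [set x | U (x *m invmx E)].
  apply/seteqP; split=> [_ [v Uv <-]|x Ux]; first by rewrite /= mulmxK.
  by exists (x *m invmx E) => //; rewrite mulmxKV.
apply: (@diffeo_comp R n H X nX (euclid R n) setT (tball p rho) e (eball r) (mulmx^~ E)) => //.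
- exact: eball_dom.
- by move=> []; exact: openT.
- by move=> y; exists tt.
- move=> [] V oV _; exists (tball p rho `&` V); first exact: openI.
  by rewrite setTI imgid.
- by move=> v w _ _ /(congr1 (mulmx^~ (invmx E))); rewrite !mulmxK.
- move=> z U Dz oU Uz; have := @open_mulmx E U oU; rewrite openE => /(_ z Uz) /nbhs_ballP[d d0 Hd].
  by exists d => // y Dy yz; apply: Hd; rewrite -ball_normE /= distrC.
- move=> V oV; exists ((mulmx^~ E) @` (eball r `&` V)).
    by rewrite imgE; apply: open_mulmx; apply: openI => //; exact: eball_open.
  by apply/seteqP; split=> [_ [v [Dv Vv] <-]|x []//]; split; [exact: rA|exists v].
- move=> []; rewrite preimage_setT setIT; have dD := @eball_dom R n r; split=> [j|].
    by apply: (sm_mulmx E j dD (F := id)) => i; exact: sm_coord.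
  exists (mulmx^~ (invmx E)); rewrite imgid imgE; split=> [j|z _]; last by rewrite mulmxK.
  have dI : dom [set x : 'rV[R]_n | eball r (x *m invmx E)] by apply: dom_open; apply: open_mulmx; exact: eball_open.
  by apply: (sm_mulmx _ j dI (F := id)) => i; exact: sm_coord.
Qed.

End LinearCharts.

Section ProductOpen.
Variables (R : realType) (Y : topologicalType).

Lemma open_prodP (V : set (Y * R)%type) : open V <-> forall y t, V (y, t) -> exists U (d : R),
  [/\ open U, U y, 0 < d & forall y' t', U y' -> `|t' - t| < d -> V (y', t')].
Proof.
split=> [oV y t Vyt|HV].
  move: (oV); rewrite openE => /(_ _ Vyt)[[P Q] [/= nP nQ] sV].
  move: nP; rewrite nbhsE => -[U [oU Uy] sU]; move: nQ => /nbhs_ballP[d d0 Hd].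
  exists U, d; split=> // y' t' Uy' tt'; apply: sV; split=> /=; first exact: sU.
  by apply: Hd; rewrite -ball_normE /= distrC.
rewrite openE => -[y t] Vyt; have [U [d [oU Uy d0 HU]]] := HV y t Vyt.
exists (U, [set s | `|s - t| < d]); last by move=> [y' t'] [h1 h2]; exact: HU.
split=> /=; first by rewrite nbhsE; exists U.
by apply/nbhs_ballP; exists d => // s; rewrite -ball_normE /= distrC.
Qed.

End ProductOpen.

Section CollarExistence.
Variables (R : realType) (n : nat) (N : 'I_n) (HN : N.+1 = n).
Variable (M : riemannian_manifold R n).
Let nX : nice (@halfspace R n) M := nice_manifold M.
Let nB : nice setT (bdry M) := nice_bdry HN nX.
Let n0 : (0 < n)%N. Proof. exact: leq_trans (ltn_ord N). Qed.

Lemma front_dist (x y : 'rV[R]_n) : `|front x - front y| <= `|x - y|.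
Proof. by apply: rv_norm_le => // i; have := rv_norm_coord (x - y) (emb i); rewrite !mxE. Qed.

Lemma lastc_dist (x y : 'rV[R]_n) : `|lastc x - lastc y| <= `|x - y|.
Proof. by have := rv_norm_coord (x - y) N; rewrite !(lastcE _ HN) !mxE. Qed.

Lemma open_cyl (P : set 'rV[R]_n.-1) (c d : R) : open P -> open [set x : 'rV[R]_n | P (front x) /\ c < lastc x < d].
Proof.
move=> oP; rewrite openE => x /= [Px /andP[cx xd]].
move: (oP); rewrite openE => /(_ _ Px) /nbhs_ballP[e e0 He].
apply/nbhs_ballP; exists (Num.min e (Num.min (lastc x - c) (d - lastc x))) => [|y] /=.
  by rewrite !lt_min e0 !subr_gt0 cx.
rewrite -ball_normE /= distrC !lt_min => /and3P[h1 h2 h3]; split.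
  by apply: He; rewrite -ball_normE /= distrC; exact: le_lt_trans (front_dist _ _) _.
have := lastc_dist y x; move: h2 h3; rewrite ler_norml; move: `|_| => q h2 h3 /andP[h4 h5].
by apply/andP; split; lra.
Qed.

Variables (r1 r2 rC : R) (e0 : 'rV[R]_n.-1 -> bdry M) (f : bdry M * R -> M).
Hypotheses (r2C : r2 <= rC)
  (dE : diffeo_on (X := euclid R n.-1) (eball r1) e0)
  (dF : diffeo_on (X := cylinder (n := n) (bdry M)) (Y := M) [set z | 0 <= z.2 < rC] f).
Let g (z : 'rV[R]_n) : cylinder (n := n) (bdry M) := (e0 (front z), lastc z).
Let A : set (cylinder (n := n) (bdry M)) := [set z | 0 <= z.2 < rC].

(** The image is a union of boxes over open subsets of the boundary; cutting the time interval at
    [rC] makes the bound t < rC part of the open set, while t >= 0 is the half space. *)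
Let cyl_img (a : chart (cylinder (n := n) (bdry M))) V : open V -> V `<=` chart_dom a ->
  exists2 U, open U & chart_map a @` (A `&` V) = @halfspace R n `&` U.
Proof.
move=> oV sV.
pose I := [set w : set (bdry M) * (R * R) | [/\ open w.1, w.1 `<=` chart_dom (a : chart (bdry M)), w.2.2 <= rC &
   forall y t, w.1 y -> w.2.1 < t < w.2.2 -> V (y, t)]].
exists (\bigcup_(w in I) [set x : 'rV[R]_n | (chart_map (a : chart (bdry M)) @` w.1) (front x) /\ w.2.1 < lastc x < w.2.2]).
  apply: bigcup_open => w [ow sw _ _]; apply: open_cyl.
  by have [U oU ->] := n_img nB ow sw; rewrite setTI.
apply/seteqP; split=> [_ [[y t] [/andP[t0 tC] Vy] <-]|x [x0 [w [ow sw wC Hw] [[y wy E] /andP[tl tr]]]]].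
  split; first by rewrite /halfspace /= lastc_snoc.
  have [U [d [oU Uy d0 HU]]] := (open_prodP V).1 oV y t Vy.
  exists (U, (t - d, Num.min (t + d) rC)).
    have HV y' t' : U y' -> t - d < t' < t + d -> V (y', t').
      by move=> Uy' /andP[h1 h2]; apply: HU => //; rewrite ltr_norml; apply/andP; split; lra.
    split=> //= [y' Uy'||y' t' Uy' /andP[h1]].
    - by apply: (sV (y', t)); apply: HV => //; apply/andP; split; lra.
    - by rewrite ge_min lexx orbT.
    - by rewrite lt_min => /andP[h2 _]; apply: HV => //; rewrite h1.
  rewrite /= front_snoc lastc_snoc // lt_min tC; split; first by exists y.
  by rewrite andbT; apply/andP; split; lra.
exists (y, lastc x); last by rewrite -[RHS]snoc_front -E.
by split; [apply/andP; split=> //; exact: lt_le_trans wC|apply: Hw => //; rewrite tl].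
Qed.

Let DgE (a : chart (bdry M)) : collar r1 r2 `&` g @^-1` chart_dom (a : chart (cylinder (n := n) (bdry M))) =
  [set z | dsub (eball r1) e0 a (front z) /\ 0 <= lastc z < r2].
Proof. by apply/seteqP; split=> z [[h1 h2] h3]. Qed.

(** [diffeo_comp] with the cylinder over the boundary in the middle: the Gaussian chart of the
    boundary times the identity, followed by the collar map. *)
Lemma collar_exists : diffeo_on (X := euclid R n) (collar r1 r2) (fun z => f (e0 (front z), lastc z)).
Proof.
have [e_inj e_cont e_open _] := dE.
have dC := @collar_dom R n N HN r1 r2.
apply: (@diffeo_comp R n (@halfspace R n) M nX (cylinder (n := n) (bdry M)) (@halfspace R n) A f (collar r1 r2) g) => //.
- exact: orth_half.
- move=> a; apply/open_prodP => y t ay; exists (chart_dom (a : chart (bdry M))), 1.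
  by split=> //; exact: n_open nB a.
- by move=> [y t]; exists (chart_at (y : bdry M)); exact: n_at nB y.

- move=> z w /set_mem zD /set_mem wD [E1 E2]; have [Dz _] := zD; have [Dw _] := wD; rewrite -(snoc_front z) -(snoc_front w) E2.
  by congr snoc; apply: e_inj => //; exact: mem_set.
- by move=> z [_ /andP[h1 h2]]; rewrite /A /= h1; exact: lt_le_trans r2C.
- move=> z V [Dz zI] oV Vz; have [U [d [oU Uy d0 HU]]] := (open_prodP V).1 oV _ _ Vz.
  have [e e0' He] := within_open e_cont Dz oU Uy.
  exists (Num.min e d) => [|y [Dy yI]]; first by rewrite lt_min e0'.
  rewrite lt_min => /andP[h1 h2]; apply: HU.
    by apply: He => //; exact: le_lt_trans (front_dist _ _) _.
  exact: le_lt_trans (lastc_dist _ _) _.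
- move=> V oV.
  pose I := [set w : set 'rV[R]_n.-1 * (R * R) | [/\ open w.1, w.1 `<=` eball r1, w.2.2 <= r2 &
    forall u t, w.1 u -> w.2.1 < t < w.2.2 -> V (snoc u t)]].
  exists (\bigcup_(w in I) [set z : bdry M * R | (e0 @` w.1) z.1 /\ w.2.1 < z.2 < w.2.2]).
    apply: bigcup_open => w [ow sw _ _]; apply/open_prodP => y t [/= ey /andP[h1 h2]].
    exists (e0 @` w.1), (Num.min (t - w.2.1) (w.2.2 - t)); split=> //.
    + by rewrite -(setIidr sw); exact: e_open.
    + by rewrite lt_min !subr_gt0 h1.
    + move=> y' t' ey'; rewrite lt_min !ltr_norml => /andP[/andP[h3 h4] /andP[h5 h6]]; split=> //.
      by apply/andP; split=> /=; lra.
  apply/seteqP; split=> [_ [z [Dz Vz] <-]|[y t] [/andP[t0 tC] [w [ow sw wr Hw] [/= [u wu <-] tI]]]].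
    have [Dz1 /andP[z0 z2]] := Dz; split; first by rewrite /A /= z0; exact: lt_le_trans r2C.
    move: (oV); rewrite openE => /(_ z Vz) /nbhs_ballP[d d0 Hd].
    exists ([set u | eball r1 u /\ `|u - front z| < d], (lastc z - d, Num.min (lastc z + d) r2)).
      split=> /= [|u []//||u t [_ ud] /andP[h1]].
      * apply: openI; first exact: eball_open.
        rewrite (_ : (fun u => _) = ball (front z) d); first exact: ball_open.
        by apply/funext => u; rewrite -ball_normE /= distrC.
      * by rewrite ge_min lexx orbT.
      * rewrite lt_min => /andP[h2 _]; apply: Hd; rewrite -ball_normE /= distrC.
        apply: rv_norm_lt => // i; rewrite mxE [X in _ + X]mxE; case: (embP i) => [iN|[j ->]].
          by rewrite snoc_last // -(lastcE z iN) ltr_norml; apply/andP; split; lra.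
        by rewrite snoc_emb; have := rv_norm_coord (u - front z) j; rewrite !mxE => h; exact: le_lt_trans h ud.
    rewrite /= lt_min z2; split; first by exists (front z) => //; split=> //; rewrite subrr normr0.
    by rewrite andbT ltrBlDr !ltrDl; apply/andP; split.
  exists (snoc u t); last by rewrite /g front_snoc lastc_snoc.
  have [_ t2] := andP tI.
  split; last exact: Hw.
  by apply/(collar_pt N); split; [exact: sw|rewrite t0 (lt_le_trans t2)].
- move=> a; rewrite DgE; have [sE [F [sF FK]]] := diffeo_sm dE a.
  set W := [set z | _].
  have roW : relopen (collar r1 r2) W.
    split=> [z [[Dz _] zI]//|z [Dz zI]]; have [_ ro] := diffeo_rel nB dE a; have [e e0' He] := ro _ Dz.
    exists e => // y [Dy yI] yz; split=> //; apply: He => //; exact: le_lt_trans (front_dist _ _) yz.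
  have dW : dom W := relopen_dom dC roW.
  have dP : dom (chart_map (a : chart (bdry M)) @` (e0 @` dsub (eball r1) e0 a)) := diffeo_img_dom nB dE a.
  have sfr D j : dom D -> sm D (fun z : 'rV[R]_n => front z 0 j).
    by move=> dD; apply: (sm_ext (f := fun z => z 0 (emb j))) (sm_coord dD (emb j)) => z _; rewrite mxE.
  have sla D : dom D -> sm D (@lastc R n).
    by move=> dD; apply: (sm_ext (f := fun z => z 0 N)) (sm_coord dD N) => z _; rewrite (lastcE z HN).
  have sm_snoc (D : set 'rV[R]_n) (F1 : 'rV[R]_n -> 'rV[R]_n.-1) F2 i : (forall j, sm D (fun z => F1 z 0 j)) -> sm D F2 ->
    sm D (fun z => snoc (F1 z) (F2 z) 0 i).
    move=> h1 h2; case: (embP i) => [iN|[j ->]].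
      by apply: (sm_ext (f := F2)) h2 => z _; rewrite snoc_last.
    by apply: (sm_ext (f := fun z => F1 z 0 j)) (h1 j) => z _; rewrite snoc_emb.
  split=> [j|].
    apply: (sm_snoc W (fun z => crd e0 a (front z)) (@lastc R n) j) => [k|]; last exact: sla.
    apply: (sm_comp (D' := dsub (eball r1) e0 a) dW (F := @front R n) (f := fun u => crd e0 a u 0 k)) => //.
    - exact: relopen_dom (@eball_dom R n.-1 r1) (diffeo_rel nB dE a).
    - by move=> z [].
    - by move=> l; exact: sfr.
  exists (fun w => snoc (F (front w)) (lastc w)); split=> [j|z [Dz _]]; last first.
    by rewrite /= front_snoc lastc_snoc // FK // snoc_front.
  set T := chart_map _ @` _.
  have dT : dom T.
    have [U oU EU] : exists2 U, open U & chart_map (a : chart (bdry M)) @` (e0 @` dsub (eball r1) e0 a) = U.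
      have [U oU EU] := relopen_open (diffeo_rel nB dE a).
      have oi : open (e0 @` dsub (eball r1) e0 a) by rewrite EU; exact: e_open.
      have [|U' oU' E'] := n_img nB (a := a) oi; first by move=> _ [u [_ h] <-].
      by exists U' => //; rewrite E' setTI.
    exists (@halfspace R n), [set x : 'rV[R]_n | U (front x) /\ -1 < lastc x < r2]; split.
    - exact: orth_half.
    - exact: open_cyl.
    apply/seteqP; split=> [_ [_ [z [[u1 u2] /andP[z0 z2]] <-] <-]|w [w0 [Uw /andP[_ w2]]]].
      rewrite /halfspace /= front_snoc lastc_snoc // z2 z0 andbT; split=> //; split.
        by rewrite -EU; exists (e0 (front z)) => //; exists (front z).
      by apply: lt_le_trans z0; rewrite oppr_lt0.
    move: Uw; rewrite -EU => -[_ [u Du <-] E].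
    exists (e0 u, lastc w); last by rewrite -[RHS]snoc_front -E.
    exists (snoc u (lastc w)); last by rewrite /g front_snoc lastc_snoc.
    by rewrite /W /= front_snoc lastc_snoc // w2 andbT.
  apply: sm_snoc => [k|]; last exact: sla.
  apply: (sm_comp (D' := chart_map (a : chart (bdry M)) @` (e0 @` dsub (eball r1) e0 a)) dT (F := @front R n) (f := fun u => F u 0 k)) => //.
  - move=> _ [_ [z [Dz _] <-] <-]; rewrite /= front_snoc; exists (e0 (front z)) => //; by exists (front z).
  - by move=> l; exact: sfr.
Qed.

End CollarExistence.

Section ChartExistence.
Variables (R : realType) (m : nat) (M : riemannian_manifold R m).
Let nX : nice (@halfspace R m) M := nice_manifold M.

Lemma boundary_in_nbhd (y : bdry M) s : 0 <= s -> boundary_nbhd s (bdry_val y).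
Proof.
move=> s0; exists y, 0; rewrite lexx s0; split=> //.
rewrite /is_normal_exp scale0r; exact: (exp_const nX).
Qed.

Lemma gauss_chart_exists (p : M) r : 0 < r -> ~ boundary p -> exp_diffeo p r ->
  exists2 kappa, gaussian_chart p r kappa & kappa 0 = p.
Proof.
move=> r0 nb [e [He dE]]; have [E oE] := orthonormal_exists nX p.
have ex v : eball r v -> is_exp p (v *m E) (e (v *m E)) by move=> Dv; apply: He; exact/(tball_frame _ _ oE).
exists (fun v => e (v *m E)).
  by split=> //; [exists E|exact: (linear_chart nX oE (lexx r) dE)].
have := ex 0 (eball0 _ r0); rewrite mul0mx => h; exact: (exp_unique nX h (exp_const nX p)).
Qed.

Lemma inj_radius_gt0 n (X : metric_chart_space R n) (p : X) : (0 < inj_radius X)%E ->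
  exists2 r : R, 0 < r & exp_diffeo p r.
Proof.
move=> H; have : (0 < inj_radius_at p)%E by apply: lt_le_trans H _; apply: ereal_inf_lbound; exists p.
move=> H1; have : exists2 x, [set r%:E | r in [set r : R | 0 < r /\ exp_diffeo p r]] x & (0 < x)%E.
  by apply/ereal_sup_gt.
by move=> [_ [r [r0 er] <-] _]; exists r.
Qed.

(** The first width depends on the point through its injectivity radius. This is harmless, since the
    estimates are uniform over all widths below [R1]. *)
Lemma collar_chart_exists (N : 'I_m) (HN : N.+1 = m) (x' : bdry M) R1 r2 rC :
  0 < R1 -> 0 < r2 -> r2 <= rC -> cond_N M rC -> cond_IC M ->
  exists r1 kappa, [/\ 0 < r1 <= R1, collar_chart x' r1 r2 kappa &
    forall t, 0 <= t < r2 -> is_normal_exp x' t (kappa (snoc 0 t))].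
Proof.
move=> R10 r20 r2C [rC0 [f [Hf dF]]] ic; have nB := nice_bdry HN nX.
have [rho rho0 [e [He dE]]] := inj_radius_gt0 x' ic.
have [E oE] := orthonormal_exists nB x'; pose r1 := Num.min rho R1.
have r10 : 0 < r1 by rewrite lt_min rho0.
have r1rho : r1 <= rho by rewrite ge_min lexx.
pose e0 u := e (u *m E).
have dE0 : diffeo_on (X := euclid R m.-1) (eball r1) e0 := linear_chart nB oE r1rho dE.
have m0 : (0 < m)%N by exact: leq_trans (ltn_ord N).
have ex u : eball r1 u -> is_exp x' (u *m E) (e0 u).
  by move=> Du; apply: He; apply/(tball_frame _ _ oE); exact: lt_le_trans r1rho.
have fx y t : 0 <= t < r2 -> is_normal_exp y t (f (y, t)).
  by move=> /andP[t0 t2]; apply: Hf; rewrite t0 (lt_le_trans t2).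
exists r1, (fun z => f (e0 (front z), lastc z)); split.
- by rewrite r10 ge_min lexx orbT.
- split; last exact: (collar_exists HN r2C dE0 dF).
  exists E => // z [Dz tI]; exists (e0 (front z)); [exact: ex|exact: fx].
- move=> t tI; rewrite front_snoc lastc_snoc //.
  have h := ex 0 (eball0 _ r10); rewrite mul0mx in h.
  by rewrite (exp_unique nB h (exp_const nB x')); exact: fx.
Qed.

End ChartExistence.

Section MainLemmas.
Variables (R : realType) (m : nat).
Implicit Type M : riemannian_manifold R m.

(** The radii are built from [Ck 0] alone. Since [Ck] need not be monotone, Ck 0 + Ck K serves as a
    common bound at order K. *)
Lemma coord_of_free_quantitative (ri rC : R) (rinj : \bar R) (Ck : nat -> R) :
  0 < ri -> 0 < rC -> (0 < rinj)%E -> (forall k, 0 < Ck k) ->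
  exists (R1 R2 R3 : R) (CK : nat -> R),
  forall M, cond_N M rC -> r_inj_bdry M = rinj -> cond_I M ri -> cond_B M Ck ->
    cond_B1 M rC ri R1 R2 R3 CK.
Proof.
move=> ri0 rC0 rinj0 Ck0; have C00 := ltW (Ck0 0%N).
have CC K : Ck 0%N <= Ck 0%N + Ck K by rewrite lerDl ltW.
have CC0 K : 0 <= Ck 0%N + Ck K := le_trans C00 (CC K).
have /choice[fa Ha] K := (exists2P _ _).1 (@gauss_metric_bounds R m K _ (CC0 K)).
have /choice[fc Hc] K := (exists2P _ _).1 (collar_metric_bounds m K C00 (CC K)).
(* The injectivity radius may be infinite, in particular for an empty boundary; then 1 is used. *)
have [rho rho0 rhoI] : exists2 rho : R, 0 < rho & (rho%:E <= rinj)%E.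
  by case: rinj rinj0 => [r|//|//] h; [exists r|exists 1; rewrite ?leey].
exists (Num.min (col_r1 m (Ck 0%N)) rho), (Num.min (col_r2 m (Ck 0%N)) rC), (Num.min (gauss_r m (Ck 0%N)) ri).
exists (fun K => 1 + fa K + fc K) => M cN rinjE cI cB.
have BR K i (p : M) : (i <= K)%N -> norm_nabla_riem i p <= Ck 0%N + Ck K.
  by move=> iK; have [_ /(_ i iK)[/(_ p) h _]] := cB K; apply: le_trans h _; rewrite lerDr.
have BL K i (y : bdry M) : (i <= K)%N -> norm_nabla_l i y <= Ck 0%N + Ck K.
  by move=> iK; have [_ /(_ i iK)[_ /(_ y) h]] := cB K; apply: le_trans h _; rewrite lerDr.
have BR0 (p : M) : norm_nabla_riem 0 p <= Ck 0%N by have [_ /(_ _ (leqnn 0))[/(_ p) h _]] := cB 0%N.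
have BL0 (y : bdry M) : norm_nabla_l 0 y <= Ck 0%N by have [_ /(_ _ (leqnn 0))[_ /(_ y) h]] := cB 0%N.
have fa0 K : 0 <= fa K by case: (Ha K).
have fc0 K : 0 <= fc K by case: (Hc K).
split.
- split; first by rewrite lt_min rho0 col_r1_gt0.
  by rewrite rinjE; apply: le_trans rhoI; rewrite lee_fin ge_min lexx orbT.
- by rewrite lt_min rC0 col_r2_gt0 //= ge_min lexx orbT.
- by rewrite lt_min ri0 gauss_r_gt0 //= ge_min lexx orbT.
- by move=> K; have := fa0 K; have := fc0 K; lra.
split.
- move=> x' r1 r2 kappa /andP[r10]; rewrite le_min => /andP[r1R _] /andP[r20]; rewrite le_min => /andP[r2R _] cK K.
  apply: (metric_bounds_le (leqnn K) (_ : (fc K) <= _)); first by have := fa0 K; lra.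
  by apply: ((Hc K).2 M x' r1 r2 kappa) => // [i z iK _|i z y iK _ _]; [exact: BR|exact: BL].
- move=> x r kappa /andP[r0]; rewrite le_min => /andP[rR _] gK K.
  apply: (metric_bounds_le (leqnn K) (_ : (fa K) <= _)); first by have := fc0 K; lra.
  by apply: ((Ha K).2 M x r kappa (Ck 0%N)) => // i z iK _; exact: BR.
Qed.

Lemma free_of_coord M : bounded_geometry_coord M -> bounded_geometry_free M.
Proof.
move=> [rC [ri [cN cIC cI [R1 [R2 [R3 [C [[R10 _] /andP[R20 R2C] /andP[R30 R3i] C0 [HC HG]]]]]]]]].
have nX := nice_manifold M.
have /choice[fb Hb] k := (exists2P _ _).1 (@gauss_curv_bounds R m k _ (ltW (C0 k.+2))).
have /choice[fd Hd] k := (exists2P _ _).1 (collar_curv_bounds m k (ltW (C0 k.+2))).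
have fb0 k : 0 <= fb k by case: (Hb k).
have fd0 k : 0 <= fd k by case: (Hd k).
exists rC, ri, (fun k => 1 + fb k + fd k); split=> // k; split; first by have := fb0 k; have := fd0 k; lra.
(* Collar charts omit t = R2, so r must lie strictly below R2; half of it is taken. *)
pose r := Num.min R3 (R2 / 2).
have R22 : R2 / 2 < R2 by rewrite ltr_pdivrMr // ltr_pMr // ltr1n.
have r0 : 0 < r by rewrite lt_min R30 divr_gt0.
have rR3 : r <= R3 by rewrite ge_min lexx.
have rR2 : r < R2 by apply: le_lt_trans R22; rewrite ge_min lexx orbT.
have col (y : bdry M) t : 0 <= t < R2 -> exists r1 kappa z, [/\ 0 < r1 <= R1, collar_chart y r1 R2 kappa,
    collar r1 R2 z & is_normal_exp y t (kappa z)].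
  move=> tI; have [/(_ M y)[]|[N HN]] := last_or_bdry0 R m.
  have [r1 [kappa [r1I cK Hk]]] := collar_chart_exists HN y R10 R20 R2C cN cIC.
  exists r1, kappa, (snoc 0 t); split=> //; last exact: Hk.
  by apply/(collar_pt N); split=> //; apply: eball0; case/andP: r1I.
have R2I : 0 < R2 <= R2 by rewrite R20 lexx.
move=> i ik; split=> [p|y].
  have [[y [t [/andP[t0 tr] pE]]]|np] := pselect (boundary_nbhd r p).
    have [|r1 [kappa [z [r1I cK Dz zE]]]] := col y t; first by rewrite t0 (le_lt_trans tr).
    have [r10 _] := andP r1I.
    have [h _] := (Hd k).2 M y r1 R2 kappa r10 R20 cK (HC _ _ _ _ r1I R2I cK _).
    rewrite (exp_unique nX pE zE); apply: le_trans (h i z ik Dz) _; have := fb0 k; lra.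
  (* Boundary points belong to N(r), at time 0, so a point outside N(r) may be the centre of a
     Gaussian chart. *)
  have nb : ~ boundary p.
    by move=> /bd_point[y yE]; apply: np; rewrite -yE; apply: boundary_in_nbhd; exact: ltW.
  have rI : 0 < r <= ri by rewrite r0 (le_trans rR3).
  have [kappa gK k0] := gauss_chart_exists r0 nb (cI.2 r rI p np).
  have r3I : 0 < r <= R3 by rewrite r0.
  have := (Hb k).2 M p r kappa gK (HG _ _ _ r3I gK _) i 0 ik (eball0 _ r0).
  by rewrite k0 => h; apply: le_trans h _; have := fd0 k; lra.
have [|r1 [kappa [z [r1I cK Dz zE]]]] := col y 0; first by rewrite lexx.
have [r10 _] := andP r1I.
have [_ h] := (Hd k).2 M y r1 R2 kappa r10 R20 cK (HC _ _ _ _ r1I R2I cK _).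
apply: le_trans (h i z y ik Dz _) _; last by have := fb0 k; lra.
move: zE; rewrite /is_normal_exp scale0r => zE; exact: (exp_unique nX zE (exp_const nX _)).
Qed.

Lemma coord_of_free M : bounded_geometry_free M -> bounded_geometry_coord M.
Proof.
move=> [rC [ri [C [cN cIC cI cB]]]]; exists rC, ri; split=> //.
have [R1 [R2 [R3 [CK H]]]] := coord_of_free_quantitative cI.1 cN.1 cIC (fun k => (cB k).1).
by exists R1, R2, R3, CK; exact: H.
Qed.

End MainLemmas.

Theorem theorem2p5 (R : realType) (m : nat) :
  (forall (C : R) (k : nat), 0 < C ->
   exists R1 R2 R3 D : R, [/\ 0 < R1, 0 < R2, 0 < R3 & 0 < D] /\
   forall M : riemannian_manifold R m,
   [/\ (* (a1) *)
       forall (x : M) (r3 : R) (kappa : 'rV[R]_m -> M),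
         0 < r3 <= R3 -> gaussian_chart x r3 kappa ->
         (forall v, eball r3 v -> ~ boundary (kappa v)) ->
         (forall i v, (i <= k)%N -> eball r3 v ->
            norm_nabla_riem i (kappa v) <= C) ->
         metric_bounds (eball r3) (pullback_metric (eball r3) kappa) k D,
       (* (a2) *)
       forall (x : M) (r3 : R) (kappa : 'rV[R]_m -> M),
         0 < r3 <= R3 -> gaussian_chart x r3 kappa ->
         (forall v, eball r3 v -> ~ boundary (kappa v)) ->
         metric_bounds (eball r3) (pullback_metric (eball r3) kappa) k.+2 C ->
         forall i v, (i <= k)%N -> eball r3 v ->
           norm_nabla_riem i (kappa v) <= D,
       (* (b1) *)
       forall (x' : bdry M) (r1 r2 : R) (kappa : 'rV[R]_m -> M),
         0 < r1 <= R1 -> 0 < r2 <= R2 -> collar_chart x' r1 r2 kappa ->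
         (forall i z, (i <= k)%N -> collar r1 r2 z ->
            norm_nabla_riem i (kappa z) <= C) ->
         (forall i z (y : bdry M), (i <= k)%N -> collar r1 r2 z ->
            kappa z = bdry_val y -> norm_nabla_l i y <= C) ->
         metric_bounds (collar r1 r2)
           (pullback_metric (collar r1 r2) kappa) k D &
       (* (b2) *)
       forall (x' : bdry M) (r1 r2 : R) (kappa : 'rV[R]_m -> M),
         0 < r1 <= R1 -> 0 < r2 <= R2 -> collar_chart x' r1 r2 kappa ->
         metric_bounds (collar r1 r2)
           (pullback_metric (collar r1 r2) kappa) k.+2 C ->
         (forall i z, (i <= k)%N -> collar r1 r2 z ->
            norm_nabla_riem i (kappa z) <= D) /\
         (forall i z (y : bdry M), (i <= k)%N -> collar r1 r2 z ->
            kappa z = bdry_val y -> norm_nabla_l i y <= D)])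
  /\ (* (c) *)
  ((forall M : riemannian_manifold R m,
      bounded_geometry_coord M <-> bounded_geometry_free M) /\
   (forall (ri rC : R) (rinj : \bar R) (Ck : nat -> R),
      0 < ri -> 0 < rC -> (0 < rinj)%E -> (forall k, 0 < Ck k) ->
      exists (R1 R2 R3 : R) (CK : nat -> R),
      forall M : riemannian_manifold R m,
        cond_N M rC -> r_inj_bdry M = rinj -> cond_I M ri -> cond_B M Ck ->
        cond_B1 M rC ri R1 R2 R3 CK)).
Proof.
split=> [C k C0|].
  have C0' := ltW C0.
  have [Ka Ka0 Ha] := @gauss_metric_bounds R m k C C0'.
  have [Kb Kb0 Hb] := @gauss_curv_bounds R m k C C0'.
  have [Kc Kc0 Hc] := collar_metric_bounds m k C0' (lexx C).
  have [Kd Kd0 Hd] := collar_curv_bounds m k C0'.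
  (* For a fixed order a single constant [C] plays both roles; the summand 1 makes D positive. *)
  exists (col_r1 m C), (col_r2 m C), (gauss_r m C), (1 + Ka + Kb + Kc + Kd).
  split; first by split; [exact: col_r1_gt0|exact: col_r2_gt0|exact: gauss_r_gt0|lra].
  move=> M; split.
  - move=> x r kappa /andP[r0 rR] gK _ HR; apply: (metric_bounds_le (leqnn k) (_ : Ka <= _)); first lra.
    by apply: (Ha M x r kappa C) => // v Dv; exact: HR.
  - move=> x r kappa /andP[r0 rR] gK _ HG i v ik Dv.
    apply: (@le_trans _ _ Kb); last lra.
    exact: (Hb M x r kappa).
  - move=> x' r1 r2 kappa /andP[r10 r1R] /andP[r20 r2R] cK HR HL; apply: (metric_bounds_le (leqnn k) (_ : Kc <= _)); first lra.
    by apply: (Hc M x' r1 r2 kappa) => // [z Dz|z y Dz zy]; [exact: HR|exact: HL zy].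
  - move=> x' r1 r2 kappa /andP[r10 r1R] /andP[r20 r2R] cK HG.
    have [h1 h2] := Hd M x' r1 r2 kappa r10 r20 cK HG.
    split=> [i z ik Dz|i z y ik Dz zy]; apply: (@le_trans _ _ Kd); try lra; [exact: h1|exact: h2 zy].
split; last exact: coord_of_free_quantitative.
by move=> M; split; [exact: free_of_coord|exact: coord_of_free].
Qed.
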